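(* Consider a collection of sets $\{\mathcal{Q}_t\subset L^2(\mathcal{G}_T)\mid0\le t\le T\}$ with $\mathcal{Q}_s\subseteq\mathcal{Q}_t$ for all $s\le t$, and fix a balanced driver $F$ with $F(t,y,0,0,x)=0$ for all $y\in\mathbb{R}$ and $x\in\mathcal{S}$, $dt\times P$-a.s. Define the functional $\mathcal{E}^F(\cdot|\mathcal{G}_t)$ for each $t$ by $\mathcal{E}^F(Q|\mathcal{G}_t)=Y_t$, where $Y_t$ is the solution (the first component at time $t$ of the solution $(Y,Z_1,Z_2)$) to $$Y_t-\int_t^TF(u,Y_u,Z_1(u),Z_2(u),X_u)\,du+\int_t^TZ_1(u)\,dW_u+\int_t^TZ_2^{\top}(u)\,dM_u=Q.$$ Suppose that for each $(t,x)\in[0,T]\times\mathcal{S}$, $F$ satisfies subadditivity, $$F(t,y^1+y^2,z_1^1+z_1^2,z_2^1+z_2^2,x)\le F(t,y^1,z_1^1,z_2^1,x)+F(t,y^2,z_1^2,z_2^2,x)$$ for all $(y^i,z_1^i,z_2^i)\in\mathbb{R}\times\mathbb{R}\times\mathbb{R}^N$, $i=1,2$, and positive homogeneity, $$F(t,\lambda y,\lambda z_1,\lambda z_2,x)=\lambda F(t,y,z_1,z_2,x)\quad\text{for all }\lambda\ge0,\ (y,z_1,z_2)\in\mathbb{R}\times\mathbb{R}\times\mathbb{R}^N.$$ Then $\mathcal{E}^F(\cdot|\mathcal{G}_t)$ is a $\mathcal{G}_t$-consistent sublinear expectation for $\{\mathcal{Q}_t\}$.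
   Context: Let $(\Omega,\mathcal{F},P)$ be a complete probability space and $T>0$. $W=\{W_t\}_{t\in[0,T]}$ is a standard Brownian motion. $X=\{X_t\}_{t\in[0,T]}$ is a continuous-time Markov chain, independent of $W$, with state space $\mathcal{S}=\{e_1,\dots,e_N\}$, the standard basis of $\mathbb{R}^N$, and time-independent rate matrix $A=[a_{ij}]_{N\times N}$, where for $i\ne j$, $a_{ji}$ is the transition rate from $e_i$ to $e_j$ (so columns of $A$ sum to $0$). There is $c\in(0,1)$ with $a_{ij}\in[c,c^{-1}]$ for all $i\neq j$. The chain has the semimartingale dynamics $X_t=X_0+\int_0^t AX_s\,ds+M_t$, with $M$ an $\mathbb{R}^N$-valued square-integrable martingale with respect to the augmented natural filtration of $X$. $\mathcal{G}_t=\mathcal{F}^X_t\vee\mathcal{F}^W_t$, where $\mathcal{F}^X,\mathcal{F}^W$ are the $P$-augmented natural filtrations of $X$ and $W$, and $\mathbb{G}=\{\mathcal{G}_t\}_{t\in[0,T]}$. $L^2(\mathcal{G}_t)$ is the set of real square-integrable $\mathcal{G}_t$-measurable random variables. Define the nonnegative definite matrix $\psi_t:=\mathrm{diag}(AX_{t-})-A\,\mathrm{diag}(X_{t-})-\mathrm{diag}(X_{t-})A^{\top}$ and the seminorm $\lVert C\rVert^2_{X_{t-}}:=C^{\top}\psi_tC$ for $C\in\mathbb{R}^N$. A driver is a map $F:\Omega\times[0,T]\times\mathbb{R}\times\mathbb{R}\times\mathbb{R}^N\times\mathcal{S}\to\mathbb{R}$ ($\omega$ suppressed) such that for all $(y,z_1,z_2,x)$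 the process $F(\cdot,y,z_1,z_2,x)$ is $\mathbb{G}$-adapted and square-integrable over $\Omega\times[0,T]$, and there is a constant $\mu>0$ such that for all $(\omega,t,x)$ and all triples, $|F(t,y,z_1,z_2,x)-F(t,y',z_1',z_2',x)|^2\le\mu(|y-y'|^2+|z_1-z_1'|^2+\lVert z_2-z_2'\rVert^2_{X_{t-}})$. A solution of the displayed backward equation with terminal value $Q\in L^2(\mathcal{G}_T)$ is a triple $(Y,Z_1,Z_2)$ satisfying it, with $Y,Z_1$ real-valued, $\mathbb{G}$-adapted and square-integrable over $\Omega\times[0,T]$ and $Z_2$ $\mathbb{R}^N$-valued, $\mathbb{G}$-predictable with $E\int_0^T\lVert Z_2(u)\rVert^2_{X_{u-}}du<\infty$; under the assumptions on the driver it exists and is unique. Balanced driver: $F$ is balanced on $\{\mathcal{Q}_t\}$ if for all $t\le T$ and all $Q^1,Q^2\in\mathcal{Q}_t$, with $(Y^i,Z_1^i,Z_2^i)$ the solution of the backward equation with driver $F$ and terminal value $Q^i$ at time $T$, the following condition holds on $(t,T]$ (time variable $u$): for all $Z_2^1(u),Z_2^2(u)$, there exists an $\epsilon>0$ such that if $[Z_2^1(u)-Z_2^2(u)]^{\top}\psi_ue_j\ge-\epsilon\lVert Z_2^1(u)-Z_2^2(u)\rVert_{X_{u-}}$ for all $j=1,\dots,N$, then $F(u,Y_u^2,Z_1^2(u),Z_2^1(u),X_u)-F(u,Y_u^2,Z_1^2(u),Z_2^2(u),X_u)\ge[Z_2^1(u)-Z_2^2(u)]^{\top}\psi_uX_{u-}$,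 with equality only if $\lVert Z_2^1(u)-Z_2^2(u)\rVert_{X_{u-}}=0$. Sublinear expectation: a system of operators $\mathcal{E}(\cdot|\mathcal{G}_t):L^2(\mathcal{G}_T)\to L^2(\mathcal{G}_t)$, $0\le t\le T$, is a $\mathcal{G}_t$-consistent sublinear expectation for $\{\mathcal{Q}_t\subset L^2(\mathcal{G}_T)\mid0\le t\le T\}$ if: 1. for $Q^1,Q^2\in\mathcal{Q}_t$, if $Q^1\ge Q^2$ $P$-a.s. then $\mathcal{E}(Q^1|\mathcal{G}_t)\ge\mathcal{E}(Q^2|\mathcal{G}_t)$ $P$-a.s., with equality iff $Q^1=Q^2$ $P$-a.s.; 2. for any $\mathcal{G}_t$-measurable $Q$, $\mathcal{E}(Q|\mathcal{G}_t)=Q$ $P$-a.s.; 3. for $s\le t$, $\mathcal{E}(\mathcal{E}(Q|\mathcal{G}_t)|\mathcal{G}_s)=\mathcal{E}(Q|\mathcal{G}_s)$ $P$-a.s.; 4. for any $B\in\mathcal{G}_t$, $1_B\mathcal{E}(Q|\mathcal{G}_t)=\mathcal{E}(1_BQ|\mathcal{G}_t)$ $P$-a.s.; 5. for $Q^1,Q^2\in\mathcal{Q}_t$, $\mathcal{E}(Q^1+Q^2|\mathcal{G}_t)\le\mathcal{E}(Q^1|\mathcal{G}_t)+\mathcal{E}(Q^2|\mathcal{G}_t)$ $P$-a.s.; 6. for $0\le\lambda\in L^2(\mathcal{G}_t)$ and $\lambda Q\in\mathcal{Q}_t$, $\mathcal{E}(\lambda Q|\mathcal{G}_t)=\lambda\mathcal{E}(Q|\mathcal{G}_t)$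 $P$-a.s.
   Formalization: In ''balanced'', the premise is required only for j with e_j ≠ X_{u-}, since requiring it for all j=1,…,N makes every driver balanced and the theorem false; ''for all Z_2^1(u), Z_2^2(u)'' is read as all vectors in R^N, with Y^2 and Z_1^2 from the solution for Q^2. *)

(* Defs.v *)
(* Random variables are functions Omega -> R compared almost
   surely, processes are functions R -> Omega -> E (time first) of which only
   the times in [0, T] matter, and the state e_i of the chain is encoded by its
   index i : 'I_N. *)
From HB Require Import structures.
From mathcomp Require Import all_boot all_order all_algebra.
From mathcomp Require Import all_classical all_reals all_analysis.

Set Implicit Arguments.
Unset Strict Implicit.
Unset Printing Implicit Defensive.

Import Order.TTheory GRing.Theory Num.Theory.
Import numFieldNormedType.Exports.

Local Open Scope classical_set_scope.
Local Open Scope ring_scope.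

Section chain_algebra.
Context {R : realType} {N : nat}.
Implicit Types (A : 'M[R]_N) (i : 'I_N) (C : 'cV[R]_N).

Definition unit_col i : 'cV[R]_N := delta_mx i 0.

(* [A j i] is the transition rate from e_i to e_j. *)
Definition rate_matrix (c : R) A : Prop :=
  [/\ 0 < c < 1,
      (forall i j, i != j -> c <= A i j <= c^-1) &
      (forall j, \sum_i A i j = 0)].

Definition exp_mx A : 'M[R]_N :=
  \matrix_(j, i) limn (series (fun k => (k`!%:R)^-1 * (A ^+ k) j i)).

(* psi, the seminorm and its square when the left limit of the chain is e_i. *)
Definition psi A i : 'M[R]_N :=
  diag_mx (A *m unit_col i)^T - A *m diag_mx (unit_col i)^T
  - diag_mx (unit_col i)^T *m A^T.

Definition sqnorm A i C : R := (C^T *m psi A i *m C) 0 0.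

Definition snorm A i C : R := Num.sqrt (sqnorm A i C).

End chain_algebra.

Section filtrations.
Context {d : measure_display} {Omega : measurableType d} {R : realType}.
Variables (P : probability Omega R) (T : R).

Definition history {E : Type} (S : set (set E)) (Y : R -> Omega -> E) (t : R) :
    set (set Omega) :=
  <<s [set A | exists s B, [/\ 0 <= s <= t, S B & A = Y s @^-1` B] ]>>.

Definition augmented (G : set (set Omega)) : set (set Omega) :=
  <<s G `|` [set A | P.-negligible A] >>.

Definition rv_in (G : set (set Omega)) (f : Omega -> R) : Prop :=
  forall B : set R, measurable B -> G (f @^-1` B).

Definition L2 (G : set (set Omega)) : set (Omega -> R) :=
  [set f | rv_in G f /\ (\int[P]_w ((f w) ^+ 2)%:E < +oo)%E].

Definition jointly_measurable (Y : R -> Omega -> R) : Prop :=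
  measurable_fun ([set: Omega] `*` `[0, T]%classic)
    (fun p : Omega * R => Y p.2 p.1).

Definition adapted_L2 (G : R -> set (set Omega)) (Y : R -> Omega -> R) : Prop :=
  [/\ (forall t, 0 <= t <= T -> rv_in (G t) (Y t)), jointly_measurable Y &
      (\int[P]_w \int[lebesgue_measure]_(t in `[0%R, T]) ((Y t w) ^+ 2)%:E
         < +oo)%E].

Definition predictable_sets (G : R -> set (set Omega)) :
    set (set (Omega * R)) :=
  <<s [set: Omega] `*` `[0, T]%classic,
      [set C | (exists2 A, G 0 A & C = A `*` [set 0]) \/
               (exists s t A, [/\ 0 <= s, s < t, t <= T, G s A &
                                C = A `*` `]s, t]%classic])] >>.

Definition predictable {k : nat} (G : R -> set (set Omega))
    (Z : R -> Omega -> 'cV[R]_k) : Prop :=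
  forall (i : 'I_k) (B : set R), measurable B ->
    predictable_sets G (([set: Omega] `*` `[0, T]%classic) `&`
      [set p | B (Z p.2 p.1 i 0)]).

Definition brownian_motion (W : R -> Omega -> R) : Prop :=
  [/\ (forall t, 0 <= t <= T -> measurable_fun setT (W t)),
      {ae P, forall w, W 0 w = 0},
      {ae P, forall w, {within `[0, T], continuous (fun t => W t w)}},
      (forall (s t : R) (B : set R), 0 <= s -> s < t -> t <= T ->
         measurable B ->
         P [set w | B (W t w - W s w)%R] = normal_prob 0 (Num.sqrt (t - s)) B) &
      (forall (s t : R) (A : set Omega) (B : set R),
         0 <= s -> s < t -> t <= T ->
         history measurable W s A -> measurable B ->
         P (A `&` [set w | B (W t w - W s w)%R])
         = (P A * P [set w | B (W t w - W s w)%R])%E)].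

(* The chain has cadlag paths; [exp_mx ((t - s) *: A) j i] is the probability of
   moving from e_i to e_j between times s and t. *)
Definition markov_chain {N : nat} (A : 'M[R]_N) (X : R -> Omega -> 'I_N) :
    Prop :=
  [/\ (forall t i, 0 <= t <= T -> measurable (X t @^-1` [set i])),
      (forall w t, 0 <= t < T -> \forall s \near t^'+, X s w = X t w),
      (forall w t, 0 < t <= T -> exists i, \forall s \near t^'-, X s w = i) &
      (forall s t i j B, 0 <= s -> s <= t -> t <= T -> history setT X s B ->
         P (B `&` (X s @^-1` [set i]) `&` (X t @^-1` [set j]))
         = (P (B `&` (X s @^-1` [set i])) * (exp_mx ((t - s) *: A) j i)%:E)%E)].

Definition independent_processes {N : nat} (X : R -> Omega -> 'I_N)
    (W : R -> Omega -> R) : Prop :=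
  forall A B, history setT X T A -> history measurable W T B ->
    P (A `&` B) = (P A * P B)%E.

Definition filtrationG {N : nat} (X : R -> Omega -> 'I_N) (W : R -> Omega -> R)
    (t : R) : set (set Omega) :=
  <<s augmented (history setT X t) `|` augmented (history measurable W t) >>.

(* The left limit of the chain, with value [X 0] at time 0. *)
Definition left_state {N : nat} (X : R -> Omega -> 'I_N) (t : R) (w : Omega) :
    'I_N :=
  xget (X t w) [set i | 0 < t /\ \forall s \near t^'-, X s w = i].

Definition chain_martingale {N : nat} (A : 'M[R]_N) (X : R -> Omega -> 'I_N)
    (t : R) (w : Omega) : 'cV[R]_N :=
  unit_col (X t w) - unit_col (X 0 w) -
  \col_k (\int[lebesgue_measure]_(s in `[0, t]) (A *m unit_col (X s w)) k 0)%R.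

(* The stochastic integral over ]t, T] is the L^2-limit of the elementary
   integrals of simple predictable integrands
   sum_i (coef i) 1_(]grid i, grid (i+1)]). *)
Record simple_integrand (k : nat) := SimpleIntegrand {
  steps : nat;
  grid : nat -> R;
  coef : nat -> Omega -> 'cV[R]_k }.

Definition admissible {k : nat} (G : R -> set (set Omega))
    (H : simple_integrand k) : Prop :=
  [/\ 0 <= grid H 0, grid H (steps H) <= T,
      (forall i, (i < steps H)%N -> grid H i <= grid H i.+1),
      (forall i j, (i < steps H)%N ->
         rv_in (G (grid H i)) (fun w => coef H i w j 0)) &
      (exists K : R, forall i j w, (i < steps H)%N -> `|coef H i w j 0| <= K)].

Definition simple_value {k : nat} (H : simple_integrand k) (u : R) (w : Omega) :
    'cV[R]_k :=
  \sum_(i < steps H | grid H i < u <= grid H i.+1) coef H i w.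

Definition elementary_integral {k : nat} (S : R -> Omega -> 'cV[R]_k)
    (H : simple_integrand k) (t : R) (w : Omega) : R :=
  \sum_(i < steps H)
    ((coef H i w)^T *m
     (S (Num.max t (grid H i.+1)) w - S (Num.max t (grid H i)) w)) 0 0.

(* [I] is the integral over ]t, T] of [Z^T] against the square-integrable
   G-martingale [S], where [q u w C du] is the predictable quadratic variation
   of the integral of [C^T] against [S]. *)
Definition ito_integral {k : nat} (G : R -> set (set Omega))
    (S : R -> Omega -> 'cV[R]_k) (q : R -> Omega -> 'cV[R]_k -> R)
    (t : R) (Z : R -> Omega -> 'cV[R]_k) (I : Omega -> R) : Prop :=
  measurable_fun setT I /\
  exists H : nat -> simple_integrand k,
    [/\ (forall n, admissible G (H n)),
        (fun n => \int[P]_w \int[lebesgue_measure]_(u in `]t, T])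
           (q u w (simple_value (H n) u w - Z u w))%:E)%E @ \oo --> 0%E &
        (fun n => \int[P]_w
           ((elementary_integral S (H n) t w - I w) ^+ 2)%:E)%E @ \oo --> 0%E].

End filtrations.

(* Arguments: w, t, y, z1, z2, x. *)
Definition driver (Omega : Type) (R : realType) (N : nat) :=
  Omega -> R -> R -> R -> 'cV[R]_N -> 'I_N -> R.

Section bsde.
Context {d : measure_display} {Omega : measurableType d} {R : realType}
  {N : nat}.
Variables (P : probability Omega R) (T : R) (A : 'M[R]_N).
Variables (X : R -> Omega -> 'I_N) (W : R -> Omega -> R).

Let G := filtrationG P X W.
Let Xm := left_state X.

Definition is_driver (F : driver Omega R N) : Prop :=
  (forall y z1 z2 x, adapted_L2 P T G (fun t w => F w t y z1 z2 x)) /\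
  exists mu : R, 0 < mu /\
    forall w t x y z1 z2 y' z1' z2', 0 <= t <= T ->
      `|F w t y z1 z2 x - F w t y' z1' z2' x| ^+ 2 <=
      mu * (`|y - y'| ^+ 2 + `|z1 - z1'| ^+ 2 + sqnorm A (Xm t w) (z2 - z2')).

Definition brownian_integral (t : R) (Z1 : R -> Omega -> R) (I : Omega -> R) :
    Prop :=
  ito_integral P T G (fun u w => (W u w)%:M : 'cV[R]_1)
    (fun _ _ C => C 0 0 ^+ 2) t (fun u w => (Z1 u w)%:M) I.

Definition chain_integral (t : R) (Z2 : R -> Omega -> 'cV[R]_N)
    (I : Omega -> R) : Prop :=
  ito_integral P T G (chain_martingale A X) (fun u w C => sqnorm A (Xm u w) C)
    t Z2 I.

Definition bsde_solution (F : driver Omega R N) (Q : Omega -> R)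
    (Y Z1 : R -> Omega -> R) (Z2 : R -> Omega -> 'cV[R]_N) : Prop :=
  [/\ adapted_L2 P T G Y, adapted_L2 P T G Z1, predictable T G Z2,
      (\int[P]_w \int[lebesgue_measure]_(u in `[0%R, T])
         (sqnorm A (Xm u w) (Z2 u w))%:E < +oo)%E &
      forall t, 0 <= t <= T -> exists I1 I2 : Omega -> R,
        [/\ brownian_integral t Z1 I1, chain_integral t Z2 I2 &
            {ae P, forall w,
              Y t w
              - (\int[lebesgue_measure]_(u in `[t, T])
                   F w u (Y u w) (Z1 u w) (Z2 u w) (X u w))%R
              + I1 w + I2 w = Q w}]].

(* [E t Q] is the value at time t of the solution with terminal value Q. *)
Definition solution_functional (F : driver Omega R N)
    (E : R -> (Omega -> R) -> (Omega -> R)) : Prop :=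
  forall Q, L2 P (G T) Q ->
    exists Y Z1 Z2, bsde_solution F Q Y Z1 Z2 /\
      forall t, 0 <= t <= T -> {ae P, forall w, E t Q w = Y t w}.

(* The vectors z, z' stand for the arbitrary values of Z_2^1(u), Z_2^2(u).
   The index j of the current state X_{u-} is left out of the premise: since
   psi_u (e_1 + ... + e_N) = 0, a premise for all j would fail for every small
   epsilon unless the seminorm of z - z' vanishes, and every driver would be
   balanced. *)
Definition balanced (F : driver Omega R N) (Qs : R -> set (Omega -> R)) :
    Prop :=
  forall t, 0 <= t <= T -> forall Q1 Q2, Qs t Q1 -> Qs t Q2 ->
  forall Y1 Z11 Z21 Y2 Z12 Z22,
    bsde_solution F Q1 Y1 Z11 Z21 -> bsde_solution F Q2 Y2 Z12 Z22 ->
  {ae (P \x lebesgue_measure)%E, forall p : Omega * R,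
    let w := p.1 in let u := p.2 in t < u <= T ->
    forall z z' : 'cV[R]_N, exists eps : R, 0 < eps /\
      ((forall j, j != Xm u w ->
          ((z - z')^T *m psi A (Xm u w) *m unit_col j) 0 0
          >= - eps * snorm A (Xm u w) (z - z')) ->
       let dF := F w u (Y2 u w) (Z12 u w) z (X u w)
                 - F w u (Y2 u w) (Z12 u w) z' (X u w) in
       let rhs := ((z - z')^T *m psi A (Xm u w) *m unit_col (Xm u w)) 0 0 in
       dF >= rhs /\ (dF = rhs -> snorm A (Xm u w) (z - z') = 0))}.

Definition normalized (F : driver Omega R N) : Prop :=
  {ae (P \x lebesgue_measure)%E, forall p : Omega * R,
    0 <= p.2 <= T -> forall y x, F p.1 p.2 y 0 0 x = 0}.

Definition subadditive_driver (F : driver Omega R N) : Prop :=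
  forall w t x, 0 <= t <= T ->
  forall y1 z11 z21 y2 z12 z22,
    F w t (y1 + y2) (z11 + z12) (z21 + z22) x
    <= F w t y1 z11 z21 x + F w t y2 z12 z22 x.

Definition positively_homogeneous_driver (F : driver Omega R N) : Prop :=
  forall w t x, 0 <= t <= T ->
  forall lambda y z1 z2, 0 <= lambda ->
    F w t (lambda * y) (lambda * z1) (lambda *: z2) x
    = lambda * F w t y z1 z2 x.

End bsde.

Definition sublinear_expectation {d : measure_display}
    {Omega : measurableType d} {R : realType} (P : probability Omega R) (T : R)
    (G : R -> set (set Omega)) (Qs : R -> set (Omega -> R))
    (E : R -> (Omega -> R) -> (Omega -> R)) : Prop :=
  (forall t Q, 0 <= t <= T -> L2 P (G T) Q -> L2 P (G t) (E t Q)) /\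
  [/\ (forall t Q1 Q2, 0 <= t <= T -> Qs t Q1 -> Qs t Q2 ->
         {ae P, forall w, Q1 w >= Q2 w} ->
         {ae P, forall w, E t Q1 w >= E t Q2 w} /\
         ({ae P, forall w, E t Q1 w = E t Q2 w} <->
          {ae P, forall w, Q1 w = Q2 w})),
      (forall t Q, 0 <= t <= T -> L2 P (G t) Q ->
         {ae P, forall w, E t Q w = Q w}),
      (forall s t Q, 0 <= s -> s <= t -> t <= T -> L2 P (G T) Q ->
         {ae P, forall w, E s (E t Q) w = E s Q w}),
      (forall t B Q, 0 <= t <= T -> G t B -> L2 P (G T) Q ->
         {ae P, forall w,
           \1_B w * E t Q w = E t (fun w' => \1_B w' * Q w') w}) &
      (forall t Q1 Q2, 0 <= t <= T -> Qs t Q1 -> Qs t Q2 ->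
         {ae P, forall w,
           E t (fun w' => Q1 w' + Q2 w') w <= E t Q1 w + E t Q2 w}) /\
      (forall t lambda Q, 0 <= t <= T -> L2 P (G t) lambda ->
         {ae P, forall w, 0 <= lambda w} -> L2 P (G T) Q ->
         Qs t (fun w => lambda w * Q w) ->
         {ae P, forall w,
           E t (fun w' => lambda w' * Q w') w = lambda w * E t Q w})].

(* Main.v *)
(* Stochastic integrals enter only through their L^2 theory: an integral is an
   L^2-limit of elementary integrals, the Brownian and the chain parts being
   treated together, with the isometry and orthogonality to the past. Since F is
   subadditive and normalized it does not depend on y, so the difference of two
   solutions satisfies V_s = V_r + \int g - \int z dS with g^2 <= C |z|^2, and
   E V_s^2 + E (\int z dS)^2 = E (\int g)^2 <= (r - s) C E (\int z dS)^2 gives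
   uniqueness on short intervals. Consistency, the zero-one law and positive
   homogeneity follow by exhibiting the solution.

   Monotonicity and subadditivity come from a comparison argument by duality.
   Balancedness and the Lipschitz condition bound g below by
   - K |z_1| - \sum_j A_ji (C_j - C_i)^+ - K \sum_j A_ji (C_j - C_i)^-, strictly
   unless the middle term vanishes. On a fine grid one multiplies conditionally
   centred factors 1 + alpha dW + c . dM, where alpha and c are read off a step
   approximation of z and the upward jumps receive the coefficient -1 + 1/m, so
   that E(1_B V_s) is at least E(Gamma V_r) up to an error that is o(1/m), while
   the negative part of the density Gamma vanishes with the mesh. For strictness,
   outside an event of probability O((r - s)^2) the chain moves at most once on
   (s, r] and Gamma is at least 1/(4 m Y) with E Y bounded, so
   P(V_s = 0 < V_r) = O((r - s)^2); summing over a partition gives zero. *)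
From HB Require Import structures.
From mathcomp Require Import all_boot all_order all_algebra.
From mathcomp Require Import all_classical all_reals all_analysis.
From mathcomp Require Import finmap measurable_realfun.
From mathcomp Require Import ring lra.
Require Import Defs.

Set Implicit Arguments.
Unset Strict Implicit.
Unset Printing Implicit Defensive.

Import Order.TTheory GRing.Theory Num.Theory.
Import numFieldNormedType.Exports.

Local Open Scope classical_set_scope.
Local Open Scope ring_scope.

(** * Integrable and square-integrable functions *)

(** No Girsanov theorem and no conditional expectation is constructed: a conditional statement is an
    expectation against a factor known at the earlier time. Such identities are tested on
    intersections of chain events and Brownian events, up to null sets. For Brownian increments the
    chain event may involve the whole path, so that they stay centred after multiplication by a
    chain increment. The polynomial factors have explicit moments, at the price of a density that
    may be negative; a fourth moment of dW controls this. Balancedness alone would lead to the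
    coefficient -1 for upward jumps, but then the factor nearly vanishes at a jump and nothing
    strict survives; with -1 + 1/m a single jump still leaves a density of order 1/m. The strictness
    in the balanced condition pays for the change: where the drift exceeds its bound the loss
    vanishes for large m, and where it meets the bound there are no upward jumps, so dominated
    convergence makes the loss o(1/m). Hence m has to be fixed before the mesh. *)

Section L1L2.
Context d (T : measurableType d) (R : realType) (mu : {measure set T -> \bar R}).
Implicit Types f g h : T -> R.

(** Real-valued versions, so that [ring] and [lra] apply to integrands. [fine] sends infinite
    integrals to 0, which is why the algebraic rules for [Iv] carry integrability hypotheses. *)
Definition int1 f : Prop := mu.-integrable setT (EFin \o f).
Definition int2 f : Prop :=
  measurable_fun setT f /\ int1 (fun x => f x ^+ 2).
Definition Iv f : R := (\int[mu]_x f x)%R.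

Lemma int1_measurable f : int1 f -> measurable_fun setT f.
Proof. by move=> /measurable_int /measurable_EFinP. Qed.

Lemma int1_eq f g : (forall x, f x = g x) -> int1 f -> int1 g.
Proof. by move=> /funext ->. Qed.

Lemma int2_eq f g : (forall x, f x = g x) -> int2 f -> int2 g.
Proof. by move=> /funext ->. Qed.

Lemma int1_le f g : measurable_fun setT f -> int1 g ->
  (forall x, `|f x| <= g x) -> int1 f.
Proof.
move=> mf ig fg; apply: (le_integrable _ _ _ ig) => //.
  exact/measurable_EFinP.
move=> x _ /=; rewrite lee_fin (le_trans (fg x))// ler_norm//.
Qed.

Lemma int1D f g : int1 f -> int1 g -> int1 (fun x => f x + g x).
Proof.
move=> hf hg; have := integrableD measurableT hf hg.
by apply: eq_integrable => // x _ /=; rewrite EFinD.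
Qed.

Lemma int1Z k f : int1 f -> int1 (fun x => k * f x).
Proof.
move=> hf; have := integrableZl measurableT k hf.
by apply: eq_integrable => // x _ /=; rewrite EFinM.
Qed.

Lemma int1N f : int1 f -> int1 (fun x => - f x).
Proof.
by move=> /(int1Z (-1)); apply: eq_integrable => // x _ /=; rewrite mulN1r.
Qed.

Lemma int1B f g : int1 f -> int1 g -> int1 (fun x => f x - g x).
Proof. by move=> hf hg; apply: int1D => //; exact: int1N. Qed.

Lemma int1_norm f : int1 f -> int1 (fun x => `|f x|).
Proof. exact: integrable_norm. Qed.

Lemma int10 : int1 (fun=> 0).
Proof. exact: integrable0. Qed.

Lemma int1_sum I (s : seq I) (p : pred I) (F : I -> T -> R) :
  (forall i, p i -> int1 (F i)) -> int1 (fun x => \sum_(i <- s | p i) F i x).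
Proof.
move=> hF; elim: s => [|i s ih].
  by apply: int1_eq int10 => x; rewrite big_nil.
apply: (@int1_eq (fun x => if p i then F i x + \sum_(j <- s | p j) F j x
  else \sum_(j <- s | p j) F j x)) => [x|]; first by rewrite big_cons.
by case: (boolP (p i)) => // pi; apply: int1D => //; exact: hF.
Qed.

Lemma Iv_eq f g : (forall x, f x = g x) -> Iv f = Iv g.
Proof. by move=> fg; congr Iv; apply/funext. Qed.

Lemma IvD f g : int1 f -> int1 g -> Iv (fun x => f x + g x) = Iv f + Iv g.
Proof. by move=> hf hg; rewrite /Iv RintegralD. Qed.

Lemma IvZ k f : int1 f -> Iv (fun x => k * f x) = k * Iv f.
Proof. by move=> hf; rewrite /Iv RintegralZl. Qed.

Lemma IvN f : int1 f -> Iv (fun x => - f x) = - Iv f.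
Proof.
by move=> hf; rewrite -mulN1r -IvZ//; apply: Iv_eq => x; rewrite mulN1r.
Qed.

Lemma IvB f g : int1 f -> int1 g -> Iv (fun x => f x - g x) = Iv f - Iv g.
Proof. by move=> hf hg; rewrite /Iv RintegralB. Qed.

Lemma Iv0 : Iv (fun=> 0) = 0.
Proof. by rewrite /Iv Rintegral_cst// mul0r. Qed.

Lemma Iv_sum I (s : seq I) (p : pred I) (F : I -> T -> R) :
  (forall i, p i -> int1 (F i)) ->
  Iv (fun x => \sum_(i <- s | p i) F i x) = \sum_(i <- s | p i) Iv (F i).
Proof.
move=> hF; elim: s => [|i s ih].
  by rewrite big_nil; apply: etrans Iv0; apply: Iv_eq => x; rewrite big_nil.
rewrite big_cons -ih; case: ifPn => pi; last first.
  by apply: Iv_eq => x; rewrite big_cons (negbTE pi).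
rewrite -IvD//; [|exact: hF|exact: int1_sum].
by apply: Iv_eq => x; rewrite big_cons pi.
Qed.

Lemma Iv_ge0 f : (forall x, 0 <= f x) -> 0 <= Iv f.
Proof. by move=> f0; exact: Rintegral_ge0. Qed.

Lemma Iv_le f g : int1 f -> int1 g -> (forall x, f x <= g x) -> Iv f <= Iv g.
Proof. by move=> hf hg fg; apply: le_Rintegral. Qed.

Lemma Iv_norm f : int1 f -> `|Iv f| <= Iv (fun x => `|f x|).
Proof. by move=> hf; apply: le_normr_Rintegral. Qed.

Lemma Iv_ae f g : measurable_fun setT f -> measurable_fun setT g ->
  {ae mu, forall x, f x = g x} -> Iv f = Iv g.
Proof.
move=> mf mg fg; rewrite /Iv /Rintegral; congr fine; apply: ae_eq_integral => //.
- exact/measurable_EFinP.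
- exact/measurable_EFinP.
- by apply: filterS fg => x /= -> _.
Qed.

Lemma int1_ae f g : measurable_fun setT g ->
  {ae mu, forall x, f x = g x} -> int1 f -> int1 g.
Proof.
move=> mg fg hf; have mf := int1_measurable hf; apply/integrableP; split.
  exact/measurable_EFinP.
have /integrableP[_] := hf; apply: le_lt_trans.
rewrite le_eqVlt; apply/orP; left; apply/eqP; apply: ae_eq_integral => //.
- by apply: measurableT_comp => //; exact/measurable_EFinP.
- by apply: measurableT_comp => //; exact/measurable_EFinP.
- by apply: filterS fg => x /= -> _.
Qed.

Lemma Iv_le_ae f g : int1 f -> int1 g -> {ae mu, forall x, f x <= g x} ->
  Iv f <= Iv g.
Proof.
move=> hf hg fg.
have mf := int1_measurable hf; have mg := int1_measurable hg.
(* The maximum equals [g] almost everywhere and dominates [f] everywhere, which reduces the claim to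
   the pointwise comparison. *)
have mm : measurable_fun setT (fun x => Num.max (f x) (g x)).
  exact: measurable_maxr.
have -> : Iv g = Iv (fun x => Num.max (f x) (g x)).
  by apply: Iv_ae => //; apply: filterS fg => x /max_idPr ->.
apply: Iv_le => //; last by move=> x; rewrite le_max lexx.
apply: int1_ae hg => //; by apply: filterS fg => x /max_idPr ->.
Qed.

Lemma Iv_eq0_ae f : int1 f -> (forall x, 0 <= f x) -> Iv f = 0 ->
  {ae mu, forall x, f x = 0}.
Proof.
move=> hf f0 If.
have mf := int1_measurable hf.
have : (\int[mu]_x `|(EFin \o f) x|)%E = 0%E.
  rewrite -[LHS]fineK; last first.
    apply: integrable_fin_num => //; exact: integrable_norm.
  congr EFin; rewrite -[RHS]If /Iv /Rintegral; congr fine.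
  by apply: eq_integral => x _ /=; rewrite ger0_norm.
move/(ae_eq_integral_abs mu measurableT (proj2 (measurable_EFinP _ _) mf)).
by apply: filterS => x /= /(_ Logic.I) [].
Qed.

Lemma int1_fin f : measurable_fun setT f -> (forall x, 0 <= f x) ->
  (\int[mu]_x (f x)%:E < +oo)%E -> int1 f.
Proof.
move=> mf f0 h; apply/integrableP; split; first exact/measurable_EFinP.
by under eq_integral => x _ do rewrite /= ger0_norm//.
Qed.

Lemma EFin_Iv f : int1 f -> (Iv f)%:E = (\int[mu]_x (f x)%:E)%E.
Proof. by move=> hf; rewrite fineK//; exact: integrable_fin_num. Qed.

Lemma int2_measurable f : int2 f -> measurable_fun setT f.
Proof. by case. Qed.

Lemma int2M f g : int2 f -> int2 g -> int1 (fun x => f x * g x).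
Proof.
move=> [mf hf] [mg hg]; apply: (@int1_le _ (fun x => f x ^+ 2 + g x ^+ 2)).
- exact: measurable_funM.
- exact: int1D.
- move=> x; have := sqr_ge0 (f x + g x); have := sqr_ge0 (f x - g x).
  by rewrite ler_norml => h1 h2; apply/andP; split; nra.
Qed.

Lemma int2D f g : int2 f -> int2 g -> int2 (fun x => f x + g x).
Proof.
move=> hf hg; have [mf sf] := hf; have [mg sg] := hg.
split; first exact: measurable_funD.
apply: (@int1_le _ (fun x => 2 * (f x ^+ 2 + g x ^+ 2))).
- by apply: measurable_funX; exact: measurable_funD.
- by apply: int1Z; exact: int1D.
- by move=> x; rewrite ger0_norm ?sqr_ge0//; have := sqr_ge0 (f x - g x); nra.
Qed.

Lemma int2Z k f : int2 f -> int2 (fun x => k * f x).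
Proof.
move=> [mf hf]; split; first exact: measurable_funM.
by apply: int1_eq (int1Z (k ^+ 2) hf) => x; rewrite exprMn.
Qed.

Lemma int2N f : int2 f -> int2 (fun x => - f x).
Proof.
move=> [mf hf]; split; first exact: measurableT_comp.
by apply: int1_eq hf => x; rewrite sqrrN.
Qed.

Lemma int2B f g : int2 f -> int2 g -> int2 (fun x => f x - g x).
Proof. by move=> hf hg; apply: int2D => //; exact: int2N. Qed.

Lemma int2_le f g : measurable_fun setT f -> int2 g ->
  (forall x, `|f x| <= `|g x|) -> int2 f.
Proof.
move=> mf [mg hg] fg; split => //; apply: int1_le hg _.
  exact: measurable_funX.
by move=> x; rewrite ger0_norm ?sqr_ge0// -(real_normK (num_real (f x)))
   -(real_normK (num_real (g x))) ler_sqr ?nnegrE.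
Qed.

Lemma int2_0 : int2 (fun=> 0).
Proof.
by split => //; apply: int1_eq int10 => x; rewrite expr0n.
Qed.

Lemma int2_sum I (s : seq I) (p : pred I) (F : I -> T -> R) :
  (forall i, p i -> int2 (F i)) -> int2 (fun x => \sum_(i <- s | p i) F i x).
Proof.
move=> hF; elim: s => [|i s ih].
  by apply: int2_eq int2_0 => x; rewrite big_nil.
apply: (@int2_eq (fun x => if p i then F i x + \sum_(j <- s | p j) F j x
  else \sum_(j <- s | p j) F j x)) => [x|]; first by rewrite big_cons.
by case: (boolP (p i)) => // pi; apply: int2D => //; exact: hF.
Qed.

Lemma int2_ae f g : measurable_fun setT g ->
  {ae mu, forall x, f x = g x} -> int2 f -> int2 g.
Proof.
move=> mg fg [mf hf]; split => //; apply: int1_ae hf.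
  exact: measurable_funX.
by apply: filterS fg => x ->.
Qed.

(** The integral of the square of [f - k g] is a nonnegative quadratic in [k]; the bound is its
    value at the minimum [k = b / c]. *)
Lemma cauchy_schwarz f g : int2 f -> int2 g ->
  Iv (fun x => f x * g x) ^+ 2 <=
  Iv (fun x => f x ^+ 2) * Iv (fun x => g x ^+ 2).
Proof.
move=> hf hg; have [mf sf] := hf; have [mg sg] := hg.
set a := Iv (fun x => f x ^+ 2); set b := Iv _; set c := Iv (fun x => g x ^+ 2).
have a0 : 0 <= a by apply: Iv_ge0 => x; exact: sqr_ge0.
have c0 : 0 <= c by apply: Iv_ge0 => x; exact: sqr_ge0.
have key k : 0 <= a - 2 * k * b + k ^+ 2 * c.
  have -> : a - 2 * k * b + k ^+ 2 * c =
      Iv (fun x => (f x ^+ 2 - 2 * k * (f x * g x)) + k ^+ 2 * g x ^+ 2).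
    have i1 : int1 (fun x => 2 * k * (f x * g x)) by apply: int1Z; exact: int2M.
    rewrite IvD; [|exact: int1B|exact: int1Z].
    by rewrite IvB// !IvZ//; exact: int2M.
  apply: Iv_ge0 => x.
  have -> : f x ^+ 2 - 2 * k * (f x * g x) + k ^+ 2 * g x ^+ 2
    = (f x - k * g x) ^+ 2 by ring.
  exact: sqr_ge0.
have [c0'|cpos] := eqVneq c 0.
  have [->|b0] := eqVneq b 0; first by rewrite expr0n c0' mulr0.
  (* For [c = 0] the expression is affine in [k], and this [k] gives it the negative value
     [- a - 2]. *)
  have := key ((a + 1) / b); rewrite c0' !mulr0 addr0.
  by rewrite mulrA mulrAC -mulrA divff//; lra.
have {}cpos : 0 < c by rewrite lt_neqAle eq_sym cpos.
have := key (b / c); have -> : a - 2 * (b / c) * b + (b / c) ^+ 2 * c = a - b ^+ 2 / c.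
  by field; rewrite gt_eqF.
by rewrite subr_ge0 ler_pdivrMr.
Qed.

Lemma dct (F : nat -> T -> R) f g : (forall n, measurable_fun setT (F n)) ->
  measurable_fun setT f -> int1 g ->
  (forall n x, `|F n x| <= g x) ->
  {ae mu, forall x, F n x @[n --> \oo] --> f x} ->
  Iv (F n) @[n --> \oo] --> Iv f.
Proof.
move=> mF mf ig Fg Ff.
have mF' n : measurable_fun setT (EFin \o F n) by exact/measurable_EFinP.
have mf' : measurable_fun setT (EFin \o f) by exact/measurable_EFinP.
have Ff' : {ae mu, forall x, setT x -> (EFin \o F n) x @[n --> \oo] --> (EFin \o f) x}.
  by apply: filterS Ff => x Hx _; apply/fine_cvgP; split; [exact: nearW|].
have Fg' : {ae mu, forall x n, setT x -> (`|(EFin \o F n) x| <= (EFin \o g) x)%E}.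
  by apply: aeW => x n _; rewrite lee_fin.
have [i1 _ h] := dominated_convergence measurableT mF' mf' Ff' ig Fg'.
by move: h; rewrite -EFin_Iv// => /fine_cvg.
Qed.

End L1L2.

(** * Measurability and conditioning *)

Section probability_cst.
Context {d : measure_display} {T : measurableType d} {R : realType}.
Variable P : probability T R.

Lemma int1_cst k : int1 P (fun=> k).
Proof. exact: finite_measure_integrable_cst. Qed.

Lemma Iv_cst k : Iv P (fun=> k) = k.
Proof.
transitivity (k * fine (P setT)); first exact: Rintegral_cst.
by rewrite probability_setT mulr1.
Qed.

Lemma int2_cst k : int2 P (fun=> k).
Proof. by split => //; exact: int1_cst. Qed.

End probability_cst.

Section rv_in_theory.
Context {d : measure_display} {Omega : measurableType d} {R : realType}.
Variables (P : probability Omega R) (G0 : set (set Omega)).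
Local Notation G := <<s G0 >>.
Local Notation GT := (g_sigma_algebraType G0).
Implicit Types f g : Omega -> R.

Lemma rv_inP f : rv_in G f <-> measurable_fun setT (f : GT -> R).
Proof.
split => [h _ B mB|h B mB]; first by rewrite setTI; exact: h.
by have := h measurableT B mB; rewrite setTI.
Qed.

Lemma rv_in_cst (k : R) : rv_in G (fun=> k : R).
Proof. by apply/rv_inP; exact: measurable_cst. Qed.

Lemma rv_inD f g : rv_in G f -> rv_in G g -> rv_in G (fun w => f w + g w).
Proof. by move=> /rv_inP hf /rv_inP hg; apply/rv_inP; exact: measurable_funD. Qed.

Lemma rv_inM f g : rv_in G f -> rv_in G g -> rv_in G (fun w => f w * g w).
Proof. by move=> /rv_inP hf /rv_inP hg; apply/rv_inP; exact: measurable_funM. Qed.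

Lemma rv_in_comp (h : R -> R) f : measurable_fun setT h -> rv_in G f ->
  rv_in G (fun w => h (f w)).
Proof. by move=> mh /rv_inP hf; apply/rv_inP; exact: measurableT_comp. Qed.

Lemma rv_inZ k f : rv_in G f -> rv_in G (fun w => k * f w).
Proof. by move=> hf; apply: rv_inM => //; exact: rv_in_cst. Qed.

Lemma rv_inN f : rv_in G f -> rv_in G (fun w => - f w).
Proof.
move=> hf; rewrite (_ : (fun w => _) = fun w => -1 * f w); first exact: rv_inZ.
by apply/funext => w; rewrite mulN1r.
Qed.

Lemma rv_inB f g : rv_in G f -> rv_in G g -> rv_in G (fun w => f w - g w).
Proof. by move=> hf hg; apply: rv_inD => //; exact: rv_inN. Qed.

Lemma rv_in_sum I (s : seq I) (p : pred I) (F : I -> Omega -> R) :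
  (forall i, p i -> rv_in G (F i)) ->
  rv_in G (fun w => \sum_(i <- s | p i) F i w).
Proof.
move=> hF; elim: s => [|i s ih].
  rewrite (_ : (fun w => _) = fun=> 0); first exact: rv_in_cst.
  by apply/funext => w; rewrite big_nil.
case: (boolP (p i)) => pi; last first.
  rewrite (_ : (fun w => _) = fun w => \sum_(j <- s | p j) F j w) //.
  by apply/funext => w; rewrite big_cons (negbTE pi).
rewrite (_ : (fun w => _) = fun w => F i w + \sum_(j <- s | p j) F j w).
  by apply: rv_inD => //; exact: hF.
by apply/funext => w; rewrite big_cons pi.
Qed.

Lemma rv_in_indic A : G A -> rv_in G (\1_A : Omega -> R).
Proof. by move=> GA; apply/rv_inP; exact: measurable_indic. Qed.

Lemma rv_in_if (b : Omega -> bool) f g : G [set w | b w] -> rv_in G f ->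
  rv_in G g -> rv_in G (fun w => if b w then f w else g w).
Proof.
move=> hb hf hg.
rewrite (_ : (fun w => _) = fun w => \1_[set w | b w] w * f w + (1 - \1_[set w | b w] w) * g w).
  apply: rv_inD; apply: rv_inM => //; first exact: rv_in_indic.
  by apply: rv_inB; [exact: rv_in_cst|exact: rv_in_indic].
apply/funext => w; rewrite indicE; case: (boolP (b w)) => bw.
  by rewrite mem_set// subrr mul0r addr0 mul1r.
by rewrite memNset ?mul0r ?add0r ?subr0 ?mul1r//; exact/negP.
Qed.

Lemma rv_in_le f g : rv_in G f -> rv_in G g -> G [set w | f w <= g w].
Proof.
move=> /rv_inP hf /rv_inP hg.
have := @measurable_fun_le _ GT R setT f g measurableT hf hg.
by rewrite setTI.
Qed.

Lemma rv_in_eq f g : rv_in G f -> rv_in G g -> G [set w | f w = g w].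
Proof.
move=> hf hg; have h1 := rv_in_le hf hg; have h2 := rv_in_le hg hf.
have := @measurableI _ GT _ _ h1 h2.
rewrite (_ : _ `&` _ = [set w | f w = g w])//; apply/seteqP; split => w /=.
  by move=> [? ?]; apply/eqP; rewrite eq_le; apply/andP.
by move=> ->.
Qed.

Lemma rv_in_lt f g : rv_in G f -> rv_in G g -> G [set w | f w < g w].
Proof.
move=> hf hg; have h1 := rv_in_le hg hf.
have := @measurableC _ GT _ h1.
rewrite (_ : ~` _ = [set w | f w < g w])//; apply/seteqP; split => w /=.
  by move=> /negP; rewrite ltNge.
by rewrite ltNge => /negP.
Qed.

Hypothesis subG : G `<=` measurable.

Lemma rv_in_measurable f : rv_in G f -> measurable_fun setT f.
Proof. by move=> hf _ B mB; rewrite setTI; apply: subG; exact: hf. Qed.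

(** Stands for a vanishing conditional expectation of [D] given [<<s G0>>], tested on indicators
    only. *)
Definition cond0 (D : Omega -> R) : Prop :=
  int1 P D /\ forall A, G A -> Iv P (fun w => \1_A w * D w) = 0.

Import HBNNSimple.

(** Simple functions measurable for [G] reduce to indicators by linearity; their increasing
    approximation of [f] is dominated through [|f D|], so the identity passes to the limit. *)
Lemma cond0_ge0 D f : cond0 D -> rv_in G f -> (forall w, 0 <= f w) ->
  int1 P (fun w => f w * D w) -> Iv P (fun w => f w * D w) = 0.
Proof.
move=> [iD hD] hf f0 ifD.
have mf : measurable_fun setT (EFin \o f : GT -> \bar R).
  by apply/measurable_EFinP; apply/rv_inP.
pose s n : {nnsfun GT >-> R} := nnsfun_approx (measurableT : measurable (setT : set GT)) mf n.
have sf n w : s n w <= f w.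
  rewrite -lee_fin /s nnsfun_approxE; apply: (le_approx _ (D := setT)) => //.
  by move=> x _; rewrite lee_fin.
have ms n : rv_in G (s n) by apply/rv_inP; exact: measurable_funP.
have s0 n : Iv P (fun w => s n w * D w) = 0.
  pose S := fset_set (range (s n)).
  have -> : Iv P (fun w => s n w * D w) =
     Iv P (fun w => \sum_(i < #|` S|) (S`_i * (\1_(s n @^-1` [set S`_i]) w * D w))).
    apply: Iv_eq => w; rewrite {1}(fimfunEord (s n)) mulr_suml.
    by apply: eq_bigr => i _; rewrite mulrA.
  have iA i : int1 P (fun w => \1_(s n @^-1` [set S`_i]) w * D w).
    apply: (int1_le _ (int1_norm iD)).
      apply: measurable_funM; last exact: int1_measurable iD.
      apply/measurable_indic/subG; exact: ms.
    move=> w; rewrite normrM ler_piMl// indicE; by case: (_ \in _); rewrite ?normr1 ?normr0.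
  rewrite Iv_sum; last by move=> i _; apply: int1Z; exact: iA.
  by rewrite big1// => i _; rewrite IvZ// hD ?mulr0//; exact: ms.
have /cvg_lim <- // : Iv P (fun w => s n w * D w) @[n --> \oo] --> Iv P (fun w => f w * D w).
  apply: (@dct _ _ _ _ _ _ (fun w => `|f w * D w|)).
  - move=> n; apply: measurable_funM; last exact: int1_measurable iD.
    exact: rv_in_measurable.
  - exact: (int1_measurable ifD).
  - exact: int1_norm.
  - move=> n w; rewrite !normrM ler_wpM2r// !ger0_norm//.
  - apply: aeW => w; apply: cvgM; last exact: cvg_cst.
    have hc : (s n w)%:E @[n --> \oo] --> (f w)%:E.
      apply: (@cvg_nnsfun_approx _ GT R setT measurableT _ mf _ w) => //.
      by move=> x _; rewrite lee_fin.
    exact: fine_cvg hc.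
by under eq_fun do rewrite s0; rewrite lim_cst.
Qed.

Lemma cond0P D f : cond0 D -> rv_in G f ->
  int1 P (fun w => f w * D w) -> Iv P (fun w => f w * D w) = 0.
Proof.
move=> cD hf ifD; have [iD _] := cD.
have mp : rv_in G (fun w => Num.max (f w) 0).
  by apply: (@rv_in_comp (fun x => Num.max x 0)) => //; exact: measurable_maxr.
have mn : rv_in G (fun w => Num.max (- f w) 0).
  by apply: (@rv_in_comp (fun x => Num.max (-x) 0)) => //; exact: measurable_maxr.
have ip : int1 P (fun w => Num.max (f w) 0 * D w).
  apply: (int1_le _ (int1_norm ifD)).
    by apply: measurable_funM; [exact: rv_in_measurable|exact: int1_measurable iD].
  move=> w; rewrite !normrM ler_wpM2r//.
  by rewrite maxEle; case: ifP => _ //; rewrite normr0.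
have ineg : int1 P (fun w => Num.max (- f w) 0 * D w).
  apply: (int1_le _ (int1_norm ifD)).
    by apply: measurable_funM; [exact: rv_in_measurable|exact: int1_measurable iD].
  move=> w; rewrite !normrM ler_wpM2r//.
  by rewrite maxEle; case: ifP => _ //; rewrite ?normrN ?normr0.
have -> : Iv P (fun w => f w * D w) =
   Iv P (fun w => Num.max (f w) 0 * D w - Num.max (- f w) 0 * D w).
  apply: Iv_eq => w; rewrite -mulrBl; congr (_ * _).
  by rewrite !maxEle oppr_le0; case: (leP (f w) 0); case: (leP 0 (f w)); lra.
by rewrite IvB// !cond0_ge0 ?subr0// => w; rewrite le_max lexx orbT.
Qed.

Section independence.
Variables (nu : probability (measurableTypeR R) R) (Phi : Omega -> measurableTypeR R).
Hypothesis mPhi : measurable_fun setT Phi.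
Hypothesis indep : forall A B, G A -> measurable B ->
  P (A `&` Phi @^-1` B) = (P A * nu B)%E.

(** The identity is seen as a random element of the sample space with the smaller sigma-algebra.
    Independence of [Phi] from [G] then says that the pair [h] has a product law, and Fubini does
    the rest. *)
Let idG (w : Omega) : GT := w.
Let midG : measurable_fun setT idG.
Proof. by move=> _ A mA; rewrite setTI; exact: subG. Qed.
Let h (w : Omega) : GT * measurableTypeR R := (w, Phi w).
Let mh : measurable_fun setT h.
Proof. by apply/measurable_fun_pairP; split; [exact: midG|exact: mPhi]. Qed.
HB.instance Definition _ := isMeasurableFun.Build _ _ _ _ idG midG.
HB.instance Definition _ := isMeasurableFun.Build _ _ _ _ h mh.
Let PG : probability GT R := distribution P idG.
Let Ph : probability (GT * measurableTypeR R)%type R := distribution P h.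

Let lawE X : measurable X -> Ph X = (PG \x nu)%E X.
Proof.
move=> mX; apply/esym; exact: product_measure_unique.
Qed.

Lemma indep_int1 f (g : measurableTypeR R -> R) : rv_in G f -> int1 P f -> int1 nu g ->
  int1 P (fun w => f w * g (Phi w)) /\
  Iv P (fun w => f w * g (Phi w)) = Iv P f * Iv nu g.
Proof.
move=> hf if_ ig.
have mf := proj1 (rv_inP f) hf.
have mg := int1_measurable ig.
have mfg : measurable_fun setT (fun p : GT * measurableTypeR R => f p.1 * g p.2).
  apply: measurable_funM; first exact: (measurableT_comp mf).
  exact: (measurableT_comp mg).
have if' : int1 PG f.
  by apply: (@integrable_pushforward _ _ _ _ _ idG midG) => //; exact/measurable_EFinP.
have ifg : int1 (PG \x nu)%E (fun p => f p.1 * g p.2).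
  apply/integrable12ltyP; first exact/measurable_EFinP.
  have -> : (\int[PG]_x \int[nu]_y `|(EFin \o (fun p => f p.1 * g p.2)%R) (x, y)|)%E
    = (\int[PG]_x (`|f x| * Iv nu (fun y => `|g y|))%R%:E)%E.
    apply: eq_integral => x _ /=.
    rewrite -IvZ; last exact: int1_norm.
    rewrite EFin_Iv; last by apply: int1Z; exact: int1_norm.
    by apply: eq_integral => y _; rewrite normrM.
  rewrite -EFin_Iv ?ltry//.
  have := int1Z (Iv nu (fun y => `|g y|)) (int1_norm if').
  by apply: int1_eq => x; rewrite mulrC.
have ifgh : int1 Ph (fun p => f p.1 * g p.2).
  have /integrableP[m1 m2] := ifg; apply/integrableP; split => //.
  by rewrite (eq_measure_integral (PG \x nu)%E)// => A mA _; exact: lawE.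
have ifgP : int1 P (fun w => f w * g (Phi w)).
  apply/integrableP; split.
    apply/measurable_EFinP; apply: measurable_funM; first exact: rv_in_measurable.
    exact: measurableT_comp.
  have /integrableP[_] := ifgh.
  rewrite ge0_integral_pushforward//.
  by apply: measurableT_comp => //; exact/measurable_EFinP.
split => //.
have -> : Iv P (fun w => f w * g (Phi w)) = Iv Ph (fun p => f p.1 * g p.2).
  rewrite /Iv /Rintegral [in RHS]integral_pushforward//.
  exact/measurable_EFinP.
have -> : Iv Ph (fun p => f p.1 * g p.2) = Iv (PG \x nu)%E (fun p => f p.1 * g p.2).
  rewrite /Iv /Rintegral; congr fine.
  by apply: eq_measure_integral => A mA _; exact: lawE.
rewrite /Iv /Rintegral -integral12_prod_meas1//.
have -> : (\int[PG]_x fubini_F nu (fun z => (f z.1 * g z.2)%:E) x)%E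
   = (\int[PG]_x (Iv nu g * f x)%R%:E)%E.
  apply: eq_integral => x _ /=.
  by rewrite /fubini_F /= mulrC -IvZ// EFin_Iv//; exact: int1Z.
rewrite -/(Rintegral PG setT _) -/(Iv PG _) IvZ// mulrC; congr (_ * _).
rewrite /Iv /Rintegral integral_pushforward//.
exact/measurable_EFinP.
Qed.

End independence.

End rv_in_theory.

(** * Gaussian moments *)

Section normal_moments.
Context {R : realType}.
Variable sigma : R.
Hypothesis sigma_gt0 : 0 < sigma.
Local Notation nu := (normal_prob 0 sigma).
Local Notation leb := (@lebesgue_measure R).

(** The Radon-Nikodym derivative of the normal law is identified almost everywhere with
    [normal_pdf], which turns expectations into Lebesgue integrals. *)
Lemma ge0_integral_normal_prob (f : R -> R) :
  measurable_fun setT f -> (forall x, 0 <= f x) ->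
  (\int[nu]_x (f x)%:E = \int[leb]_x (f x * normal_pdf 0 sigma x)%:E)%E.
Proof.
move=> mf f0; have dom := normal_prob_dominates (0:R) sigma.
rewrite -(Radon_Nikodym_SigmaFinite.change_of_variables dom)//; first last.
- exact/measurable_EFinP.
apply: ae_eq_integral => //.
- apply: emeasurable_funM; first exact/measurable_EFinP.
  exact: measurable_int (Radon_Nikodym_SigmaFinite.f_integrable dom).
- apply/measurable_EFinP; apply: measurable_funM => //.
  exact: measurable_normal_pdf.
under [X in ae_eq _ _ _ X]eq_fun do rewrite EFinM.
apply: ae_eqe_mul2l; apply: integral_ae_eq => //.
- exact: Radon_Nikodym_SigmaFinite.f_integrable.
- apply/measurable_EFinP; exact: measurable_normal_pdf.
- by move=> E _ mE; rewrite -(Radon_Nikodym_SigmaFinite.f_integral dom).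
Qed.

(** A likelihood ratio of two normal densities has expectation 1. Both exponential moments below are
    such ratios, so no Gaussian integral is computed directly. *)
Lemma normal_ratio (m s : R) (r : R -> R) : measurable_fun setT r ->
  (forall x, 0 <= r x) ->
  (forall x, r x * normal_pdf 0 sigma x = normal_pdf m s x) ->
  int1 nu r /\ Iv nu r = 1.
Proof.
move=> mr r0 re.
have e : (\int[nu]_x (r x)%:E = 1)%E.
  rewrite ge0_integral_normal_prob// -[RHS](integral_normal_pdf m s).
  by apply: eq_integral => x _; rewrite re.
have i : int1 nu r by apply: int1_fin => //; rewrite e ltry.
by split => //; apply: EFin_inj; rewrite EFin_Iv.
Qed.

Let s0 : sigma != 0. Proof. by rewrite gt_eqF. Qed.

Lemma normal_exp (m : R) :
  let r x := expR (m * x / sigma ^+ 2 - m ^+ 2 / (sigma ^+ 2 *+ 2)) in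
  int1 nu r /\ Iv nu r = 1.
Proof.
move=> r; apply: (@normal_ratio m sigma).
- apply: measurableT_comp => //; apply: measurable_funB => //.
  apply: measurable_funM => //; exact: measurable_funM.
- by move=> x; exact: expR_ge0.
- move=> x; rewrite !normal_pdfE// mulrCA; congr (_ * _).
  rewrite /normal_fun /r -expRD; congr expR; field.
  by rewrite s0.
Qed.

Lemma normal_expsqr (rho : R) : 0 < rho ->
  let k := (1 - rho ^- 2) / (sigma ^+ 2 *+ 2) in
  int1 nu (fun x => expR (k * x ^+ 2)) /\
  Iv nu (fun x => expR (k * x ^+ 2)) = rho.
Proof.
move=> rho0 k.
have rn0 : rho != 0 by rewrite gt_eqF.
have [i1 e1] : int1 nu (fun x => rho^-1 * expR (k * x ^+ 2)) /\
   Iv nu (fun x => rho^-1 * expR (k * x ^+ 2)) = 1.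
  apply: (@normal_ratio 0 (rho * sigma)).
  - apply: measurable_funM => //; apply: measurableT_comp => //.
    by apply: measurable_funM => //; exact: measurable_funX.
  - by move=> x; apply: mulr_ge0; [rewrite invr_ge0 ltW|exact: expR_ge0].
  - move=> x; rewrite !normal_pdfE ?mulf_neq0//.
    rewrite mulrACA; congr (_ * _).
      rewrite /normal_peak.
      have -> : (rho * sigma) ^+ 2 * pi *+ 2 = rho ^+ 2 * (sigma ^+ 2 * pi *+ 2).
        by rewrite exprMn -mulrA mulrnAr.
      rewrite (sqrtrM _ (sqr_ge0 rho)) (sqrtr_sqr rho) (ger0_norm (ltW rho0)).
      by rewrite invfM.
    rewrite /normal_fun -expRD; congr expR; rewrite /k; field.
    by rewrite s0 rn0.
have i2 : int1 nu (fun x => expR (k * x ^+ 2)).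
  by apply: int1_eq (int1Z rho i1) => x; rewrite mulrA divff// mul1r.
split => //; rewrite IvZ// in e1.
by apply: (mulfI (invr_neq0 rn0)); rewrite e1 mulVf.
Qed.

Let k2 := (1 - 2 ^- 2) / (sigma ^+ 2 *+ 2) : R.
Let k2_gt0 : 0 < k2.
Proof.
rewrite /k2 divr_gt0//; first by lra.
by rewrite pmulrn_lgt0// exprn_gt0.
Qed.

(** With [y = k2 x^2], the bound [y^2 <= 4 exp y] and the exponential moment for [rho = 2] give the
    constant 512/9, rounded up to 64. *)
Lemma normal_int4 : int1 nu (fun x => x ^+ 4) /\
  Iv nu (fun x => x ^+ 4) <= 64 * sigma ^+ 4.
Proof.
have [i e] := normal_expsqr (ltr0n _ 2); rewrite -/k2 in i e.
have kx x : x ^+ 4 <= 4 / k2 ^+ 2 * expR (k2 * x ^+ 2).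
  have y0 : 0 <= k2 * x ^+ 2 by rewrite mulr_ge0 ?sqr_ge0// ltW.
  rewrite mulrAC ler_pdivlMr ?exprn_gt0//.
  have -> : x ^+ 4 * k2 ^+ 2 = (k2 * x ^+ 2) ^+ 2 by ring.
  have := expR_ge1Dx (k2 * x ^+ 2 / 2).
  move: y0; set y := k2 * x ^+ 2 => y0 h.
  have -> : expR y = expR (y / 2) ^+ 2.
    by rewrite -expRM_natl; congr expR; rewrite mulrC divfK.
  have : 0 <= y / 2 by rewrite divr_ge0.
  move: h; set e' := expR _; move: (expR_ge0 (y/2)); rewrite -/e'. nra.
have i4 : int1 nu (fun x => x ^+ 4).
  apply: (int1_le _ (int1Z (4 / k2 ^+ 2) i)); first exact: measurable_funX.
  by move=> x; rewrite ger0_norm// (exprM x 2 2) sqr_ge0.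
split => //; apply: le_trans (Iv_le i4 (int1Z (4 / k2 ^+ 2) i) kx) _.
rewrite IvZ// e /k2.
have -> : 4 / ((1 - 2 ^- 2) / (sigma ^+ 2 *+ 2)) ^+ 2 * 2 = (512 / 9) * sigma ^+ 4 :> R.
  by field; rewrite s0 /=; lra.
have : 0 <= sigma ^+ 4 by rewrite exprn_ge0// ltW.
lra.
Qed.

Lemma normal_int2 : int1 nu (fun x => x ^+ 2).
Proof.
have [i _] := normal_int4.
apply: (int1_le _ (int1D i (int1_cst nu 1))).
  exact: measurable_funX.
move=> x; rewrite ger0_norm ?sqr_ge0// (exprM x 2 2) /=.
by have := sqr_ge0 (x ^+ 2 - 1); have := sqr_ge0 x; nra.
Qed.

Lemma normal_int1 : int1 nu (fun x => x).
Proof.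
apply: (int1_le _ (int1D normal_int2 (int1_cst nu 1))) => //.
move=> x /=; rewrite ler_norml.
by have := sqr_ge0 (x - 1); have := sqr_ge0 (x + 1) => h1 h2; apply/andP; split; nra.
Qed.

(** From [1 + u <= exp u] and [normal_exp], m times the mean is at most [m^2 / 2] for every real m;
    small m of both signs force the mean to be 0. *)
Lemma normal_mean : Iv nu (fun x => x) = 0.
Proof.
have key m : m * Iv nu (fun x => x) <= m ^+ 2 / 2.
  have [i e] := normal_exp m.
  have i' : int1 nu (fun x => (1 - m ^+ 2 / (sigma ^+ 2 *+ 2)) + m / sigma ^+ 2 * x).
    apply: int1D; first exact: int1_cst.
    apply: int1Z; exact: normal_int1.
  have := Iv_le i' i; rewrite e.
  rewrite IvD; [|exact: int1_cst|exact: int1Z normal_int1].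
  rewrite IvZ; last exact: normal_int1.
  rewrite Iv_cst.
  move=> /(_ _)/= H.
  have {}H : 1 - m ^+ 2 / (sigma ^+ 2 *+ 2) + m / sigma ^+ 2 * Iv nu (fun x => x) <= 1.
    apply: H => x; apply: le_trans (expR_ge1Dx _).
    by rewrite le_eqVlt; apply/orP; left; apply/eqP; field.
  have : m / sigma ^+ 2 * Iv nu (fun x => x) <= m ^+ 2 / (sigma ^+ 2 *+ 2) by lra.
  have sp : 0 < (sigma ^+ 2)^-1 by rewrite invr_gt0 exprn_gt0.
  have -> : m ^+ 2 / (sigma ^+ 2 *+ 2) = m ^+ 2 / 2 * (sigma ^+ 2)^-1 by field.
  by rewrite mulrAC ler_pM2r.
apply/eqP; rewrite eq_le; apply/andP; split; apply/ler_addgt0Pr => e e0.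
- have := key (e); nra.
- have := key (- e); nra.
Qed.

(** The inequality [1 + k x^2 <= exp (k x^2)] compares the variance with [normal_expsqr]; letting
    [rho] tend to 1 from above gives the upper bound, from below the lower bound. *)
Lemma normal_variance : Iv nu (fun x => x ^+ 2) = sigma ^+ 2.
Proof.
set s := Iv _ _; have i2 := normal_int2.
have sp : 0 < sigma ^+ 2 by rewrite exprn_gt0.
have key rho : 0 < rho -> (1 - rho ^- 2) * s <= (rho - 1) * (sigma ^+ 2 *+ 2).
  move=> rho0; have [i e] := normal_expsqr rho0.
  set k := (1 - rho ^- 2) / (sigma ^+ 2 *+ 2) in i e *.
  have : Iv nu (fun x => 1 + k * x ^+ 2) <= rho.
    rewrite -[leRHS]e; apply: Iv_le => //.
      apply: int1D; first exact: int1_cst.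
      exact: int1Z.
    by move=> x; exact: expR_ge1Dx.
  rewrite IvD; [|exact: int1_cst|exact: int1Z].
  rewrite Iv_cst IvZ// -/s.
  move=> H.
  have {}H : k * s <= rho - 1 by lra.
  rewrite -ler_pdivrMr ?pmulrn_lgt0//.
  by rewrite mulrAC.
have s0' : 0 <= s by apply: Iv_ge0 => x; exact: sqr_ge0.
have key2 rho : 0 < rho -> (rho ^+ 2 - 1) * s <= (rho - 1) * (sigma ^+ 2 *+ 2) * rho ^+ 2.
  move=> r0; have H := ler_wpM2r (ltW (exprn_gt0 2 r0)) (key _ r0).
  apply: le_trans H; rewrite le_eqVlt; apply/orP; left; apply/eqP; field.
  by rewrite gt_eqF.
apply/eqP; rewrite eq_le; apply/andP; split; apply/ler_addgt0Pr => e e0.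
- pose h := Num.min 1 (e / (3 * sigma ^+ 2)).
  have h0 : 0 < h by rewrite lt_min ltr01 divr_gt0// mulr_gt0.
  have h1 : h <= 1 by rewrite ge_min lexx.
  have he : h * (3 * sigma ^+ 2) <= e.
    by rewrite -ler_pdivlMr ?mulr_gt0// ge_min lexx orbT.
  have := key2 (1 + h) (ltr_wpDr (ltW h0) ltr01).
  have -> : ((1 + h) ^+ 2 - 1) * s = h * ((2 + h) * s) by ring.
  have -> : (1 + h - 1) * (sigma ^+ 2 *+ 2) * (1 + h) ^+ 2 =
    h * (2 * sigma ^+ 2 * (1 + h) ^+ 2) by ring.
  rewrite ler_pM2l// => H. nra.
- pose h := Num.min (1/2) (e / (2 * sigma ^+ 2)).
  have h0 : 0 < h by rewrite lt_min divr_gt0//= divr_gt0// mulr_gt0.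
  have h1 : h <= 1/2 by rewrite ge_min lexx.
  have he : h * (2 * sigma ^+ 2) <= e.
    by rewrite -ler_pdivlMr ?mulr_gt0// ge_min lexx orbT.
  have h1' : 0 < 1 - h by lra.
  have := key2 (1 - h) h1'.
  have -> : ((1 - h) ^+ 2 - 1) * s = h * (- ((2 - h) * s)) by ring.
  have -> : (1 - h - 1) * (sigma ^+ 2 *+ 2) * (1 - h) ^+ 2 =
    h * (- (2 * sigma ^+ 2 * (1 - h) ^+ 2)) by ring.
  rewrite ler_pM2l// => H. nra.
Qed.

End normal_moments.

(** * Product of the sample space and time *)

Section L1_more.
Context d (T : measurableType d) (R : realType) (mu : {measure set T -> \bar R}).
Implicit Types f g : T -> R.

Lemma int1_le_ae f g : measurable_fun setT f -> int1 mu g ->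
  {ae mu, forall x, `|f x| <= g x} -> int1 mu f.
Proof.
move=> mf ig fg; apply/integrableP; split; first exact/measurable_EFinP.
have /integrableP[mg] := ig; apply: le_lt_trans.
apply: ae_ge0_le_integral => //.
- by apply: measurableT_comp => //; exact/measurable_EFinP.
- by apply: measurableT_comp => //.
- apply: filterS fg => x fgx _ /=; rewrite lee_fin (le_trans fgx)//.
  exact: ler_norm.
Qed.

Lemma int1M_bounded f g (k : R) : measurable_fun setT f ->
  (forall x, `|f x| <= k) -> int1 mu g -> int1 mu (fun x => f x * g x).
Proof.
move=> mf fk ig; apply: (int1_le _ (int1Z k (int1_norm ig))).
  by apply: measurable_funM => //; exact: int1_measurable ig.
by move=> x; rewrite normrM ler_wpM2r.
Qed.

Lemma int2M_bounded f g (k : R) : measurable_fun setT f ->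
  (forall x, `|f x| <= k) -> int2 mu g -> int2 mu (fun x => f x * g x).
Proof.
move=> mf fk ig; apply: (int2_le _ (int2Z k ig)).
  by apply: measurable_funM => //; exact: int2_measurable ig.
move=> x; rewrite !normrM ler_wpM2r//.
by apply: le_trans (fk x) _; exact: ler_norm.
Qed.

Lemma int1_set g (A : set T) : measurable A -> int1 mu g ->
  int1 mu (fun x => \1_A x * g x).
Proof.
move=> mA; apply: (@int1M_bounded _ _ 1); first exact: measurable_indic.
by move=> x; rewrite indicE; case: (_ \in _); rewrite ?normr1 ?normr0.
Qed.

Lemma int2_set g (A : set T) : measurable A -> int2 mu g ->
  int2 mu (fun x => \1_A x * g x).
Proof.
move=> mA; apply: (@int2M_bounded _ _ 1); first exact: measurable_indic.
by move=> x; rewrite indicE; case: (_ \in _); rewrite ?normr1 ?normr0.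
Qed.

End L1_more.

(** Half-open on the left like predictable rectangles, so that adjacent intervals add up without a
    correction at the common endpoint. *)
Definition ind {R : realType} (s t u : R) : R := ((s < u <= t)%R)%:R.

Section ind_theory.
Context {R : realType}.
Implicit Types s t u r : R.

Lemma indE s t u : ind s t u = \1_(`]s, t]%classic) u.
Proof.
rewrite indicE /ind; congr ((nat_of_bool _)%:R); apply/idP/idP => [h|/set_mem].
  by rewrite mem_set//= in_itv.
by rewrite /= in_itv.
Qed.

Lemma measurable_ind s t : measurable_fun setT (ind s t).
Proof. by rewrite (funext (indE s t)); exact: measurable_indic. Qed.

Lemma ind_ge0 s t u : 0 <= ind s t u. Proof. exact: ler0n. Qed.

Lemma ind_le1 s t u : ind s t u <= 1.
Proof. by rewrite /ind; case: ((_ < _ <= _)%R) => //=; rewrite ler01. Qed.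

Lemma norm_ind s t u : `|ind s t u| <= 1.
Proof. by rewrite ger0_norm ?ind_ge0// ind_le1. Qed.

Lemma ind_idem s t u : ind s t u ^+ 2 = ind s t u.
Proof. by rewrite /ind; case: ((_ < _ <= _)%R); rewrite ?expr1n ?expr0n. Qed.

Lemma ind_cat s r t u : s <= r -> r <= t -> ind s t u = ind s r u + ind r t u.
Proof.
move=> sr rt; rewrite /ind.
case: (leP u r) => ur; case: (ltP s u) => su //=; rewrite ?andbF ?andbT ?addr0 ?add0r//.
- by rewrite (le_trans ur rt).
- by have := le_lt_trans su (le_lt_trans sr ur); rewrite ltxx.
Qed.

Lemma ind_sub s t s' t' u : s' <= s -> t <= t' -> ind s t u = ind s t u * ind s' t' u.
Proof.
move=> h1 h2; rewrite /ind; case: (boolP (s < u <= t)); last by rewrite mul0r.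
by move=> /andP[su ut]; rewrite (le_lt_trans h1 su) (le_trans ut h2) mulr1.
Qed.

Lemma int1_ind s t : int1 (@lebesgue_measure R) (ind s t).
Proof.
rewrite (funext (indE s t)); exact: integrable_indic_itv.
Qed.

Lemma Iv_ind s t : s <= t -> Iv (@lebesgue_measure R) (ind s t) = t - s.
Proof.
move=> st; rewrite (funext (indE s t)) /Iv /Rintegral integral_indic// setIT.
rewrite /= lebesgue_measure_itv /= lte_fin; move: st; rewrite le_eqVlt.
by move=> /predU1P[->|->]//=; rewrite ltxx subrr.
Qed.

End ind_theory.

Section fubini_strip.
Context {d : measure_display} {Omega : measurableType d} {R : realType}.
Variable P : probability Omega R.
Local Notation leb := (@lebesgue_measure R).
Local Notation mu := (P \x lebesgue_measure)%E.
Implicit Types (f g : Omega * R -> R) (s t u : R).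

Definition slice f w : R := Iv leb (fun u => f (w, u)).

Lemma int1_slice_ae f : int1 mu f ->
  {ae P, forall w, int1 leb (fun u => f (w, u))}.
Proof. by move=> hf; have := ae_integrable1 hf. Qed.

Lemma slice_int1 f : int1 mu f -> int1 P (slice f).
Proof.
move=> hf; have iF := integrable_fubini_F hf.
apply/integrableP; split.
  apply/measurable_EFinP.
  have mF : measurable_fun setT (fubini_F leb (EFin \o f)) := measurable_int _ iF.
  exact: (measurableT_comp (fine_measurable measurableT) mF).
have /integrableP[mF h] := iF; apply: le_lt_trans h.
apply: ae_ge0_le_integral => //.
- apply: measurableT_comp => //; apply/measurable_EFinP.
  exact: (measurableT_comp (fine_measurable measurableT) mF).
- exact: measurableT_comp.
- apply: filterS (int1_slice_ae hf) => w hw _.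
  by have -> : fubini_F leb (EFin \o f) w = (slice f w)%:E by rewrite /slice EFin_Iv.
Qed.

Lemma slice_Iv f : int1 mu f -> Iv P (slice f) = Iv mu f.
Proof.
move=> hf; apply: EFin_inj; rewrite !EFin_Iv//; last exact: slice_int1.
have -> : (\int[mu]_x (f x)%:E = \int[P]_w fubini_F leb (EFin \o f) w)%E.
  by rewrite integral12_prod_meas1.
have iF := integrable_fubini_F hf.
apply: ae_eq_integral => //.
- apply/measurable_EFinP; exact: int1_measurable (slice_int1 hf).
- exact: measurable_int iF.
- by apply: filterS (int1_slice_ae hf) => w hw _; rewrite /slice EFin_Iv.
Qed.

Lemma Iv_swap f : int1 mu f -> (forall u, int1 P (fun w => f (w, u))) ->
  Iv mu f = Iv leb (fun u => Iv P (fun w => f (w, u))).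
Proof.
move=> hf hu; rewrite /Iv {1 2}/Rintegral; congr fine.
rewrite -integral21_prod_meas1//; apply: eq_integral => u _.
by rewrite /fubini_G -EFin_Iv//; exact: hu.
Qed.

Lemma measurable_strip_fst (g : Omega -> R) : measurable_fun setT g ->
  measurable_fun setT (fun p : Omega * R => g p.1).
Proof. by move=> mg; exact: measurableT_comp. Qed.

Lemma measurable_strip_ind s t :
  measurable_fun setT (fun p : Omega * R => ind s t p.2).
Proof. exact: (measurableT_comp (measurable_ind s t)). Qed.

Lemma int1_strip s t (g : Omega -> R) : int1 P g ->
  int1 mu (fun p => ind s t p.2 * g p.1).
Proof.
move=> ig; apply/integrable12ltyP.
  apply/measurable_EFinP; apply: measurable_funM; first exact: measurable_strip_ind.
  by apply: measurable_strip_fst; exact: int1_measurable ig.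
have i1 : int1 leb (fun u => `|ind s t u|) by apply: int1_norm; exact: int1_ind.
rewrite (eq_integral (fun w => ((Iv leb (fun u => `|ind s t u|)) * `|g w|)%:E)).
  rewrite -EFin_Iv ?ltry//; apply: int1Z; exact: int1_norm.
move=> w _ /=; rewrite mulrC -IvZ// EFin_Iv; last exact: int1Z.
by apply: eq_integral => u _; rewrite normrM mulrC.
Qed.

Lemma int2_strip s t (g : Omega -> R) : int2 P g ->
  int2 mu (fun p => ind s t p.2 * g p.1).
Proof.
move=> [mg ig]; split.
  by apply: measurable_funM; [exact: measurable_strip_ind|exact: measurable_strip_fst].
by apply: int1_eq (int1_strip s t ig) => p; rewrite exprMn ind_idem.
Qed.

Lemma Iv_strip s t (g : Omega -> R) : s <= t -> int1 P g ->
  Iv mu (fun p => ind s t p.2 * g p.1) = (t - s) * Iv P g.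
Proof.
move=> st ig; rewrite -slice_Iv; last exact: int1_strip.
rewrite -IvZ//; apply: Iv_eq => w; rewrite /slice /=.
rewrite -(Iv_ind st) mulrC -IvZ; last exact: int1_ind.
by apply: Iv_eq => u; rewrite mulrC.
Qed.

Lemma int2_int1_strip s t f : int2 mu (fun p => ind s t p.2 * f p) ->
  int1 mu (fun p => ind s t p.2 * f p).
Proof.
move=> hf.
have := int2M (int2_strip s t (int2_cst P 1)) hf.
by apply: int1_eq => p; rewrite mulr1 mulrA -expr2 ind_idem.
Qed.

(** Cauchy-Schwarz in time on almost every path, followed by Fubini. The factor [t - s] is what
    makes the short-interval argument for uniqueness close. *)
Lemma slice_int2 s t f : s <= t -> int2 mu (fun p => ind s t p.2 * f p) ->
  let F := slice (fun p => ind s t p.2 * f p) in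
  int2 P F /\
  Iv P (fun w => F w ^+ 2) <= (t - s) * Iv mu (fun p => (ind s t p.2 * f p) ^+ 2).
Proof.
move=> st hf F; have i1 := int2_int1_strip hf; have iF := slice_int1 i1.
have [_ i2] := hf; have iG := slice_int1 i2.
have ae : {ae P, forall w, F w ^+ 2 <=
    (t - s) * slice (fun p => (ind s t p.2 * f p) ^+ 2) w}.
  have h1 := int1_slice_ae i1; have h2 := int1_slice_ae i2.
  apply: filterS2 h1 h2 => w h1 h2.
  have g1 : int2 leb (fun u => ind s t u * f (w, u)).
    by split => //; exact: int1_measurable h1.
  have g2 : int2 leb (ind s t).
    split; first exact: measurable_ind.
    by apply: int1_eq (int1_ind s t) => u; rewrite ind_idem.
  have := cauchy_schwarz g2 g1.
  rewrite (_ : Iv leb (fun u => ind s t u ^+ 2) = t - s); last first.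
    by rewrite -(Iv_ind st); apply: Iv_eq => u; rewrite ind_idem.
  apply: le_trans; rewrite le_eqVlt; apply/orP; left; apply/eqP; congr (_ ^+ 2).
  by apply: Iv_eq => u; rewrite mulrA -expr2 ind_idem.
have iF2 : int1 P (fun w => F w ^+ 2).
  apply: (int1_le_ae _ (int1Z (t - s) iG)).
    by apply: measurable_funX; exact: int1_measurable iF.
  by apply: filterS ae => w; rewrite ger0_norm// sqr_ge0.
split; first by split => //; exact: int1_measurable iF.
apply: le_trans (Iv_le_ae iF2 (int1Z (t - s) iG) ae) _.
by rewrite IvZ// slice_Iv.
Qed.

End fubini_strip.

(** * The transition semigroup *)

Lemma cvg_bigsum {R : realType} {T : Type} (F : set_system T) {FF : Filter F}
  (I : Type) (r : seq I) (p : pred I) (f : I -> T -> R) (l : I -> R) :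
  (forall i, p i -> f i x @[x --> F] --> l i) ->
  \sum_(i <- r | p i) f i x @[x --> F] --> \sum_(i <- r | p i) l i.
Proof.
move=> h; elim: r => [|i r ih].
  rewrite big_nil; under eq_fun do rewrite big_nil.
  exact: cvg_cst.
rewrite big_cons; under eq_fun do rewrite big_cons.
by case: (boolP (p i)) => // pi; apply: cvgD => //; exact: h.
Qed.

Section exp_mx_theory.
Context {R : realType} {N : nat}.
Variable A : 'M[R]_N.
Local Notation leb := (@lebesgue_measure R).

Definition pexp (j i : 'I_N) (r : R) : R := exp_mx (r *: A) j i.

Let c (j i : 'I_N) (k : nat) : R := (k`!%:R)^-1 * (A ^+ k) j i.
Let a : R := \sum_l \sum_m `|A l m|.

Let a_ge0 : 0 <= a.
Proof. by apply: sumr_ge0 => l _; apply: sumr_ge0. Qed.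

Let row_le j : \sum_m `|A j m| <= a.
Proof.
rewrite /a [leRHS](bigD1 j)//= lerDl; apply: sumr_ge0 => l _; exact: sumr_ge0.
Qed.

Let pow_le k j i : `|(A ^+ k) j i| <= a ^+ k.
Proof.
elim: k j i => [|k ih] j i.
  by rewrite !expr0 mxE; case: (j == i); rewrite ?normr1 ?normr0 ?ler01.
rewrite exprS mxE exprS (le_trans (ler_norm_sum _ _ _))//.
apply: le_trans (ler_wpM2r (exprn_ge0 _ a_ge0) (row_le j)).
by rewrite mulr_suml; apply: ler_sum => l _; rewrite normrM ler_wpM2l.
Qed.

Lemma scale_expmx (r : R) k : (r *: A) ^+ k = r ^+ k *: A ^+ k.
Proof.
elim: k => [|k ih]; first by rewrite !expr0 scale1r.
rewrite !exprS ih; apply/matrixP => i j; rewrite !mxE mulr_sumr.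
by apply: eq_bigr => l _; rewrite !mxE; ring.
Qed.

Let pexpE j i r : pexp j i r = limn (pseries (c j i) r).
Proof.
rewrite /pexp /exp_mx mxE /pseries; congr (limn (series _)).
by apply/funext => k; rewrite scale_expmx mxE /c mulrCA mulrC.
Qed.

Let cvg_c j i r : cvgn (pseries (c j i) r).
Proof.
apply: normed_cvg; have h := is_cvg_series_exp_coeff (a * `|r|).
apply: (series_le_cvg _ _ _ h) => k.
- exact: normr_ge0.
- by rewrite /exp_coeff /= divr_ge0// exprn_ge0// mulr_ge0.
rewrite /exp_coeff /= /c !normrM normrX exprMn ger0_norm ?invr_ge0//.
rewrite [leRHS]mulrC mulrA; apply: ler_wpM2r; first exact: exprn_ge0.
by apply: ler_wpM2l => //; rewrite invr_ge0.
Qed.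

Let diffs_c j i k : pseries_diffs (c j i) k = \sum_l A j l * c l i k.
Proof.
rewrite /pseries_diffs /c factS natrM invfM mulrA mulrA divff ?mul1r ?pnatr_eq0//.
rewrite exprS mxE mulr_sumr; apply: eq_bigr => l _; ring.
Qed.

Let series_diffs j i r : pseries (pseries_diffs (c j i)) r =
  fun n => \sum_l A j l * pseries (c l i) r n.
Proof.
apply/funext => n; rewrite /pseries /series /=.
under eq_bigr do rewrite diffs_c mulr_suml.
rewrite exchange_big /=; apply: eq_bigr => l _.
by rewrite mulr_sumr; apply: eq_bigr => k _; rewrite mulrA.
Qed.

Let cvg_diffs j i r : pseries (pseries_diffs (c j i)) r @ \oo -->
  \sum_l A j l * pexp l i r.
Proof.
rewrite series_diffs; apply: cvg_bigsum => l _; apply: cvgM; first exact: cvg_cst.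
rewrite pexpE; exact: cvg_c.
Qed.

(** Kolmogorov's equation, by termwise differentiation of the exponential series. By [diffs_c]
    differentiating multiplies the coefficients by [A], so the derived series converge because the
    original ones do. *)
Lemma pexp_derive j i r :
  is_derive r (1 : R) (pexp j i) (\sum_l A j l * pexp l i r).
Proof.
have := @pseries_snd_diffs R (c j i) (`|r| + 1) r.
have -> : (fun x => limn (pseries (c j i) x)) = pexp j i.
  by apply/funext => x; rewrite pexpE.
rewrite (cvg_lim _ (cvg_diffs (j := j) (i := i) (r := r)))//; apply.
- exact: cvg_c.
- by apply/cvg_ex; eexists; exact: cvg_diffs.
- have -> : pseries (pseries_diffs (pseries_diffs (c j i))) (`|r| + 1) =
     fun n => \sum_l A j l * pseries (pseries_diffs (c l i)) (`|r| + 1) n.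
    apply/funext => n; rewrite /pseries /series /=.
    transitivity (\sum_(0 <= k < n) \sum_l A j l *
       (pseries_diffs (c l i) k * (`|r| + 1) ^+ k)).
      apply: eq_bigr => k _; rewrite {1}/pseries_diffs diffs_c !mulr_sumr mulr_suml.
      by apply: eq_bigr => l _; rewrite /pseries_diffs; ring.
    by rewrite exchange_big /=; apply: eq_bigr => l _; rewrite mulr_sumr.
  apply/cvg_ex; eexists; apply: cvg_bigsum => l _; apply: cvgM; first exact: cvg_cst.
  exact: cvg_diffs.
- by rewrite [ltRHS]ger0_norm ?ltrDl// addr_ge0.
Qed.

Lemma pexp0 j i : pexp j i 0 = (j == i)%:R.
Proof.
rewrite pexpE; apply/cvg_lim => //.
(* The partial sum of index 0 is empty; in every later one only the term [k = 0] survives. *)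
rewrite -(cvg_shiftn 1) /=.
rewrite (_ : (fun n => _) = fun=> (j == i)%:R); first exact: cvg_cst.
apply/funext => n; rewrite /pseries /series /= addn1 big_nat_recl//= big1 ?addr0.
  by rewrite /c !expr0 fact0 invr1 mul1r mulr1 mxE; case: (j == i).
by move=> k _; rewrite expr0n mulr0.
Qed.

Lemma continuous_pexp j i : continuous (pexp j i).
Proof.
move=> r; apply: differentiable_continuous; apply/derivable1_diffP.
by have [] := pexp_derive j i r.
Qed.

Lemma pexp_integral j i s t : s <= t ->
  pexp j i (t - s) - (j == i)%:R =
  Iv leb (fun u => ind s t u * \sum_l A j l * pexp l i (u - s)).
Proof.
rewrite le_eqVlt => /predU1P[->|st].
  rewrite subrr pexp0 subrr; apply/esym.
  rewrite -(Iv0 leb); apply: Iv_eq => u.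
  by rewrite /ind ltNge; case: (u <= t); rewrite ?mul0r.
pose f u : R := \sum_l A j l * pexp l i (u - s).
pose F u := pexp j i (u - s).
have cf : continuous f.
  move=> u; apply: cvg_bigsum => l _; apply: cvgM; first exact: cvg_cst.
  apply: continuous_comp; last exact: continuous_pexp.
  by apply: cvgB; [exact: cvg_id|exact: cvg_cst].
have dF u : is_derive u (1 : R) F (f u).
  have h1 : is_derive u (1:R) (fun u : R => u - s) 1.
    have := is_deriveB (is_derive_id u 1) (is_derive_cst s u 1).
    by rewrite subr0.
  have := @is_derive1_comp _ (pexp j i) (fun u : R => u - s) u _ _ (pexp_derive j i (u - s)) h1.
  by rewrite mulr1.
have cF : continuous F.
  move=> u; apply: differentiable_continuous; apply/derivable1_diffP.
  by have [] := dF u.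
have H : (\int[leb]_(x in `[s, t]) (f x)%:E = (F t)%:E - (F s)%:E)%E.
  apply: continuous_FTC2 => //.
  - exact: continuous_subspaceT.
  - split.
    + by move=> x _; have [] := dF x.
    + by apply: cvg_at_right_filter; exact: cF.
    + by apply: cvg_at_left_filter; exact: cF.
  - by move=> x _; rewrite derive1E; have [_ ->] := dF x.
have mf : measurable_fun setT f by exact: continuous_measurable_fun.
have e : Iv leb (fun u => ind s t u * f u) = (\int[leb]_(x in `]s, t]) f x)%R.
  rewrite [RHS]Rintegral_mkcond; apply: Iv_eq => u.
  by rewrite indE patchE indicE; case: (_ \in _); rewrite ?mul1r ?mul0r.
rewrite e /Rintegral integral_itv_obnd_cbnd; last first.
  by apply/measurable_EFinP; exact: measurable_funTS.
by rewrite H /F subrr pexp0.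
Qed.

End exp_mx_theory.

Lemma int1_ind_continuous {R : realType} (f : R -> R) (s t : R) : continuous f ->
  int1 (@lebesgue_measure R) (fun u => ind s t u * f u).
Proof.
move=> cf.
have h : (@lebesgue_measure R).-integrable `[s, t] (EFin \o f).
  by apply: continuous_compact_integrable; [exact: segment_compact|exact: continuous_subspaceT].
have h2 : (@lebesgue_measure R).-integrable `]s, t] (EFin \o f).
  by apply: integrableS h => //; exact: subset_itv_oc_cc.
have /integrableP[m2 i2] := h2.
have mI := measurable_itv `]s, t].
have e : (fun u => ind s t u * f u) = f \_ `]s, t].
  apply/funext => u; rewrite patchE indE indicE.
  by case: (_ \in _); rewrite ?mul1r ?mul0r.
rewrite /int1 e -restrict_EFin; apply/integrableP; split.
  by apply/(measurable_restrictT _ _).1.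
have <- : (\int[@lebesgue_measure R]_(x in `]s, t]) `|(EFin \o f) x| =
  \int[@lebesgue_measure R]_x `|((EFin \o f) \_ `]s, t]) x|)%E; last exact: i2.
by rewrite integral_mkcond; apply: eq_integral => x _; rewrite restrict_abse.
Qed.

(** * Joint measurability of the chain *)

Section step_measurability.
Context {d : measure_display} {Om : measurableType d} {R : realType} {N : nat}.
Variables (T : R) (X : R -> Om -> 'I_N).
Hypothesis T0 : 0 <= T.
Hypothesis mX : forall t i, 0 <= t <= T -> measurable (X t @^-1` [set i]).

(** Paths are sampled at the next grid point for [X] itself, by right continuity, and at the
    previous one for its left limit. [Num.min T] keeps the sampling times in [0, T], where [X] is
    known to be measurable. *)
Let right_grid (n k : nat) : R := Num.min T (k.+1%:R / n.+1%:R).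
Let left_grid (n k : nat) : R := Num.min T (k%:R / n.+1%:R).

Let grid_set (rho : nat -> R) (I : nat -> interval R) (i : 'I_N) : set (Om * R) :=
  \bigcup_k ((X (rho k) @^-1` [set i]) `*` [set` I k]).

Let measurable_grid_set rho I i : (forall k, 0 <= rho k <= T) ->
  measurable (grid_set rho I i).
Proof.
move=> h; apply: bigcupT_measurable => k; apply: measurableX; first exact: mX.
exact: measurable_itv.
Qed.

Let right_gridP n k : 0 <= right_grid n k <= T.
Proof. by rewrite /right_grid le_min T0 ge_min lexx divr_ge0. Qed.

Let left_gridP n k : 0 <= left_grid n k <= T.
Proof. by rewrite /left_grid le_min T0 ge_min lexx divr_ge0. Qed.

(** States are discrete, so a sampled path is eventually equal to its limit and a set-theoretic
    lower limit describes the event. *)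
Let liminf (E : nat -> set (Om * R)) := \bigcup_m \bigcap_(n in [set n | (m <= n)%N]) E n.

Let measurable_liminf E : (forall n, measurable (E n)) -> measurable (liminf E).
Proof.
by move=> h; apply: bigcupT_measurable => m; apply: bigcap_measurable => // ; exists m => /=.
Qed.

Lemma small_inv (e : R) : 0 < e -> exists m : nat, forall n, (m <= n)%N -> n.+1%:R^-1 < e.
Proof.
move=> e0; exists (Num.truncn e^-1) => n mn.
rewrite invf_plt ?posrE// (lt_le_trans (truncnS_gt _))// ler_nat ltnS//.
Qed.

Let right_set n i := grid_set (right_grid n)
  (fun k => `[k%:R / n.+1%:R, k.+1%:R / n.+1%:R[%R) i.
Let left_set n i := grid_set (left_grid n)
  (fun k => `]k%:R / n.+1%:R, k.+1%:R / n.+1%:R]%R) i.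

Lemma measurable_chain_set i :
  (forall w t, 0 <= t < T -> \forall s \near t^'+, X s w = X t w) ->
  measurable [set p : Om * R | 0 <= p.2 <= T /\ X p.2 p.1 = i].
Proof.
move=> rc.
have key w u : 0 <= u < T -> exists m, forall n, (m <= n)%N ->
    forall j, right_set n j (w, u) <-> X u w = j.
  move=> /andP[u0 uT]; have : \forall s \near u^'+, X s w = X u w.
    by apply: rc; rewrite u0.
  move=> [e /= e0 he]; have [m hm] := small_inv e0.
  exists m => n mn j.
  have n0 : (0 : R) < n.+1%:R by [].
  pose k := Num.truncn (u * n.+1%:R).
  have un0 : 0 <= u * n.+1%:R by rewrite mulr_ge0.
  have [k1 k2] : k%:R / n.+1%:R <= u /\ u < k.+1%:R / n.+1%:R.
    rewrite ler_pdivrMr// ltr_pdivlMr//; have /andP[-> ->] := truncn_itv un0.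
    by [].
  have Xr : X (right_grid n k) w = X u w.
    have ur : u < right_grid n k by rewrite /right_grid lt_min uT k2.
    apply: he => //=; rewrite ltr0_norm ?subr_lt0// opprB.
    apply: le_lt_trans (hm _ mn); rewrite lerBlDr /right_grid ge_min.
    apply/orP; right; rewrite -natr1 mulrDl mul1r addrC lerD2l//.
  split.
    move=> [k' _ [/= <-]]; rewrite in_itv/= => /andP[k1' k2'].
    suff -> : k' = k by [].
    rewrite ler_pdivrMr// in k1'; rewrite ltr_pdivlMr// in k2'.
    by apply/esym; apply: truncn_def; rewrite k1' k2'.
  by move=> Xj; exists k => //; split => /=; rewrite ?in_itv/= ?k1 ?k2// Xr.
rewrite (_ : [set p | _] = (liminf (fun n => right_set n i) `&` ([set: Om] `*` `[0, T[))
  `|` ((X T @^-1` [set i]) `*` [set T])).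
  apply: measurableU.
    apply: measurableI; first by apply: measurable_liminf => n; exact: measurable_grid_set.
    exact: measurableX.
  by apply: measurableX => //; apply: mX; rewrite T0 lexx.
apply/seteqP; split => [[w u] /= [/andP[u0 uT] Xu]|[w u] /=].
  move: uT; rewrite le_eqVlt => /predU1P[uT|uT]; first by right; rewrite -uT.
  left; split; last by split => //=; rewrite in_itv/= u0.
  have [m hm] := key w u ltac:(by rewrite u0).
  by exists m => // n /= mn; apply/(hm _ mn).
move=> [[[m _ hm] [_ /=]]|[/= Xu ->]]; last by rewrite T0 lexx.
rewrite in_itv/= => /andP[u0 uT]; split; first by rewrite u0 ltW.
have [m' hm'] := key w u ltac:(by rewrite u0).
by apply/(hm' (maxn m m') (leq_maxr _ _)); apply: hm => /=; exact: leq_maxl.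
Qed.

(** Two eventual values to the left of [t] agree at some common time, since left neighbourhoods are
    never empty. *)
Lemma left_stateP w t i : 0 < t -> (\forall s \near t^'-, X s w = i) ->
  left_state X t w = i.
Proof.
move=> t0 hi; rewrite /left_state.
have [_ hj] := @xgetPex _ (X t w) [set i | 0 < t /\ \forall s \near t^'-, X s w = i]
   (ex_intro _ i (conj t0 hi)).
near (t^'-) => s; rewrite -(_ : X s w = i); last by near: s; exact: hi.
apply/esym; near: s; exact: hj.
Unshelve. all: by end_near.
Qed.

Lemma measurable_left_set i :
  (forall w t, 0 < t <= T -> exists i, \forall s \near t^'-, X s w = i) ->
  measurable [set p : Om * R | 0 < p.2 <= T /\ left_state X p.2 p.1 = i].
Proof.
move=> lc.
have key w u : 0 < u <= T -> exists m, forall n, (m <= n)%N ->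
    forall j, left_set n j (w, u) <-> left_state X u w = j.
  move=> /andP[u0 uT]; have [i0 hi0] : exists i, \forall s \near u^'-, X s w = i.
    by apply: lc; rewrite u0.
  have -> := left_stateP u0 hi0.
  move: hi0 => [e /= e0 he]; have [m hm] := small_inv e0.
  exists m => n mn j.
  have n0 : (0 : R) < n.+1%:R by [].
  have un0 : 0 < u * n.+1%:R by rewrite mulr_gt0.
  have Xr k : k%:R / n.+1%:R < u -> u <= k.+1%:R / n.+1%:R -> X (left_grid n k) w = i0.
    move=> k1 k2; have -> : left_grid n k = k%:R / n.+1%:R.
      by rewrite /left_grid; apply/min_idPr; exact: ltW (lt_le_trans k1 uT).
    apply: he => //=; rewrite gtr0_norm ?subr_gt0//.
    apply: le_lt_trans (hm _ mn); rewrite lerBlDr (le_trans k2)//.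
    by rewrite -natr1 mulrDl mul1r addrC lerD2l.
  split.
    by move=> [k' _ [/= <-]]; rewrite in_itv/= => /andP[k1' k2']; rewrite Xr.
  move=> <-.
  (* Cells are open on the left here: the least [k] with [u (n + 1) <= k + 1] gives the strict lower
     inequality, which truncation would miss at grid points. *)
  have [k [k1 k2]] : exists k : nat, k%:R / n.+1%:R < u /\ u <= k.+1%:R / n.+1%:R.
    have : exists k : nat, u * n.+1%:R <= k.+1%:R.
      by exists (Num.truncn (u * n.+1%:R)); exact: ltW (truncnS_gt _).
    move=> /ex_minnP[k hk kmin]; exists k; rewrite ltr_pdivrMr// ler_pdivlMr//.
    split => //; rewrite ltNge; apply/negP; case: k hk kmin => [|k] hk kmin hk'.
      by rewrite leNgt un0 in hk'.
    by have := kmin _ hk'; rewrite ltnn.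
  by exists k => //; split => /=; [exact: Xr|rewrite in_itv/= k1].
rewrite (_ : [set p | _] = (liminf (fun n => left_set n i) `&` ([set: Om] `*` `]0, T]))).
  apply: measurableI; first by apply: measurable_liminf => n; exact: measurable_grid_set.
  exact: measurableX.
apply/seteqP; split => [[w u] /= [/andP[u0 uT] Xu]|[w u] /=].
  split; last by split => //=; rewrite in_itv/= u0.
  have [m hm] := key w u ltac:(by rewrite u0).
  by exists m => // n /= mn; apply/(hm _ mn).
move=> [[m _ hm] [_ /=]].
rewrite in_itv/= => /andP[u0 uT]; split; first by rewrite u0.
have [m' hm'] := key w u ltac:(by rewrite u0).
by apply/(hm' (maxn m m') (leq_maxr _ _)); apply: hm => /=; exact: leq_maxl.
Qed.

End step_measurability.

(** * Generating sigma-algebras by intersections, up to null sets *)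

Section pi_systems.
Context {d : measure_display} {Omega : measurableType d} {R : realType}.
Variable P : probability Omega R.
Hypothesis Pcomp : measure_is_complete P.
Implicit Types (A B : set Omega) (H : set (set Omega)).

(** Completeness makes both differences measurable; [A] is recovered from [B] by removing one and
    adding the other. *)
Lemma ae_eq_set_measurable A B : measurable B ->
  {ae P, forall w, A w <-> B w} -> measurable A.
Proof.
move=> mB AB.
have h1 : measurable (A `\` B).
  by apply: Pcomp; apply: negligibleS AB => w /= [Aw Bw] h; apply/Bw/h.
have h2 : measurable (B `\` A).
  by apply: Pcomp; apply: negligibleS AB => w /= [Bw Aw] h; apply/Aw/h.
rewrite (_ : A = (B `\` (B `\` A)) `|` (A `\` B)).
  by apply: measurableU => //; exact: measurableD.
apply/seteqP; split => w /=.
  by move=> Aw; case: (pselect (B w)) => Bw; [left; split => // -[]|right].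
by move=> [[Bw h]|[]//]; apply: contrapT => Aw; exact: h.
Qed.

(** Stable under intersection, and containing both sigma-algebras and every null set; the
    sigma-algebra it generates therefore contains their augmented join. *)
Definition pi_prod H1 H2 : set (set Omega) :=
  [set A | exists A1 A2, [/\ H1 A1, H2 A2 &
     {ae P, forall w, A w <-> (A1 `&` A2) w}]].

Variables (K1 K2 : set (set Omega)).
Let H1 := <<s K1 >>.
Let H2 := <<s K2 >>.
Hypotheses (sH1 : H1 `<=` measurable) (sH2 : H2 `<=` measurable).
Local Notation Pi := (pi_prod H1 H2).

Let setTH K : <<s K >> [set: Omega].
Proof. exact: (@measurableT _ (g_sigma_algebraType K)). Qed.

Lemma pi_prod_measurable : Pi `<=` measurable.
Proof.
move=> A [A1 [A2 [h1 h2 h]]]; apply: (@ae_eq_set_measurable _ (A1 `&` A2)) => //.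
by apply: measurableI; [exact: sH1|exact: sH2].
Qed.

Lemma sigma_pi_measurable : <<s Pi >> `<=` measurable.
Proof.
by apply: smallest_sub; [exact: sigma_algebra_measurable|exact: pi_prod_measurable].
Qed.

Lemma pi_prod_l : H1 `<=` Pi.
Proof.
move=> A hA; exists A, setT; split => //; first exact: setTH.
by apply: aeW => w; rewrite setIT.
Qed.

Lemma pi_prod_r : H2 `<=` Pi.
Proof.
move=> A hA; exists setT, A; split => //; first exact: setTH.
by apply: aeW => w; rewrite setTI.
Qed.

Lemma pi_prod_null : P.-negligible `<=` Pi.
Proof.
move=> A hA; exists set0, setT; split => //.
- exact: (@measurable0 _ (g_sigma_algebraType K1)).
- exact: setTH.
- rewrite set0I; apply: negligibleS hA => w /= h; apply: contrapT => Aw.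
  by apply: h; split.
Qed.

Lemma pi_prod_setI : setI_closed Pi.
Proof.
move=> A B [A1 [A2 [h1 h2 h]]] [B1 [B2 [g1 g2 g]]].
exists (A1 `&` B1), (A2 `&` B2); split.
- exact: (@measurableI _ (g_sigma_algebraType K1)).
- exact: (@measurableI _ (g_sigma_algebraType K2)).
- apply: filterS2 h g => w /= h g; split => [[/h[? ?] /g[? ?]]//|].
  by move=> [[? ?] [? ?]]; split; [apply/h|apply/g].
Qed.

(** Dynkin's argument: the measurable sets over which [D] integrates to 0 form a lambda-system, so
    rectangles suffice. *)
Lemma cond0_pi (D : Omega -> R) : int1 P D ->
  (forall A1 A2, H1 A1 -> H2 A2 -> Iv P (fun w => \1_(A1 `&` A2) w * D w) = 0) ->
  cond0 P Pi D.
Proof.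
move=> iD hD; split => // A hA.
suff [] : measurable A /\ Iv P (fun w => \1_A w * D w) = 0 by [].
pose C := [set A | measurable A /\ Iv P (fun w => \1_A w * D w) = 0].
apply: (@lambda_system_subset _ Pi pi_prod_setI setT C) hA => //.
- split => //.
  + split => //; have := hD setT setT (@setTH K1) (@setTH K2).
    by rewrite setIT.
  + move=> E F FE [mE hE] [mF hF]; split; first exact: measurableD.
    rewrite -[RHS](subrr 0) -{1}hE -hF -IvB; [|exact: int1_set|exact: int1_set].
    apply: Iv_eq => w; rewrite -mulrBl; congr (_ * _).
    rewrite !indicE in_setD.
    have [Ew|Ew] := boolP (w \in E); have [Fw|Fw] := boolP (w \in F) => //=;
      rewrite ?subrr ?subr0//.
    by move: Ew; rewrite mem_set//; apply: FE; exact: set_mem Fw.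
  + move=> F ndF hF; split; first by apply: bigcupT_measurable => n; have [] := hF n.
    have h : Iv P (fun w => \1_(F n) w * D w) @[n --> \oo] -->
        Iv P (fun w => \1_(\bigcup_n F n) w * D w).
      apply: (@dct _ _ _ _ _ _ (fun w => `|D w|)).
      * move=> n; apply: measurable_funM; last exact: int1_measurable iD.
        by apply: measurable_indic; have [] := hF n.
      * apply: measurable_funM; last exact: int1_measurable iD.
        by apply: measurable_indic; apply: bigcupT_measurable => n; have [] := hF n.
      * exact: int1_norm.
      * move=> n w; rewrite normrM indicE; case: (_ \in _); rewrite ?normr1 ?mul1r// normr0 mul0r//.
      * apply: aeW => w; apply: cvgM; last exact: cvg_cst.
        have [[m _ hm]|hn] := pselect ((\bigcup_n F n) w).
          apply: cvg_near_cst; exists m => // n /= mn.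
          rewrite !indicE !mem_set//; first by exists m.
          by have /subsetPset := ndF _ _ mn; apply.
        apply: cvg_near_cst; apply: nearW => n; rewrite !indicE !memNset//.
        by move=> h; apply: hn; exists n.
    have <- := cvg_lim (@Rhausdorff R) h.
    rewrite (_ : (fun n => _) = fun=> 0); first by rewrite lim_cst.
    by apply/funext => n; have [] := hF n.
- move=> E hE; split; first exact: pi_prod_measurable.
  have [A1 [A2 [h1 h2 h]]] := hE; rewrite -(hD A1 A2)//.
  apply: Iv_ae.
  + apply: measurable_funM; last exact: int1_measurable iD.
    apply: measurable_indic; exact: pi_prod_measurable.
  + apply: measurable_funM; last exact: int1_measurable iD.
    by apply: measurable_indic; apply: measurableI; [exact: sH1|exact: sH2].
  + apply: filterS h => w h; congr (_ * _); rewrite !indicE; congr (nat_of_bool _)%:R.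
    by apply/idP/idP => /set_mem /h /mem_set.
Qed.

End pi_systems.

(** * The filtration *)

Section chain_paths.
Context {d : measure_display} {Om : measurableType d} {R : realType} {N : nat}.
Variables (T : R) (X : R -> Om -> 'I_N).
Local Notation leb := (@lebesgue_measure R).
Hypothesis T0 : 0 <= T.
Hypothesis mX : forall t i, 0 <= t <= T -> measurable (X t @^-1` [set i]).
Hypothesis rcX : forall w t, 0 <= t < T -> \forall s \near t^'+, X s w = X t w.
Implicit Types (f : 'I_N -> R).

Lemma measurable_section (g : Om * R -> R) w : measurable_fun setT g ->
  measurable_fun setT (fun u => g (w, u)).
Proof.
move=> mg; apply: (measurableT_comp mg).
by apply/measurable_fun_pairP; split; [exact: measurable_cst|exact: measurable_id].
Qed.

Definition fbound f : R := \sum_i `|f i|.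

Lemma fboundP f i : `|f i| <= fbound f.
Proof. by rewrite /fbound (bigD1 i)//= lerDl; exact: sumr_ge0. Qed.

Lemma fbound_ge0 f : 0 <= fbound f.
Proof. exact: sumr_ge0. Qed.

Lemma measurable_chain_process f s t : 0 <= s -> t <= T ->
  measurable_fun setT (fun p : Om * R => ind s t p.2 * f (X p.2 p.1)).
Proof.
move=> s0 tT.
rewrite (_ : (fun p => _) = fun p => \sum_i f i * (ind s t p.2 *
   \1_[set p : Om * R | 0 <= p.2 <= T /\ X p.2 p.1 = i] p)); last first.
  apply/funext => p; rewrite (bigD1 (X p.2 p.1))//= big1 ?addr0 => [|i iX].
    rewrite indicE; have [|h] := boolP (s < p.2 <= t); last first.
      by rewrite /ind (negbTE h) !mul0r mulr0.
    move=> /andP[su ut]; rewrite mem_set ?mulr1 1?mulrC//; split => //.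
    by rewrite (le_trans s0 (ltW su)) (le_trans ut tT).
  rewrite indicE memNset ?mulr0// => -[_ e]; by rewrite e eqxx in iX.
apply: measurable_sum => i; apply: measurable_funM => //.
apply: measurable_funM; first exact: (measurableT_comp (measurable_ind s t)).
by apply: measurable_indic; apply: measurable_chain_set.
Qed.

Lemma int1_chain_path f s t w : 0 <= s -> t <= T ->
  int1 leb (fun u => ind s t u * f (X u w)).
Proof.
move=> s0 tT; apply: (int1_le _ (int1Z (fbound f) (int1_ind s t))).
  exact: (measurable_section w (measurable_chain_process f s0 tT)).
move=> u; rewrite normrM mulrC (ger0_norm (ind_ge0 s t u)).
by rewrite ler_wpM2r ?ind_ge0// fboundP.
Qed.

Definition chain_int f s t w : R := Iv leb (fun u => ind s t u * f (X u w)).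

Lemma chain_int_cat f s r t w : 0 <= s -> s <= r -> r <= t -> t <= T ->
  chain_int f s t w = chain_int f s r w + chain_int f r t w.
Proof.
move=> s0 sr rt tT; rewrite -IvD.
- by apply: Iv_eq => u; rewrite (ind_cat u sr rt) mulrDl.
- by apply: int1_chain_path => //; exact: le_trans rt tT.
- by apply: int1_chain_path => //; exact: le_trans s0 sr.
Qed.

Lemma measurable_chain_int f s t : 0 <= s -> s <= t -> t <= T ->
  measurable_fun setT (chain_int f s t).
Proof.
move=> s0 st tT.
(* Adding a constant makes the integrand nonnegative, as Tonelli's measurability statement requires;
   the added part integrates to a known constant. *)
pose g i := f i + fbound f.
have g0 i : 0 <= g i.
  by rewrite /g; have := fboundP f i; rewrite ler_norml => /andP[h _]; lra.
rewrite (_ : chain_int f s t = fun w => chain_int g s t w - fbound f * (t - s)); last first.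
  apply/funext => w; rewrite -(Iv_ind st) -IvZ; last exact: int1_ind.
  rewrite -IvB; [|exact: int1_chain_path|by apply: int1Z; exact: int1_ind].
  by apply: Iv_eq => u; rewrite /g; ring.
apply: measurable_funB => //.
have h : measurable_fun setT (fubini_F leb (fun p : Om * R => (ind s t p.2 * g (X p.2 p.1))%:E)).
  apply: measurable_fun_fubini_tonelli_F.
    by apply/measurable_EFinP; exact: measurable_chain_process.
  by move=> p; rewrite lee_fin mulr_ge0 ?ind_ge0.
exact: (measurableT_comp (fine_measurable measurableT) h).
Qed.

End chain_paths.

Section model.
Context {d : measure_display} {Omega : measurableType d} {R : realType}
  {N : nat}.
Variables (P : probability Omega R) (T c : R) (A : 'M[R]_N).
Variables (X : R -> Omega -> 'I_N) (W : R -> Omega -> R).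
Hypotheses (Pcomp : measure_is_complete P) (T0 : 0 < T)
  (hA : rate_matrix c A) (hW : brownian_motion P T W)
  (hX : markov_chain P T A X) (hXW : independent_processes P T X W).

Local Notation HX := (history setT X).
Local Notation HW := (history measurable W).
Local Notation G := (filtrationG P X W).

(** [hatG0] knows the whole path of the chain, so that chain increments after [s] count as known
    when a Brownian increment is averaged. [piG0] generates a sigma-algebra containing the
    filtration at [s] and serves for everything else. *)
Definition hatG0 (s : R) := pi_prod P (HX T) (HW s).
Definition piG0 (s : R) := pi_prod P (HX s) (HW s).

Lemma measurable_X t (B : set 'I_N) : 0 <= t <= T -> measurable (X t @^-1` B).
Proof.
move=> tT; rewrite (_ : X t @^-1` B = \bigcup_(i in B) (X t @^-1` [set i])).
  apply: fin_bigcup_measurable => [|i _]; first exact: finite_finset.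
  by have [h _ _ _] := hX; exact: h.
by apply/seteqP; split => w /=; [move=> Bw; exists (X t w)|move=> [i Bi /= ->]].
Qed.

Lemma HX_sub t : t <= T -> HX t `<=` measurable.
Proof.
move=> tT; apply: smallest_sub; first exact: sigma_algebra_measurable.
move=> _ [s [B [/andP[s0 st] _ ->]]]; apply: measurable_X.
by rewrite s0 (le_trans st).
Qed.

Lemma HW_sub t : t <= T -> HW t `<=` measurable.
Proof.
move=> tT; apply: smallest_sub; first exact: sigma_algebra_measurable.
move=> _ [s [B [/andP[s0 st] mB ->]]]; have [h _ _ _ _] := hW.
by rewrite -[_ @^-1` _]setTI; apply: h => //; rewrite s0 (le_trans st).
Qed.

Lemma history_mono (E : Type) (S : set (set E)) (Y : R -> Omega -> E) s t :
  s <= t -> history S Y s `<=` history S Y t.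
Proof.
move=> st; apply: sub_smallest2r; first exact: smallest_sigma_algebra.
move=> _ [r [B [/andP[r0 rs] SB ->]]].
by exists r, B; split => //; rewrite r0 (le_trans rs).
Qed.

Lemma pi_mono (H1 H2 K1 K2 : set (set Omega)) : H1 `<=` K1 -> H2 `<=` K2 ->
  <<s pi_prod P H1 H2 >> `<=` <<s pi_prod P K1 K2 >>.
Proof.
move=> h1 h2; apply: sub_smallest2r; first exact: smallest_sigma_algebra.
move=> B [A1 [A2 [g1 g2 g]]].
by exists A1, A2; split => //; [exact: h1|exact: h2].
Qed.

Lemma augmented_sub H K : H `<=` <<s K >> -> P.-negligible `<=` <<s K >> ->
  augmented P H `<=` <<s K >>.
Proof.
move=> HK nK; apply: smallest_sub; first exact: smallest_sigma_algebra.
by rewrite subUset.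
Qed.

Lemma G_pi t : G t `<=` <<s piG0 t >>.
Proof.
have nK : P.-negligible `<=` <<s piG0 t >>.
  by move=> B hB; apply: sub_sigma_algebra; exact: pi_prod_null.
apply: smallest_sub; first exact: smallest_sigma_algebra.
rewrite subUset; split; apply: augmented_sub => // B hB; apply: sub_sigma_algebra.
- exact: pi_prod_l.
- exact: pi_prod_r.
Qed.

Lemma pi_hat t : t <= T -> <<s piG0 t >> `<=` <<s hatG0 t >>.
Proof. by move=> tT; apply: pi_mono => //; exact: history_mono. Qed.

Lemma hat_sub t : t <= T -> <<s hatG0 t >> `<=` measurable.
Proof. by move=> tT; apply: sigma_pi_measurable => //; [exact: HX_sub|exact: HW_sub]. Qed.

Lemma pi_sub t : t <= T -> <<s piG0 t >> `<=` measurable.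
Proof. by move=> tT; apply: sigma_pi_measurable => //; [exact: HX_sub|exact: HW_sub]. Qed.

Lemma G_sub t : t <= T -> G t `<=` measurable.
Proof. by move=> tT B /G_pi; exact: pi_sub. Qed.

Lemma G_HX t : HX t `<=` G t.
Proof. by move=> B hB; apply: sub_sigma_algebra; left; apply: sub_sigma_algebra; left. Qed.

Lemma G_HW t : HW t `<=` G t.
Proof. by move=> B hB; apply: sub_sigma_algebra; right; apply: sub_sigma_algebra; left. Qed.

Lemma G_null t : P.-negligible `<=` G t.
Proof. by move=> B hB; apply: sub_sigma_algebra; left; apply: sub_sigma_algebra; right. Qed.

Lemma augmented_mono (H K : set (set Omega)) : H `<=` K -> augmented P H `<=` augmented P K.
Proof.
move=> HK; apply: sub_smallest2r; first exact: smallest_sigma_algebra.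
by move=> B [hB|hB]; [left; exact: HK|right].
Qed.

Lemma G_mono s t : s <= t -> G s `<=` G t.
Proof.
move=> st; apply: sub_smallest2r; first exact: smallest_sigma_algebra.
by move=> B [hB|hB]; [left|right]; move: B hB;
  apply: augmented_mono; exact: history_mono.
Qed.

Lemma rv_in_sub (H K : set (set Omega)) (f : Omega -> R) : H `<=` K ->
  rv_in H f -> rv_in K f.
Proof. by move=> HK hf B mB; apply: HK; exact: hf. Qed.

(** The symmetric difference of the two preimages is a null set, and the augmented filtration
    contains all of these. *)
Lemma rv_in_ae t (f g : Omega -> R) : t <= T -> rv_in (G t) f ->
  {ae P, forall w, f w = g w} -> rv_in (G t) g.
Proof.
move=> tT hf fg B mB.
have n1 : G t (f @^-1` B `\` g @^-1` B).
  by apply: G_null; apply: negligibleS fg => w /= [fB gB] h; apply: gB; rewrite /= -h.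
have n2 : G t (g @^-1` B `\` f @^-1` B).
  by apply: G_null; apply: negligibleS fg => w /= [fB gB] h; apply: gB; rewrite /= h.
rewrite (_ : g @^-1` B = (f @^-1` B `\` (f @^-1` B `\` g @^-1` B)) `|` (g @^-1` B `\` f @^-1` B)).
  apply: (@measurableU _ (g_sigma_algebraType _)) => //.
  apply: (@measurableD _ (g_sigma_algebraType _)) => //; exact: hf.
apply/seteqP; split => w /=.
  by move=> gB; case: (pselect (B (f w))) => fB; [left; split => // -[]|right].
by move=> [[fB h]|[]//]; apply: contrapT => gB; exact: h.
Qed.

Lemma HX_X s t (B : set 'I_N) : 0 <= s <= t -> HX t (X s @^-1` B).
Proof. by move=> st; apply: sub_sigma_algebra; exists s, B. Qed.

Lemma HW_W s t (B : set R) : 0 <= s <= t -> measurable B -> HW t (W s @^-1` B).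
Proof. by move=> st mB; apply: sub_sigma_algebra; exists s, B. Qed.

Lemma rv_X s t (f : 'I_N -> R) : 0 <= s <= t -> rv_in (HX t) (fun w => f (X s w)).
Proof. by move=> st B mB; apply: (@HX_X s t (f @^-1` B)). Qed.

Lemma rv_W s t : 0 <= s <= t -> rv_in (HW t) (W s).
Proof. by move=> st B mB; exact: HW_W. Qed.

Lemma rv_chain_int f s t : 0 <= s -> s <= t -> t <= T ->
  rv_in (HX t) (chain_int X f s t).
Proof.
move=> s0 st tT; apply/rv_inP.
have t0 : 0 <= t := le_trans s0 st.
have [_ rc _ _] := hX.
(* The joint measurability result is used with the history up to [t] as ambient sigma-algebra and
   [t] as horizon; this yields adaptedness, not merely measurability. *)
apply: (@measurable_chain_int _ (g_sigma_algebraType _) _ _ t) => //.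
- by move=> u i ut; exact: HX_X.
- by move=> w u /andP[u0 ut]; apply: rc; rewrite u0 (lt_le_trans ut tT).
Qed.

Lemma measurable_W t : 0 <= t <= T -> measurable_fun setT (W t).
Proof. by have [h _ _ _ _] := hW; exact: h. Qed.

Definition dW s t w := W t w - W s w.

(** On a rectangle, independence of the two processes detaches the chain event and independence of
    increments detaches the Brownian past; [cond0_pi] extends this to the generated
    sigma-algebra. *)
Lemma dW_indep s t B E : 0 <= s -> s < t -> t <= T ->
  <<s hatG0 s >> B -> measurable E ->
  P (B `&` dW s t @^-1` E) = (P B * normal_prob 0 (Num.sqrt (t - s)) E)%E.
Proof.
move=> s0 st tT hB mE.
have sT : s <= T := ltW (lt_le_trans st tT).
have t0 : 0 <= t := le_trans s0 (ltW st).
have mdW : measurable_fun setT (dW s t).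
  by apply: measurable_funB; apply: measurable_W; rewrite ?s0 ?t0.
have mdE : measurable (dW s t @^-1` E) by rewrite -[_ @^-1` _]setTI; exact: mdW.
have fnE : normal_prob 0 (Num.sqrt (t - s)) E \is a fin_num by exact: fin_num_measure.
set k := fine (normal_prob 0 (Num.sqrt (t - s)) E).
pose D w := \1_(dW s t @^-1` E) w - k.
have iE F : measurable F -> int1 P (\1_F : Omega -> R).
  by move=> mF; exact: integrable_indic.
have IE F : measurable F -> (Iv P (\1_F : Omega -> R))%:E = P F.
  by move=> mF; rewrite EFin_Iv ?integral_indic ?setIT//; exact: iE.
have iD : int1 P D by apply: int1B; [exact: iE|exact: int1_cst].
have ID F : measurable F -> (Iv P (fun w => \1_F w * D w))%:E =
    (P (F `&` dW s t @^-1` E) - P F * normal_prob 0 (Num.sqrt (t - s)) E)%E.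
  move=> mF; rewrite -[normal_prob _ _ _]fineK// -/k -!IE//; last exact: measurableI.
  rewrite -EFinM -EFinB; congr (_%:E).
  rewrite [_ * k]mulrC -IvZ; last exact: iE.
  rewrite -IvB; [|by apply: iE; exact: measurableI|by apply: int1Z; exact: iE].
  by apply: Iv_eq => w; rewrite indicI /D/=; ring.
have [_ h] : cond0 P (hatG0 s) D.
  apply: cond0_pi => //; [exact: HX_sub|exact: HW_sub|].
  move=> A1 A2 h1 h2; apply: EFin_inj; rewrite ID; last first.
    by apply: measurableI; [exact: HX_sub h1|exact: HW_sub h2].
  have hWT : HW T (A2 `&` dW s t @^-1` E).
    apply: (@measurableI _ (g_sigma_algebraType _)); first exact: (history_mono sT).
    have : rv_in (HW T) (dW s t).
      by apply: rv_inB; apply: rv_W; rewrite ?s0 ?t0.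
    exact.
  have [_ _ _ law ind_] := hW.
  have h2' := history_mono sT h2.
  rewrite -setIA (hXW h1 hWT) (hXW h1 h2') ind_//.
  have -> : P [set w | E (W t w - W s w)] = normal_prob 0 (Num.sqrt (t - s)) E by exact: law.
  by rewrite muleA subee// fin_numM// fin_numM// fin_num_measure//; [exact: HX_sub h1|exact: HW_sub h2].
have mB := hat_sub sT hB.
have f1 : P (B `&` dW s t @^-1` E) \is a fin_num.
  by apply: fin_num_measure; exact: measurableI.
have f2 : (P B * normal_prob 0 (Num.sqrt (t - s)) E)%E \is a fin_num.
  by rewrite fin_numM// fin_num_measure.
have := ID B mB; rewrite (h B hB) -[X in (X - _)%E](fineK f1) -[X in (_ - X)%E](fineK f2).
rewrite -EFinB => -[] /esym/eqP; rewrite subr_eq0 => /eqP e.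
by rewrite -[LHS](fineK f1) e fineK.
Qed.

(** Independence reduces each moment to a Gaussian one with standard deviation [sqrt (t - s)]; the
    degenerate case [s = t] is treated separately. *)
Lemma dW_moments s t f : 0 <= s -> s <= t -> t <= T ->
  rv_in <<s hatG0 s >> f -> int1 P f ->
  [/\ int1 P (fun w => f w * dW s t w) /\ Iv P (fun w => f w * dW s t w) = 0,
      int1 P (fun w => f w * dW s t w ^+ 2) /\
      Iv P (fun w => f w * dW s t w ^+ 2) = (t - s) * Iv P f,
      int1 P (fun w => f w * dW s t w ^+ 4) &
      0 <= Iv P f -> Iv P (fun w => f w * dW s t w ^+ 4) <= 64 * (t - s) ^+ 2 * Iv P f].
Proof.
move=> s0; rewrite le_eqVlt => /predU1P[->|st] tT hf if_.
  have z (k : nat) : (0 < k)%N -> forall w, f w * dW t t w ^+ k = 0.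
    by move=> k0 w; rewrite /dW subrr expr0n; case: k k0 => // k _; rewrite mulr0.
  have z1 : forall w, f w * dW t t w = 0 by move=> w; rewrite /dW subrr mulr0.
  have e1 g : (forall w, g w = 0) -> int1 P g /\ Iv P g = 0.
    move=> /funext ->; split; [exact: int10|exact: Iv0].
  have [i1 j1] := e1 _ z1; have [i2 j2] := e1 _ (z 2%N isT); have [i4 j4] := e1 _ (z 4%N isT).
  by split; rewrite ?j2 ?j4 ?subrr ?expr0n ?mulr0 ?mul0r.
have sT : s <= T := ltW (lt_le_trans st tT).
have t0 : 0 <= t := le_trans s0 (ltW st).
have mdW : measurable_fun setT (dW s t).
  by apply: measurable_funB; apply: measurable_W; rewrite ?s0 ?t0.
have sig : 0 < Num.sqrt (t - s) by rewrite sqrtr_gt0 subr_gt0.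
have sq2 : Num.sqrt (t - s) ^+ 2 = t - s by rewrite sqr_sqrtr// subr_ge0 ltW.
have H g : int1 (normal_prob 0 (Num.sqrt (t - s))) g ->
    int1 P (fun w => f w * g (dW s t w)) /\
    Iv P (fun w => f w * g (dW s t w)) = Iv P f * Iv (normal_prob 0 (Num.sqrt (t - s))) g.
  move=> ig.
  have ind_ B E : <<s hatG0 s >> B -> measurable E ->
    P (B `&` dW s t @^-1` E) = (P B * normal_prob 0 (Num.sqrt (t - s)) E)%E.
    by move=> hB mE; exact: dW_indep.
  exact: (indep_int1 (hat_sub sT) mdW ind_ hf if_ ig).
have [i1 e1] := H _ (normal_int1 sig).
have [i2 e2] := H _ (normal_int2 sig).
have [j4 k4] := normal_int4 sig.
have [i4 e4] := H _ j4.
split => //.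
- by split => //; rewrite e1 normal_mean ?mulr0.
- by split => //; rewrite e2 normal_variance// sq2 mulrC.
- move=> f0; rewrite e4 mulrC; apply: ler_wpM2r => //; apply: le_trans k4 _.
  by rewrite (exprM _ 2 2) sq2.
Qed.

End model.

(** * The generator and its quadratic form *)

Section generator.
Context {R : realType} {N : nat}.
Variables (c : R) (A : 'M[R]_N).
Hypothesis hA : rate_matrix c A.
Implicit Types f g : 'I_N -> R.

(** The generator of the chain on functions of the state; a column of [A] belongs to the state being
    left. *)
Definition LA f i : R := \sum_j A j i * f j.

(** The carre du champ of the generator: the density of the predictable covariation of the
    martingales attached to [f] and [g]. *)
Definition gam f g i : R := \sum_j A j i * (f j - f i) * (g j - g i).

Definition colf (C : 'cV[R]_N) (i : 'I_N) : R := C i 0.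

Lemma col_sum i : \sum_j A j i = 0.
Proof. by have [_ _ ->] := hA. Qed.

(** Expanding the product of differences leaves an extra term proportional to a column sum of [A],
    which is zero. *)
Lemma LA_prod f g i : LA (fun j => f j * g j) i - f i * LA g i - g i * LA f i = gam f g i.
Proof.
rewrite /LA /gam.
transitivity (\sum_j (A j i * (f j - f i) * (g j - g i) - f i * g i * A j i)).
  by rewrite !mulr_sumr -!sumrB; apply: eq_bigr => j _; ring.
by rewrite sumrB -mulr_sumr col_sum mulr0 subr0.
Qed.

Lemma psi_entry i k l :
  psi A i k l = A k i *+ (k == l) - A k i *+ (l == i) - A l i *+ (k == i).
Proof.
have uc j m : (unit_col i : 'cV[R]_N) j m = (j == i)%:R.
  by rewrite mxE [m]ord1 eqxx andbT.
have Ai j m : (A *m unit_col i) j m = A j i.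
  rewrite mxE (bigD1 i)//= big1 ?addr0 => [|n ni]; rewrite uc ?eqxx ?mulr1//.
  by rewrite (negbTE ni) mulr0.
have dgE j m : (diag_mx (unit_col i)^T : 'M[R]_N) j m = ((j == i) && (j == m))%:R.
  by rewrite !mxE eqxx andbT; case: (j == i); case: (j == m); rewrite ?mulr1n ?mulr0n ?mul0rn.
have -> : psi A i k l = diag_mx (A *m unit_col i)^T k l
   - (A *m diag_mx (unit_col i)^T) k l - (diag_mx (unit_col i)^T *m A^T) k l.
  by rewrite /psi [LHS]mxE [X in X + _]mxE [X in _ + X + _]mxE [X in _ + X]mxE.
congr (_ - _ - _).
- by rewrite mxE mxE Ai.
- rewrite mxE (bigD1 i)//= big1 ?addr0 => [|n ni]; rewrite dgE ?eqxx /=.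
    by rewrite eq_sym mulr_natr.
  by rewrite (negbTE ni) mulr0.
- rewrite mxE (bigD1 i)//= big1 ?addr0 => [|n ni]; rewrite dgE ?mxE ?eqxx /=.
    by rewrite andbb; case: (k == i); rewrite ?mul0r ?mul1r.
  by case: (k =P i) => [->|_]; rewrite 1?eq_sym ?(negbTE ni) mul0r.
Qed.

(** Identifies the matrix form of the seminorm with the carre du champ, so that only differences of
    coordinates across a transition matter. *)
Lemma psiE (C D : 'cV[R]_N) i :
  (C^T *m psi A i *m D) 0 0 = gam (colf C) (colf D) i.
Proof.
have delta (F : 'I_N -> R) j : \sum_k F k *+ (k == j) = F j.
  by rewrite (bigD1 j)//= eqxx big1 ?addr0// => k /negbTE ->.
have row l : \sum_k C k 0 * psi A i k l =
   C l 0 * A l i - LA (colf C) i *+ (l == i) - C i 0 * A l i.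
  transitivity (\sum_k ((C k 0 * A k i) *+ (k == l) - (A k i * C k 0) *+ (l == i)
     - (C k 0 * A l i) *+ (k == i))).
    by apply: eq_bigr => k _; rewrite psi_entry !mulrBr !mulrnAr [A k i * _]mulrC.
  by rewrite !sumrB !delta -sumrMnl.
rewrite mxE -LA_prod.
transitivity (\sum_l ((A l i * (colf C l * colf D l)) - (LA (colf C) i * D l 0) *+ (l == i)
   - C i 0 * (A l i * colf D l))).
  apply: eq_bigr => l _; rewrite mxE.
  transitivity ((\sum_k C k 0 * psi A i k l) * D l 0).
    by congr (_ * _); apply: eq_bigr => k _; rewrite mxE.
  by rewrite row !mulrBl mulrnAl /colf; ring.
rewrite !sumrB delta -mulr_sumr /LA /colf; ring.
Qed.

Lemma sqnormE i C : sqnorm A i C = gam (colf C) (colf C) i.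
Proof. exact: psiE. Qed.

End generator.

(** * Markov property and Dynkin's formula *)

Section model.
Context {d : measure_display} {Omega : measurableType d} {R : realType}
  {N : nat}.
Variables (P : probability Omega R) (T c : R) (A : 'M[R]_N).
Variables (X : R -> Omega -> 'I_N) (W : R -> Omega -> R).
Hypotheses (Pcomp : measure_is_complete P) (T0 : 0 < T)
  (hA : rate_matrix c A) (hW : brownian_motion P T W)
  (hX : markov_chain P T A X) (hXW : independent_processes P T X W).

Local Notation leb := (@lebesgue_measure R).
Local Notation mu := (P \x lebesgue_measure)%E.
Local Notation HX := (history setT X).
Local Notation HW := (history measurable W).
Local Notation piG0 := (piG0 P X W).
Implicit Types (f g h : 'I_N -> R) (zeta : Omega -> R) (s t a b r : R).

Definition dl (i : 'I_N) (k : 'I_N) : R := (k == i)%:R.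

Lemma Iv_indic (F : set Omega) : measurable F -> (Iv P (\1_F))%:E = P F.
Proof.
move=> mF; rewrite EFin_Iv ?integral_indic ?setIT//; exact: integrable_indic.
Qed.

Lemma sT0 s t : 0 <= s -> s <= t -> t <= T -> [/\ 0 <= s <= T, 0 <= t <= T & s <= T].
Proof.
move=> s0 st tT; split; last exact: le_trans tT.
  by rewrite s0 (le_trans st).
by rewrite tT (le_trans s0).
Qed.

Lemma measurable_fX f t : 0 <= t <= T -> measurable_fun setT (fun w => f (X t w)).
Proof. by move=> tT _ B mB; rewrite setTI; exact: (measurable_X hX (f @^-1` B)). Qed.

Lemma int1_fX f t zeta : 0 <= t <= T -> int1 P zeta ->
  int1 P (fun w => zeta w * f (X t w)).
Proof.
move=> tT iz; have : int1 P (fun w => f (X t w) * zeta w).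
  apply: (@int1M_bounded _ _ _ _ _ _ (fbound f)) => //; first exact: measurable_fX.
  by move=> w; exact: fboundP.
by apply: int1_eq => w; rewrite mulrC.
Qed.

(** The Markov property is given for the chain history alone. On a rectangle the Brownian event
    splits off by independence, so the property holds for the joint information. *)
Lemma markov_cond s t i j : 0 <= s -> s <= t -> t <= T ->
  cond0 P (piG0 s) (fun w => dl i (X s w) * (dl j (X t w) - pexp A j i (t - s))).
Proof.
move=> s0 st tT; have [s0T t0T sT] := sT0 s0 st tT.
apply: cond0_pi => //; [exact: (HX_sub hX)|exact: (HW_sub hW)| |].
  have : int1 P (fun w => 1 * (dl i (X s w)) * (dl j (X t w) - pexp A j i (t - s))).
    apply: (@int1_eq _ _ _ _ (fun w => (1 * dl i (X s w)) * dl j (X t w) -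
       pexp A j i (t - s) * (1 * dl i (X s w)))) => [w|]; first by ring.
    apply: int1B; first by apply: int1_fX => //; apply: int1_fX => //; exact: int1_cst.
    by apply: int1Z; apply: int1_fX => //; exact: int1_cst.
  by apply: int1_eq => w; rewrite mul1r.
move=> A1 A2 h1 h2.
pose E1 := A1 `&` X s @^-1` [set i].
pose E2 := E1 `&` X t @^-1` [set j].
have mXi r k : 0 <= r <= T -> measurable (X r @^-1` [set k]).
  by move=> rT; exact: (measurable_X hX).
have hT : HX s `<=` HX T by exact: history_mono.
have hE1 : HX T E1.
  apply: (@measurableI _ (g_sigma_algebraType _)); first exact: hT.
  exact: (@HX_X _ _ _ _ X s T).
have hE2 : HX T E2.
  by apply: (@measurableI _ (g_sigma_algebraType _)) => //; exact: (@HX_X _ _ _ _ X t T).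
have hA2 : HW T A2 by exact: (history_mono sT).
have mA1 : measurable A1 := HX_sub hX sT h1.
have mA2 : measurable A2 := HW_sub hW sT h2.
have mE1 : measurable E1 by apply: measurableI => //; exact: mXi.
have mE2 : measurable E2 by apply: measurableI => //; exact: mXi.
have [_ _ _ mk] := hX.
have e12 : Iv P (\1_(E2 `&` A2)) = pexp A j i (t - s) * Iv P (\1_(E1 `&` A2)).
  apply: EFin_inj; rewrite EFinM !Iv_indic; try exact: measurableI.
  rewrite (hXW hE1 hA2) (hXW hE2 hA2) muleA; congr (_ * _)%E.
  by rewrite /E2 /E1 mk// muleC.
transitivity (Iv P (fun w => \1_(E2 `&` A2) w - pexp A j i (t - s) * \1_(E1 `&` A2) w)).
  apply: Iv_eq => w.
  have X1 k r : \1_(X r @^-1` [set k]) w = dl k (X r w).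
    rewrite indicE /dl; congr (nat_of_bool _)%:R.
    by apply/idP/idP => [/set_mem/eqP//|/eqP e]; rewrite mem_set.
  by rewrite /E2 /E1 !indicI /= !X1; ring.
have i1 : int1 P (\1_(E1 `&` A2) : Omega -> R).
  by apply: integrable_indic; exact: measurableI.
have i2 : int1 P (\1_(E2 `&` A2) : Omega -> R).
  by apply: integrable_indic; exact: measurableI.
by rewrite IvB ?IvZ ?e12 ?subrr//; exact: int1Z.
Qed.

Lemma measurable_chain f s t : 0 <= s -> t <= T ->
  measurable_fun setT (fun p : Omega * measurableTypeR R => ind s t p.2 * f (X p.2 p.1)).
Proof.
move=> s0 tT; have [h rc _ _] := hX.
exact: (measurable_chain_process (ltW T0) h rc f s0 tT).
Qed.

Lemma int1_chain f s t zeta : 0 <= s -> t <= T -> int1 P zeta ->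
  int1 mu (fun p => ind s t p.2 * (zeta p.1 * f (X p.2 p.1))).
Proof.
move=> s0 tT iz.
have := int1M_bounded (k := fbound f) (measurable_chain f s0 tT) _ (int1_strip s t iz).
move=> /(_ _)/= H; apply: int1_eq (H _) => [p|p].
  by rewrite -[in RHS]ind_idem; ring.
rewrite normrM; apply: le_trans (fboundP f (X p.2 p.1)).
by rewrite ler_piMl// norm_ind.
Qed.

Lemma Iv_chain f s t zeta : 0 <= s -> t <= T -> int1 P zeta ->
  Iv mu (fun p => ind s t p.2 * (zeta p.1 * f (X p.2 p.1))) =
  Iv leb (fun u => ind s t u * Iv P (fun w => zeta w * f (X u w))).
Proof.
move=> s0 tT iz; rewrite Iv_swap; last 2 first.
- exact: int1_chain.
- move=> u /=; have [|h] := boolP (s < u <= t).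
    by move=> /andP[su ut]; apply: int1Z; apply: int1_fX => //; rewrite (le_trans s0 (ltW su)) (le_trans ut).
  apply: int1_eq (int10 _) => w; by rewrite /ind (negbTE h) mul0r.
apply: Iv_eq => u /=; have [|h] := boolP (s < u <= t).
  move=> /andP[su ut]; rewrite IvZ//; apply: int1_fX => //.
  by rewrite (le_trans s0 (ltW su)) (le_trans ut).
rewrite [in RHS]/ind (negbTE h) mul0r -[RHS](Iv0 P); apply: Iv_eq => w.
by rewrite /ind (negbTE h) mul0r.
Qed.

Lemma rv_pi_X s t f : 0 <= s <= t -> t <= T -> rv_in <<s piG0 t >> (fun w => f (X s w)).
Proof.
move=> st tT; apply: (@rv_in_sub _ _ _ (HX t)); last exact: rv_X.
by move=> B hB; apply: G_pi; exact: G_HX.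
Qed.

Lemma markov_int s t i j zeta : 0 <= s -> s <= t -> t <= T ->
  rv_in <<s piG0 s >> zeta -> int1 P zeta ->
  Iv P (fun w => zeta w * dl i (X s w) * dl j (X t w)) =
  pexp A j i (t - s) * Iv P (fun w => zeta w * dl i (X s w)).
Proof.
move=> s0 st tT hz iz; have [s0T t0T sT] := sT0 s0 st tT.
have i1 : int1 P (fun w => zeta w * dl i (X s w)) by exact: int1_fX.
have i2 : int1 P (fun w => zeta w * dl i (X s w) * dl j (X t w)) by exact: int1_fX.
have e w : zeta w * (dl i (X s w) * (dl j (X t w) - pexp A j i (t - s))) =
    zeta w * dl i (X s w) * dl j (X t w) - pexp A j i (t - s) * (zeta w * dl i (X s w)).
  by ring.
have := cond0P (pi_sub Pcomp hW hX sT) (markov_cond i j s0 st tT) hz.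
rewrite (funext e) => /(_ (int1B i2 (int1Z _ i1))).
by rewrite IvB// ?IvZ// => [/eqP|]; [rewrite subr_eq0 => /eqP|exact: int1Z].
Qed.

Lemma f_dl f k : f k = \sum_i f i * dl i k.
Proof.
rewrite (bigD1 k)//= /dl eqxx mulr1 big1 ?addr0// => i ik.
by rewrite eq_sym (negbTE ik) mulr0.
Qed.

Lemma dl_sum k : \sum_i dl i k = 1.
Proof. by rewrite {1}[RHS](f_dl (fun=> 1) k); apply: eq_bigr => i _; rewrite mul1r. Qed.

Lemma markov_f s t f zeta : 0 <= s -> s <= t -> t <= T ->
  rv_in <<s piG0 s >> zeta -> int1 P zeta ->
  Iv P (fun w => zeta w * f (X t w)) =
  \sum_i \sum_j f j * pexp A j i (t - s) * Iv P (fun w => zeta w * dl i (X s w)).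
Proof.
move=> s0 st tT hz iz; have [s0T t0T sT] := sT0 s0 st tT.
transitivity (Iv P (fun w => \sum_i \sum_j f j * (zeta w * dl i (X s w) * dl j (X t w)))).
  apply: Iv_eq => w; rewrite {1}(f_dl f).
  transitivity (\sum_i dl i (X s w) * (zeta w * \sum_j f j * dl j (X t w))).
    by rewrite -mulr_suml dl_sum mul1r.
  by apply: eq_bigr => i _; rewrite !mulr_sumr; apply: eq_bigr => j _; ring.
have i2 i j : int1 P (fun w => f j * (zeta w * dl i (X s w) * dl j (X t w))).
  by apply: int1Z; apply: int1_fX => //; exact: int1_fX.
rewrite Iv_sum => [|i _]; last by apply: int1_sum.
apply: eq_bigr => i _; rewrite Iv_sum => [|j _]; last exact: i2.
apply: eq_bigr => j _; rewrite IvZ; last by apply: int1_fX => //; exact: int1_fX.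
by rewrite markov_int// mulrA.
Qed.

(** Expanding over the states at both ends reduces the claim to the integrated Kolmogorov equation
    [pexp_integral] for each pair of states. *)
Lemma dynkin s t f zeta : 0 <= s -> s <= t -> t <= T ->
  rv_in <<s piG0 s >> zeta -> int1 P zeta ->
  Iv P (fun w => zeta w * f (X t w)) = Iv P (fun w => zeta w * f (X s w)) +
  Iv mu (fun p => ind s t p.2 * (zeta p.1 * LA A f (X p.2 p.1))).
Proof.
move=> s0 st tT hz iz; have [s0T t0T sT] := sT0 s0 st tT.
set e := fun i => Iv P (fun w => zeta w * dl i (X s w)).
have iq j i : int1 leb (fun u => ind s t u * \sum_l A j l * pexp A l i (u - s)).
  apply: int1_ind_continuous => u; apply: cvg_bigsum => l _.
  apply: cvgM; first exact: cvg_cst.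
  apply: continuous_comp; last exact: continuous_pexp.
  by apply: cvgB; [exact: cvg_id|exact: cvg_cst].
rewrite Iv_chain//.
have -> : Iv leb (fun u => ind s t u * Iv P (fun w => zeta w * LA A f (X u w))) =
  Iv leb (fun u => \sum_i \sum_j f j * e i * (ind s t u * \sum_l A j l * pexp A l i (u - s))).
  apply: Iv_eq => u; have [|h] := boolP (s < u <= t); last first.
    rewrite /ind (negbTE h) mul0r big1// => i _; rewrite big1// => j _.
    by rewrite mul0r mulr0.
  move=> /andP[su ut]; rewrite (@markov_f s u)//; [|exact: ltW|exact: le_trans ut tT].
  rewrite mulr_sumr; apply: eq_bigr => i _; rewrite mulr_sumr.
  rewrite -/(e i).
  transitivity (\sum_l \sum_j ind s t u * (A j l * f j * pexp A l i (u - s) * e i)).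
    apply: eq_bigr => l _; rewrite /LA !mulr_suml mulr_sumr.
    by apply: eq_bigr => j _; ring.
  rewrite exchange_big /=; apply: eq_bigr => j _; rewrite !mulr_sumr.
  by apply: eq_bigr => l _; ring.
rewrite Iv_sum => [|i _]; last by apply: int1_sum => j _; exact: int1Z.
rewrite (markov_f f s0 st tT hz iz) (markov_f f s0 (lexx s) sT hz iz) -big_split /=.
apply: eq_bigr => i _; rewrite Iv_sum => [|j _]; last exact: int1Z.
rewrite -big_split /=; apply: eq_bigr => j _.
by rewrite IvZ// -pexp_integral// subrr pexp0 -/(e i); ring.
Qed.

Definition Ca : R := \sum_j \sum_i `|A j i|.

Lemma Ca_ge0 : 0 <= Ca.
Proof. by apply: sumr_ge0 => j _; exact: sumr_ge0. Qed.

Lemma LA_le f (k : R) i : (forall j, `|f j| <= k) -> `|LA A f i| <= Ca * k.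
Proof.
move=> fk; have k0 : 0 <= k := le_trans (normr_ge0 _) (fk i).
rewrite /LA (le_trans (ler_norm_sum _ _ _))// /Ca mulr_suml; apply: ler_sum => j _.
rewrite normrM; apply: ler_pM => //.
by rewrite (bigD1 i)//= lerDl; exact: sumr_ge0.
Qed.

Lemma neqE s t w : (X t w != X s w)%:R = \sum_i dl i (X s w) * (1 - dl i (X t w)) :> R.
Proof.
rewrite (bigD1 (X s w))//= /dl eqxx mul1r big1 ?addr0 => [|i iX].
  by case: (X t w == X s w); rewrite ?subrr ?subr0.
by rewrite eq_sym (negbTE iX) mul0r.
Qed.

Lemma int1_change s t zeta : 0 <= s -> s <= t -> t <= T -> int1 P zeta ->
  int1 P (fun w => zeta w * (X t w != X s w)%:R).
Proof.
move=> s0 st tT iz; have [s0T t0T sT] := sT0 s0 st tT.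
have : int1 P (fun w => \sum_i (zeta w * dl i (X s w)) * (1 - dl i (X t w))).
  apply: int1_sum => i _.
  by apply: (int1_fX (fun k => 1 - dl i k)) => //; exact: int1_fX.
by apply: int1_eq => w; rewrite neqE mulr_sumr; apply: eq_bigr => i _; rewrite mulrA.
Qed.

(** Dynkin's formula for [1 - dl i] on the event that the chain is in [i] at time [s], where this
    function starts from 0. *)
Lemma change_le s t zeta : 0 <= s -> s <= t -> t <= T ->
  rv_in <<s piG0 s >> zeta -> int1 P zeta -> (forall w, 0 <= zeta w) ->
  Iv P (fun w => zeta w * (X t w != X s w)%:R) <= Ca * (t - s) * Iv P zeta.
Proof.
move=> s0 st tT hz iz z0; have [s0T t0T sT] := sT0 s0 st tT.
have iz1 i : int1 P (fun w => zeta w * dl i (X s w)) by exact: int1_fX.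
have iz2 i : int1 P (fun w => (zeta w * dl i (X s w)) * (1 - dl i (X t w))).
  exact: (int1_fX (fun k => 1 - dl i k)).
have -> : Iv P (fun w => zeta w * (X t w != X s w)%:R) =
   \sum_i Iv P (fun w => (zeta w * dl i (X s w)) * (1 - dl i (X t w))).
  rewrite -Iv_sum//; apply: Iv_eq => w.
  by rewrite neqE mulr_sumr; apply: eq_bigr => i _; rewrite mulrA.
have -> : Iv P zeta = \sum_i Iv P (fun w => zeta w * dl i (X s w)).
  rewrite -Iv_sum//; apply: Iv_eq => w.
  by rewrite -mulr_sumr dl_sum mulr1.
rewrite mulr_sumr; apply: ler_sum => i _.
rewrite (dynkin (fun k => 1 - dl i k) s0 st tT)//; last first.
  by apply: rv_inM => //; apply: rv_pi_X => //; rewrite s0 lexx.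
rewrite (_ : Iv P _ = 0) ?add0r; last first.
  rewrite -[RHS](Iv0 P); apply: Iv_eq => w; rewrite /dl.
  by case: (X s w == i); rewrite ?subrr ?mulr0 ?mul0r.
rewrite -mulrA -(Iv_strip st (iz1 i)) -IvZ; last exact: (int1_strip s t (iz1 i)).
apply: Iv_le; [exact: (int1_chain _ s0 tT (iz1 i))|exact: (int1Z _ (int1_strip s t (iz1 i)))|].
move=> p; rewrite [leRHS]mulrCA; apply: ler_wpM2l; first exact: ind_ge0.
rewrite mulrC; apply: ler_wpM2r.
  by rewrite mulr_ge0// /dl ler0n.
apply: le_trans (ler_norm _) _; rewrite -[leRHS]mulr1; apply: LA_le => j.
by rewrite /dl; case: (j == i); rewrite ?subrr ?subr0 ?normr0 ?normr1.
Qed.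

Lemma int1_change_strip s t zeta : 0 <= s -> s <= t -> t <= T -> int1 P zeta ->
  int1 mu (fun p => ind s t p.2 * (zeta p.1 * (X p.2 p.1 != X s p.1)%:R)).
Proof.
move=> s0 st tT iz; have [s0T t0T sT] := sT0 s0 st tT.
have : int1 mu (fun p => \sum_i ind s t p.2 * ((zeta p.1 * dl i (X s p.1)) * (1 - dl i (X p.2 p.1)))).
  apply: int1_sum => i _.
  by apply: (@int1_chain (fun k => 1 - dl i k) s t (fun w => zeta w * dl i (X s w))) => //; exact: int1_fX.
apply: int1_eq => p; rewrite neqE mulr_sumr mulr_sumr.
by apply: eq_bigr => i _; rewrite !mulrA.
Qed.

(** The probability of being elsewhere at time [u] is of order [u - s]; integrated over the strip
    this is quadratic in its length, hence negligible when summed over a fine grid. *)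
Lemma change_strip s t zeta : 0 <= s -> s <= t -> t <= T ->
  rv_in <<s piG0 s >> zeta -> int1 P zeta -> (forall w, 0 <= zeta w) ->
  Iv mu (fun p => ind s t p.2 * (zeta p.1 * (X p.2 p.1 != X s p.1)%:R))
  <= Ca * (t - s) ^+ 2 * Iv P zeta.
Proof.
move=> s0 st tT hz iz z0; have [s0T t0T sT] := sT0 s0 st tT.
have iu u : s < u <= t -> int1 P (fun w => zeta w * (X u w != X s w)%:R).
  by move=> /andP[su ut]; exact: (int1_change s0 (ltW su) (le_trans ut tT) iz).
rewrite Iv_swap; last 2 first.
- exact: int1_change_strip.
- move=> u /=; have [h|h] := boolP (s < u <= t); first by apply: int1Z; exact: iu.
  by apply: int1_eq (int10 _) => w; rewrite /ind (negbTE h) mul0r.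
have e u : Iv P (fun w => ind s t u * (zeta w * (X u w != X s w)%:R)) <=
    Ca * (t - s) * Iv P zeta * ind s t u.
  have [h|h] := boolP (s < u <= t); last first.
    rewrite /ind (negbTE h) mulr0 -[leRHS](Iv0 P) le_eqVlt; apply/orP; left; apply/eqP.
    by apply: Iv_eq => w; rewrite mul0r.
  have /andP[su ut] := h; rewrite /ind h mulr1; under Iv_eq do rewrite mul1r.
  apply: le_trans (change_le s0 (ltW su) (le_trans ut tT) hz iz z0) _.
  apply: ler_wpM2r; first exact: Iv_ge0.
  by apply: ler_wpM2l; [exact: Ca_ge0|rewrite lerD2r].
have -> : Ca * (t - s) ^+ 2 * Iv P zeta = Ca * (t - s) * Iv P zeta * (t - s) by ring.
apply: (@le_trans _ _ (Iv leb (fun u => Ca * (t - s) * Iv P zeta * ind s t u))); last first.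
  by rewrite IvZ; [rewrite (Iv_ind st)|exact: int1_ind].
apply: Iv_le; [|exact: (int1Z _ (int1_ind s t))|exact: e].
have mG := measurable_fubini_G (int1_change_strip s0 st tT iz).
apply: (int1_le_ae _ (int1Z (Ca * (t - s) * Iv P zeta) (int1_ind s t))).
  exact: (measurableT_comp (fine_measurable measurableT) mG).
apply: aeW => u; rewrite ger0_norm; first exact: e.
by apply: Iv_ge0 => w; rewrite mulr_ge0 ?ind_ge0// mulr_ge0.
Qed.

End model.

(** * The chain martingales *)

(* Halving the interval repeatedly: an additive interval function that is
   quadratically small vanishes. *)
Lemma additive_quadratic0 {R : realType} (e : R -> R -> R) (s t K : R) :
  s <= t ->
  (forall a r b, s <= a -> a <= r -> r <= b -> b <= t -> e a b = e a r + e r b) ->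
  (forall a b, s <= a -> a <= b -> b <= t -> `|e a b| <= K * (b - a) ^+ 2) ->
  e s t = 0.
Proof.
move=> st add bnd.
have key n a b : s <= a -> a <= b -> b <= t -> `|e a b| <= K * (b - a) ^+ 2 / 2 ^+ n.
  elim: n a b => [|n ih] a b sa ab bt; first by rewrite expr0 divr1; exact: bnd.
  pose m := (a + b) / 2.
  have am : a <= m by rewrite /m; lra.
  have mb : m <= b by rewrite /m; lra.
  rewrite (add a m b)// (le_trans (ler_normD _ _))//.
  apply: le_trans (lerD (ih a m sa am (le_trans mb bt)) (ih m b (le_trans sa am) mb bt)) _.
  rewrite le_eqVlt; apply/orP; left; apply/eqP; rewrite /m (exprS 2 n).
  have q0 : (2 : R) ^+ n != 0 by rewrite expf_neq0.
  by move: q0; set q := 2 ^+ n => q0; field.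
apply/eqP; rewrite -normr_eq0 eq_le normr_ge0 andbT.
pose C := K * (t - s) ^+ 2.
have h n : `|e s t| <= C / 2 ^+ n by exact: key.
have cv : C / 2 ^+ n @[n --> \oo] --> 0.
  rewrite -(mulr0 C); apply: cvgM; first exact: cvg_cst.
  rewrite (_ : (fun n => _) = (fun n => (2^-1) ^+ n)); last first.
    by apply/funext => n; rewrite exprVn.
  by apply: cvg_expr; rewrite ger0_norm ?invr_ge0// invf_lt1 ?ltr1n.
have := @limr_ge _ _ _ _ (`|e s t|) (fun n => C / 2 ^+ n) (cvgP _ cv).
rewrite (cvg_lim _ cv)//; apply; exact: nearW.
Qed.

Section model.
Context {d : measure_display} {Omega : measurableType d} {R : realType}
  {N : nat}.
Variables (P : probability Omega R) (T c : R) (A : 'M[R]_N).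
Variables (X : R -> Omega -> 'I_N) (W : R -> Omega -> R).
Hypotheses (Pcomp : measure_is_complete P) (T0 : 0 < T)
  (hA : rate_matrix c A) (hW : brownian_motion P T W)
  (hX : markov_chain P T A X) (hXW : independent_processes P T X W).

Local Notation leb := (@lebesgue_measure R).
Local Notation mu := (P \x lebesgue_measure)%E.
Local Notation HX := (history setT X).
Local Notation hatG0 := (hatG0 P T X W).
Local Notation piG0 := (piG0 P X W).
Local Notation dW := (dW W).
Implicit Types (f g h : 'I_N -> R) (zeta : Omega -> R) (s t a b r : R).
Local Notation chI := (chain_int X).
Local Notation Ca := (Ca A).

(** Increment of Dynkin's martingale of [f]; for [f = dl j] it is that of the j-th coordinate of the
    chain martingale. *)
Definition dM f s t w := f (X t w) - f (X s w) - chI (LA A f) s t w.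

Lemma chI_rc : forall w t, 0 <= t < T -> \forall s \near t^'+, X s w = X t w.
Proof. by have [_ h _ _] := hX. Qed.

Lemma mXi t i : 0 <= t <= T -> measurable (X t @^-1` [set i]).
Proof. by have [h _ _ _] := hX; exact: h. Qed.

Lemma chI_le f s t w (k : R) : 0 <= s -> s <= t -> t <= T -> (forall i, `|f i| <= k) ->
  `|chI f s t w| <= k * (t - s).
Proof.
move=> s0 st tT fk.
have i := int1_chain_path (ltW T0) mXi chI_rc f w s0 tT.
apply: le_trans (Iv_norm i) _.
apply: (@le_trans _ _ (Iv leb (fun u => k * ind s t u))); last first.
  by rewrite IvZ; [rewrite (Iv_ind st)|exact: int1_ind].
apply: Iv_le; [exact: int1_norm|exact: (int1Z _ (int1_ind s t))|].
move=> u; rewrite normrM mulrC (ger0_norm (ind_ge0 s t u)).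
by rewrite ler_wpM2r ?ind_ge0.
Qed.

Lemma chI_LA_le f s t w : 0 <= s -> s <= t -> t <= T ->
  `|chI (LA A f) s t w| <= Ca * fbound f * (t - s).
Proof.
move=> s0 st tT; apply: chI_le => // i.
by apply: LA_le => j; exact: fboundP.
Qed.

Lemma measurable_chI f s t : 0 <= s -> s <= t -> t <= T ->
  measurable_fun setT (chI f s t).
Proof.
move=> s0 st tT.
exact: (measurable_chain_int (ltW T0) mXi chI_rc f s0 st tT).
Qed.

Lemma chI_cat f s r t w : 0 <= s -> s <= r -> r <= t -> t <= T ->
  chI f s t w = chI f s r w + chI f r t w.
Proof. exact: (chain_int_cat (ltW T0) mXi chI_rc). Qed.

Lemma chI_lin f g (k l : R) s t w : 0 <= s -> t <= T ->
  chI (fun i => k * f i + l * g i) s t w = k * chI f s t w + l * chI g s t w.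
Proof.
move=> s0 tT.
have i1 := int1_chain_path (ltW T0) mXi chI_rc f w s0 tT.
have i2 := int1_chain_path (ltW T0) mXi chI_rc g w s0 tT.
rewrite -!IvZ// -IvD; [|exact: int1Z|exact: int1Z].
by apply: Iv_eq => u; ring.
Qed.

Lemma LA_lin f g (k l : R) i : LA A (fun j => k * f j + l * g j) i = k * LA A f i + l * LA A g i.
Proof.
by rewrite /LA !mulr_sumr -big_split /=; apply: eq_bigr => j _; ring.
Qed.

Lemma dM_lin f g (k l : R) s t w : 0 <= s -> t <= T ->
  dM (fun i => k * f i + l * g i) s t w = k * dM f s t w + l * dM g s t w.
Proof.
move=> s0 tT; rewrite /dM (_ : LA A _ = fun i => k * LA A f i + l * LA A g i).
  by rewrite chI_lin//; ring.
by apply/funext => i; exact: LA_lin.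
Qed.

Lemma dM_cat f s r t w : 0 <= s -> s <= r -> r <= t -> t <= T ->
  dM f s t w = dM f s r w + dM f r t w.
Proof. by move=> s0 sr rt tT; rewrite /dM (chI_cat _ _ s0 sr rt tT); ring. Qed.

Definition KM f : R := 2 * fbound f + Ca * fbound f * T.

Lemma dM_le f s t w : 0 <= s -> s <= t -> t <= T -> `|dM f s t w| <= KM f.
Proof.
move=> s0 st tT.
have h1 := fboundP f (X t w); have h2 := fboundP f (X s w).
have h3 := chI_LA_le f w s0 st tT.
have h4 : Ca * fbound f * (t - s) <= Ca * fbound f * T.
  apply: ler_wpM2l; first by rewrite mulr_ge0 ?Ca_ge0 ?fbound_ge0.
  by rewrite lerBlDr (le_trans tT)// lerDl.
rewrite /dM /KM (le_trans (ler_normB _ _))//.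
by have := ler_normB (f (X t w)) (f (X s w)); lra.
Qed.

Lemma rv_pi_chI f s t : 0 <= s -> s <= t -> t <= T -> rv_in <<s piG0 t >> (chI f s t).
Proof.
move=> s0 st tT; apply: (@rv_in_sub _ _ _ (HX t)).
  by move=> B hB; apply: G_pi; exact: G_HX.
exact: (rv_chain_int hX).
Qed.

Lemma rv_pi_dM f s t : 0 <= s -> s <= t -> t <= T -> rv_in <<s piG0 t >> (dM f s t).
Proof.
move=> s0 st tT; apply: rv_inB; last exact: rv_pi_chI.
by apply: rv_inB; apply: (@rv_pi_X _ _ _ _ P T X W) => //; rewrite ?lexx ?(le_trans s0 st) ?s0 ?st.
Qed.

Lemma measurable_dM f s t : 0 <= s -> s <= t -> t <= T -> measurable_fun setT (dM f s t).
Proof.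
move=> s0 st tT; apply: (rv_in_measurable (pi_sub Pcomp hW hX tT)); exact: rv_pi_dM.
Qed.

Lemma int1_dM f s t zeta : 0 <= s -> s <= t -> t <= T -> int1 P zeta ->
  int1 P (fun w => zeta w * dM f s t w).
Proof.
move=> s0 st tT iz.
have : int1 P (fun w => dM f s t w * zeta w).
  apply: (int1M_bounded (k := KM f)) => //; first exact: measurable_dM.
  by move=> w; exact: dM_le.
by apply: int1_eq => w; rewrite mulrC.
Qed.

Lemma int2_dM f s t zeta : 0 <= s -> s <= t -> t <= T -> int2 P zeta ->
  int2 P (fun w => zeta w * dM f s t w).
Proof.
move=> s0 st tT iz.
have : int2 P (fun w => dM f s t w * zeta w).
  apply: (int2M_bounded (k := KM f)) => //; first exact: measurable_dM.
  by move=> w; exact: dM_le.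
by apply: int2_eq => w; rewrite mulrC.
Qed.

Lemma int1_chI f s t zeta : 0 <= s -> s <= t -> t <= T -> int1 P zeta ->
  int1 P (fun w => zeta w * chI f s t w).
Proof.
move=> s0 st tT iz.
have : int1 P (fun w => chI f s t w * zeta w).
  apply: (int1M_bounded (k := fbound f * (t - s))) => //; first exact: measurable_chI.
  by move=> w; apply: chI_le => // i; exact: fboundP.
by apply: int1_eq => w; rewrite mulrC.
Qed.

Lemma Iv_chI f s t zeta : 0 <= s -> s <= t -> t <= T -> int1 P zeta ->
  Iv P (fun w => zeta w * chI f s t w) =
  Iv mu (fun p => ind s t p.2 * (zeta p.1 * f (X p.2 p.1))).
Proof.
move=> s0 st tT iz; rewrite -slice_Iv; last exact: (int1_chain T0 hX).
apply: Iv_eq => w; rewrite /slice /chain_int -IvZ.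
  by apply: Iv_eq => u /=; ring.
exact: (int1_chain_path (ltW T0) mXi chI_rc).
Qed.

Lemma M1 f s t zeta : 0 <= s -> s <= t -> t <= T ->
  rv_in <<s piG0 s >> zeta -> int1 P zeta ->
  Iv P (fun w => zeta w * dM f s t w) = 0.
Proof.
move=> s0 st tT hz iz; have [s0T t0T sT] := sT0 s0 st tT.
have i1 := int1_fX hX f t0T iz; have i2 := int1_fX hX f s0T iz.
have i3 := int1_chI (LA A f) s0 st tT iz.
transitivity (Iv P (fun w => zeta w * f (X t w) - zeta w * f (X s w) - zeta w * chI (LA A f) s t w)).
  by apply: Iv_eq => w; rewrite /dM; ring.
rewrite IvB//; last exact: int1B.
rewrite IvB// Iv_chI// (dynkin Pcomp T0 hW hX hXW f s0 st tT hz iz); ring.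
Qed.

(** With [D] the increment of [f (X)] and [J] its compensator, the square expands into three terms.
    Dynkin's formula for [f] and [f^2] produces the carre du champ, apart from terms that contain
    [J] or the change of [f (X_u)] since [s]; each of these is quadratic in [t - s]. *)
Lemma M2_bound f s t zeta : 0 <= s -> s <= t -> t <= T ->
  rv_in <<s piG0 s >> zeta -> int1 P zeta ->
  `|Iv P (fun w => zeta w * dM f s t w ^+ 2) -
    Iv mu (fun p => ind s t p.2 * (zeta p.1 * gam A f f (X p.2 p.1)))| <=
  (9 * (Ca * fbound f) ^+ 2) * Iv P (fun w => `|zeta w|) * (t - s) ^+ 2.
Proof.
move=> s0 st tT hz iz; have [s0T t0T sT] := sT0 s0 st tT.
set F := fbound f; set g := LA A f; set Z := Iv P (fun w => `|zeta w|).
have F0 : 0 <= F := fbound_ge0 f.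
have C0 := Ca_ge0 A.
have gF i : `|g i| <= Ca * F by apply: LA_le => j; exact: fboundP.
have hz' : rv_in <<s piG0 s >> (fun w => `|zeta w|).
  by apply: (@rv_in_comp _ _ _ _ (fun x => `|x|)).
have iz' := int1_norm iz.
pose D w := f (X t w) - f (X s w).
pose J w := chI g s t w.
have JK w : `|J w| <= Ca * F * (t - s) by exact: chI_LA_le.
have mJ : measurable_fun setT J by exact: measurable_chI.
have i_tt : int1 P (fun w => zeta w * (f (X t w) * f (X t w))).
  exact: (int1_fX hX (fun i => f i * f i)).
have i_ss : int1 P (fun w => zeta w * (f (X s w) * f (X s w))).
  exact: (int1_fX hX (fun i => f i * f i)).
have i_s : int1 P (fun w => zeta w * f (X s w)) by exact: (int1_fX hX f s0T iz).
have i_st : int1 P (fun w => (zeta w * f (X s w)) * f (X t w)) by exact: (int1_fX hX f t0T i_s).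
have h_s : rv_in <<s piG0 s >> (fun w => zeta w * f (X s w)).
  by apply: rv_inM => //; apply: (@rv_pi_X _ _ _ _ P T X W) => //; rewrite s0 lexx.
have i_D2 : int1 P (fun w => zeta w * D w ^+ 2).
  have := int1D (int1B i_tt (int1Z 2 i_st)) i_ss.
  by apply: int1_eq => w; rewrite /D; ring.
have i_DJ : int1 P (fun w => zeta w * D w * J w).
  apply: int1_chI => //; have := int1B (int1_fX hX f t0T iz) i_s.
  by apply: int1_eq => w; rewrite /D; ring.
have i_JJ : int1 P (fun w => zeta w * J w * J w).
  by apply: int1_chI => //; exact: int1_chI.
have e1 : Iv P (fun w => zeta w * dM f s t w ^+ 2) =
   Iv P (fun w => zeta w * D w ^+ 2) - 2 * Iv P (fun w => zeta w * D w * J w)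
   + Iv P (fun w => zeta w * J w * J w).
  rewrite -IvZ// -IvB//; last exact: int1Z.
  rewrite -IvD//; last by apply: int1B => //; exact: int1Z.
  by apply: Iv_eq => w; rewrite /dM -/g -/(J w) -/(D w); ring.
have ic1 := int1_chain T0 hX (LA A (fun i => f i * f i)) s0 tT iz.
have ic2 := int1_chain T0 hX g s0 tT i_s.
have ic3 := int1_chain T0 hX (gam A f f) s0 tT iz.
have ic4 := int1_chain T0 hX (fun i => f i * g i) s0 tT iz.
have e2 : Iv P (fun w => zeta w * D w ^+ 2) =
   Iv mu (fun p => ind s t p.2 * (zeta p.1 * LA A (fun i => f i * f i) (X p.2 p.1))) -
   2 * Iv mu (fun p => ind s t p.2 * ((zeta p.1 * f (X s p.1)) * g (X p.2 p.1))).
  transitivity (Iv P (fun w => zeta w * (f (X t w) * f (X t w)))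
    - 2 * Iv P (fun w => (zeta w * f (X s w)) * f (X t w))
    + Iv P (fun w => zeta w * (f (X s w) * f (X s w)))).
    rewrite -IvZ// -IvB//; last exact: int1Z.
    rewrite -IvD//; last by apply: int1B => //; exact: int1Z.
    by apply: Iv_eq => w; rewrite /D; ring.
  rewrite (dynkin Pcomp T0 hW hX hXW (fun i => f i * f i) s0 st tT hz iz).
  rewrite (dynkin Pcomp T0 hW hX hXW f s0 st tT h_s i_s).
  have -> : Iv P (fun w => zeta w * f (X s w) * f (X s w)) =
    Iv P (fun w => zeta w * (f (X s w) * f (X s w))) by apply: Iv_eq => w; ring.
  by rewrite -/g; ring.
have e3 : Iv mu (fun p => ind s t p.2 * (zeta p.1 * gam A f f (X p.2 p.1))) =
   Iv mu (fun p => ind s t p.2 * (zeta p.1 * LA A (fun i => f i * f i) (X p.2 p.1)))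
   - 2 * Iv mu (fun p => ind s t p.2 * (zeta p.1 * (f (X p.2 p.1) * g (X p.2 p.1)))).
  rewrite -IvZ// -IvB//; last exact: int1Z.
  by apply: Iv_eq => p; rewrite -(LA_prod hA) -/g; ring.
pose q p := ind s t p.2 * (zeta p.1 * ((f (X p.2 p.1) - f (X s p.1)) * g (X p.2 p.1))).
have iq : int1 mu q by have := int1B ic4 ic2; apply: int1_eq => p; rewrite /q; ring.
have eq : Iv mu (fun p => ind s t p.2 * (zeta p.1 * (f (X p.2 p.1) * g (X p.2 p.1)))) -
  Iv mu (fun p => ind s t p.2 * ((zeta p.1 * f (X s p.1)) * g (X p.2 p.1))) = Iv mu q.
  by rewrite -IvB//; apply: Iv_eq => p; rewrite /q; ring.
have DF w u : `|f (X u w) - f (X s w)| <= 2 * F * (X u w != X s w)%:R.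
  case: eqP => [->|_] /=; first by rewrite subrr normr0 mulr0.
  rewrite mulr1 (le_trans (ler_normB _ _))//.
  by have := fboundP f (X u w); have := fboundP f (X s w); rewrite -/F; lra.
have bq : `|Iv mu q| <= 2 * (Ca * F) ^+ 2 * Z * (t - s) ^+ 2.
  apply: le_trans (Iv_norm iq) _.
  have ics := int1_change_strip T0 hX s0 st tT iz'.
  apply: (@le_trans _ _ (2 * F * (Ca * F) * Iv mu (fun p =>
    ind s t p.2 * (`|zeta p.1| * (X p.2 p.1 != X s p.1)%:R)))).
    rewrite -IvZ//; apply: Iv_le; [exact: int1_norm|exact: int1Z|].
    move=> p; rewrite /q !normrM (ger0_norm (ind_ge0 s t p.2)).
    rewrite [leRHS]mulrCA; apply: ler_wpM2l; first exact: ind_ge0.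
    rewrite [leRHS]mulrCA; apply: ler_wpM2l => //.
    by rewrite mulrAC; apply: ler_pM.
  apply: le_trans (ler_wpM2l _ (change_strip Pcomp T0 hW hX hXW s0 st tT hz' iz' _)) _ => //.
    by rewrite !mulr_ge0.
  rewrite le_eqVlt; apply/orP; left; apply/eqP; rewrite -/Z; ring.
have b1 : `|Iv P (fun w => zeta w * D w * J w)| <= 2 * (Ca * F) ^+ 2 * Z * (t - s) ^+ 2.
  apply: le_trans (Iv_norm i_DJ) _.
  have icc := int1_change hX s0 st tT iz'.
  apply: (@le_trans _ _ (2 * F * (Ca * F * (t - s)) *
     Iv P (fun w => `|zeta w| * (X t w != X s w)%:R))).
    rewrite -IvZ//; apply: Iv_le; [exact: int1_norm|exact: int1Z|].
    move=> w; rewrite !normrM -mulrA [leRHS]mulrCA; apply: ler_wpM2l => //.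
    by rewrite mulrAC; apply: ler_pM => //; exact: DF.
  apply: le_trans (ler_wpM2l _ (change_le Pcomp T0 hW hX hXW s0 st tT hz' iz' _)) _ => //.
    by rewrite !mulr_ge0// subr_ge0.
  rewrite le_eqVlt; apply/orP; left; apply/eqP; rewrite -/Z; ring.
have b2 : `|Iv P (fun w => zeta w * J w * J w)| <= (Ca * F) ^+ 2 * Z * (t - s) ^+ 2.
  apply: le_trans (Iv_norm i_JJ) _.
  apply: (@le_trans _ _ ((Ca * F * (t - s)) ^+ 2 * Z)); last first.
    by rewrite le_eqVlt; apply/orP; left; apply/eqP; ring.
  rewrite -IvZ//; apply: Iv_le; [exact: int1_norm|exact: int1Z|].
  move=> w; rewrite !normrM -mulrA [leRHS]mulrC; apply: ler_wpM2l => //.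
  by rewrite expr2; apply: ler_pM.
(* The three remainders have constants 2, 2 and 1 and enter with multiplicities 2, 2 and 1, whence
   the 9. *)
have -> : Iv P (fun w => zeta w * dM f s t w ^+ 2) -
    Iv mu (fun p => ind s t p.2 * (zeta p.1 * gam A f f (X p.2 p.1))) =
   2 * Iv mu q - 2 * Iv P (fun w => zeta w * D w * J w) + Iv P (fun w => zeta w * J w * J w).
  by rewrite e1 e2 e3 -eq; ring.
move: bq b1 b2.
have -> : 9 * (Ca * F) ^+ 2 * Z * (t - s) ^+ 2 = 9 * ((Ca * F) ^+ 2 * Z * (t - s) ^+ 2) by ring.
have -> : 2 * (Ca * F) ^+ 2 * Z * (t - s) ^+ 2 = 2 * ((Ca * F) ^+ 2 * Z * (t - s) ^+ 2) by ring.
rewrite !ler_norml => /andP[a1 a2] /andP[a3 a4] /andP[a5 a6].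
by apply/andP; split; lra.
Qed.

(** Both sides are additive over adjacent intervals, the cross term vanishing by [M1], so their
    quadratically small difference is zero. *)
Lemma M2 f s t zeta : 0 <= s -> s <= t -> t <= T ->
  rv_in <<s piG0 s >> zeta -> int1 P zeta ->
  Iv P (fun w => zeta w * dM f s t w ^+ 2) =
  Iv mu (fun p => ind s t p.2 * (zeta p.1 * gam A f f (X p.2 p.1))).
Proof.
move=> s0 st tT hz iz; apply/eqP; rewrite -subr_eq0; apply/eqP.
pose e a b := Iv P (fun w => zeta w * dM f a b w ^+ 2) -
  Iv mu (fun p => ind a b p.2 * (zeta p.1 * gam A f f (X p.2 p.1))).
have up a : s <= a -> a <= T -> rv_in <<s piG0 a >> zeta.
  move=> sa aT; apply: rv_in_sub hz; apply: pi_mono; exact: history_mono.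
apply: (@additive_quadratic0 _ e s t
  ((9 * (Ca * fbound f) ^+ 2) * Iv P (fun w => `|zeta w|))) => // [a r b sa ar rb bt|a b sa ab bt].
- have a0 := le_trans s0 sa; have bT := le_trans bt tT.
  have rT := le_trans rb bT; have r0 := le_trans a0 ar.
  have i1 : int1 P (fun w => zeta w * dM f a r w) by exact: int1_dM.
  have i2 : int1 P (fun w => zeta w * dM f a r w * dM f a r w) by exact: int1_dM.
  have i3 : int1 P (fun w => zeta w * dM f a r w * dM f r b w) by exact: int1_dM.
  have i4 : int1 P (fun w => zeta w * dM f r b w * dM f r b w).
    by apply: int1_dM => //; exact: int1_dM.
  rewrite /e.
  have -> : Iv P (fun w => zeta w * dM f a b w ^+ 2) = Iv P (fun w => zeta w * dM f a r w ^+ 2)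
    + Iv P (fun w => zeta w * dM f r b w ^+ 2).
    transitivity (Iv P (fun w => zeta w * dM f a r w * dM f a r w +
       2 * (zeta w * dM f a r w * dM f r b w) + zeta w * dM f r b w * dM f r b w)).
      by apply: Iv_eq => w; rewrite (dM_cat f w a0 ar rb bT); ring.
    rewrite IvD//; last by apply: int1D => //; exact: int1Z.
    rewrite IvD//; last exact: int1Z.
    rewrite IvZ// (M1 (zeta := fun w => zeta w * dM f a r w) f r0 rb bT)//; last first.
      by apply: rv_inM; [exact: (up r (le_trans sa ar))|exact: rv_pi_dM].
    by rewrite mulr0 addr0; congr (_ + _); apply: Iv_eq => w; ring.
  have -> : Iv mu (fun p => ind a b p.2 * (zeta p.1 * gam A f f (X p.2 p.1))) =
    Iv mu (fun p => ind a r p.2 * (zeta p.1 * gam A f f (X p.2 p.1))) +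
    Iv mu (fun p => ind r b p.2 * (zeta p.1 * gam A f f (X p.2 p.1))).
    rewrite -IvD; [|exact: (int1_chain T0 hX)|exact: (int1_chain T0 hX)].
    by apply: Iv_eq => p; rewrite (ind_cat p.2 ar rb); ring.
  by rewrite opprD addrACA.
- apply: M2_bound => //; [exact: le_trans s0 sa|exact: le_trans bt tT|].
  by apply: up => //; exact: le_trans ab (le_trans bt tT).
Qed.

Lemma M2_polar f g s t zeta : 0 <= s -> s <= t -> t <= T ->
  rv_in <<s piG0 s >> zeta -> int1 P zeta ->
  Iv P (fun w => zeta w * (dM f s t w * dM g s t w)) =
  Iv mu (fun p => ind s t p.2 * (zeta p.1 * gam A f g (X p.2 p.1))).
Proof.
move=> s0 st tT hz iz.
have ic f' g' := int1_chain T0 hX (gam A f' g') s0 tT iz.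
have i2 f' : int1 P (fun w => zeta w * dM f' s t w ^+ 2).
  have : int1 P (fun w => zeta w * dM f' s t w * dM f' s t w).
    by apply: int1_dM => //; exact: int1_dM.
  by apply: int1_eq => w; ring.
pose p' i := 1 * f i + 1 * g i; pose m' i := 1 * f i + (-1) * g i.
have e1 : Iv P (fun w => zeta w * (dM f s t w * dM g s t w)) =
  4^-1 * (Iv P (fun w => zeta w * dM p' s t w ^+ 2) - Iv P (fun w => zeta w * dM m' s t w ^+ 2)).
  rewrite -IvB// -IvZ; last exact: int1B.
  by apply: Iv_eq => w; rewrite /p' /m' !dM_lin//; field.
rewrite e1 !M2// -IvB// -IvZ; last exact: int1B.
apply: Iv_eq => p; rewrite /gam /p' /m' -!mulrBr mulrCA; congr (_ * _).
rewrite mulrCA; congr (_ * _); rewrite -sumrB mulr_sumr.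
by apply: eq_bigr => j _; field.
Qed.

(** The chain increment is measurable for [hatG0 s]; it is absorbed into the known factor in front
    of the centred Brownian increment. *)
Lemma WM f s t zeta : 0 <= s -> s <= t -> t <= T ->
  rv_in <<s piG0 s >> zeta -> int1 P zeta ->
  int1 P (fun w => zeta w * dW s t w * dM f s t w) /\
  Iv P (fun w => zeta w * dW s t w * dM f s t w) = 0.
Proof.
move=> s0 st tT hz iz; have [s0T t0T sT] := sT0 s0 st tT.
have hM : rv_in <<s hatG0 s >> (dM f s t).
  have hXT : rv_in (HX T) (dM f s t).
    apply: rv_inB.
      by apply: rv_inB; apply: rv_X.
    apply: (@rv_in_sub _ _ _ (HX t)); first exact: history_mono.
    exact: (rv_chain_int hX).
  apply: rv_in_sub hXT => B hB; apply: sub_sigma_algebra; exact: pi_prod_l.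
have hz' : rv_in <<s hatG0 s >> zeta by apply: rv_in_sub hz; exact: pi_hat.
have [[i e] _ _ _] := dW_moments Pcomp hW hX hXW s0 st tT (rv_inM hz' hM) (int1_dM f s0 st tT iz).
split.
  by apply: int1_eq i => w; ring.
by rewrite -[RHS]e; apply: Iv_eq => w; ring.
Qed.

End model.

(** * Elementary integrals and their isometry *)

Section quadratic_form.
Context {R : realType} {N : nat}.
Variables (c : R) (A : 'M[R]_N).
Hypothesis hA : rate_matrix c A.
Implicit Types f g : 'I_N -> R.

Lemma rate_ge0 j i : j != i -> 0 <= A j i.
Proof.
have [/andP[c0 _] h _] := hA; move=> ji; have /andP[h1 _] := h j i ji.
exact: le_trans (ltW c0) h1.
Qed.

Lemma gam_ge0 f i : 0 <= gam A f f i.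
Proof.
apply: sumr_ge0 => j _; have [->|ji] := eqVneq j i; first by rewrite subrr !mulr0.
by rewrite -mulrA mulr_ge0 ?rate_ge0// -expr2 sqr_ge0.
Qed.

(** The free parameter [k] makes this a substitute for the triangle inequality of the L^2 norm,
    without square roots. *)
Lemma sqr_young (x y k : R) : 0 < k -> (x + y) ^+ 2 <= (1 + k) * x ^+ 2 + (1 + k^-1) * y ^+ 2.
Proof.
move=> k0; rewrite -subr_ge0.
have -> : (1 + k) * x ^+ 2 + (1 + k^-1) * y ^+ 2 - (x + y) ^+ 2 = k^-1 * (k * x - y) ^+ 2.
  by field; rewrite gt_eqF.
by rewrite mulr_ge0 ?sqr_ge0// invr_ge0 ltW.
Qed.

Lemma gam_young f g (k : R) i : 0 < k ->
  gam A (fun j => f j + g j) (fun j => f j + g j) i <=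
  (1 + k) * gam A f f i + (1 + k^-1) * gam A g g i.
Proof.
move=> k0; rewrite /gam !mulr_sumr -big_split /=; apply: ler_sum => j _.
have [->|ji] := eqVneq j i; first by rewrite !subrr !mulr0 addr0.
have := rate_ge0 ji; set x := A j i => x0.
have := sqr_young (f j - f i) (g j - g i) k0.
have -> : x * (f j + g j - (f i + g i)) * (f j + g j - (f i + g i)) =
  x * ((f j - f i) + (g j - g i)) ^+ 2 by ring.
have -> : (1 + k) * (x * (f j - f i) * (f j - f i)) + (1 + k^-1) * (x * (g j - g i) * (g j - g i))
 = x * ((1 + k) * (f j - f i) ^+ 2 + (1 + k^-1) * (g j - g i) ^+ 2) by ring.
exact: ler_wpM2l.
Qed.

Lemma gam_suml I (r : seq I) (F : I -> 'I_N -> R) g i :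
  gam A (fun j => \sum_(l <- r) F l j) g i = \sum_(l <- r) gam A (F l) g i.
Proof.
rewrite /gam exchange_big /=; apply: eq_bigr => j _.
by rewrite -!mulrA -sumrB mulr_suml mulr_sumr; apply: eq_bigr => l _; rewrite mulrA.
Qed.

Lemma gamC f g i : gam A f g i = gam A g f i.
Proof. by apply: eq_bigr => j _; ring. Qed.

Lemma gam_sumr I (r : seq I) (F : I -> 'I_N -> R) g i :
  gam A g (fun j => \sum_(l <- r) F l j) i = \sum_(l <- r) gam A g (F l) i.
Proof. by rewrite gamC gam_suml; apply: eq_bigr => l _; rewrite gamC. Qed.

Lemma gamZ f g (k l : R) i : gam A (fun j => k * f j) (fun j => l * g j) i = k * l * gam A f g i.
Proof. by rewrite /gam mulr_sumr; apply: eq_bigr => j _; ring. Qed.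

Lemma gam_delta (C D : 'I_N -> R) i :
  \sum_j \sum_k C j * D k * gam A (dl j) (dl k) i = gam A C D i.
Proof.
have e f : f = (fun k => \sum_j f j * dl j k) by apply/funext => k; exact: f_dl.
rewrite [in RHS](e C) [in RHS](e D) gam_suml; apply: eq_bigr => j _.
by rewrite gam_sumr; apply: eq_bigr => k _; rewrite gamZ.
Qed.

End quadratic_form.

Section processes.
Context {R : realType} {N : nat} {Omega : Type}.
Variables (T : R) (A : 'M[R]_N) (X : R -> Omega -> 'I_N).

Definition proc := option 'I_N -> Omega * R -> R.

(** Nothing is assumed about [X] outside [0, T]; the value at time 0 is used there, which makes the
    process measurable on the whole product. *)
Definition Xext (p : Omega * R) : 'I_N := X (if 0 <= p.2 <= T then p.2 else 0) p.1.

(** Density of the covariation of two integrals against the Brownian motion and the chain martingale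
    jointly, whose mutual bracket is zero. The current state stands in for the left limit; at almost
    every time of ]0, T] they agree. *)
Definition pinner (z z' : proc) p : R :=
  z None p * z' None p + gam A (fun j => z (Some j) p) (fun j => z' (Some j) p) (Xext p).

Definition pnorm (z : proc) p : R := pinner z z p.

Definition zlin (k l : R) (z z' : proc) : proc := fun o p => k * z o p + l * z' o p.

Lemma XextE p : 0 <= p.2 <= T -> Xext p = X p.2 p.1.
Proof. by rewrite /Xext => ->. Qed.

(* An integrand supported by one interval; [None] indexes the coefficient of
   the Brownian motion, [Some j] the j-th coefficient of the chain martingale. *)
Record item := Item { ia : R; ib : R; io : option 'I_N -> Omega -> R }.

Definition zit (e : item) : proc := fun o p => ind (ia e) (ib e) p.2 * io e o p.1.

End processes.

Section model.
Context {d : measure_display} {Omega : measurableType d} {R : realType}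
  {N : nat}.
Variables (P : probability Omega R) (T c : R) (A : 'M[R]_N).
Variables (X : R -> Omega -> 'I_N) (W : R -> Omega -> R).
Hypotheses (Pcomp : measure_is_complete P) (T0 : 0 < T)
  (hA : rate_matrix c A) (hW : brownian_motion P T W)
  (hX : markov_chain P T A X) (hXW : independent_processes P T X W).

Local Notation mu := (P \x lebesgue_measure)%E.
Local Notation HW := (history measurable W).
Local Notation hatG0 := (hatG0 P T X W).
Local Notation piG0 := (piG0 P X W).
Local Notation dW := (dW W).
Implicit Types (zeta phi I : Omega -> R) (s t a b r : R) (z : @proc R N Omega)
  (e : @item R N Omega).
Local Notation dM := (dM A X).
Local Notation Xe := (Xext T X).
Local Notation nrm := (pnorm T A X).
Local Notation ipz := (pinner T A X).
Local Notation H s := <<s piG0 s >>.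

Lemma H_mono s t : s <= t -> H s `<=` H t.
Proof. by move=> st; apply: pi_mono; exact: history_mono. Qed.

Lemma H_meas s (f : Omega -> R) : s <= T -> rv_in (H s) f -> measurable_fun setT f.
Proof. by move=> sT; apply: (rv_in_measurable (pi_sub Pcomp hW hX sT)). Qed.

Definition el e w : R :=
  io e None w * dW (ia e) (ib e) w + \sum_j io e (Some j) w * dM (dl j) (ia e) (ib e) w.

Definition valid s e : Prop :=
  [/\ 0 <= s, s <= ia e, ia e <= ib e, ib e <= T &
      forall o, rv_in (H (ia e)) (io e o) /\ int2 P (io e o)].

Lemma int2_xidW s t (xi : Omega -> R) : 0 <= s -> s <= t -> t <= T ->
  rv_in (H s) xi -> int2 P xi -> int2 P (fun w => xi w * dW s t w).
Proof.
move=> s0 st tT hx [mx ix]; have [s0T t0T sT] := sT0 s0 st tT.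
split.
  by apply: measurable_funM => //; apply: measurable_funB; apply: (measurable_W hW).
have hx2 : rv_in <<s hatG0 s >> (fun w => xi w ^+ 2).
  have : rv_in (H s) (fun w => xi w ^+ 2).
    by apply: (@rv_in_comp _ _ _ _ (fun x => x ^+ 2)) => //; exact: measurable_funX.
  by apply: rv_in_sub; exact: pi_hat.
have [_ [i _] _ _] := dW_moments Pcomp hW hX hXW s0 st tT hx2 ix.
by apply: int1_eq i => w; rewrite exprMn.
Qed.

Lemma int2_el s e : valid s e -> int2 P (el e).
Proof.
move=> [s0 sa ab bT h]; have a0 := le_trans s0 sa.
apply: int2D; first by have [? ?] := h None; exact: int2_xidW.
apply: int2_sum => j _; have [_ ?] := h (Some j).
exact: (int2_dM Pcomp T0 hW hX).
Qed.

Lemma rv_el s e : valid s e -> rv_in (H (ib e)) (el e).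
Proof.
move=> [s0 sa ab bT h]; have a0 := le_trans s0 sa.
have up o : rv_in (H (ib e)) (io e o).
  by apply: rv_in_sub (proj1 (h o)); exact: H_mono.
apply: rv_inD.
  apply: rv_inM => //; apply: (@rv_in_sub _ _ _ (HW (ib e))).
    by move=> B hB; apply: G_pi; exact: G_HW.
  by apply: rv_inB; apply: rv_W; rewrite ?lexx ?a0 ?(le_trans a0 ab).
apply: rv_in_sum => j _; apply: rv_inM => //.
exact: (rv_pi_dM hX).
Qed.

Lemma E_el s e phi : valid s e -> rv_in (H (ia e)) phi -> int2 P phi ->
  Iv P (fun w => phi w * el e w) = 0.
Proof.
move=> [s0 sa ab bT h] hp ip; have a0 := le_trans s0 sa.
have aT := le_trans ab bT.
have [h0 i0] := h None.
have up := rv_inM hp h0.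
have uph : rv_in <<s hatG0 (ia e) >> (fun w => phi w * io e None w).
  by apply: rv_in_sub up; exact: pi_hat.
have [[i1 e1] _ _ _] := dW_moments Pcomp hW hX hXW a0 ab bT uph (int2M ip i0).
have ij j : int1 P (fun w => phi w * io e (Some j) w * dM (dl j) (ia e) (ib e) w).
  by apply: (int1_dM Pcomp T0 hW hX) => //; apply: int2M => //; have [] := h (Some j).
transitivity (Iv P (fun w => phi w * io e None w * dW (ia e) (ib e) w +
   \sum_j phi w * io e (Some j) w * dM (dl j) (ia e) (ib e) w)).
  apply: Iv_eq => w; rewrite /el mulrDr mulrA mulr_sumr; congr (_ + _).
  by apply: eq_bigr => j _; rewrite mulrA.
rewrite IvD//; last exact: int1_sum.
rewrite e1 add0r Iv_sum// big1// => j _; have [hj ijj] := h (Some j).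
apply: (M1 Pcomp T0 hW hX hXW) => //; [exact: rv_inM|exact: int2M].
Qed.

Lemma measurable_Xe (f : 'I_N -> R) :
  measurable_fun setT (fun p : Omega * measurableTypeR R => f (Xe p)).
Proof.
have [mX rcX _ _] := hX.
have mset i : measurable [set p : Omega * measurableTypeR R | Xe p = i].
  pose S1 := [set p : Omega * R | 0 <= p.2 <= T /\ X p.2 p.1 = i].
  pose S2 := (X 0 @^-1` [set i]) `*` (~` `[0, T]%classic : set R).
  have m1 : measurable (S1 : set (Omega * measurableTypeR R)%type).
    have m1 : measurable S1 by apply: measurable_chain_set => //; exact: ltW.
    exact: m1.
  have m2 : measurable (S2 : set (Omega * measurableTypeR R)%type).
    apply: measurableX; first by apply: mX; rewrite lexx ltW.
    by apply: measurableC; exact: measurable_itv.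
  rewrite (_ : [set p | _] = S1 `|` S2); first exact: measurableU.
  apply/seteqP; split => [[w u]|[w u]]; rewrite /S1 /S2 /= /Xext /= in_itv /=.
    by case: ifP => h <-; [left|right; split => //; rewrite h].
  by move=> [[-> ->]//|[h1 /negP/negbTE ->]].
rewrite (_ : (fun p => _) = fun p => \sum_i f i * \1_[set p | Xe p = i] p).
  by apply: measurable_sum => i; apply: measurable_funM => //; exact: measurable_indic.
apply/funext => p; rewrite (bigD1 (Xe p))//= big1 ?addr0 => [|i ip].
  by rewrite indicE mem_set// mulr1.
rewrite indicE memNset ?mulr0// => /= e; by rewrite e eqxx in ip.
Qed.

Definition mproc z : Prop :=
  forall o, measurable_fun setT (z o : Omega * measurableTypeR R -> R).

Lemma measurable_ipz z z' : mproc z -> mproc z' ->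
  measurable_fun setT (ipz z z' : Omega * measurableTypeR R -> R).
Proof.
move=> mz mz'; apply: measurable_funD; first exact: measurable_funM.
apply: measurable_sum => j; rewrite (_ : (fun p => _) = fun p =>
  \sum_i (A j i * dl i (Xe p)) * (z (Some j) p - z (Some i) p) * (z' (Some j) p - z' (Some i) p)).
  apply: measurable_sum => i; apply: measurable_funM; last exact: measurable_funB.
  apply: measurable_funM; last exact: measurable_funB.
  by apply: measurable_funM => //; exact: measurable_Xe.
apply/funext => p; rewrite (bigD1 (Xe p))//= big1 ?addr0 => [|i ip].
  by rewrite /dl eqxx mulr1.
by rewrite /dl eq_sym (negbTE ip) mulr0 !mul0r.
Qed.

Lemma nrm_ge0 z p : 0 <= nrm z p.
Proof. by rewrite /pnorm /pinner addr_ge0 ?(gam_ge0 hA)// -expr2 sqr_ge0. Qed.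

Lemma nrm_young z z' (k : R) p : 0 < k ->
  nrm (zlin 1 1 z z') p <= (1 + k) * nrm z p + (1 + k^-1) * nrm z' p.
Proof.
move=> k0; have h1 := sqr_young (z None p) (z' None p) k0.
have h2 := gam_young hA (fun j => z (Some j) p) (fun j => z' (Some j) p) (Xe p) k0.
rewrite /pnorm /pinner /zlin.
have -> : (fun j => 1 * z (Some j) p + 1 * z' (Some j) p) =
  (fun j => z (Some j) p + z' (Some j) p) by apply/funext => j; rewrite !mul1r.
move: h1 h2; rewrite !expr2 !mul1r; lra.
Qed.

Let lin3 (k l m x y u : R) (F F' F'' : 'I_N -> R) :
  k * (x + \sum_j F j) + l * (y + \sum_j F' j) + m * (u + \sum_j F'' j) =
  (k * x + l * y + m * u) + \sum_j (k * F j + l * F' j + m * F'' j).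
Proof. by rewrite !big_split /= -!mulr_sumr; ring. Qed.

Lemma nrm_lin (k l : R) z z' p : nrm (zlin k l z z') p =
  k ^+ 2 * nrm z p + 2 * (k * l) * ipz z z' p + l ^+ 2 * nrm z' p.
Proof.
rewrite /pnorm /pinner /gam lin3 /zlin; congr (_ + _); first by ring.
by apply: eq_bigr => j _; ring.
Qed.

Lemma ipz_ge_norm z z' p : `|ipz z z' p| <= nrm z p + nrm z' p.
Proof.
have h1 := nrm_ge0 (zlin 1 1 z z') p; have h2 := nrm_ge0 (zlin 1 (-1) z z') p.
rewrite !nrm_lin in h1 h2.
have := nrm_ge0 z p; have := nrm_ge0 z' p => p1 p2.
by rewrite ler_norml; apply/andP; split; lra.
Qed.

Definition H2 z : Prop := mproc z /\ int1 mu (nrm z).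

Lemma mproc_lin (k l : R) z z' : mproc z -> mproc z' -> mproc (zlin k l z z').
Proof. by move=> mz mz' o; apply: measurable_funD; apply: measurable_funM. Qed.

Lemma int1_ipz z z' : H2 z -> H2 z' -> int1 mu (ipz z z').
Proof.
move=> [mz iz] [mz' iz']; apply: (int1_le _ (int1D iz iz')).
  exact: measurable_ipz.
exact: ipz_ge_norm.
Qed.

Lemma H2_lin (k l : R) z z' : H2 z -> H2 z' -> H2 (zlin k l z z').
Proof.
move=> hz hz'; split; first by apply: mproc_lin; [case: hz|case: hz'].
have := int1D (int1D (int1Z (k ^+ 2) hz.2) (int1Z (2 * (k * l)) (int1_ipz hz hz'))) (int1Z (l ^+ 2) hz'.2).
by apply: int1_eq => p; rewrite nrm_lin.
Qed.

Lemma ind_strip s t p : 0 <= s -> t <= T -> ind s t p.2 != 0 -> Xe p = X p.2 p.1.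
Proof.
rewrite /ind => s0 tT h; apply: XextE; move: h; case: (boolP (s < p.2 <= t)); last by rewrite eqxx.
by move=> /andP[su ut] _; rewrite (le_trans s0 (ltW su)) (le_trans ut tT).
Qed.

Lemma H2_zit s e : valid s e -> H2 (zit e).
Proof.
move=> [s0 sa ab bT h]; have a0 := le_trans s0 sa; have aT := le_trans ab bT.
have mo o : measurable_fun setT (io e o) by have [? _] := h o; exact: H_meas aT _.
split.
  move=> o; apply: measurable_funM; first exact: measurable_strip_ind.
  exact: measurable_strip_fst.
have i1 : int1 mu (fun p => ind (ia e) (ib e) p.2 * io e None p.1 ^+ 2).
  by have [_ [_ i]] := h None; exact: (int1_strip _ _ i).
have i2 j k : int1 mu (fun p => ind (ia e) (ib e) p.2 *
   (io e (Some j) p.1 * io e (Some k) p.1 * gam A (dl j) (dl k) (X p.2 p.1))).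
  apply: (int1_chain T0 hX (gam A (dl j) (dl k)) a0 bT (zeta := fun w => io e (Some j) w * io e (Some k) w)).
  by apply: int2M; have [_ ?] := h (Some j); have [_ ?] := h (Some k).
have : int1 mu (fun p => ind (ia e) (ib e) p.2 * io e None p.1 ^+ 2 +
  \sum_j \sum_k ind (ia e) (ib e) p.2 *
   (io e (Some j) p.1 * io e (Some k) p.1 * gam A (dl j) (dl k) (X p.2 p.1))).
  by apply: int1D => //; apply: int1_sum => j _; exact: int1_sum.
apply: int1_eq => p; rewrite /pnorm /pinner /zit.
have [i0|i0] := eqVneq (ind (ia e) (ib e) p.2) 0.
  rewrite i0 !mul0r big1 ?addr0 => [|j _]; last by rewrite big1// => k _; rewrite mul0r.
  by rewrite /gam big1 ?addr0// => j _; rewrite !mul0r subrr !mulr0.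
rewrite gamZ -(ind_strip a0 bT i0) -(gam_delta A (fun j => io e (Some j) p.1)) -!expr2 ind_idem.
rewrite exprMn ind_idem; congr (_ + _); rewrite mulr_sumr; apply: eq_bigr => j _.
by rewrite mulr_sumr.
Qed.

Definition restr a b e : item := Item a b (io e).

Lemma el_cut s e r w : valid s e -> ia e <= r -> r <= ib e ->
  el e w = el (restr (ia e) r e) w + el (restr r (ib e) e) w.
Proof.
move=> [s0 sa ab bT h] ar rb; have a0 := le_trans s0 sa.
rewrite /el /= addrACA; congr (_ + _); first by rewrite /dW; ring.
rewrite -big_split /=; apply: eq_bigr => j _.
by rewrite (dM_cat T0 hX (dl j) w a0 ar rb bT) mulrDr.
Qed.

Lemma valid_restr s a b e : valid s e -> ia e <= a -> a <= b -> b <= T ->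
  valid s (restr a b e).
Proof.
move=> [s0 sa ab bT h] aa ab' bT'; split => //=; first exact: le_trans sa aa.
by move=> o; have [h1 h2] := h o; split => //; apply: rv_in_sub h1; exact: H_mono.
Qed.

Lemma valid_mono s t e : 0 <= s -> s <= t -> valid t e -> valid s e.
Proof. by move=> s0 st [t0 ta ab bT h]; split => //; exact: le_trans st ta. Qed.

Let iso e e' := Iv P (fun w => el e w * el e' w) = Iv mu (ipz (zit e) (zit e')).

Let isoC e e' : iso e e' -> iso e' e.
Proof.
move=> h; rewrite /iso.
have -> : Iv P (fun w => el e' w * el e w) = Iv P (fun w => el e w * el e' w).
  by apply: Iv_eq => w; rewrite mulrC.
rewrite h; apply: Iv_eq => p; rewrite /pinner gamC; ring.
Qed.

(** The earlier integral is known when the later one starts, so both sides vanish: one by centring,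
    the other by disjoint supports. *)
Let iso_disj s e e' : valid s e -> valid s e' -> ib e <= ia e' -> iso e e'.
Proof.
move=> he he' le; have [s0 sa ab bT h] := he; have [_ sa' ab' bT' h'] := he'.
rewrite /iso (E_el (s := s))//; last exact: int2_el he.
  rewrite -(Iv0 mu); apply: Iv_eq => p; rewrite /pinner /zit.
  have z : ind (ia e) (ib e) p.2 * ind (ia e') (ib e') p.2 = 0.
    rewrite /ind; case: (boolP (ia e < p.2 <= ib e)) => [/andP[_ h1]|]; last by rewrite mul0r.
    by rewrite [ia e' < _]ltNge (le_trans h1 le) mulr0.
  by rewrite gamZ mulrACA z !mul0r addr0.
by apply: rv_in_sub (rv_el he); exact: H_mono.
Qed.

(** The product expands into squared Brownian, mixed and pure chain terms, evaluated by
    [dW_moments], [WM] and [M2_polar]. *)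
Let iso_same s e e' : valid s e -> valid s e' -> ia e = ia e' -> ib e = ib e' -> iso e e'.
Proof.
move=> he he' ea eb; have [s0 sa ab bT h] := he; have [_ _ _ _ h'] := he'.
have a0 := le_trans s0 sa; have aT := le_trans ab bT.
move: h'; rewrite /iso /el /zit -ea -eb => h'.
move: (ia e) (ib e) sa ab bT h a0 aT h' {ea eb he he'} => a b sa ab bT h a0 aT h'.
have uph (f : Omega -> R) : rv_in (H a) f -> rv_in <<s hatG0 a >> f.
  by apply: rv_in_sub; exact: pi_hat.
pose x := io e None; pose x' := io e' None.
pose y j := io e (Some j); pose y' j := io e' (Some j).
have [rx ix] := h None; have [rx' ix'] := h' None.
have ry j := (h (Some j)).1; have iy j := (h (Some j)).2.
have ry' j := (h' (Some j)).1; have iy' j := (h' (Some j)).2.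
have [_ [iWW eWW] _ _] := dW_moments Pcomp hW hX hXW a0 ab bT (uph _ (rv_inM rx rx')) (int2M ix ix').
have iWM j := WM Pcomp T0 hW hX hXW (dl j) a0 ab bT (rv_inM rx (ry' j)) (int2M ix (iy' j)).
have iMW j := WM Pcomp T0 hW hX hXW (dl j) a0 ab bT (rv_inM rx' (ry j)) (int2M ix' (iy j)).
have iMM j k : int1 P (fun w => y j w * y' k w * (dM (dl j) a b w * dM (dl k) a b w)).
  have : int1 P (fun w => (y j w * y' k w) * dM (dl j) a b w * dM (dl k) a b w).
    apply: (int1_dM Pcomp T0 hW hX) => //; apply: (int1_dM Pcomp T0 hW hX) => //.
    exact: (int2M (iy j) (iy' k)).
  by apply: int1_eq => w; ring.
have eMM j k := M2_polar Pcomp T0 hA hW hX hXW (dl j) (dl k) a0 ab bT (rv_inM (ry j) (ry' k)) (int2M (iy j) (iy' k)).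
transitivity (Iv P (fun w => x w * x' w * dW a b w ^+ 2 +
   (((\sum_j x w * y' j w * dW a b w * dM (dl j) a b w) +
   (\sum_j x' w * y j w * dW a b w * dM (dl j) a b w)) +
   \sum_j \sum_k y j w * y' k w * (dM (dl j) a b w * dM (dl k) a b w)))).
  have dist (p q s1 s2 : R) : (p + s1) * (q + s2) = p * q + ((p * s2 + s1 * q) + s1 * s2).
    by ring.
  apply: Iv_eq => w; rewrite dist -/x -/x'; congr (_ + (_ + _ + _)).
  - by ring.
  - by rewrite mulr_sumr; apply: eq_bigr => j _; rewrite /x /y'; ring.
  - by rewrite mulr_suml; apply: eq_bigr => j _; rewrite /x' /y; ring.
  rewrite mulr_suml; apply: eq_bigr => j _; rewrite mulr_sumr.
  by apply: eq_bigr => k _; rewrite /y /y'; ring.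
have s1 : int1 P (fun w => \sum_j x w * y' j w * dW a b w * dM (dl j) a b w).
  by apply: int1_sum => j _; have [] := iWM j.
have s2 : int1 P (fun w => \sum_j x' w * y j w * dW a b w * dM (dl j) a b w).
  by apply: int1_sum => j _; have [] := iMW j.
have s3 : int1 P (fun w => \sum_j \sum_k y j w * y' k w * (dM (dl j) a b w * dM (dl k) a b w)).
  by apply: int1_sum => j _; exact: int1_sum.
rewrite IvD//; last by apply: int1D => //; exact: int1D.
rewrite IvD//; last exact: int1D.
rewrite IvD// eWW.
rewrite (@Iv_sum _ _ _ P _ _ _ (fun j w => x w * y' j w * dW a b w * dM (dl j) a b w)); last first.
  by move=> j _; have [] := iWM j.
rewrite (@Iv_sum _ _ _ P _ _ _ (fun j w => x' w * y j w * dW a b w * dM (dl j) a b w)); last first.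
  by move=> j _; have [] := iMW j.
rewrite big1 => [|j _]; last by have [] := iWM j.
rewrite big1 => [|j _]; last by have [] := iMW j.
rewrite addr0 add0r -(Iv_strip ab (int2M ix ix')).
rewrite Iv_sum => [|j _]; last exact: int1_sum.
have ic j k := int1_chain T0 hX (gam A (dl j) (dl k)) a0 bT (int2M (iy j) (iy' k)).
rewrite (eq_bigr (fun j => \sum_k Iv mu (fun p => ind a b p.2 * ((y j p.1 * y' k p.1) *
   gam A (dl j) (dl k) (X p.2 p.1))))) => [|j _]; last first.
  by rewrite Iv_sum//; apply: eq_bigr => k _; exact: eMM.
rewrite (eq_bigr (fun j => Iv mu (fun p => \sum_k ind a b p.2 * ((y j p.1 * y' k p.1) *
   gam A (dl j) (dl k) (X p.2 p.1))))) => [|j _]; last by rewrite Iv_sum// => k _; exact: ic.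
rewrite -Iv_sum => [|j _]; last by apply: int1_sum => k _; exact: ic.
rewrite -IvD; last 2 first.
- exact: int1_strip (int2M ix ix').
- by apply: int1_sum => j _; apply: int1_sum => k _; exact: ic.
apply: Iv_eq => p; rewrite /pinner.
have [i0|i0] := eqVneq (ind a b p.2) 0.
  rewrite i0 !mul0r big1 ?addr0 => [|j _]; last by rewrite big1// => k _; rewrite mul0r.
  by rewrite /gam big1 ?addr0// => j _; rewrite !mul0r subrr !mulr0.
rewrite gamZ -(ind_strip a0 bT i0) -(gam_delta A (fun j => io e (Some j) p.1)) -!expr2 ind_idem.
rewrite mulrACA -expr2 ind_idem; congr (_ + _); rewrite mulr_sumr; apply: eq_bigr => j _.
by rewrite mulr_sumr.
Qed.

Let iso_add s e e' r : valid s e -> valid s e' -> ia e <= r -> r <= ib e ->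
  iso (restr (ia e) r e) e' -> iso (restr r (ib e) e) e' -> iso e e'.
Proof.
move=> he he' ar rb h1 h2; have [s0 sa ab bT h] := he.
have v1 : valid s (restr (ia e) r e) by apply: valid_restr => //; exact: le_trans rb bT.
have v2 : valid s (restr r (ib e) e) by exact: valid_restr.
rewrite /iso.
transitivity (Iv P (fun w => el (restr (ia e) r e) w * el e' w + el (restr r (ib e) e) w * el e' w)).
  by apply: Iv_eq => w; rewrite (el_cut w he ar rb) mulrDl.
have i' := int2_el he'.
rewrite IvD; [|exact: int2M (int2_el v1) i'|exact: int2M (int2_el v2) i'].
rewrite h1 h2 -IvD; [|exact: int1_ipz (H2_zit v1) (H2_zit he')|exact: int1_ipz (H2_zit v2) (H2_zit he')].
apply: Iv_eq => p; rewrite /pinner /zit /= !gamZ (ind_cat p.2 ar rb); ring.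
Qed.

(** The intervals are cut at each other's endpoints until they are disjoint or equal. The nested
    reductions order the left endpoints, make them equal, and order the right endpoints. *)
Lemma isometry_item s e e' : valid s e -> valid s e' ->
  Iv P (fun w => el e w * el e' w) = Iv mu (ipz (zit e) (zit e')).
Proof.
suff main f f' : valid s f -> valid s f' -> ia f <= ia f' -> iso f f'.
  by move=> he he'; case: (leP (ia e) (ia e')) => [|/ltW] h; [|apply: isoC]; exact: main.
suff main g g' : valid s g -> valid s g' -> ia g = ia g' -> iso g g'.
  move=> he he' aa; have [s0 sa ab bT h] := he; have [_ sa' ab' bT' h'] := he'.
  case: (leP (ib f) (ia f')) => [|/ltW] hb; first exact: iso_disj he he' hb.
  apply: (iso_add he he' aa hb).
    apply: (iso_disj (s := s)) => //; apply: valid_restr => //.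
    exact: le_trans ab' bT'.
  by apply: main => //; exact: valid_restr.
suff main l l' : valid s l -> valid s l' -> ia l = ia l' -> ib l <= ib l' -> iso l l'.
  by move=> he he' aa; case: (leP (ib g) (ib g')) => [|/ltW] hb; [|apply: isoC]; exact: main.
move=> he he' aa bb; have [s0 sa ab bT h] := he; have [_ sa' ab' bT' h'] := he'.
have ar : ia l' <= ib l by rewrite -aa.
apply: isoC; apply: (iso_add he' he ar bb); last first.
  by apply: isoC; apply: (iso_disj (s := s)) => //; exact: valid_restr.
by apply: (iso_same (s := s)) => //; exact: valid_restr.
Qed.

End model.

(** * Square-integrable integrals *)

Section model.
Context {d : measure_display} {Omega : measurableType d} {R : realType}
  {N : nat}.
Variables (P : probability Omega R) (T c : R) (A : 'M[R]_N).
Variables (X : R -> Omega -> 'I_N) (W : R -> Omega -> R).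
Hypotheses (Pcomp : measure_is_complete P) (T0 : 0 < T)
  (hA : rate_matrix c A) (hW : brownian_motion P T W)
  (hX : markov_chain P T A X) (hXW : independent_processes P T X W).

Local Notation mu := (P \x lebesgue_measure)%E.
Implicit Types (zeta phi I J : Omega -> R) (s t a b r : R) (z : @proc R N Omega)
  (e : @item R N Omega) (L : seq (@item R N Omega)).
Local Notation nrm := (pnorm T A X).
Local Notation ipz := (pinner T A X).
Local Notation valid := (valid P T X W).
Local Notation el := (el A X W).
Local Notation H2 := (H2 P T A X).

Fixpoint allv s L : Prop := if L is e :: L' then valid s e /\ allv s L' else True.

Definition eltot L w : R := \sum_(e <- L) el e w.
Definition ztot L : @proc R N Omega := fun o p => \sum_(e <- L) zit e o p.

Lemma eltot_cons e L w : eltot (e :: L) w = el e w + eltot L w.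
Proof. by rewrite /eltot big_cons. Qed.

Lemma ztot_cons e L : ztot (e :: L) = zlin 1 1 (zit e) (ztot L).
Proof. by apply/funext => o; apply/funext => p; rewrite /ztot big_cons /zlin !mul1r. Qed.

Lemma allv_cat s L L' : allv s L -> allv s L' -> allv s (L ++ L').
Proof. by elim: L => //= e L ih [? ?] ?; split => //; exact: ih. Qed.

Lemma proc0 : H2 (fun _ _ => 0).
Proof.
split; first by move=> o; exact: measurable_cst.
apply: int1_eq (int10 _) => p; rewrite /pnorm /pinner /gam mulr0 add0r big1// => j _.
by rewrite subrr !mulr0.
Qed.

Lemma ztot_nil : ztot [::] = fun _ _ => 0.
Proof. by apply/funext => o; apply/funext => p; rewrite /ztot big_nil. Qed.

Lemma int2_eltot s L : allv s L -> int2 P (eltot L).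
Proof.
elim: L => [_|e L ih [he hL]]; first by apply: int2_eq (int2_0 P) => w; rewrite /eltot big_nil.
apply: int2_eq (int2D (int2_el Pcomp T0 hW hX hXW he) (ih hL)) => w.
by rewrite eltot_cons.
Qed.

Lemma H2_ztot s L : allv s L -> H2 (ztot L).
Proof.
elim: L => [_|e L ih [he hL]]; first by rewrite ztot_nil; exact: proc0.
rewrite ztot_cons; apply: (H2_lin T0 hA hX) => //; last exact: ih.
exact: (H2_zit Pcomp T0 hW hX he).
Qed.

Lemma pinner_lin (k l : R) z z1 z2 p :
  ipz z (zlin k l z1 z2) p = k * ipz z z1 p + l * ipz z z2 p.
Proof.
rewrite /pinner /gam /zlin !mulrDr !mulr_sumr addrACA; congr (_ + _); first by ring.
by rewrite -big_split /=; apply: eq_bigr => j _; ring.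
Qed.

Lemma isometry_tot s L : allv s L ->
  Iv P (fun w => eltot L w ^+ 2) = Iv mu (nrm (ztot L)).
Proof.
have cross e L' : valid s e -> allv s L' ->
    Iv P (fun w => el e w * eltot L' w) = Iv mu (ipz (zit e) (ztot L')).
  move=> he; have h2e := H2_zit Pcomp T0 hW hX he.
  have i2e := int2_el Pcomp T0 hW hX hXW he.
  elim: L' => [_|e' L' ih [he' hL']].
    rewrite ztot_nil (_ : Iv P _ = 0); last first.
      by apply: etrans (Iv0 P); apply: Iv_eq => w; rewrite /eltot big_nil mulr0.
    apply/esym; apply: etrans (Iv0 mu); apply: Iv_eq => p.
    by rewrite /pinner /gam mulr0 add0r big1// => j _; rewrite subrr mulr0.
  have h2e' := H2_zit Pcomp T0 hW hX he'; have h2L := H2_ztot hL'.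
  transitivity (Iv P (fun w => el e w * el e' w + el e w * eltot L' w)).
    by apply: Iv_eq => w; rewrite eltot_cons mulrDr.
  rewrite IvD; last 2 first.
  - exact: int2M i2e (int2_el Pcomp T0 hW hX hXW he').
  - exact: int2M i2e (int2_eltot hL').
  rewrite (isometry_item Pcomp T0 hA hW hX hXW he he') ih// ztot_cons -IvD; last 2 first.
  - exact: (int1_ipz T0 hA hX).
  - exact: (int1_ipz T0 hA hX).
  by apply: Iv_eq => p; rewrite pinner_lin !mul1r.
elim: L => [_|e L ih [he hL]].
  rewrite (_ : Iv P _ = 0); last first.
    by apply: etrans (Iv0 P); apply: Iv_eq => w; rewrite /eltot big_nil expr0n.
  rewrite ztot_nil; apply/esym; apply: etrans (Iv0 mu); apply: Iv_eq => p.
  by rewrite /pnorm /pinner /gam mulr0 add0r big1// => j _; rewrite subrr mulr0.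
have h2e := H2_zit Pcomp T0 hW hX he; have h2L := H2_ztot hL.
have i2e := int2_el Pcomp T0 hW hX hXW he; have i2L := int2_eltot hL.
transitivity (Iv P (fun w => el e w ^+ 2 + 2 * (el e w * eltot L w) + eltot L w ^+ 2)).
  by apply: Iv_eq => w; rewrite eltot_cons; ring.
have ic : int1 P (fun w => 2 * (el e w * eltot L w)) by apply: int1Z; exact: int2M.
rewrite IvD; [|exact: int1D i2e.2 ic|exact: i2L.2].
rewrite (IvD i2e.2 ic) IvZ; last exact: int2M.
rewrite ih// cross//.
have -> : Iv P (fun w => el e w ^+ 2) = Iv mu (nrm (zit e)).
  by rewrite -(isometry_item Pcomp T0 hA hW hX hXW he he).
have ii := int1_ipz T0 hA hX h2e h2L.
rewrite -IvZ// -IvD; [|exact: h2e.2|exact: int1Z].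
rewrite -IvD; [|by apply: int1D; [exact: h2e.2|exact: int1Z]|exact: h2L.2].
apply: Iv_eq => p; rewrite ztot_cons nrm_lin; ring.
Qed.

(** [I] is the L^2 integral of [z], approximated only by items that start at [s] or later. One list
    serves both approximations, so the isometry and the orthogonality to the past of [s] pass to the
    limit. *)
Definition SI s I z : Prop :=
  [/\ int2 P I, H2 z & forall eps : R, 0 < eps -> exists L,
    [/\ allv s L, Iv P (fun w => (eltot L w - I w) ^+ 2) <= eps &
        Iv mu (nrm (zlin 1 (-1) (ztot L) z)) <= eps]].

Lemma Iv_nrm_young z z' (k : R) : 0 < k -> H2 z -> H2 z' ->
  Iv mu (nrm (zlin 1 1 z z')) <= (1 + k) * Iv mu (nrm z) + (1 + k^-1) * Iv mu (nrm z').
Proof.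
move=> k0 hz hz'; rewrite -!IvZ; [|exact: hz'.2|exact: hz.2].
rewrite -IvD; [|by apply: int1Z; exact: hz.2|by apply: int1Z; exact: hz'.2].
apply: Iv_le; [exact: (H2_lin T0 hA hX 1 1 hz hz').2| |].
  by apply: int1D; apply: int1Z; [exact: hz.2|exact: hz'.2].
by move=> p; exact: (nrm_young T X hA).
Qed.

Lemma Iv_sqr_young (f g : Omega -> R) (k : R) : 0 < k -> int2 P f -> int2 P g ->
  Iv P (fun w => (f w + g w) ^+ 2) <= (1 + k) * Iv P (fun w => f w ^+ 2) + (1 + k^-1) * Iv P (fun w => g w ^+ 2).
Proof.
move=> k0 hf hg; rewrite -!IvZ; [|exact: hg.2|exact: hf.2].
rewrite -IvD; [|by apply: int1Z; exact: hf.2|by apply: int1Z; exact: hg.2].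
apply: Iv_le; [exact: (int2D hf hg).2| |by move=> w; exact: sqr_young].
by apply: int1D; apply: int1Z; [exact: hf.2|exact: hg.2].
Qed.

Lemma nrmN z z' p : nrm (zlin 1 (-1) z z') p = nrm (zlin 1 (-1) z' z) p.
Proof. by rewrite !nrm_lin /pinner gamC; ring. Qed.

(** For fixed [k] the error [eps] is made negligible, half of the tolerance being reserved for it;
    [k <= q / (6 (y + 1))] keeps [(1 + k)^2 y - y <= 3 k y] within the other half. *)
Lemma young_limit (x y C : R) : 0 <= y ->
  (forall k eps : R, 0 < k -> k < 1 -> 0 < eps -> x <= (1 + k) ^+ 2 * y + (C + C / k) * eps) ->
  x <= y.
Proof.
move=> y0 h; apply/ler_addgt0Pr => q q0.
pose k : R := Num.min (1/2) (q / (6 * (y + 1))).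
have y1 : 0 < 6 * (y + 1) by lra.
have k0 : 0 < k by rewrite lt_min divr_gt0//= divr_gt0.
have k1 : k <= 1/2 by rewrite ge_min lexx.
have kd : k * (6 * (y + 1)) <= q by rewrite -ler_pdivlMr// ge_min lexx orbT.
pose D := `|C + C / k| + 1.
have D0 : 0 < D by rewrite /D; have := normr_ge0 (C + C / k); lra.
have e0 : 0 < q / (2 * D) by rewrite divr_gt0// mulr_gt0.
have k1' : k < 1 by lra.
apply: le_trans (h k _ k0 k1' e0) _.
have h2 : (C + C / k) * (q / (2 * D)) <= q / 2.
  apply: (@le_trans _ _ (D * (q / (2 * D)))).
    apply: ler_wpM2r; first exact: ltW.
    by rewrite /D; have := ler_norm (C + C / k); lra.
  by rewrite le_eqVlt; apply/orP; left; apply/eqP; field; rewrite gt_eqF.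
have ky : 0 <= k * y by rewrite mulr_ge0// ltW.
have hk : k * (k * y) <= 1 * (k * y) by apply: ler_wpM2r => //; exact: ltW.
have -> : (1 + k) ^+ 2 * y = y + 2 * (k * y) + k * (k * y) by ring.
have kd' : 6 * (k * y) + 6 * k <= q by move: kd; rewrite (_ : k * _ = 6 * (k * y) + 6 * k)//; ring.
lra.
Qed.

Lemma young_chain (k q eps Z x i u1 u2 : R) : 0 < k -> k < 1 -> 0 < q -> 0 < eps ->
  x <= (1 + k) * Z + (1 + q) * u2 -> u2 <= eps ->
  i <= (1 + k) * x + (1 + q) * u1 -> u1 <= eps ->
  i <= (1 + k) ^+ 2 * Z + (4 + 4 * q) * eps.
Proof.
move=> k0 k1 q0 e0 hx h2 hi h1.
have q1 : 0 <= 1 + q by lra.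
have k1' : 0 <= 1 + k by lra.
pose m := (1 + q) * eps.
have m0 : 0 <= m by rewrite mulr_ge0// ltW.
have a1 : (1 + q) * u1 <= m by exact: ler_wpM2l.
have a2 : (1 + q) * u2 <= m by exact: ler_wpM2l.
have a3 : (1 + k) * x <= (1 + k) * ((1 + k) * Z + m).
  by apply: ler_wpM2l => //; lra.
have a4 : k * m <= 1 * m by apply: ler_wpM2r => //; exact: ltW.
have -> : (4 + 4 * q) * eps = 4 * m by rewrite /m; ring.
move: a3; have -> : (1 + k) * ((1 + k) * Z + m) = (1 + k) ^+ 2 * Z + m + k * m by ring.
lra.
Qed.

(** Each inequality goes through an approximating list, where the isometry is exact, with one use of
    Young's inequality on either side of it. *)
Lemma SI_norm s I z : SI s I z -> Iv P (fun w => I w ^+ 2) = Iv mu (nrm z).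
Proof.
move=> [iI hz h]; have I0 : 0 <= Iv P (fun w => I w ^+ 2) by apply: Iv_ge0 => w; exact: sqr_ge0.
have Z0 : 0 <= Iv mu (nrm z) by apply: Iv_ge0 => p; exact: (nrm_ge0 T X hA).
have key k eps : 0 < k -> k < 1 -> 0 < eps ->
   Iv P (fun w => I w ^+ 2) <= (1 + k) ^+ 2 * Iv mu (nrm z) + (4 + 4 / k) * eps /\
   Iv mu (nrm z) <= (1 + k) ^+ 2 * Iv P (fun w => I w ^+ 2) + (4 + 4 / k) * eps.
  move=> k0 k1 e0; have [L [vL h1 h2]] := h eps e0.
  have iL := int2_eltot vL; have hL := H2_ztot vL; have eL := isometry_tot vL.
  have hD := H2_lin T0 hA hX 1 (-1) hL hz.
  have hD' := H2_lin T0 hA hX 1 (-1) hz hL.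
  have iD := int2B iL iI; have iD' := int2B iI iL.
  have kk : 0 < k^-1 by rewrite invr_gt0.
  split.
  - have := Iv_sqr_young k0 iL iD'.
    have -> : Iv P (fun w => (eltot L w + (I w - eltot L w)) ^+ 2) = Iv P (fun w => I w ^+ 2).
      by apply: Iv_eq => w; rewrite addrCA subrr addr0.
    have -> : Iv P (fun w => (I w - eltot L w) ^+ 2) = Iv P (fun w => (eltot L w - I w) ^+ 2).
      by apply: Iv_eq => w; rewrite -sqrrN opprB.
    have := Iv_nrm_young k0 hz hD.
    have -> : zlin 1 1 z (zlin 1 (-1) (ztot L) z) = ztot L.
      by apply/funext => o; apply/funext => p; rewrite /zlin; ring.
    by rewrite -eL => g1 g2; exact: (young_chain k0 k1 kk e0 g1 h2 g2 h1).
  - have := Iv_nrm_young k0 hL hD'.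
    have -> : zlin 1 1 (ztot L) (zlin 1 (-1) z (ztot L)) = z.
      by apply/funext => o; apply/funext => p; rewrite /zlin; ring.
    rewrite (Iv_eq mu (nrmN z (ztot L))).
    have := Iv_sqr_young k0 iI iD.
    have -> : Iv P (fun w => (I w + (eltot L w - I w)) ^+ 2) = Iv P (fun w => eltot L w ^+ 2).
      by apply: Iv_eq => w; rewrite addrCA subrr addr0.
    by rewrite -eL => g1 g2; exact: (young_chain k0 k1 kk e0 g1 h1 g2 h2).
by apply/eqP; rewrite eq_le; apply/andP; split; apply: (@young_limit _ _ 4) => // k eps k0 k1 e0;
  have [] := key k eps k0 k1 e0.
Qed.

End model.

(** * Scaling, linearity and orthogonality of the integrals *)

Section model.
Context {d : measure_display} {Omega : measurableType d} {R : realType}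
  {N : nat}.
Variables (P : probability Omega R) (T c : R) (A : 'M[R]_N).
Variables (X : R -> Omega -> 'I_N) (W : R -> Omega -> R).
Hypotheses (Pcomp : measure_is_complete P) (T0 : 0 < T)
  (hA : rate_matrix c A) (hW : brownian_motion P T W)
  (hX : markov_chain P T A X) (hXW : independent_processes P T X W).

Local Notation mu := (P \x lebesgue_measure)%E.
Local Notation piG0 := (piG0 P X W).
Implicit Types (zeta phi lam I J : Omega -> R) (s t a b r : R) (z : @proc R N Omega)
  (e : @item R N Omega) (L : seq (@item R N Omega)).
Local Notation nrm := (pnorm T A X).
Local Notation ipz := (pinner T A X).
Local Notation H s := <<s piG0 s >>.
Local Notation valid := (valid P T X W).
Local Notation el := (el A X W).
Local Notation H2 := (H2 P T A X).
Local Notation SI := (SI P T A X W).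
Local Notation allv := (allv P T X W).
Local Notation eltot := (eltot A X W).

Definition zsc (lam : Omega -> R) z : @proc R N Omega := fun o p => lam p.1 * z o p.
Definition sc (lam : Omega -> R) e : item := Item (ia e) (ib e) (fun o w => lam w * io e o w).

Lemma valid_sc s lam (k : R) e : rv_in (H s) lam -> (forall w, `|lam w| <= k) -> valid s e ->
  valid s (sc lam e).
Proof.
move=> hl lk [s0 sa ab bT h]; split => //= o; have [h1 h2] := h o.
have hl' : rv_in (H (ia e)) lam by apply: rv_in_sub hl; exact: H_mono.
split; first exact: rv_inM.
apply: (int2M_bounded (k := k)) => //.
exact: (H_meas Pcomp hW hX (le_trans ab bT)).
Qed.

Lemma el_sc lam e w : el (sc lam e) w = lam w * el e w.
Proof.
rewrite /el /= [RHS]mulrDr mulrA; congr (_ + _); rewrite mulr_sumr.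
by apply: eq_bigr => j _; rewrite mulrA.
Qed.

Lemma eltot_sc lam L w : eltot (map (sc lam) L) w = lam w * eltot L w.
Proof.
elim: L => [|e L ih]; first by rewrite /eltot !big_nil mulr0.
by rewrite /= !eltot_cons ih el_sc [RHS]mulrDr.
Qed.

Lemma ztot_sc lam L : ztot (map (sc lam) L) = zsc lam (ztot L).
Proof.
apply/funext => o; apply/funext => p; rewrite /zsc /ztot big_map mulr_sumr.
by apply: eq_bigr => e _; rewrite /zit /=; ring.
Qed.

Lemma allv_sc s lam (k : R) L : rv_in (H s) lam -> (forall w, `|lam w| <= k) -> allv s L ->
  allv s (map (sc lam) L).
Proof.
move=> hl lk; elim: L => [//|e L ih [he hL]]; split; last exact: ih.
exact: valid_sc lk he.
Qed.

Lemma nrm_zsc lam z p : nrm (zsc lam z) p = lam p.1 ^+ 2 * nrm z p.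
Proof. by rewrite /pnorm /pinner /zsc gamZ; ring. Qed.

Lemma H2_zsc lam (k : R) z : measurable_fun setT lam -> (forall w, `|lam w| <= k) ->
  H2 z -> H2 (zsc lam z).
Proof.
move=> ml lk [mz iz]; split.
  by move=> o; apply: measurable_funM => //; exact: measurable_strip_fst.
have : int1 mu (fun p => lam p.1 ^+ 2 * nrm z p).
  apply: (int1M_bounded (k := k ^+ 2)) => //.
    by apply: measurable_funX; exact: measurable_strip_fst.
  by move=> p; rewrite normrX ler_pXn2r ?nnegrE// (le_trans _ (lk p.1)).
by apply: int1_eq => p; rewrite nrm_zsc.
Qed.

(** The items start no earlier than [s], so a factor known at [s] can be moved into their
    coefficients; its boundedness keeps them square-integrable. *)
Lemma SI_scale s lam (k : R) I z : s <= T -> rv_in (H s) lam -> (forall w, `|lam w| <= k) ->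
  SI s I z -> SI s (fun w => lam w * I w) (zsc lam z).
Proof.
move=> sT hl lk [iI hz h]; have ml := H_meas Pcomp hW hX sT hl.
split; [exact: (int2M_bounded ml lk iI)|exact: (H2_zsc ml lk hz)|].
move=> eps e0; pose q := k ^+ 2 + 1.
have q0 : 0 < q by rewrite /q; have := sqr_ge0 k; lra.
have [L [vL h1 h2]] := h (eps / q) (divr_gt0 e0 q0).
have iL := int2_eltot Pcomp T0 hW hX hXW vL; have hL := H2_ztot Pcomp T0 hA hW hX vL.
have l2 w : lam w ^+ 2 <= q.
  apply: (@le_trans _ _ (k ^+ 2)); last by rewrite lerDl.
  by rewrite -[lam w ^+ 2]ger0_norm ?sqr_ge0// normrX ler_pXn2r ?nnegrE// (le_trans _ (lk w)).
exists (map (sc lam) L); split; first exact: allv_sc lk vL.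
- have i1 := int2B iL iI.
  apply: (@le_trans _ _ (q * Iv P (fun w => (eltot L w - I w) ^+ 2))); last first.
    by rewrite mulrC -ler_pdivlMr.
  rewrite -IvZ; last exact: i1.2.
  apply: Iv_le; [|by apply: int1Z; exact: i1.2|].
    apply: int1_eq (int2M_bounded ml lk i1).2 => w.
    by rewrite eltot_sc; ring.
  move=> w; rewrite eltot_sc.
  have -> : (lam w * eltot L w - lam w * I w) ^+ 2 = lam w ^+ 2 * (eltot L w - I w) ^+ 2 by ring.
  by apply: ler_wpM2r => //; exact: sqr_ge0.
- have i1 := H2_lin T0 hA hX 1 (-1) hL hz.
  apply: (@le_trans _ _ (q * Iv mu (nrm (zlin 1 (-1) (ztot L) z)))); last first.
    by rewrite mulrC -ler_pdivlMr.
  rewrite -IvZ; last exact: i1.2.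
  have e : zlin 1 (-1) (ztot (map (sc lam) L)) (zsc lam z) = zsc lam (zlin 1 (-1) (ztot L) z).
    by rewrite ztot_sc; apply/funext => o; apply/funext => p; rewrite /zsc /zlin; ring.
  rewrite e; apply: Iv_le; [exact: (H2_zsc ml lk i1).2|by apply: int1Z; exact: i1.2|].
  move=> p; rewrite nrm_zsc; apply: ler_wpM2r => //; exact: (nrm_ge0 T X hA).
Qed.

Lemma eltot_cat L L' w : eltot (L ++ L') w = eltot L w + eltot L' w.
Proof. by rewrite /eltot big_cat. Qed.

Lemma ztot_cat L L' : ztot (L ++ L') = zlin 1 1 (ztot L) (ztot L').
Proof.
by apply/funext => o; apply/funext => p; rewrite /ztot big_cat /zlin !mul1r.
Qed.

Lemma SI_add s I z I' z' : SI s I z -> SI s I' z' ->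
  SI s (fun w => I w + I' w) (zlin 1 1 z z').
Proof.
move=> [iI hz h] [iI' hz' h']; split; [exact: int2D|exact: (H2_lin T0 hA hX)|].
move=> eps e0; have e4 : 0 < eps / 4 by rewrite divr_gt0.
have [L [vL h1 h2]] := h _ e4; have [L' [vL' h1' h2']] := h' _ e4.
have iL := int2_eltot Pcomp T0 hW hX hXW vL; have hL := H2_ztot Pcomp T0 hA hW hX vL.
have iL' := int2_eltot Pcomp T0 hW hX hXW vL'; have hL' := H2_ztot Pcomp T0 hA hW hX vL'.
exists (L ++ L'); split; first exact: allv_cat.
- have := Iv_sqr_young ltr01 (int2B iL iI) (int2B iL' iI').
  rewrite (_ : Iv P (fun w => (eltot L w - I w + (eltot L' w - I' w)) ^+ 2) =
    Iv P (fun w => (eltot (L ++ L') w - (I w + I' w)) ^+ 2)); last first.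
    by apply: Iv_eq => w; rewrite eltot_cat; ring.
  rewrite invr1; lra.
- have := Iv_nrm_young T0 hA hX ltr01 (H2_lin T0 hA hX 1 (-1) hL hz) (H2_lin T0 hA hX 1 (-1) hL' hz').
  rewrite (_ : zlin 1 1 (zlin 1 (-1) (ztot L) z) (zlin 1 (-1) (ztot L') z') =
    zlin 1 (-1) (ztot (L ++ L')) (zlin 1 1 z z')); last first.
    by rewrite ztot_cat; apply/funext => o; apply/funext => p; rewrite /zlin; ring.
  rewrite invr1; lra.
Qed.

Lemma SI_lin s (k l : R) I z I' z' : s <= T -> SI s I z -> SI s I' z' ->
  SI s (fun w => k * I w + l * I' w) (zlin k l z z').
Proof.
move=> sT h h'.
have hk (m : R) : rv_in (H s) (fun=> m) by exact: rv_in_cst.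
have := SI_add (SI_scale sT (hk k) (fun=> lexx `|k|) h) (SI_scale sT (hk l) (fun=> lexx `|l|) h').
rewrite (_ : zlin 1 1 _ _ = zlin k l z z')//.
by apply/funext => o; apply/funext => p; rewrite /zlin /zsc; ring.
Qed.

Lemma SI_mono s t I z : 0 <= s -> s <= t -> SI t I z -> SI s I z.
Proof.
move=> s0 st [iI hz h]; split => // eps e0; have [L [vL h1 h2]] := h eps e0.
exists L; split => //; elim: L vL {h1 h2} => //= e L ih [he hL]; split; last exact: ih.
exact: valid_mono he.
Qed.

Lemma SI_item s e : valid s e -> SI s (el e) (zit e).
Proof.
move=> he; split; [exact: (int2_el Pcomp T0 hW hX hXW he)|exact: (H2_zit Pcomp T0 hW hX he)|].
move=> eps e0; exists [:: e]; split => //.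
- rewrite (_ : Iv P _ = 0) ?ltW//; apply: etrans (Iv0 P); apply: Iv_eq => w.
  by rewrite /eltot big_seq1 subrr expr0n.
- rewrite (_ : Iv mu _ = 0) ?ltW//; apply: etrans (Iv0 mu); apply: Iv_eq => p.
  rewrite nrm_lin (_ : ztot [:: e] = zit e) ?/pnorm; first by ring.
  by apply/funext => o; apply/funext => q; rewrite /ztot big_seq1.
Qed.

(** Exact for lists of items; Cauchy-Schwarz controls the approximation error. The 1 added in [D]
    avoids a division by zero. *)
Lemma SI_orth s I z phi : SI s I z -> rv_in (H s) phi -> int2 P phi ->
  Iv P (fun w => phi w * I w) = 0.
Proof.
move=> [iI hz h] hp ip.
have F0 : 0 <= Iv P (fun w => phi w ^+ 2) by apply: Iv_ge0 => w; exact: sqr_ge0.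
suff : Iv P (fun w => phi w * I w) ^+ 2 <= 0.
  by rewrite le_eqVlt ltNge sqr_ge0 orbF sqrf_eq0 => /eqP.
apply/ler_addgt0Pr => q q0; rewrite add0r.
pose D := Iv P (fun w => phi w ^+ 2) + 1.
have D0 : 0 < D by rewrite /D; lra.
have [L [vL h1 _]] := h (q / D) (divr_gt0 q0 D0).
have iL := int2_eltot Pcomp T0 hW hX hXW vL.
have eL : Iv P (fun w => phi w * eltot L w) = 0.
  elim: L vL {h1 iL} => [_|e L ih /= [he hL]].
    by apply: etrans (Iv0 P); apply: Iv_eq => w; rewrite /eltot big_nil mulr0.
  transitivity (Iv P (fun w => phi w * el e w + phi w * eltot L w)).
    by apply: Iv_eq => w; rewrite eltot_cons mulrDr.
  rewrite IvD; last 2 first.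
  - exact: int2M ip (int2_el Pcomp T0 hW hX hXW he).
  - exact: int2M ip (int2_eltot Pcomp T0 hW hX hXW hL).
  rewrite ih// addr0 (E_el Pcomp T0 hW hX hXW he)//.
  by apply: rv_in_sub hp; have [s0 sa _ _ _] := he; exact: H_mono.
have -> : Iv P (fun w => phi w * I w) = - Iv P (fun w => phi w * (eltot L w - I w)).
  have -> : Iv P (fun w => phi w * (eltot L w - I w)) =
     Iv P (fun w => phi w * eltot L w - phi w * I w) by apply: Iv_eq => w; ring.
  by rewrite IvB ?eL ?sub0r ?opprK//; exact: int2M.
rewrite sqrrN; apply: le_trans (cauchy_schwarz ip (int2B iL iI)) _.
apply: (@le_trans _ _ (D * (q / D))).
  by apply: ler_pM => //; [apply: Iv_ge0 => w; exact: sqr_ge0|rewrite /D; lra].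
by rewrite mulrC divfK// gt_eqF.
Qed.

Lemma SI_polar s I z I' z' : s <= T -> SI s I z -> SI s I' z' ->
  Iv P (fun w => I w * I' w) = Iv mu (ipz z z').
Proof.
move=> sT h h'; have [iI hz _] := h; have [iI' hz' _] := h'.
have e1 := SI_norm Pcomp T0 hA hW hX hXW (SI_lin 1 1 sT h h').
have e2 := SI_norm Pcomp T0 hA hW hX hXW h.
have e3 := SI_norm Pcomp T0 hA hW hX hXW h'.
have ii := int1_ipz T0 hA hX hz hz'.
have jj := int2M iI iI'.
have l1 : Iv P (fun w => (1 * I w + 1 * I' w) ^+ 2) =
   Iv P (fun w => I w ^+ 2) + 2 * Iv P (fun w => I w * I' w) + Iv P (fun w => I' w ^+ 2).
  rewrite -IvZ// -IvD; [|exact: iI.2|exact: int1Z].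
  rewrite -IvD; [|by apply: int1D; [exact: iI.2|exact: int1Z]|exact: iI'.2].
  by apply: Iv_eq => w; ring.
have l2 : Iv mu (nrm (zlin 1 1 z z')) = Iv mu (nrm z) + 2 * Iv mu (ipz z z') + Iv mu (nrm z').
  rewrite -IvZ// -IvD; [|exact: hz.2|exact: int1Z].
  rewrite -IvD; [|by apply: int1D; [exact: hz.2|exact: int1Z]|exact: hz'.2].
  by apply: Iv_eq => p; rewrite nrm_lin; ring.
move: e1; rewrite l1 l2 e2 e3; lra.
Qed.

End model.

(** * Encoding of the backward equation *)

Section almost_everywhere.
Context {d : measure_display} {T : measurableType d} {R : realType}.
Variable mu : {measure set T -> \bar R}.
Implicit Types p q r : T -> Prop.

Lemma ae_imp p q : (forall x, p x -> q x) ->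
  {ae mu, forall x, p x} -> {ae mu, forall x, q x}.
Proof. by move=> pq; apply: filterS. Qed.

Lemma ae_imp2 p q r : (forall x, p x -> q x -> r x) ->
  {ae mu, forall x, p x} -> {ae mu, forall x, q x} -> {ae mu, forall x, r x}.
Proof. by move=> pq; apply: filterS2. Qed.

Lemma ae_all p : (forall x, p x) -> {ae mu, forall x, p x}.
Proof. by move=> h; apply: aeW. Qed.

End almost_everywhere.

Section iterated_integrals.
Context {d : measure_display} {Omega : measurableType d} {R : realType}.
Variables (P : probability Omega R) (T : R).
Local Notation leb := (@lebesgue_measure R).
Local Notation mu := (P \x lebesgue_measure)%E.

Lemma iter_EFin (D : set R) (f : R -> Omega -> R) : measurable D ->
  measurable_fun setT (fun p : Omega * measurableTypeR R => \1_D p.2 * f p.2 p.1) ->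
  (forall p : Omega * R, 0 <= \1_D p.2 * f p.2 p.1) ->
  (\int[P]_w \int[leb]_(u in D) (f u w)%:E =
   \int[mu]_p (\1_D p.2 * f p.2 p.1)%:E)%E.
Proof.
move=> mD mf f0; rewrite [RHS]fubini_tonelli1//; last first.
  by apply: (iffRL (measurable_EFinP _ _)); exact: mf.
apply: eq_integral => w _; rewrite integral_mkcond /fubini_F; congr (integral _ _ _); apply/funext => u /=.
by rewrite /patch indicE; case: (u \in D); rewrite ?mul1r ?mul0r.
Qed.

Lemma measurable_strip_on s t (f : R -> Omega -> R) : 0 <= s -> t <= T ->
  jointly_measurable T f ->
  measurable_fun setT (fun p : Omega * measurableTypeR R => ind s t p.2 * f p.2 p.1).
Proof.
move=> s0 tT mf.
have mD : measurable ([set: Omega] `*` `[0, T]%classic : set (Omega * measurableTypeR R)%type).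
  by apply: measurableX => //; exact: measurable_itv.
have /(measurable_restrictT _ mD) mf' : measurable_fun ([set: Omega] `*` `[0, T]%classic
   : set (Omega * measurableTypeR R)%type) (fun p => f p.2 p.1) by exact: mf.
rewrite (_ : (fun p => _) = fun p : Omega * measurableTypeR R => ind s t p.2 *
   ((fun p => f p.2 p.1) \_ ([set: Omega] `*` `[0, T]%classic)) p).
  by apply: measurable_funM mf'; exact: measurable_strip_ind.
apply/funext => p; rewrite /patch; case: ifPn => //.
rewrite notin_setE /= => h; rewrite /ind; case: (boolP (s < p.2 <= t)); last by rewrite !mul0r.
move=> /andP[h1 h2]; exfalso; apply: h; split => //.
by rewrite /= in_itv /= (le_trans s0 (ltW h1)) (le_trans h2 tT).
Qed.

(** The closed interval of the backward equation and the half-open one used here differ by the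
    single point [s]. *)
Lemma Rintegral_ind s t (f : R -> R) : s <= t ->
  measurable_fun setT (fun u => ind s t u * f u) ->
  (\int[leb]_(u in `[s, t]) f u)%R = Iv leb (fun u => ind s t u * f u).
Proof.
move=> st mf.
have -> : (\int[leb]_(u in `[s, t]) f u)%R = (\int[leb]_u (f \_ `[s, t]%classic) u)%R.
  by rewrite Rintegral_mkcond.
rewrite /Iv /Rintegral; congr fine.
apply: ae_eq_integral => //.
- apply/measurable_EFinP.
  rewrite (_ : f \_ _ = fun u => ind s t u * f u + \1_[set s] u * f s).
    by apply: measurable_funD => //; apply: measurable_funM.
  apply/funext => u; rewrite /patch /ind indicE; case: ifPn.
    move=> /set_mem /=; rewrite in_itv /= => /andP[su ut].
    case: ltgtP su => // [su|<-] _; last by rewrite mem_set// mul1r mul0r add0r.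
    by rewrite ut memNset ?mul1r ?mul0r ?addr0// => e; rewrite e ltxx in su.
  rewrite notin_setE /= in_itv /= => h.
  rewrite memNset; last by move=> e; apply: h; rewrite e lexx.
  case: (boolP (s < u <= t)) => [/andP[h1 h2]|_]; last by rewrite !mul0r addr0.
  by exfalso; apply: h; rewrite (ltW h1).
- by apply/measurable_EFinP.
exists [set s]; split; [exact: measurable_set1|exact: lebesgue_measure_set1|].
move=> u /= h; apply: contrapT => us; apply: h => _; congr EFin; rewrite /patch /ind.
case: ifPn.
  move=> /set_mem /=; rewrite in_itv /= => /andP[su ->]; rewrite lt_neqAle su andbT andbT.
  by rewrite (introN eqP) ?mul1r// => e; apply: us.
rewrite notin_setE /= in_itv /= => h; case: (boolP (s < u <= t)); last by rewrite mul0r.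
by move=> /andP[h1 h2]; exfalso; apply: h; rewrite (ltW h1).
Qed.

Lemma predictable_measurable (G : R -> set (set Omega)) (k : nat)
  (Z : R -> Omega -> 'cV[R]_k) i :
  (forall s, s <= T -> G s `<=` measurable) -> 0 <= T -> predictable T G Z ->
  jointly_measurable T (fun u w => Z u w i 0).
Proof.
move=> sG T0 hZ _ B mB.
suff h : predictable_sets T G `<=` (measurable : set (set (Omega * measurableTypeR R)%type)).
  exact: (h _ (hZ i B mB)).
apply: smallest_sub.
  split; first exact: measurable0.
  - move=> D mD; apply: measurableD => //.
    by apply: measurableX => //; exact: measurable_itv.
  - by move=> F mF; exact: bigcup_measurable.
move=> C [[D GD ->]|[s [t [D [s0 st tT GD ->]]]]].
- by apply: measurableX; [exact: sG GD|exact: measurable_set1].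
- apply: measurableX; first by apply: sG GD; exact: le_trans (ltW st) tT.
  exact: measurable_itv.
Qed.

End iterated_integrals.

Section model.
Context {d : measure_display} {Omega : measurableType d} {R : realType}
  {N : nat}.
Variables (P : probability Omega R) (T c : R) (A : 'M[R]_N).
Variables (X : R -> Omega -> 'I_N) (W : R -> Omega -> R).
Hypotheses (Pcomp : measure_is_complete P) (T0 : 0 < T)
  (hA : rate_matrix c A) (hW : brownian_motion P T W)
  (hX : markov_chain P T A X) (hXW : independent_processes P T X W).

Local Notation leb := (@lebesgue_measure R).
Local Notation mu := (P \x lebesgue_measure)%E.
Local Notation piG0 := (piG0 P X W).
Implicit Types (zeta phi lam I J : Omega -> R) (s t a b r : R) (z : @proc R N Omega)
  (e : @item R N Omega) (L : seq (@item R N Omega)).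
Local Notation H s := <<s piG0 s >>.

(** At a fixed time [u], a jump exactly at [u] is a limit of changes between [u - 1/n] and [u], of
    probability at most [Ca / n], so it has probability 0. Fubini turns this into a statement about
    almost every pair. *)
Lemma left_ae : {ae mu, forall p, 0 < p.2 <= T -> left_state X p.2 p.1 = X p.2 p.1}.
Proof.
have [mX rcX lcX _] := hX.
pose f (p : Omega * R) : R := ind 0 T p.2 * (left_state X p.2 p.1 != X p.2 p.1)%:R.
have fE p : f p = ind 0 T p.2 -
   \sum_i \1_[set p : Omega * R | 0 < p.2 <= T /\ left_state X p.2 p.1 = i] p *
          (ind 0 T p.2 * dl i (X p.2 p.1)).
  rewrite (bigD1 (X p.2 p.1))//= big1 ?addr0 => [|i ip]; last first.
    by rewrite /dl eq_sym (negbTE ip) !mulr0.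
  rewrite /dl eqxx mulr1 indicE /f /ind; have [h|h] := boolP (0 < p.2 <= T); last first.
    by rewrite mul0r mulr0 subr0.
  have [e|e] /= := eqVneq (left_state X p.2 p.1) (X p.2 p.1).
    by rewrite mem_set// mulr0 mulr1 subrr.
  by rewrite memNset ?mul0r ?subr0 ?mulr1// => -[_ /eqP]; rewrite (negbTE e).
have mf : measurable_fun setT (f : Omega * measurableTypeR R -> R).
  rewrite (funext fE); apply: measurable_funB; first exact: measurable_strip_ind.
  apply: measurable_sum => i; apply: measurable_funM.
    by apply: measurable_indic; exact: (measurable_left_set (ltW T0) mX i lcX).
  by apply: (measurable_chain T0 hX (dl i)).
have f0 p : 0 <= f p by rewrite mulr_ge0// ?ind_ge0 ?ler0n.
have i1 : int1 mu f.
  apply: (int1_le _ (int1_strip 0 T (int1_cst P 1))) => //.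
  move=> p; rewrite ger0_norm// ler_wpM2l ?ind_ge0//.
  by rewrite -[1]/(1%:R) ler_nat; case: (_ != _).
have fu u : int1 P (fun w => f (w, u)).
  apply: (int1_le _ (int1_cst P 1)).
    by apply: (measurableT_comp (f := f)) => //; exact: pair2_measurable.
  move=> w; rewrite ger0_norm// /f /= -[leRHS](mulr1 1) ler_pM ?ind_ge0 ?ind_le1//.
  by rewrite -[1]/(1%:R) ler_nat; case: (_ != _).
have key u : Iv P (fun w => f (w, u)) = 0.
  have [h|h] := boolP (0 < u <= T); last first.
    by apply: etrans (Iv0 P); apply: Iv_eq => w; rewrite /f /ind /= (negbTE h) mul0r.
  have /andP[u0 uT] := h.
  pose un (n : nat) := Num.max 0 (u - n.+1%:R^-1).
  have un0 n : 0 <= un n by rewrite le_max lexx.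
  have unu n : un n <= u by rewrite ge_max (ltW u0) lerBlDr lerDl invr_ge0 ler0n.
  pose g n w : R := (X u w != X (un n) w)%:R.
  have gl n : Iv P (g n) <= Ca A * n.+1%:R^-1.
    have r1 : rv_in (H (un n)) (fun=> 1 : R) by exact: rv_in_cst.
    have := change_le Pcomp T0 hW hX hXW (un0 n) (unu n) uT r1 (int1_cst P 1) (fun=> ler01).
    rewrite Iv_cst mulr1 => h1; apply: le_trans (_ : Ca A * (u - un n) <= _).
      apply: le_trans h1; rewrite le_eqVlt; apply/orP; left; apply/eqP.
      by apply: Iv_eq => w; rewrite mul1r.
    apply: ler_wpM2l; first exact: Ca_ge0.
    by rewrite lerBlDr -lerBlDl le_max lexx orbT.
  have ig n : int1 P (g n).
    have := int1_change hX (un0 n) (unu n) uT (int1_cst P 1).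
    by apply: int1_eq => w; rewrite mul1r.
  have cv : Iv P (g n) @[n --> \oo] --> Iv P (fun w => f (w, u)).
    apply: (dct (g := fun=> 1)).
    - by move=> n; exact: int1_measurable (ig n).
    - exact: int1_measurable (fu u).
    - exact: int1_cst.
    - by move=> n w; rewrite ger0_norm ?ler0n// -[1]/(1%:R) ler_nat /g; case: (_ != _).
    - apply: aeW => w; apply: cvg_near_cst.
      have [i hi] := lcX w u h; have := hi => -[e /= e0 he]; have [m hm] := small_inv e0.
      have [m' hm'] := small_inv u0.
      exists (maxn m m') => // n /=; rewrite geq_max => /andP[mn mn'].
      rewrite /f /ind /= h mul1r (left_stateP u0 hi) /g.
      have eun : un n = u - n.+1%:R^-1.
        by apply/max_idPr; rewrite subr_ge0; exact: ltW (hm' n mn').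
      rewrite (_ : X (un n) w = i) 1?eq_sym// eun.
      apply: he => /=; last by rewrite ltrBlDr ltrDl invr_gt0.
      by rewrite opprB addrC subrK ger0_norm ?invr_ge0//; exact: hm.
  have cv0 : Ca A * n.+1%:R^-1 @[n --> \oo] --> (0 : R).
    by rewrite -(mulr0 (Ca A)); apply: cvgM; [exact: cvg_cst|exact: cvg_harmonic].
  apply/eqP; rewrite eq_le; apply/andP; split; last by apply: Iv_ge0.
  by apply: ler_cvg_to cv cv0 _; apply: nearW.
have : Iv mu f = 0.
  by rewrite (Iv_swap i1 fu) (Iv_eq leb key) Iv0.
move=> /(Iv_eq0_ae i1 f0); apply: filterS => p + h.
by rewrite /f /ind h mul1r; case: eqVneq => // _ /eqP; rewrite oner_eq0.
Qed.

End model.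

Section model.
Context {d : measure_display} {Omega : measurableType d} {R : realType}
  {N : nat}.
Variables (P : probability Omega R) (T c : R) (A : 'M[R]_N).
Variables (X : R -> Omega -> 'I_N) (W : R -> Omega -> R).
Hypotheses (Pcomp : measure_is_complete P) (T0 : 0 < T)
  (hA : rate_matrix c A) (hW : brownian_motion P T W)
  (hX : markov_chain P T A X) (hXW : independent_processes P T X W).

Local Notation leb := (@lebesgue_measure R).
Local Notation mu := (P \x lebesgue_measure)%E.
Local Notation G := (filtrationG P X W).
Local Notation piG0 := (piG0 P X W).
Local Notation dW := (dW W).
Implicit Types (zeta phi lam I J : Omega -> R) (s t a b r : R) (z : @proc R N Omega)
  (e : @item R N Omega) (L : seq (@item R N Omega)).
Local Notation dM := (dM A X).
Local Notation nrm := (pnorm T A X).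
Local Notation H s := <<s piG0 s >>.
Local Notation H2 := (H2 P T A X).
Local Notation SI := (SI P T A X W).
Local Notation allv := (allv P T X W).
Local Notation eltot := (eltot A X W).

(** Elementary integrals over ]t, T] replace the grid points by their maximum with [t]; this amounts
    to cutting the integrand at [t]. *)
Lemma max_ind t a b u : b <= T ->
  ind (Num.max t a) (Num.max t b) u = ind t T u * ind a b u.
Proof.
move=> bT; rewrite /ind gt_max le_max; case: (leP u t) => ut /=; last first.
  case: (boolP (a < u)) => //= _; last by rewrite mulr0.
  case: (leP u b) => ub; last by rewrite mulr0.
  by rewrite (le_trans ub bT) mul1r.
by rewrite mul0r.
Qed.

Lemma chain_martingaleE a b j w : 0 <= a -> a <= b -> b <= T ->
  (chain_martingale A X b w - chain_martingale A X a w) j 0 = dM (dl j) a b w.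
Proof.
move=> a0 ab bT; have b0 := le_trans a0 ab; have aT := le_trans ab bT.
have e r : 0 <= r -> r <= T ->
  (\int[leb]_(s in `[0, r]) (A *m unit_col (X s w)) j 0)%R = chain_int X (LA A (dl j)) 0 r w.
  move=> r0 rT.
  have E : (fun s => (A *m unit_col (X s w)) j 0) = fun s => LA A (dl j) (X s w).
    apply/funext => s; rewrite /LA !mxE; rewrite (bigD1 (X s w))//= big1 ?addr0 => [|k kx].
      rewrite (bigD1 j)//= big1 ?addr0 => [|k kj]; last by rewrite /dl (negbTE kj) mulr0.
      by rewrite /unit_col mxE /dl !eqxx.
    by rewrite /unit_col mxE (negbTE kx) mulr0.
  rewrite E Rintegral_ind//.
  exact: int1_measurable (int1_chain_path (ltW T0) (mXi hX) (chI_rc hX) (LA A (dl j)) w (lexx 0) rT).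
rewrite /chain_martingale /dM !mxE !e// /dl !eqxx !andbT.
rewrite (eq_sym (X b w)) (eq_sym (X a w)) (chI_cat T0 hX _ _ (lexx 0) a0 ab bT).
by rewrite /dl; ring.
Qed.

(** * Brownian and chain integrals as instances of the joint integral *)

Section one_integrator.
Variables (k : nat) (cv : 'cV[R]_k -> option 'I_N -> R)
  (S : R -> Omega -> 'cV[R]_k) (Q : 'I_N -> 'cV[R]_k -> R).
Hypotheses (cv_coord : forall o, (forall C, cv C o = 0) \/ exists j, forall C, cv C o = C j 0)
  (cvS : forall a b C w, 0 <= a -> a <= b -> b <= T ->
     (C^T *m (S b w - S a w)) 0 0 =
     cv C None * dW a b w + \sum_j cv C (Some j) * dM (dl j) a b w)
  (cvQ : forall i C, Q i C = cv C None * cv C None +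
     gam A (fun j => cv C (Some j)) (fun j => cv C (Some j)) i).
Implicit Types (Z : R -> Omega -> 'cV[R]_k) (V : @simple_integrand d Omega R k).

(** [cv] places the coordinates of an integrand among the joint ones, those of the other integrator
    being 0; one proof then serves both kinds of integral. *)
Definition zproc t Z : @proc R N Omega := fun o p => ind t T p.2 * cv (Z p.2 p.1) o.

Let cv0 o : cv 0 o = 0.
Proof. by case: (cv_coord o) => [->//|[j ->]]; rewrite mxE. Qed.

Let cvD C D o : cv (C + D) o = cv C o + cv D o.
Proof. by case: (cv_coord o) => [h|[j h]]; rewrite !h ?addr0// mxE. Qed.

Let cvB C D o : cv (C - D) o = cv C o - cv D o.
Proof. by case: (cv_coord o) => [h|[j h]]; rewrite !h ?subr0// !mxE. Qed.

Let cv_sum (U : Type) (r : seq U) (p : pred U) (F : U -> 'cV[R]_k) o :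
  cv (\sum_(i <- r | p i) F i) o = \sum_(i <- r | p i) cv (F i) o.
Proof. by apply: (big_morph (cv^~ o)) => [C D|]; rewrite ?cvD ?cv0. Qed.

Definition sitems t V : seq (@item R N Omega) :=
  map (fun i : 'I_(steps V) => Item (Num.max t (grid V i)) (Num.max t (grid V i.+1))
     (fun o w => cv (coef V i w) o)) (index_enum 'I_(steps V)).

Lemma ztot_sitems t V : admissible T G V -> ztot (sitems t V) = zproc t (simple_value V).
Proof.
move=> [g0 gT gm _ _]; apply/funext => o; apply/funext => p.
have gle n : (n <= steps V)%N -> grid V n <= T.
  move=> nH; apply: le_trans gT; move: nH; rewrite -(subnKC (leqnn n)).
  have : forall m n, (n + m <= steps V)%N -> grid V n <= grid V (n + m)%N.
    elim => [n'|m ih n']; first by rewrite addn0.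
    rewrite addnS => h; apply: le_trans (ih _ (ltnW h)) _; exact: gm.
  by move=> hh; rewrite subnn addn0 => nH; have := hh (steps V - n)%N n; rewrite subnKC//; apply.
rewrite /ztot big_map /zproc cv_sum [in RHS]big_mkcond mulr_sumr; apply: eq_bigr => i _.
rewrite /zit /= max_ind; last exact: gle.
by rewrite -mulrA /ind; case: ifP => _; rewrite ?mul1r ?mul0r ?mulr0.
Qed.

Lemma sitems_spec t V w : 0 <= t <= T -> admissible T G V ->
  allv t (sitems t V) /\ eltot (sitems t V) w = elementary_integral S V t w.
Proof.
move=> /andP[t0 tT] [g0 gT gm grv [K gK]].
have gle n m : (n + m <= steps V)%N -> grid V n <= grid V (n + m)%N.
  elim: m n => [n'|m ih n']; first by rewrite addn0.
  rewrite addnS => h; apply: le_trans (ih _ (ltnW h)) _; exact: gm.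
have glT n : (n <= steps V)%N -> grid V n <= T.
  by move=> nH; apply: le_trans gT; have := gle n (steps V - n)%N; rewrite subnKC//; apply.
have g0n n : (n <= steps V)%N -> 0 <= grid V n.
  by move=> nH; apply: le_trans g0 _; exact: (gle 0%N n).
have v (i : 'I_(steps V)) : [/\ 0 <= Num.max t (grid V i),
   Num.max t (grid V i) <= Num.max t (grid V i.+1) & Num.max t (grid V i.+1) <= T].
  split; first by rewrite le_max t0.
  - by rewrite ge_max !le_max lexx gm// orbT.
  - by rewrite ge_max tT glT.
split.
  rewrite /sitems; elim: (index_enum _) => //= i r ih; split => //.
  have [v1 v2 v3] := v i; split => //=; first by rewrite le_max lexx.
  have hj j : rv_in (H (Num.max t (grid V i))) (fun w => coef V i w j 0) /\
     int2 P (fun w => coef V i w j 0).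
    have h : rv_in (H (Num.max t (grid V i))) (fun w => coef V i w j 0).
      apply: rv_in_sub (grv i j (ltn_ord i)) => B GB.
      have hm : H (grid V i) `<=` H (Num.max t (grid V i)).
        by apply: H_mono; rewrite le_max lexx orbT.
      by apply: hm; exact: G_pi.
    split => //; apply: (int2_le _ (int2_cst P `|K|)).
      exact: (H_meas Pcomp hW hX (le_trans v2 v3)).
    by move=> w'; rewrite normr_id; apply: le_trans (gK i j w' (ltn_ord i)) (ler_norm _).
  move=> o; case: (cv_coord o) => [h|[j h]].
    have -> : (fun w => cv (coef V i w) o) = fun=> 0 by apply/funext => w'; rewrite h.
    by split; [exact: rv_in_cst|exact: int2_0].
  have -> : (fun w => cv (coef V i w) o) = fun w => coef V i w j 0.
    by apply/funext => w'; rewrite h.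
  exact: hj.
rewrite /eltot big_map /elementary_integral; apply: eq_bigr => i _.
by have [v1 v2 v3] := v i; rewrite cvS.
Qed.

(** The definition of the integrals uses the left limit of the chain, the isometry its current
    value. This is the left-limit form, cut to ]0, T] so as to be measurable everywhere; [Qz_ae]
    identifies the two. *)
Definition Qz z (p : Omega * R) : R := ind 0 T p.2 * (z None p * z None p +
  gam A (fun j => z (Some j) p) (fun j => z (Some j) p) (left_state X p.2 p.1)).

Lemma measurable_Qz z : mproc z -> measurable_fun setT (Qz z : Omega * measurableTypeR R -> R).
Proof.
have [mX rcX lcX _] := hX.
move=> mz; rewrite (_ : Qz z = fun p =>
  \sum_i \1_[set p : Omega * R | 0 < p.2 <= T /\ left_state X p.2 p.1 = i] p *
    (z None p * z None p + gam A (fun j => z (Some j) p) (fun j => z (Some j) p) i)).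
  apply: measurable_sum => i; apply: measurable_funM.
    by apply: measurable_indic; exact: (measurable_left_set (ltW T0) mX i lcX).
  apply: measurable_funD; first exact: measurable_funM.
  apply: measurable_sum => j; apply: measurable_funM; last exact: measurable_funB.
  by apply: measurable_funM => //; exact: measurable_funB.
apply/funext => p; rewrite (bigD1 (left_state X p.2 p.1))//= big1 ?addr0 => [|i ip].
  rewrite /Qz /ind indicE; case: (boolP (0 < p.2 <= T)) => h; first by rewrite mem_set.
  by rewrite memNset// => -[h']; rewrite h' in h.
by rewrite indicE memNset ?mul0r// => -[_ e]; rewrite e eqxx in ip.
Qed.

Lemma Qz_ae z : {ae mu, forall p, Qz z p = ind 0 T p.2 * nrm z p}.
Proof.
apply: ae_imp (left_ae Pcomp T0 hW hX hXW) => p h; rewrite /Qz /ind.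
case: (boolP (0 < p.2 <= T)) => [h'|_]; last by rewrite !mul0r.
have /andP[h1 h2] := h'.
by rewrite /pnorm /pinner h// XextE// h2 ltW.
Qed.

Lemma ind0 t u : 0 <= t -> ind t T u = ind 0 T u * ind t T u.
Proof. by move=> t0; rewrite mulrC -ind_sub. Qed.

Lemma nrm_zproc t Z p : 0 <= t -> ind 0 T p.2 * nrm (zproc t Z) p = nrm (zproc t Z) p.
Proof.
by move=> t0; rewrite /pnorm /pinner /zproc gamZ -!expr2 exprMn ind_idem -mulrDr mulrA -ind0.
Qed.

Lemma Qz_zproc t Z p : 0 <= t -> Qz (zproc t Z) p = ind t T p.2 * Q (left_state X p.2 p.1) (Z p.2 p.1).
Proof.
by move=> t0; rewrite /Qz /zproc gamZ cvQ (ind0 p.2 t0) -!expr2 exprMn -{1 2}ind0 // ind_idem -mulrDr mulrA -ind0.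
Qed.

Lemma Qz_ge0 z p : 0 <= Qz z p.
Proof. by rewrite mulr_ge0 ?ind_ge0// addr_ge0 ?(gam_ge0 hA)// -expr2 sqr_ge0. Qed.

Lemma mproc_zproc t Z : 0 <= t -> (forall j, jointly_measurable T (fun u w => Z u w j 0)) ->
  mproc (zproc t Z).
Proof.
move=> t0 mZ o; rewrite /zproc; case: (cv_coord o) => [h|[j h]].
  rewrite (_ : (fun p => _) = fun=> 0); first exact: measurable_cst.
  by apply/funext => p; rewrite h mulr0.
rewrite (_ : (fun p => _) = fun p => ind t T p.2 * Z p.2 p.1 j 0).
  exact: (measurable_strip_on t0 (lexx T) (mZ j)).
by apply/funext => p; rewrite h.
Qed.

Lemma iter_Qz t Z : 0 <= t -> mproc (zproc t Z) ->
  (\int[P]_w \int[leb]_(u in `]t, T]) (Q (left_state X u w) (Z u w))%:E =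
   \int[mu]_p (Qz (zproc t Z) p)%:E)%E.
Proof.
move=> t0 mz; have mQ := measurable_Qz mz.
have e p : \1_(`]t, T]%classic) p.2 * Q (left_state X p.2 p.1) (Z p.2 p.1) = Qz (zproc t Z) p.
  by rewrite -indE Qz_zproc.
rewrite (@iter_EFin _ _ _ P `]t, T]%classic (fun u w => Q (left_state X u w) (Z u w)))//.
- by apply: eq_integral => p _; rewrite e.
- by rewrite (funext e).
- by move=> p; rewrite e Qz_ge0.
Qed.

Lemma H2_zproc t Z : 0 <= t -> (forall j, jointly_measurable T (fun u w => Z u w j 0)) ->
  (\int[P]_w \int[leb]_(u in `[0%R, T]) (Q (left_state X u w) (Z u w))%:E < +oo)%E ->
  H2 (zproc t Z).
Proof.
move=> t0 mZ fZ.
have mz0 := mproc_zproc (lexx 0) mZ; have mz := mproc_zproc t0 mZ.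
split => //.
have i0 : int1 mu (Qz (zproc 0 Z)).
  apply: int1_fin; [exact: measurable_Qz|exact: Qz_ge0|].
  move: fZ; set J := (X in (X < _)%E); suff -> : J = (\int[mu]_p (Qz (zproc 0 Z) p)%:E)%E by [].
  rewrite -(iter_Qz (lexx 0) mz0) /J; apply/esym.
  apply: eq_integral => w _; apply: integral_itv_obnd_cbnd.
  apply/measurable_EFinP.
  have mw : measurable_fun setT (fun u => Qz (zproc 0 Z) (w, u)).
    by apply: (measurable_section w (measurable_Qz mz0)).
  apply: (eq_measurable_fun (fun u => Qz (zproc 0 Z) (w, u))); last exact: measurable_funS mw.
  move=> u /set_mem /=; rewrite in_itv /= => h.
  by rewrite Qz_zproc//= /ind h mul1r.
apply: (@int1_ae _ _ _ mu (Qz (zproc t Z))); first exact: (measurable_ipz T0 hX mz mz).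
  by apply: ae_imp (Qz_ae (zproc t Z)) => p ->; rewrite nrm_zproc.
apply: (@int1_le _ _ _ mu _ (Qz (zproc 0 Z)) _ i0); first exact: measurable_Qz.
move=> p; rewrite ger0_norm ?Qz_ge0// !Qz_zproc// (ind0 _ t0) -mulrA (mulrC (ind t T _)) mulrA.
rewrite -Qz_zproc// -[leRHS]mulr1 ler_wpM2l ?Qz_ge0//; exact: ind_le1.
Qed.

(** A single index of the defining sequence is good for both errors. That [I] is square-integrable
    follows from one index whose error is finite. *)
Lemma ito_SI t Z I : 0 <= t <= T ->
  (forall j, jointly_measurable T (fun u w => Z u w j 0)) ->
  (\int[P]_w \int[leb]_(u in `[0%R, T]) (Q (left_state X u w) (Z u w))%:E < +oo)%E ->
  ito_integral P T G S (fun u w => Q (left_state X u w)) t Z I ->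
  SI t I (zproc t Z).
Proof.
move=> tT mZ fZ [mI [V [adm hq hI]]]; have /andP[t0 tT'] := tT.
have hZ := H2_zproc t0 mZ fZ.
have vV n : allv t (sitems t (V n)).
  by have [] := sitems_spec point tT (adm n).
have eV n w : eltot (sitems t (V n)) w = elementary_integral S (V n) t w.
  by have [] := sitems_spec w tT (adm n).
have iV n := int2_eltot Pcomp T0 hW hX hXW (vV n).
have hV n := H2_ztot Pcomp T0 hA hW hX (vV n).
have small (u : nat -> \bar R) (eps : R) : 0 < eps -> u @ \oo --> 0%E ->
    \forall n \near \oo, (u n < eps%:E)%E.
  move=> e0 hu; have h : nbhs (0%E : \bar R) [set x | (x < eps%:E)%E].
    by apply: open_nbhs_nbhs; split; [exact: open_ereal_lt_ereal|rewrite /= lte_fin].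
  exact: (hu _ h).
have i1 n : (\int[P]_w ((elementary_integral S (V n) t w - I w) ^+ 2)%:E < +oo)%E ->
    int2 P (fun w => eltot (sitems t (V n)) w - I w).
  move=> h; have mB : measurable_fun setT (fun w => eltot (sitems t (V n)) w - I w).
    by apply: measurable_funB => //; exact: (iV n).1.
  split => //; apply: int1_fin; [exact: measurable_funX|by move=> w; exact: sqr_ge0|].
  by apply: le_lt_trans h; rewrite le_eqVlt; apply/orP; left; apply/eqP; apply: eq_integral => w _; rewrite eV.
have iI : int2 P I.
  have [n _ /(_ n (leqnn n)) hn] := small _ 1 ltr01 hI.
  have := int2B (iV n) (i1 n (lt_trans hn (ltry 1))).
  by apply: int2_eq => w; rewrite opprB addrC subrK.
split => // eps e0.
have [n _ /(_ n (leqnn n)) [hn1 hn2]] := filterI (small _ eps e0 hI) (small _ eps e0 hq).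
exists (sitems t (V n)); split => //.
- rewrite -lee_fin EFin_Iv; last exact: (i1 n (lt_trans hn1 (ltry _))).2.
  apply: le_trans (ltW hn1); rewrite le_eqVlt; apply/orP; left; apply/eqP.
  by apply: eq_integral => w _; rewrite eV.
- have hd := H2_lin T0 hA hX 1 (-1) (hV n) hZ.
  have ez : zlin 1 (-1) (ztot (sitems t (V n))) (zproc t Z) =
     zproc t (fun u w => simple_value (V n) u w - Z u w).
    rewrite ztot_sitems//; apply/funext => o; apply/funext => p.
    by rewrite /zlin /zproc cvB; ring.
  rewrite ez in hd *; rewrite -lee_fin EFin_Iv; last exact: hd.2.
  apply: le_trans (ltW hn2); rewrite iter_Qz//; last exact: hd.1.
  rewrite le_eqVlt; apply/orP; left; apply/eqP; apply: ae_eq_integral => //.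
  - by apply/measurable_EFinP; exact: int1_measurable hd.2.
  - by apply/measurable_EFinP; exact: (measurable_Qz hd.1).
  by apply: ae_imp (Qz_ae (zproc t (fun u w => simple_value (V n) u w - Z u w))) => p -> _; rewrite nrm_zproc.
Qed.

End one_integrator.

Definition cvW (C : 'cV[R]_1) (o : option 'I_N) : R := if o is None then C 0 0 else 0.
Definition cvX (C : 'cV[R]_N) (o : option 'I_N) : R := if o is Some j then C j 0 else 0.

Definition zof t (Z1 : R -> Omega -> R) (Z2 : R -> Omega -> 'cV[R]_N) : @proc R N Omega :=
  fun o p => ind t T p.2 * (if o is Some j then Z2 p.2 p.1 j 0 else Z1 p.2 p.1).

Lemma bsde_SI t Z1 Z2 I1 I2 : 0 <= t <= T -> adapted_L2 P T G Z1 -> predictable T G Z2 ->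
  (\int[P]_w \int[leb]_(u in `[0%R, T]) (sqnorm A (left_state X u w) (Z2 u w))%:E < +oo)%E ->
  brownian_integral P T X W t Z1 I1 -> chain_integral P T A X W t Z2 I2 ->
  SI t (fun w => I1 w + I2 w) (zof t Z1 Z2).
Proof.
move=> tT [_ m1 f1] pZ f2 b1 b2.
have h1 : SI t I1 (zproc cvW t (fun u w => (Z1 u w)%:M)).
  apply: (@ito_SI 1 cvW (fun u w => (W u w)%:M) (fun _ C => C 0 0 ^+ 2)) => //.
  - by case=> [j|]; [left|right; exists 0].
  - move=> a b C w _ _ _; rewrite /cvW big1 ?addr0 => [|j _]; last by rewrite mul0r.
    by rewrite !mxE big_ord1 !mxE eqxx !mulr1n.
  - move=> i C; rewrite /gam big1 ?addr0 ?expr2// => j _.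
    by rewrite subrr !mulr0.
  - move=> j; rewrite (_ : (fun u w => _) = Z1)//.
    by apply/funext => u; apply/funext => w; rewrite mxE (ord1 j) eqxx mulr1n.
  - apply: le_lt_trans f1; rewrite le_eqVlt; apply/orP; left; apply/eqP.
    by apply: eq_integral => w _; apply: eq_integral => u _; rewrite mxE eqxx mulr1n.
have h2 : SI t I2 (zproc cvX t Z2).
  apply: (@ito_SI N cvX (chain_martingale A X) (fun i C => sqnorm A i C)) => //.
  - by case=> [j|]; [right; exists j|left].
  - move=> a b C w a0 ab bT; rewrite mul0r add0r mxE; apply: eq_bigr => j _.
    by rewrite mxE chain_martingaleE.
  - by move=> i C; rewrite mulr0 add0r (sqnormE hA).
  - have sG s : s <= T -> G s `<=` measurable by move=> sT; exact: (G_sub Pcomp hW hX sT).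
    by move=> j; exact: (predictable_measurable j sG (ltW T0) pZ).
have := SI_add Pcomp T0 hA hW hX hXW h1 h2.
rewrite (_ : zlin _ _ _ _ = zof t Z1 Z2)//.
apply/funext => o; apply/funext => p; rewrite /zlin /zproc /zof /cvW /cvX.
by case: o => [j|]; rewrite ?mxE ?eqxx ?mulr1n; ring.
Qed.

End model.

(** * Linear backward equations and uniqueness *)

Section model.
Context {d : measure_display} {Omega : measurableType d} {R : realType}
  {N : nat}.
Variables (P : probability Omega R) (T c : R) (A : 'M[R]_N).
Variables (X : R -> Omega -> 'I_N) (W : R -> Omega -> R).
Hypotheses (Pcomp : measure_is_complete P) (T0 : 0 < T)
  (hA : rate_matrix c A) (hW : brownian_motion P T W)
  (hX : markov_chain P T A X) (hXW : independent_processes P T X W).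

Local Notation mu := (P \x lebesgue_measure)%E.
Local Notation piG0 := (piG0 P X W).
Implicit Types (zeta phi lam I J : Omega -> R) (s t a b r : R) (z : @proc R N Omega)
  (e : @item R N Omega) (L : seq (@item R N Omega)).
Local Notation nrm := (pnorm T A X).
Local Notation H s := <<s piG0 s >>.
Local Notation H2 := (H2 P T A X).
Local Notation SI := (SI P T A X W).

Lemma mu_ind s t : measurable_fun setT (fun p : Omega * measurableTypeR R => ind s t p.2).
Proof. exact: measurable_strip_ind. Qed.

Lemma mu_fst (f : Omega -> R) : measurable_fun setT f ->
  measurable_fun setT (fun p : Omega * measurableTypeR R => f p.1).
Proof. exact: measurable_strip_fst. Qed.

Lemma mu_indM s t (f : Omega * R -> R) : int1 mu f -> int1 mu (fun p => ind s t p.2 * f p).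
Proof. by move=> h; exact: (int1M_bounded (mu_ind s t) (fun p => norm_ind s t p.2) h). Qed.

Lemma mu_indM2 s t (f : Omega * R -> R) : int2 mu f -> int2 mu (fun p => ind s t p.2 * f p).
Proof. by move=> h; exact: (int2M_bounded (mu_ind s t) (fun p => norm_ind s t p.2) h). Qed.

Definition cutp s t z : @proc R N Omega := fun o p => ind s t p.2 * z o p.

Lemma nrm_cutp s t z p : nrm (cutp s t z) p = ind s t p.2 * nrm z p.
Proof. by rewrite /pnorm /pinner /cutp gamZ -!expr2 exprMn ind_idem mulrDr. Qed.

Lemma cutp_lin s t (k l : R) z z' : cutp s t (zlin k l z z') = zlin k l (cutp s t z) (cutp s t z').
Proof. by apply/funext => o; apply/funext => p; rewrite /cutp /zlin; ring. Qed.

Lemma cutp_cut s t s' t' z : s' <= s -> t <= t' -> cutp s t (cutp s' t' z) = cutp s t z.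
Proof.
by move=> ss tt; apply/funext => o; apply/funext => p; rewrite /cutp mulrA -ind_sub.
Qed.

Lemma H2_cutp s t z : H2 z -> H2 (cutp s t z).
Proof.
move=> [mz iz]; split.
  by move=> o; apply: measurable_funM => //; exact: mu_ind.
have := mu_indM s t iz.
by apply: int1_eq => p; rewrite nrm_cutp.
Qed.

Lemma cutp_cat s r t z : s <= r -> r <= t ->
  zlin 1 (-1) (cutp s t z) (cutp r t z) = cutp s r z.
Proof.
move=> sr rt; apply/funext => o; apply/funext => p.
by rewrite /zlin /cutp (ind_cat _ sr rt); ring.
Qed.

Lemma SI_cut s r t I J z : 0 <= s -> s <= r -> r <= t -> t <= T ->
  SI s I (cutp s t z) -> SI r J (cutp r t z) ->
  SI s (fun w => 1 * I w + -1 * J w) (cutp s r z).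
Proof.
move=> s0 sr rt tT h1 h2; rewrite -(cutp_cat z sr rt).
apply: (SI_lin Pcomp T0 hA hW hX hXW) => //; first exact: le_trans sr (le_trans rt tT).
exact: SI_mono s0 sr h2.
Qed.

Implicit Types (V : R -> Omega -> R) (g : Omega * R -> R).

Lemma int2_cut s t s' t' g : s' <= s -> t <= t' ->
  int2 mu (fun p => ind s' t' p.2 * g p) -> int2 mu (fun p => ind s t p.2 * g p).
Proof.
move=> ss tt h.
have := mu_indM2 s t h.
by apply: int2_eq => p; rewrite mulrA -ind_sub.
Qed.

(* [V] solves [V_s = V_r + \int_s^r g - \int_s^r z dS] between any two times of
   [[t0, t1]], where [S] is the pair made of [W] and the chain martingale. *)
Definition BE t0 t1 V g z : Prop :=
  [/\ (forall t, t0 <= t <= t1 -> rv_in (H t) (V t) /\ int2 P (V t)),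
      int2 mu (fun p => ind t0 t1 p.2 * g p), H2 (cutp t0 t1 z) &
      forall s r, t0 <= s -> s <= r -> r <= t1 -> exists I, SI s I (cutp s r z) /\
        {ae P, forall w, V s w = V r w + slice (fun p => ind s r p.2 * g p) w - I w}].

Lemma slice_int2' t0 t1 s r g : t0 <= s -> s <= r -> r <= t1 ->
  int2 mu (fun p => ind t0 t1 p.2 * g p) ->
  int2 P (slice (fun p => ind s r p.2 * g p)) /\
  Iv P (fun w => slice (fun p => ind s r p.2 * g p) w ^+ 2) <=
    (r - s) * Iv mu (fun p => ind s r p.2 * g p ^+ 2).
Proof.
move=> ts sr rt h; have := int2_cut ts rt h => h'.
have [h1 h2] := slice_int2 sr h'; split => //; apply: le_trans h2 _.
rewrite ler_wpM2l ?subr_ge0// le_eqVlt; apply/orP; left; apply/eqP.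
by apply: Iv_eq => p; rewrite exprMn ind_idem.
Qed.

Lemma slice_ae (f f' : Omega * R -> R) : int1 mu f -> measurable_fun setT (f' : Omega * measurableTypeR R -> R) ->
  {ae mu, forall p, f p = f' p} -> {ae P, forall w, slice f w = slice f' w}.
Proof.
move=> if_ mf' ff; have if' := int1_ae mf' ff if_.
have i0 : int1 mu (fun p => `|f p - f' p|) by exact: int1_norm (int1B if_ if').
have e0 : Iv P (slice (fun p => `|f p - f' p|)) = 0.
  rewrite slice_Iv// -(Iv0 mu); apply: Iv_ae => //; first exact: int1_measurable i0.
  by apply: ae_imp ff => p ->; rewrite subrr normr0.
have s0 w : 0 <= slice (fun p => `|f p - f' p|) w by apply: Iv_ge0 => u; exact: normr_ge0.
have h1 := Iv_eq0_ae (slice_int1 i0) s0 e0.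
apply: ae_imp2 h1 (filterI (int1_slice_ae if_) (int1_slice_ae if')) => w h [h2 h3].
apply/eqP; rewrite -subr_eq0 -normr_le0 -h /slice -IvB//.
exact: (Iv_norm (int1B h2 h3)).
Qed.

Lemma slice_lin (k l : R) (f f' : Omega * R -> R) : int1 mu f -> int1 mu f' ->
  {ae P, forall w, slice (fun p => k * f p + l * f' p) w = k * slice f w + l * slice f' w}.
Proof.
move=> h h'; apply: ae_imp2 (int1_slice_ae h) (int1_slice_ae h') => w iw iw'.
by rewrite /slice IvD ?IvZ//; exact: int1Z.
Qed.

Lemma BE_lin t0 t1 (k l : R) V g z V' g' z' : 0 <= t0 -> t1 <= T ->
  BE t0 t1 V g z -> BE t0 t1 V' g' z' ->
  BE t0 t1 (fun t w => k * V t w + l * V' t w) (fun p => k * g p + l * g' p) (zlin k l z z').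
Proof.
move=> t00 t1T [hV hg hz h] [hV' hg' hz' h']; split.
- move=> t tt; have [r1 i1] := hV t tt; have [r2 i2] := hV' t tt; split.
    by apply: rv_inD; exact: rv_inZ.
  by apply: int2D; exact: int2Z.
- have := int2D (int2Z k hg) (int2Z l hg').
  by apply: int2_eq => p; ring.
- by rewrite cutp_lin; exact: (H2_lin T0 hA hX).
move=> s r ts sr rt; have [I [SI1 e1]] := h s r ts sr rt; have [I' [SI2 e2]] := h' s r ts sr rt.
exists (fun w => k * I w + l * I' w); split.
  rewrite cutp_lin; apply: (SI_lin Pcomp T0 hA hW hX hXW) => //.
  exact: le_trans sr (le_trans rt t1T).
have j1 := int2_int1_strip (int2_cut ts rt hg); have j2 := int2_int1_strip (int2_cut ts rt hg').
apply: ae_imp2 (filterI e1 e2) (slice_lin k l j1 j2) => w [-> ->].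
have -> : (fun p => ind s r p.2 * (k * g p + l * g' p)) =
  fun p => k * (ind s r p.2 * g p) + l * (ind s r p.2 * g' p) by apply/funext => p; ring.
by move=> ->; ring.
Qed.

Lemma BE_scale t0 t1 lam (k : R) V g z : 0 <= t0 -> t1 <= T -> rv_in (H t0) lam ->
  (forall w, `|lam w| <= k) -> BE t0 t1 V g z ->
  BE t0 t1 (fun t w => lam w * V t w) (fun p => lam p.1 * g p) (zsc lam z).
Proof.
move=> t00 t1T hl lk [hV hg hz h].
(* For [t0 > t1] every clause is vacuous or about zero. In the other case [t0 <= T], from which
   [lam] is seen to be measurable. *)
have [tt|tt] := leP t0 t1; last first.
  split.
  - by move=> t /andP[a b]; have := lt_le_trans tt (le_trans a b); rewrite ltxx.
  - apply: int2_eq (int2_0 mu) => p; rewrite /ind (_ : _ < _ <= _ = false) ?mul0r//.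
    by apply/negP => /andP[a b]; have := lt_trans tt (lt_le_trans a b); rewrite ltxx.
  - rewrite (_ : cutp _ _ _ = fun _ _ => 0); first exact: proc0.
    apply/funext => o; apply/funext => p; rewrite /cutp /ind (_ : _ < _ <= _ = false) ?mul0r//.
    by apply/negP => /andP[a b]; have := lt_trans tt (lt_le_trans a b); rewrite ltxx.
  - move=> s r a b e; have := lt_le_trans tt (le_trans a (le_trans b e)).
    by rewrite ltxx.
have ml := H_meas Pcomp hW hX (le_trans tt t1T) hl.
have hls s : t0 <= s -> rv_in (H s) lam.
  by move=> ts; apply: rv_in_sub hl; exact: H_mono.
have mlp := mu_fst ml.
split.
- move=> t /[dup] tt' /andP[tt0 _]; have [r1 i1] := hV t tt'; split.
    by apply: rv_inM => //; exact: hls.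
  exact: (int2M_bounded ml lk i1).
- have := int2M_bounded mlp (fun p => lk p.1) hg.
  by apply: int2_eq => p; ring.
- rewrite (_ : cutp _ _ _ = zsc lam (cutp t0 t1 z)); first exact: (H2_zsc ml lk hz).
  by apply/funext => o; apply/funext => p; rewrite /cutp /zsc; ring.
move=> s r ts sr rt; have [I [SI1 e1]] := h s r ts sr rt.
have sT := le_trans sr (le_trans rt t1T).
exists (fun w => lam w * I w); split.
  have -> : cutp s r (zsc lam z) = zsc lam (cutp s r z).
    by apply/funext => o; apply/funext => p; rewrite /cutp /zsc; ring.
  exact: (SI_scale Pcomp T0 hA hW hX hXW sT (hls _ ts) lk SI1).
have j1 := int2_int1_strip (int2_cut ts rt hg).
apply: ae_imp2 e1 (int1_slice_ae j1) => w -> iw.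
rewrite (_ : slice (fun p => ind s r p.2 * (lam p.1 * g p)) w =
   lam w * slice (fun p => ind s r p.2 * g p) w); first by ring.
by rewrite /slice -IvZ//; apply: Iv_eq => u /=; ring.
Qed.

Lemma BE_restrict t0 t1 s r V g z : t0 <= s -> r <= t1 -> BE t0 t1 V g z -> BE s r V g z.
Proof.
move=> ts rt [hV hg hz h]; split.
- by move=> t /andP[a b]; apply: hV; rewrite (le_trans ts a) (le_trans b rt).
- exact: int2_cut hg.
- by rewrite -(cutp_cut z ts rt); exact: H2_cutp.
by move=> s' r' a b e; apply: h => //; [exact: le_trans a|exact: le_trans rt].
Qed.

Lemma Iv_sqr0_ae (f : Omega -> R) : int2 P f -> Iv P (fun w => f w ^+ 2) <= 0 ->
  {ae P, forall w, f w = 0}.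
Proof.
move=> hf h; have h0 : Iv P (fun w => f w ^+ 2) = 0.
  by apply/eqP; rewrite eq_le h Iv_ge0// => w; exact: sqr_ge0.
apply: ae_imp (Iv_eq0_ae hf.2 _ h0) => w; last exact: sqr_ge0.
by move=> /eqP; rewrite sqrf_eq0 => /eqP.
Qed.

(* E V_s^2 + E (\int z dS)^2 = E (\int g)^2 <= (r - s) K E (\int z dS)^2. *)
Lemma BE_unique_step t0 t1 V g z (K : R) s r : 0 <= t0 -> t1 <= T -> BE t0 t1 V g z ->
  {ae mu, forall p, t0 < p.2 <= t1 -> g p ^+ 2 <= K * nrm z p} ->
  t0 <= s -> s <= r -> r <= t1 -> (r - s) * K <= 1 ->
  {ae P, forall w, V r w = 0} -> {ae P, forall w, V s w = 0}.
Proof.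
move=> t00 t1T [hV hg hz h] hgz ts sr rt small V0.
have [I [SI1 e1]] := h s r ts sr rt; have [iI hzI _] := SI1.
have [rvs is_] := hV s (introT andP (conj ts (le_trans sr rt))).
have [jg hjg] := slice_int2' ts sr rt hg.
set gi := slice _ in e1 jg hjg.
have eq1 : {ae P, forall w, V s w + I w = gi w}.
  by apply: ae_imp2 V0 e1 => w -> ->; rewrite add0r subrK.
have eq2 : Iv P (fun w => (V s w + I w) ^+ 2) = Iv P (fun w => gi w ^+ 2).
  apply: Iv_ae; [exact: int1_measurable (int2D is_ iI).2|exact: int1_measurable jg.2|].
  by apply: ae_imp eq1 => w ->.
have sT := le_trans sr (le_trans rt t1T).
have eq3 : Iv P (fun w => (V s w + I w) ^+ 2) = Iv P (fun w => V s w ^+ 2) + Iv P (fun w => I w ^+ 2).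
  have := SI_orth Pcomp T0 hW hX hXW SI1 rvs is_ => o.
  have iVI := int2M is_ iI.
  transitivity (Iv P (fun w => V s w ^+ 2 + 2 * (V s w * I w) + I w ^+ 2)).
    by apply: Iv_eq => w; ring.
  rewrite IvD; [|by apply: int1D; [exact: is_.2|exact: int1Z]|exact: iI.2].
  rewrite IvD; [|exact: is_.2|exact: int1Z].
  by rewrite IvZ// o mulr0 addr0.
have eq4 : Iv mu (fun p => ind s r p.2 * g p ^+ 2) <= K * Iv P (fun w => I w ^+ 2).
  rewrite (SI_norm Pcomp T0 hA hW hX hXW SI1) -IvZ; last exact: hzI.2.
  have i1 := (int2_cut ts rt hg).2.
  have i2 : int1 mu (fun p => ind s r p.2 * g p ^+ 2).
    by apply: int1_eq i1 => p; rewrite exprMn ind_idem.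
  apply: Iv_le_ae i2 (int1Z _ hzI.2) _.
  apply: ae_imp hgz => p hp; rewrite nrm_cutp /ind.
  case: (boolP (s < p.2 <= r)) => [/andP[a b]|_]; last by rewrite !mul0r mulr0.
  by rewrite !mul1r; apply: hp; rewrite (le_lt_trans ts a) (le_trans b rt).
apply: Iv_sqr0_ae is_ _.
have I0 : 0 <= Iv P (fun w => I w ^+ 2) by apply: Iv_ge0 => w; exact: sqr_ge0.
have h1 : Iv P (fun w => gi w ^+ 2) <= Iv P (fun w => I w ^+ 2).
  apply: le_trans hjg _; apply: (@le_trans _ _ ((r - s) * (K * Iv P (fun w => I w ^+ 2)))).
    by rewrite ler_wpM2l ?subr_ge0.
  by rewrite mulrA -[leRHS]mul1r ler_wpM2r.
rewrite -eq2 eq3 in h1; lra.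
Qed.

(** Backward induction on a uniform grid; [n] exceeds [|K| (t1 - t0)], so each step satisfies the
    smallness condition. *)
Lemma BE_unique t0 t1 V g z (K : R) : 0 <= t0 -> t0 <= t1 -> t1 <= T -> BE t0 t1 V g z ->
  {ae mu, forall p, t0 < p.2 <= t1 -> g p ^+ 2 <= K * nrm z p} ->
  {ae P, forall w, V t1 w = 0} -> {ae P, forall w, V t0 w = 0}.
Proof.
move=> t00 tt t1T hB hg V1.
pose n := (Num.truncn (`|K| * (t1 - t0))).+1.
have n0 : (0 : R) < n%:R by rewrite ltr0n.
have hn : (t1 - t0) / n%:R * K <= 1.
  rewrite mulrAC ler_pdivrMr// mul1r; apply: (@le_trans _ _ (`|K| * (t1 - t0))).
    by rewrite mulrC ler_wpM2r ?subr_ge0// ler_norm.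
  by apply/ltW/Num.Theory.truncnS_gt.
pose u k : R := t1 - k%:R * ((t1 - t0) / n%:R).
have D0 : 0 <= (t1 - t0) / n%:R by rewrite divr_ge0// ?subr_ge0// ltW.
have uS k : u k = u k.+1 + (t1 - t0) / n%:R.
  by rewrite /u -natr1; ring.
have un : u n = t0 by rewrite /u mulrC divfK ?gt_eqF//; ring.
suff H0 k : (k <= n)%N -> t0 <= u k /\ {ae P, forall w, V (u k) w = 0}.
  by have [_] := H0 n (leqnn n); rewrite un.
elim: k => [_|k ih kn].
  by rewrite /u mul0r subr0.
have [a b] := ih (ltnW kn).
have tk : t0 <= u k.+1.
  rewrite /u lerBrDl -lerBrDr; apply: (@le_trans _ _ (n%:R * ((t1 - t0) / n%:R))).
    by apply: ler_wpM2r => //; rewrite ler_nat.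
  by rewrite mulrC divfK ?gt_eqF.
split => //; apply: (BE_unique_step t00 t1T hB hg tk _ _ _ b).
- by rewrite (uS k) lerDl.
- by rewrite /u gerBl mulr_ge0.
- by rewrite (uS k) addrAC subrr add0r.
Qed.

End model.

(** * Discrete densities *)

Section rate_bounds.
Context {R : realType} {N : nat}.
Variables (c : R) (A : 'M[R]_N).
Hypothesis hA : rate_matrix c A.
Implicit Types f g : 'I_N -> R.

Lemma col_le i : \sum_j `|A j i| <= Ca A.
Proof.
rewrite /Ca; apply: ler_sum => j _; rewrite (bigD1 i)//= lerDl.
by apply: sumr_ge0 => k _; exact: normr_ge0.
Qed.

Lemma gam_le f (k : R) i : (forall j, `|f j| <= k) -> gam A f f i <= 4 * k ^+ 2 * Ca A.
Proof.
move=> fk.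
apply: (@le_trans _ _ (4 * k ^+ 2 * \sum_j `|A j i|)); last first.
  by apply: ler_wpM2l (col_le i); rewrite mulr_ge0// sqr_ge0.
rewrite mulr_sumr; apply: ler_sum => j _.
apply: le_trans (ler_norm _) _; rewrite -mulrA normrM mulrC; apply: ler_wpM2r => //.
rewrite -expr2 normrX (_ : 4 * k ^+ 2 = (2 * k) ^+ 2); last by ring.
rewrite ler_pXn2r ?nnegrE//; last first.
  by rewrite mulr_ge0//; exact: le_trans (fk j).
by apply: le_trans (ler_normB _ _) _; have := fk j; have := fk i; lra.
Qed.

End rate_bounds.

Definition neg {R : realType} (x : R) : R := Num.max 0 (- x).

Lemma neg_ge0 {R : realType} (x : R) : 0 <= neg x.
Proof. by rewrite /neg le_max lexx. Qed.

(** A negative product has exactly one negative factor. This separates the sign already carried by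
    the density from that of the new factor. *)
Lemma neg_sqr_mul {R : realType} (x y : R) :
  neg (x * y) ^+ 2 <= (neg x * y) ^+ 2 + (x * neg y) ^+ 2.
Proof.
have n0 (z : R) : 0 <= z -> neg z = 0 by move=> z0; apply/max_idPl; rewrite oppr_le0.
have n1 (z : R) : z <= 0 -> neg z = - z by move=> z0; apply/max_idPr; rewrite oppr_ge0.
have sq (z : R) := sqr_ge0 z.
have [x0|/ltW x0] := leP 0 x; have [y0|/ltW y0] := leP 0 y.
- by rewrite (n0 (x * y)) ?mulr_ge0// expr0n; apply: addr_ge0.
- by rewrite (n1 (x * y)) ?mulr_ge0_le0// (n1 y)// !sqrrN mulrN sqrrN lerDr.
- by rewrite (n1 (x * y)) ?mulr_le0_ge0// (n1 x)// mulNr !sqrrN lerDl.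
- by rewrite (n0 (x * y)) ?mulr_le0// expr0n; apply: addr_ge0.
Qed.

Lemma pow_exp {R : realType} (C D : R) k : 0 <= C -> 0 <= D ->
  (1 + C * D) ^+ k <= expR (C * (k%:R * D)).
Proof.
move=> C0 D0; rewrite mulrCA expRM_natl; apply: lerXn2r; rewrite ?nnegrE ?expR_ge0 ?expR_ge1Dx//.
by rewrite addr_ge0// mulr_ge0.
Qed.

Section model.
Context {d : measure_display} {Omega : measurableType d} {R : realType}
  {N : nat}.
Variables (P : probability Omega R) (T c : R) (A : 'M[R]_N).
Variables (X : R -> Omega -> 'I_N) (W : R -> Omega -> R).
Hypotheses (Pcomp : measure_is_complete P) (T0 : 0 < T)
  (hA : rate_matrix c A) (hW : brownian_motion P T W)
  (hX : markov_chain P T A X) (hXW : independent_processes P T X W).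

Local Notation mu := (P \x lebesgue_measure)%E.
Local Notation HW := (history measurable W).
Local Notation hatG0 := (hatG0 P T X W).
Local Notation piG0 := (piG0 P X W).
Local Notation dW := (dW W).
Implicit Types (zeta phi lam I J : Omega -> R) (s t a b r : R) (z : @proc R N Omega)
  (e : @item R N Omega) (L : seq (@item R N Omega)).
Local Notation dM := (dM A X).
Local Notation Xe := (Xext T X).
Local Notation H s := <<s piG0 s >>.
Local Notation valid := (valid P T X W).
Local Notation el := (el A X W).

Lemma dM_sum f a b w : 0 <= a -> b <= T ->
  \sum_j f j * dM (dl j) a b w = dM f a b w.
Proof.
move=> a0 bT.
have main (r : seq 'I_N) : \sum_(j <- r) f j * dM (dl j) a b w =
    dM (fun i => \sum_(j <- r) f j * dl j i) a b w.
  elim: r => [|j r ih].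
    rewrite big_nil (_ : (fun i => _) = fun i => 0 * f i + 0 * f i); last first.
      by apply/funext => i; rewrite big_nil; ring.
    by rewrite (dM_lin T0 hX)// !mul0r addr0.
  rewrite big_cons ih (_ : (fun i => \sum_(j <- j :: r) _) =
    fun i => f j * dl j i + 1 * \sum_(j <- r) f j * dl j i).
    by rewrite (dM_lin T0 hX)// mul1r.
  by apply/funext => i; rewrite big_cons mul1r.
by rewrite main; congr (dM _ a b w); apply/funext => i; rewrite -f_dl.
Qed.

Section density.
Variables (s D K : R) (n : nat) (al : nat -> Omega -> R) (cc : nat -> 'I_N -> Omega -> R)
  (B : set Omega).
Definition tk k : R := s + k%:R * D.
Hypotheses (s0 : 0 <= s) (D0 : 0 < D) (nT : tk n <= T) (K1 : 1 <= K)
  (al_rv : forall k, (k < n)%N -> rv_in (H (tk k)) (al k))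
  (al_le : forall k w, `|al k w| <= K)
  (cc_rv : forall k j, (k < n)%N -> rv_in (H (tk k)) (cc k j))
  (cc_le : forall k j w, `|cc k j w| <= K)
  (cc_X : forall k w, cc k (X (tk k) w) w = 0)
  (B_H : H s B).

Let D0' : 0 <= D := ltW D0.

Lemma tkS k : tk k.+1 = tk k + D.
Proof. by rewrite /tk -natr1; ring. Qed.

Lemma tk_mono k l : (k <= l)%N -> tk k <= tk l.
Proof. by move=> kl; rewrite lerD2l ler_wpM2r// ler_nat. Qed.

Lemma tk_s k : s <= tk k.
Proof. by rewrite lerDl mulr_ge0. Qed.

Lemma tk_ge0 k : 0 <= tk k.
Proof. exact: le_trans (tk_s k). Qed.

Lemma tkT k : (k <= n)%N -> tk k <= T.
Proof. by move=> kn; exact: le_trans (tk_mono kn) nT. Qed.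

Lemma tk_le k : tk k <= tk k.+1.
Proof. exact: tk_mono. Qed.

Definition de k : @item R N Omega :=
  Item (tk k) (tk k.+1) (fun o w => if o is Some j then cc k j w else al k w).

(** A discrete stochastic exponential started from the indicator of [B], the counterpart on the grid
    of a change-of-measure density. *)
Fixpoint Gam k w : R := if k is k'.+1 then Gam k' w * (1 + el (de k') w) else \1_B w.

Lemma valid_de k phi : (k < n)%N -> rv_in (H (tk k)) phi -> int2 P phi ->
  valid (tk k) (sc phi (de k)).
Proof.
move=> kn hp ip; have kT := tkT (ltnW kn); split => //=; [exact: tk_ge0|exact: tk_le|exact: tkT|].
have bd (f : Omega -> R) : rv_in (H (tk k)) f -> (forall w, `|f w| <= K) ->
    rv_in (H (tk k)) (fun w => phi w * f w) /\ int2 P (fun w => phi w * f w).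
  move=> hf fK; split; first exact: rv_inM.
  have mf := H_meas Pcomp hW hX kT hf.
  by apply: int2_eq (int2M_bounded mf fK ip) => w; rewrite mulrC.
by case=> [j|]; apply: bd => //; [exact: cc_rv|exact: al_rv].
Qed.

(** [C1] bounds the bracket of the pair ([al], [cc]) per unit of time, [C2] the compensator of its
    jump part. *)
Definition C1 : R := K ^+ 2 + 4 * K ^+ 2 * Ca A.
Definition C2 : R := Ca A * K.

Let K0 : 0 <= K. Proof. by apply: le_trans K1. Qed.

Lemma C1_ge0 : 0 <= C1.
Proof. by rewrite /C1 addr_ge0 ?sqr_ge0// !mulr_ge0// ?Ca_ge0. Qed.

Lemma C2_ge0 : 0 <= C2.
Proof. by rewrite /C2 mulr_ge0// ?Ca_ge0. Qed.

Lemma el_norm_le k phi : (k < n)%N -> rv_in (H (tk k)) phi -> int2 P phi ->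
  Iv P (fun w => el (sc phi (de k)) w ^+ 2) <= C1 * D * Iv P (fun w => phi w ^+ 2).
Proof.
move=> kn hp ip; have v := valid_de kn hp ip.
rewrite (Iv_eq P (fun w => expr2 _)) (isometry_item Pcomp T0 hA hW hX hXW v v).
have i2 := int1Z C1 (int1_strip (tk k) (tk k.+1) ip.2).
apply: (@le_trans _ _ (Iv mu (fun p => C1 * (ind (tk k) (tk k.+1) p.2 * phi p.1 ^+ 2)))).
  apply: Iv_le i2 _; first exact: (H2_zit Pcomp T0 hW hX v).2.
  move=> p; rewrite /pinner /zit /= !gamZ -!expr2 !exprMn !ind_idem.
  have -> : ind (tk k) (tk k.+1) p.2 * (phi p.1 ^+ 2 * al k p.1 ^+ 2) +
    ind (tk k) (tk k.+1) p.2 * (phi p.1 ^+ 2 * gam A (cc k ^~ p.1) (cc k ^~ p.1) (Xe p)) =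
    (al k p.1 ^+ 2 + gam A (cc k ^~ p.1) (cc k ^~ p.1) (Xe p)) * (ind (tk k) (tk k.+1) p.2 * phi p.1 ^+ 2) by ring.
  apply: ler_wpM2r; first by rewrite mulr_ge0 ?ind_ge0 ?sqr_ge0.
  apply: lerD; last exact: gam_le.
  by rewrite -[al k p.1 ^+ 2]ger0_norm ?sqr_ge0// normrX ler_pXn2r ?nnegrE.
rewrite IvZ; last exact: (int1_strip _ _ ip.2).
rewrite (Iv_strip (tk_le k) ip.2).
by rewrite tkS addrAC subrr add0r mulrA.
Qed.

(** The increment is centred given the information at [tk k], so the cross term vanishes and second
    moments grow at most geometrically. *)
Lemma step2 k phi : (k < n)%N -> rv_in (H (tk k)) phi -> int2 P phi ->
  [/\ rv_in (H (tk k.+1)) (fun w => phi w * (1 + el (de k) w)),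
      int2 P (fun w => phi w * (1 + el (de k) w)) &
      Iv P (fun w => (phi w * (1 + el (de k) w)) ^+ 2) <=
      (1 + C1 * D) * Iv P (fun w => phi w ^+ 2)].
Proof.
move=> kn hp ip; have v := valid_de kn hp ip.
have e w : phi w * (1 + el (de k) w) = phi w + el (sc phi (de k)) w.
  by rewrite el_sc [LHS]mulrDr mulr1.
have ie := int2_el Pcomp T0 hW hX hXW v.
rewrite (funext e); split.
- apply: rv_inD; last exact: (rv_el hX v).
  by apply: rv_in_sub hp; apply: H_mono; exact: tk_le.
- exact: int2D.
have i1 := int2M ip ie.
have -> : Iv P (fun w => (phi w * (1 + el (de k) w)) ^+ 2) =
   Iv P (fun w => phi w ^+ 2 + 2 * (phi w * el (sc phi (de k)) w) + el (sc phi (de k)) w ^+ 2).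
  by apply: Iv_eq => w; rewrite e; ring.
rewrite IvD; [|by apply: int1D; [exact: ip.2|exact: int1Z]|exact: ie.2].
rewrite IvD; [|exact: ip.2|exact: int1Z].
rewrite IvZ// (E_el Pcomp T0 hW hX hXW v)// mulr0 addr0 mulrDl mul1r lerD2l.
exact: el_norm_le.
Qed.

Lemma Gam_spec k : (k <= n)%N -> [/\ rv_in (H (tk k)) (Gam k), int2 P (Gam k) &
  Iv P (fun w => Gam k w ^+ 2) <= (1 + C1 * D) ^+ k].
Proof.
elim: k => [_|k ih kn].
  have hB : rv_in (H (tk 0)) (\1_B : Omega -> R).
    by rewrite /tk mul0r addr0; exact: rv_in_indic.
  have iB : int2 P (\1_B : Omega -> R).
    apply: (int2_le _ (int2_cst P 1)); first exact: (H_meas Pcomp hW hX (tkT (leq0n n)) hB).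
    by move=> w; rewrite indicE normr1; case: (_ \in _); rewrite ?normr0 ?normr1.
  split => //; rewrite expr0 -[leRHS](Iv_cst P 1); apply: Iv_le; [exact: iB.2|exact: int1_cst|].
  by move=> w /=; rewrite indicE; case: (_ \in _); rewrite ?expr1n ?expr0n.
have [h1 h2 h3] := ih (ltnW kn); have [g1 g2 g3] := step2 kn h1 h2; split => //.
rewrite exprS; apply: le_trans g3 _; apply: ler_wpM2l h3.
by rewrite addr_ge0// mulr_ge0// C1_ge0.
Qed.

Lemma Gam_bound k : (k <= n)%N -> Iv P (fun w => Gam k w ^+ 2) <= expR (C1 * T).
Proof.
move=> kn; have [_ _ h] := Gam_spec kn; apply: le_trans h _.
apply: le_trans (pow_exp k C1_ge0 D0') _; rewrite ler_expR ler_wpM2l ?C1_ge0//.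
by apply: le_trans (tkT kn); rewrite /tk lerDr.
Qed.

(** As [cc] vanishes at the state occupied at the left end, the chain part reduces to the
    coefficient of the state found at the right end, minus a compensator [r]. *)
Lemma el_de k w : (k < n)%N -> exists r : R, `|r| <= C2 * D /\
  el (de k) w = al k w * dW (tk k) (tk k.+1) w + cc k (X (tk k.+1) w) w - r.
Proof.
move=> kn; exists (chain_int X (LA A (cc k ^~ w)) (tk k) (tk k.+1) w); split.
  have := chI_le T0 hX w (tk_ge0 k) (tk_le k) (tkT kn) (fun i => LA_le A i (cc_le k ^~ w)).
  by rewrite {2}tkS [tk k + D - _]addrAC subrr add0r.
rewrite /el /= dM_sum; [|exact: tk_ge0|exact: tkT].
by rewrite /dM cc_X subr0 addrA.
Qed.

Variable m : R.
Hypotheses (m1 : 1 <= m) (cc_lo : forall k j w, -1 + m^-1 <= cc k j w)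
  (D_small : C2 * D <= (4 * m)^-1).

Let m0 : 0 < m. Proof. exact: lt_le_trans m1. Qed.

Let i4m : (4 * m)^-1 = m^-1 / 4. Proof. by rewrite invfM mulrC. Qed.

(** The factor 4 of [eta_neg] times the 64 of the Gaussian fourth moment. *)
Definition Cm : R := 256 * m ^+ 2 * K ^+ 4.

Lemma Cm_ge0 : 0 <= Cm.
Proof. by apply: mulr_ge0; [rewrite mulr_ge0 ?sqr_ge0|exact: exprn_ge0]. Qed.

(** Apart from the Brownian term the factor is at least [1 / (2 m)]. It is negative only if
    [v = K |dW|] exceeds this value, and then its negative part is at most [v <= 2 m v^2]. *)
Lemma eta_neg k w : (k < n)%N ->
  neg (1 + el (de k) w) ^+ 2 <= 4 * m ^+ 2 * K ^+ 4 * dW (tk k) (tk k.+1) w ^+ 4.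
Proof.
move=> kn; have [r [hr ->]] := el_de w kn.
have hcc := cc_lo k (X (tk k.+1) w) w; set cx := cc k _ w in hcc *.
set x := dW _ _ w; have aK := al_le k w; set a := al k w in aK *.
pose v := K * `|x|.
have ax : `|a * x| <= v by rewrite normrM ler_wpM2r.
have v0 : 0 <= v by rewrite mulr_ge0.
have i0 : 0 < m^-1 by rewrite invr_gt0.
have lo : m^-1 / 2 - v <= 1 + (a * x + cx - r).
  move: hr D_small ax; rewrite i4m !ler_norml => /andP[_ hr] hD /andP[ax _]; lra.
have -> : 4 * m ^+ 2 * K ^+ 4 * x ^+ 4 = (v * (2 * m * v)) ^+ 2.
  rewrite /v -[x ^+ 4](_ : `|x| ^+ 4 = _); first by ring.
  by rewrite -normrX ger0_norm// (_ : x ^+ 4 = (x ^+ 2) ^+ 2) ?sqr_ge0//; ring.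
rewrite ler_pXn2r ?nnegrE ?neg_ge0//; last by rewrite !mulr_ge0// ltW.
have [h|h] := leP (m^-1 / 2) v.
  apply: (@le_trans _ _ v).
    rewrite /neg ge_max v0 /=; lra.
  have mm : m * m^-1 = 1 by rewrite mulfV ?gt_eqF.
  have h2 : m * (m^-1 / 2) <= m * v by rewrite ler_pM2l.
  rewrite mulrA mm in h2.
  rewrite -[leLHS]mulr1 ler_wpM2l// -mulrA; lra.
rewrite /neg (max_idPl _); last by lra.
by rewrite !mulr_ge0// ltW.
Qed.

Lemma measurable_neg : measurable_fun setT (@neg R).
Proof. by apply: measurable_maxr => //; exact: measurable_oppr. Qed.

(** By [neg_sqr_mul] a step carries over the old negative part, enlarged by [1 + C1 D] in mean
    square, and adds a fourth Brownian moment of order [D^2]. Over the whole grid this sums to order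
    [D]. *)
Lemma Gam_neg k : (k <= n)%N -> int2 P (fun w => neg (Gam k w)) /\
  Iv P (fun w => neg (Gam k w) ^+ 2) <= k%:R * (Cm * D ^+ 2) * (1 + C1 * D) ^+ k.
Proof.
have neg_int2 l : (l <= n)%N -> rv_in (H (tk l)) (fun w => neg (Gam l w)) /\ int2 P (fun w => neg (Gam l w)).
  move=> ln; have [h1 h2 _] := Gam_spec ln.
  have h3 : rv_in (H (tk l)) (fun w => neg (Gam l w)) by exact: (rv_in_comp measurable_neg h1).
  split => //; apply: int2_le h2 _; first exact: (H_meas Pcomp hW hX (tkT ln) h3).
  move=> w; rewrite ger0_norm ?neg_ge0// /neg ge_max normr_ge0 -normrN ler_norm//.
move=> kn; split; first by have [] := neg_int2 k kn.
elim: k kn => [_|k ih kn].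
  rewrite !mul0r (_ : Iv P _ = 0)//; apply: etrans (Iv0 P); apply: Iv_eq => w /=.
  by rewrite /neg (max_idPl _) ?expr0n// oppr_le0 indicE ler0n.
have [r1 j1] := neg_int2 k (ltnW kn); have [r2 j2] := neg_int2 k.+1 kn.
have [g1 g2 g3] := Gam_spec (ltnW kn).
have [_ s2 s3] := step2 kn r1 j1.
have hk := tk_le k; have h0 := tk_ge0 k; have hT := tkT kn.
have rG : rv_in <<s hatG0 (tk k) >> (fun w => Gam k w ^+ 2).
  have : rv_in (H (tk k)) (fun w => Gam k w ^+ 2) by exact: (rv_inM g1 g1).
  by apply: rv_in_sub; apply: pi_hat; exact: le_trans hT.
have [_ _ i4 e4] := dW_moments Pcomp hW hX hXW h0 hk hT rG g2.2.
have e4' := e4 (Iv_ge0 P (fun w => sqr_ge0 (Gam k w))).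
rewrite tkS [tk k + D - _]addrAC subrr add0r -tkS in e4'.
have kk : 0 <= 4 * m ^+ 2 * K ^+ 4 by apply: mulr_ge0; [rewrite mulr_ge0 ?sqr_ge0|exact: exprn_ge0].
apply: (@le_trans _ _ (Iv P (fun w => (neg (Gam k w) * (1 + el (de k) w)) ^+ 2 +
   4 * m ^+ 2 * K ^+ 4 * (Gam k w ^+ 2 * dW (tk k) (tk k.+1) w ^+ 4)))).
  apply: Iv_le; [exact: j2.2|by apply: int1D; [exact: s2.2|exact: int1Z]|].
  move=> w; apply: le_trans (neg_sqr_mul _ _) _; rewrite lerD2l exprMn [leRHS]mulrCA.
  by apply: ler_wpM2l; [exact: sqr_ge0|exact: eta_neg].
rewrite IvD; [|exact: s2.2|exact: int1Z].
rewrite IvZ//.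
pose q := (1 + C1 * D) ^+ k.
have q1 : 1 <= 1 + C1 * D by rewrite lerDl mulr_ge0// C1_ge0.
have q0 : 0 <= q by rewrite exprn_ge0// (le_trans ler01).
have a1 : Iv P (fun w => (neg (Gam k w) * (1 + el (de k) w)) ^+ 2) <=
   (1 + C1 * D) * (k%:R * (Cm * D ^+ 2) * q).
  by apply: le_trans s3 _; apply: ler_wpM2l; [exact: le_trans ler01 q1|exact: ih (ltnW kn)].
have a2 : 4 * m ^+ 2 * K ^+ 4 * Iv P (fun w => Gam k w ^+ 2 * dW (tk k) (tk k.+1) w ^+ 4) <=
   (Cm * D ^+ 2) * ((1 + C1 * D) * q).
  apply: (@le_trans _ _ (4 * m ^+ 2 * K ^+ 4 * (64 * D ^+ 2 * q))).
    apply: ler_wpM2l => //; apply: le_trans e4' _.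
    by apply: ler_wpM2l => //; rewrite mulr_ge0// sqr_ge0.
  rewrite (_ : 4 * m ^+ 2 * K ^+ 4 * (64 * D ^+ 2 * q) = (Cm * D ^+ 2) * q); last by rewrite /Cm; ring.
  apply: ler_wpM2l; first by rewrite mulr_ge0 ?Cm_ge0 ?sqr_ge0.
  by rewrite -[leLHS]mul1r ler_wpM2r.
rewrite -[k.+1%:R]natr1 [_ ^+ k.+1]exprS -/q; move: a1 a2; set Q := (1 + C1 * D) * q.
rewrite (_ : (1 + C1 * D) * (k%:R * (Cm * D ^+ 2) * q) = k%:R * (Cm * D ^+ 2) * Q); last by rewrite /Q; ring.
rewrite (_ : (k%:R + 1) * (Cm * D ^+ 2) * Q = k%:R * (Cm * D ^+ 2) * Q + Cm * D ^+ 2 * Q); last by ring.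
lra.
Qed.

Lemma Gam_neg_bound k : (k <= n)%N ->
  Iv P (fun w => neg (Gam k w) ^+ 2) <= T * Cm * expR (C1 * T) * D.
Proof.
move=> kn; have [_ h] := Gam_neg kn; apply: le_trans h _.
have kT : k%:R * D <= T by apply: le_trans (tkT kn); rewrite /tk lerDr.
rewrite (_ : k%:R * (Cm * D ^+ 2) * _ = (k%:R * D) * (1 + C1 * D) ^+ k * (Cm * D)); last by ring.
rewrite (_ : T * Cm * expR (C1 * T) * D = T * expR (C1 * T) * (Cm * D)); last by ring.
apply: ler_wpM2r; first by rewrite mulr_ge0 ?Cm_ge0.
apply: ler_pM => //; [by rewrite mulr_ge0|by rewrite exprn_ge0// addr_ge0// mulr_ge0// C1_ge0|].
apply: le_trans (pow_exp k C1_ge0 D0') _; rewrite ler_expR ler_wpM2l ?C1_ge0//.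
Qed.

(** Counts cells with different end states rather than jumps: by [el_de], the factor of a cell sees
    only its end state, up to the compensator. *)
Fixpoint Sc k w : nat := if k is k'.+1 then (Sc k' w + (X (tk k'.+1) w != X (tk k') w))%N else 0%N.

Definition xk k w : R := al k w * dW (tk k) (tk k.+1) w - C2 * D.

(** A substitute for the inverse of [Gam] on cells without change of state: [(1 + v)(1 - v + 2 v^2)
    = 1 + v^2 (1 + 2 v) >= 1] for [v >= -1/2]. Being polynomial in the Brownian increment, it has a
    computable mean. *)
Fixpoint Yp k w : R :=
  if k is k'.+1 then Yp k' w * (1 - xk k' w + 2 * xk k' w ^+ 2) else 1.

(** The minimum 7/8 is attained at [x = 1/4]. *)
Let y_ge (x : R) : 7 / 8 <= 1 - x + 2 * x ^+ 2.
Proof. by have := sqr_ge0 (x - 1 / 4); rewrite sqrrB; lra. Qed.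

Lemma Yp_gt0 k w : 0 < Yp k w.
Proof.
elim: k => [|k ih] //=; rewrite mulr_gt0//.
by apply: lt_le_trans (y_ge _); lra.
Qed.

(** A cell without change contributes a factor at least 1 to [Gam * Yp]; a cell with a change
    contributes at least [(1 / (2 m)) (7 / 8)], hence [1 / (4 m)]. *)
Lemma Gam_low k w : (k <= n)%N -> B w ->
  (forall j, (j < k)%N -> K * `|dW (tk j) (tk j.+1) w| <= (4 * m)^-1) ->
  (4 * m)^-1 ^+ Sc k w <= Gam k w * Yp k w.
Proof.
move=> + Bw; elim: k => [_ _|k ih kn hx] /=.
  by rewrite expr0 indicE mem_set// mulr1.
have ih' := ih (ltnW kn) (fun j jk => hx j (leq_trans jk (leqnSn k))).
have [r [hr ->]] := el_de w kn.
have hk := hx k (ltnSn k); set x := dW _ _ w in hk *.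
have ax : `|al k w * x| <= (4 * m)^-1.
  by apply: le_trans hk; rewrite normrM ler_wpM2r.
have i0 : 0 < m^-1 by rewrite invr_gt0.
have i1 : m^-1 <= 1 by rewrite invf_le1.
set y := 1 - xk k w + _; have y78 : 7 / 8 <= y by exact: y_ge.
set e := 1 + _.
rewrite (_ : Gam k w * e * (Yp k w * y) = (Gam k w * Yp k w) * (e * y)); last by ring.
rewrite exprD; apply: ler_pM => //.
- by rewrite exprn_ge0// invr_ge0 mulr_ge0// ltW.
- by rewrite exprn_ge0// invr_ge0 mulr_ge0// ltW.
move: ax hr D_small; rewrite i4m !ler_norml => /andP[ax1 ax2] /andP[hr1 hr2] hD.
have CD : 0 <= C2 * D by rewrite mulr_ge0// C2_ge0.
have [eX|nX] /= := eqVneq (X (tk k.+1) w) (X (tk k) w).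
  rewrite expr0; set v := xk k w; have ev : v = al k w * x - C2 * D by [].
  have elo : 1 + v <= e by rewrite /e eX cc_X ev; lra.
  have yv : y = 1 - v + 2 * v ^+ 2 by [].
  have y0 : 0 <= y by lra.
  apply: le_trans (ler_wpM2r y0 elo); rewrite yv.
  have h1 : 0 <= v ^+ 2 * (1 + 2 * v) by rewrite mulr_ge0 ?sqr_ge0// ev; lra.
  move: h1; rewrite (_ : (1 + v) * (1 - v + 2 * v ^+ 2) = 1 + v ^+ 2 * (1 + 2 * v)); last by ring.
  lra.
rewrite expr1; have elo : m^-1 / 2 <= e by have := cc_lo k (X (tk k.+1) w) w; rewrite /e; lra.
apply: (@le_trans _ _ (m^-1 / 2 * (7 / 8))); first by lra.
by apply: ler_pM => //; lra.
Qed.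

Definition C3 : R := C2 + 2 * C2 ^+ 2 * T + 2 * K ^+ 2.

Lemma C3_ge0 : 0 <= C3.
Proof.
have h : 0 <= 2 * C2 ^+ 2 by rewrite mulr_ge0 ?sqr_ge0.
have h' : 0 <= 2 * K ^+ 2 by rewrite mulr_ge0 ?sqr_ge0.
by rewrite /C3 addr_ge0// addr_ge0 ?C2_ge0// mulr_ge0// ltW.
Qed.

(** Given the past, the new factor has mean [1 + C2 D + 2 C2^2 D^2 + 2 al^2 D]; with [D <= T] this
    is at most [1 + C3 D]. *)
Lemma Yp_spec k : (k <= n)%N -> [/\ rv_in (H (tk k)) (Yp k), int1 P (Yp k) &
  Iv P (Yp k) <= (1 + C3 * D) ^+ k].
Proof.
elim: k => [_|k ih kn].
  split; [exact: rv_in_cst|exact: int1_cst|].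
  by rewrite expr0 -[leRHS](Iv_cst P 1); apply: Iv_le; [exact: int1_cst|exact: int1_cst|].
have [h1 h2 h3] := ih (ltnW kn).
have hk := tk_le k; have h0 := tk_ge0 k; have hT := tkT kn; have kT := tkT (ltnW kn).
have up (f : Omega -> R) : rv_in (H (tk k)) f -> rv_in (H (tk k.+1)) f.
  by apply: rv_in_sub; exact: H_mono.
have hat (f : Omega -> R) : rv_in (H (tk k)) f -> rv_in <<s hatG0 (tk k) >> f.
  by apply: rv_in_sub; exact: pi_hat.
have ral := al_rv kn; have mal := H_meas Pcomp hW hX kT ral.
have rW : rv_in (H (tk k.+1)) (dW (tk k) (tk k.+1)).
  apply: (@rv_in_sub _ _ _ (HW (tk k.+1))).
    by move=> E hE; apply: G_pi; exact: G_HW.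
  by apply: rv_inB; apply: rv_W; rewrite ?lexx ?h0 ?hk ?(le_trans h0 hk).
have r1 := rv_inM h1 ral; have r2 := rv_inM r1 ral.
have i1 : int1 P (fun w => Yp k w * al k w).
  by apply: int1_eq (int1M_bounded mal (al_le k) h2) => w; rewrite mulrC.
have i2 : int1 P (fun w => Yp k w * al k w * al k w).
  by apply: int1_eq (int1M_bounded mal (al_le k) i1) => w; rewrite mulrC.
have [[j1 e1] _ _ _] := dW_moments Pcomp hW hX hXW h0 hk hT (hat _ r1) i1.
have [_ [j2 e2] _ _] := dW_moments Pcomp hW hX hXW h0 hk hT (hat _ r2) i2.
have eD : tk k.+1 - tk k = D by rewrite tkS addrAC subrr add0r.
rewrite eD in e2.
pose q1 := 1 + C2 * D + 2 * C2 ^+ 2 * D ^+ 2.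
pose q2 := -1 - 4 * C2 * D.
have E w : Yp k.+1 w = q1 * Yp k w + q2 * (Yp k w * al k w * dW (tk k) (tk k.+1) w) +
   2 * (Yp k w * al k w * al k w * dW (tk k) (tk k.+1) w ^+ 2).
  by rewrite /= /xk /q1 /q2; set x := dW _ _ w; ring.
have i3 := int1D (int1D (int1Z q1 h2) (int1Z q2 j1)) (int1Z 2 j2).
split.
- apply: rv_inM (up _ h1) _.
  have rx : rv_in (H (tk k.+1)) (xk k).
    by apply: rv_inB (rv_inM (up _ ral) rW) _; exact: rv_in_cst.
  have r3 : rv_in (H (tk k.+1)) (fun w => 1 + (-1) * xk k w + 2 * (xk k w * xk k w)).
    by apply: rv_inD; [apply: rv_inD; [exact: rv_in_cst|exact: rv_inZ]|exact: rv_inZ (rv_inM rx rx)].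
  by rewrite (_ : (fun w => _) = (fun w => 1 + (-1) * xk k w + 2 * (xk k w * xk k w)))//;
     apply/funext => w; ring.
- by apply: int1_eq i3 => w; rewrite E.
rewrite (Iv_eq P E) IvD; [|by apply: int1D; exact: int1Z|exact: int1Z].
rewrite IvD; [|exact: int1Z|exact: int1Z].
rewrite IvZ// IvZ// IvZ// e1 mulr0 addr0 e2.
have Y0 : 0 <= Iv P (Yp k) by apply: Iv_ge0 => w; exact: ltW (Yp_gt0 k w).
have a2 : Iv P (fun w => Yp k w * al k w * al k w) <= K ^+ 2 * Iv P (Yp k).
  rewrite -IvZ//; apply: Iv_le => //; first exact: int1Z.
  move=> w; rewrite -mulrA mulrC; apply: ler_wpM2r; first exact: ltW (Yp_gt0 k w).
  by rewrite -expr2 -[al k w ^+ 2]ger0_norm ?sqr_ge0// normrX ler_pXn2r ?nnegrE.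
have DT : D <= T.
  apply: le_trans hT; rewrite tkS lerDr; exact: h0.
apply: (@le_trans _ _ ((1 + C3 * D) * Iv P (Yp k))); last first.
  rewrite exprS; apply: ler_wpM2l h3; by rewrite addr_ge0// mulr_ge0// C3_ge0.
have b1 : D * Iv P (fun w => Yp k w * al k w * al k w) <= D * (K ^+ 2 * Iv P (Yp k)).
  exact: ler_wpM2l.
have b2 : (2 * C2 ^+ 2) * (D * D) * Iv P (Yp k) <= (2 * C2 ^+ 2) * (T * D) * Iv P (Yp k).
  apply: ler_wpM2r => //; apply: ler_wpM2l; first by rewrite mulr_ge0 ?sqr_ge0.
  exact: ler_wpM2r.
move: b1 b2; rewrite /q1 /C3; set Y := Iv P (Yp k); set Y2 := Iv P _.
have -> : (1 + (C2 + 2 * C2 ^+ 2 * T + 2 * K ^+ 2) * D) * Y =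
  Y + C2 * D * Y + 2 * C2 ^+ 2 * (T * D) * Y + 2 * (D * (K ^+ 2 * Y)) by ring.
have -> : (1 + C2 * D + 2 * C2 ^+ 2 * D ^+ 2) * Y =
  Y + C2 * D * Y + 2 * C2 ^+ 2 * (D * D) * Y by ring.
lra.
Qed.

Lemma Yp_bound k : (k <= n)%N -> Iv P (Yp k) <= expR (C3 * T).
Proof.
move=> kn; have [_ _ h] := Yp_spec kn; apply: le_trans h _.
apply: le_trans (pow_exp k C3_ge0 D0') _; rewrite ler_expR ler_wpM2l ?C3_ge0//.
by apply: le_trans (tkT kn); rewrite /tk lerDr.
Qed.

(** A second change needs an earlier one together with a change in the current cell. The product of
    the earlier count and the new change has mean at most [Ca D] times the mean count, and the sum
    over cells is quadratic. *)
Lemma Sc_spec k : (k <= n)%N -> [/\ rv_in (H (tk k)) (fun w => (Sc k w)%:R : R),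
   int1 P (fun w => (Sc k w)%:R), Iv P (fun w => (Sc k w)%:R) <= k%:R * (Ca A * D) &
   int1 P (fun w => (1 < Sc k w)%N%:R) /\
   Iv P (fun w => (1 < Sc k w)%N%:R) <= (k%:R * (Ca A * D)) ^+ 2].
Proof.
elim: k => [_|k ih kn].
  split; [exact: rv_in_cst|exact: int1_cst| |split]; rewrite ?mul0r ?expr0n.
  - by rewrite -[leRHS](Iv_cst P 0); apply: Iv_le; [exact: int1_cst|exact: int1_cst|].
  - exact: int1_cst.
  - by rewrite -[leRHS](Iv_cst P 0); apply: Iv_le; [exact: int1_cst|exact: int1_cst|].
have [h1 h2 h3 [h4 h5]] := ih (ltnW kn).
have hk := tk_le k; have h0 := tk_ge0 k; have hT := tkT kn.
have eD : tk k.+1 - tk k = D by rewrite tkS addrAC subrr add0r.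
have c1 := int1_change hX h0 hk hT (int1_cst P 1).
have c2 := int1_change hX h0 hk hT h2.
have r1 : rv_in (H (tk k)) (fun=> 1 : R) by exact: rv_in_cst.
have l1 := change_le Pcomp T0 hW hX hXW h0 hk hT r1 (int1_cst P 1) (fun=> ler01).
have l2 := change_le Pcomp T0 hW hX hXW h0 hk hT h1 h2 (fun w => ler0n _ _).
rewrite eD Iv_cst mulr1 in l1; rewrite eD in l2.
have ES w : (Sc k.+1 w)%:R = (Sc k w)%:R + 1 * (X (tk k.+1) w != X (tk k) w)%:R :> R.
  by rewrite /= natrD mul1r.
have rchg : rv_in (H (tk k.+1)) (fun w => (X (tk k.+1) w != X (tk k) w)%:R : R).
  have e w : (X (tk k.+1) w != X (tk k) w)%:R = \sum_i dl i (X (tk k) w) * (1 - dl i (X (tk k.+1) w)) :> R.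
    exact: neqE.
  rewrite (funext e); apply: rv_in_sum => i _; apply: rv_inM.
    by apply: (rv_pi_X (dl i)); rewrite ?h0.
  apply: rv_inB; first exact: rv_in_cst.
  by apply: (rv_pi_X (dl i)); rewrite ?(le_trans h0 hk) ?lexx.
have rS : rv_in (H (tk k.+1)) (fun w => (Sc k.+1 w)%:R : R).
  rewrite (funext ES); apply: rv_inD; last exact: rv_inZ.
  by apply: rv_in_sub h1; exact: H_mono.
have i2 : int1 P (fun w => (1 < Sc k.+1 w)%N%:R : R).
  apply: (int1_le _ (int1_cst P 1)).
    have -> : (fun w => (1 < Sc k.+1 w)%N%:R) = (fun w => ((1 : R) < (Sc k.+1 w)%:R)%R%:R : R).
      by apply/funext => w; rewrite ltr1n.
    have mS := H_meas Pcomp hW hX hT rS.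
    rewrite (_ : (fun w => _) = \1_[set w | (1 : R) < (Sc k.+1 w)%:R]).
      apply: measurable_indic; rewrite -[X in measurable X]setTI.
      by apply: measurable_fun_ltr => //; exact: measurable_cst.
    by apply/funext => w; rewrite indicE; case: (boolP (_ < _)) => h; [rewrite mem_set|rewrite memNset//=; exact/negP].
  by move=> w; rewrite ger0_norm ?ler0n// -[1]/(1%:R) ler_nat; case: (_ < _)%N.
split => //.
- by apply: int1_eq (int1D h2 c1) => w; rewrite ES.
- by rewrite (Iv_eq P ES) IvD// -natr1 mulrDl mul1r; exact: lerD.
split => //.
apply: (@le_trans _ _ (Iv P (fun w => (1 < Sc k w)%N%:R + (Sc k w)%:R * (X (tk k.+1) w != X (tk k) w)%:R))).
  apply: Iv_le => //; first exact: int1D.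
  move=> w /=; rewrite -natrM -natrD ler_nat.
  by case: (_ != _); rewrite ?addn1 ?addn0 ?muln1 ?muln0; case: (Sc k w) => [|[|q]].
rewrite IvD//; move: l2; set u := Iv P _; set v := Iv P _ => l2.
have CD : 0 <= Ca A * D by rewrite mulr_ge0 ?Ca_ge0.
have h3' : Ca A * D * Iv P (fun w => (Sc k w)%:R) <= Ca A * D * (k%:R * (Ca A * D)) by exact: ler_wpM2l.
have : 0 <= (k%:R + 1) * (Ca A * D) ^+ 2 by rewrite mulr_ge0 ?sqr_ge0// addr_ge0.
rewrite -[k.+1%:R]natr1.
rewrite (_ : ((k%:R + 1) * (Ca A * D)) ^+ 2 = (k%:R * (Ca A * D)) ^+ 2 + Ca A * D * (k%:R * (Ca A * D)) + (k%:R + 1) * (Ca A * D) ^+ 2); last by ring.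
move: h5 l2 h3'; set a1 := (k%:R * _) ^+ 2; set a2 := _ * (k%:R * _); set a3 := (k%:R + 1) * _.
rewrite -/v; lra.
Qed.

(** Markov's inequality with the fourth moment: the resulting [D^2] makes the sum over all cells
    vanish with the mesh. *)
Lemma dW_large k : (k < n)%N -> int1 P (fun w => (K * `|dW (tk k) (tk k.+1) w| > (4 * m)^-1)%R%:R) /\
  Iv P (fun w => (K * `|dW (tk k) (tk k.+1) w| > (4 * m)^-1)%R%:R) <= 64 * (4 * m * K) ^+ 4 * D ^+ 2.
Proof.
move=> kn; have hk := tk_le k; have h0 := tk_ge0 k; have hT := tkT kn.
have r1 : rv_in <<s hatG0 (tk k) >> (fun=> 1 : R) by exact: rv_in_cst.
have [_ _ i4 e4] := dW_moments Pcomp hW hX hXW h0 hk hT r1 (int1_cst P 1).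
have eD : tk k.+1 - tk k = D by rewrite tkS addrAC subrr add0r.
rewrite Iv_cst eD mulr1 in e4.
have m4 : 0 < 4 * m by rewrite mulr_gt0.
have mW : measurable_fun setT (dW (tk k) (tk k.+1)).
  by apply: measurable_funB; apply: (measurable_W hW); rewrite ?h0 ?(le_trans h0 hk) ?hT ?(le_trans hk hT).
have ii : int1 P (fun w => (K * `|dW (tk k) (tk k.+1) w| > (4 * m)^-1)%R%:R).
  apply: (int1_le _ (int1_cst P 1)).
    rewrite (_ : (fun w => _) = \1_[set w | (4 * m)^-1 < K * `|dW (tk k) (tk k.+1) w|]).
      apply: measurable_indic; rewrite -[X in measurable X]setTI.
      apply: measurable_fun_ltr => //.
      by apply: measurable_funM => //; exact: measurableT_comp.
    by apply/funext => w; rewrite indicE; case: (boolP (_ < _)) => h; [rewrite mem_set|rewrite memNset//=; exact/negP].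
  by move=> w; rewrite ger0_norm ?ler0n// -[1]/(1%:R) ler_nat; case: (_ < _).
split => //.
apply: (@le_trans _ _ ((4 * m * K) ^+ 4 * Iv P (fun w => 1 * dW (tk k) (tk k.+1) w ^+ 4))); last first.
  rewrite (_ : 64 * (4 * m * K) ^+ 4 * D ^+ 2 = (4 * m * K) ^+ 4 * (64 * D ^+ 2)); last by ring.
  by apply: ler_wpM2l; [rewrite exprn_ge0// mulr_ge0// ltW|apply: e4].
rewrite -IvZ//; apply: Iv_le => //; first exact: int1Z.
move=> w; set x := dW _ _ w.
have -> : (4 * m * K) ^+ 4 * (1 * x ^+ 4) = (4 * m * (K * `|x|)) ^+ 4.
  rewrite -[x ^+ 4](_ : `|x| ^+ 4 = _); first by ring.
  by rewrite -normrX ger0_norm// (_ : x ^+ 4 = (x ^+ 2) ^+ 2) ?sqr_ge0//; ring.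
have p0 : 0 <= 4 * m * (K * `|x|) by rewrite mulr_ge0 ?mulr_ge0// ltW.
case: (ltP (4 * m)^-1 (K * `|x|)) => h; last by rewrite exprn_ge0.
apply: exprn_ege1; have := ler_wpM2l (ltW m4) (ltW h).
by rewrite mulfV ?lt0r_neq0.
Qed.

End density.

End model.

(** * Pointwise lower bounds for the drift *)

Section pointwise.
Context {R : realType} {N : nat}.
Variables (c : R) (A : 'M[R]_N).
Hypothesis hA : rate_matrix c A.
Implicit Types C h f : 'I_N -> R.

Definition pos (x : R) : R := Num.max 0 x.

Lemma pos_ge0 x : 0 <= pos x. Proof. by rewrite /pos le_max lexx. Qed.

Variables (K m : R).
Hypotheses (K1 : 1 <= K) (m1 : 1 <= m).

(** Upward jumps have the weight [1 - 1/m] instead of 1, which matches the coefficient [-1 + 1/m] of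
    [tilt]. *)
Definition drift_low (i : 'I_N) (z1 : R) C : R :=
  - K * `|z1| - \sum_j A j i * ((1 - m^-1) * pos (C j - C i) + K * neg (C j - C i)).

(** Jump coefficients of the density seen from state [i]. The direction of a jump is read off the
    approximation [h], because the coefficients must be known at the left end of a cell. *)
Definition tilt (h : 'I_N -> R) (i j : 'I_N) : R :=
  if j == i then 0 else if h i <= h j then -1 + m^-1 else K.

Let i0 : 0 < m^-1. Proof. by rewrite invr_gt0; exact: lt_le_trans m1. Qed.
Let i1 : m^-1 <= 1. Proof. by rewrite invf_le1//; exact: lt_le_trans m1. Qed.

Lemma tilt_le h i j : `|tilt h i j| <= K.
Proof.
have k1 : 1 <= K := K1; have j0 : 0 < m^-1 := i0; have j1 : m^-1 <= 1 := i1.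
rewrite /tilt; case: ifP => _; first by rewrite normr0; lra.
by case: ifP => _; rewrite ler_norml; apply/andP; split; lra.
Qed.

Lemma tilt_lo h i j : -1 + m^-1 <= tilt h i j.
Proof.
have k1 : 1 <= K := K1; have j0 : 0 < m^-1 := i0; have j1 : m^-1 <= 1 := i1.
by rewrite /tilt; case: ifP => _; [lra|case: ifP => _; lra].
Qed.

Lemma absP (x : R) : (0 <= x /\ `|x| = x) \/ (x <= 0 /\ `|x| = - x).
Proof. by have [h|/ltW h] := leP 0 x; [left|right]; split => //; [exact: ger0_norm|exact: ler0_norm]. Qed.

Lemma posneg (x : R) : (0 <= x /\ pos x = x /\ neg x = 0) \/ (x <= 0 /\ pos x = 0 /\ neg x = - x).
Proof.
rewrite /pos /neg; have [h|/ltW h] := leP 0 x; [left|right]; split => //; split => //.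
- by apply/max_idPl; rewrite oppr_le0.
- by apply/max_idPr; rewrite oppr_ge0.
Qed.

(** If [h] and [C] jump in the same direction, the two sides agree up to the nonnegative penalty. If
    not, the jump of [C] is no larger than that of [C - h], and the penalty [2 K] pays for it. *)
Lemma tilt_mul h i j C :
  (1 - m^-1) * pos (C j - C i) + K * neg (C j - C i)
    - 2 * K * `|(C j - h j) - (C i - h i)| <= - (tilt h i j * (C j - C i)).
Proof.
have k1 : 1 <= K := K1; have j0 : 0 < m^-1 := i0; have j1 : m^-1 <= 1 := i1.
rewrite /tilt; have [->|ji] := eqVneq j i.
  by rewrite !subrr normr0 /pos /neg oppr0 maxxx; lra.
have -> : C j - h j - (C i - h i) = (C j - C i) - (h j - h i) by ring.
have -> : (h i <= h j) = (0 <= h j - h i) by rewrite subr_ge0.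
set x := C j - C i; set y := h j - h i; clearbody x y.
have kx (u : R) : 0 <= u -> u <= K * u by move=> u0; rewrite ler_peMl.
have mx (u : R) : 0 <= u -> m^-1 * u <= u by move=> u0; rewrite ler_piMl// ltW.
have mx0 (u : R) : 0 <= u -> 0 <= m^-1 * u by move=> u0; rewrite mulr_ge0// ltW.
have n0 := normr_ge0 (x - y).
have [[hx [-> ->]]|[hx [-> ->]]] := posneg x; case: (leP 0 y) => hy;
  have := absP (x - y) => -[[e1 e2]|[e1 e2]]; rewrite ?e2.
- have := kx _ e1; lra.
- have := kx (- (x - y)); rewrite oppr_ge0 => /(_ e1); lra.
- have := kx _ hx; have := mx0 _ hx; have : K * x <= K * (x - y).
    by apply: ler_wpM2l; lra.
  lra.
- by lra.
- have -> : x = 0 by lra.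
  have -> : y = 0 by lra.
  by rewrite subrr oppr0 !mulr0; lra.
- have hx' : 0 <= - x by lra.
  have := kx _ hx'; have := mx0 _ hx'; have : K * (- x) <= K * (- (x - y)).
    by apply: ler_wpM2l; lra.
  lra.
- have := kx _ e1; lra.
- have := kx (- (x - y)); rewrite oppr_ge0 => /(_ e1); lra.
Qed.

(** The Brownian analogue: a wrong sign of [y] is paid for by its distance to [x]. *)
Lemma mul_sign (x y : R) : K * `|x| - 2 * K * `|x - y| <= K * Num.sg y * x.
Proof.
have K0 : 0 <= K := le_trans ler01 K1.
have tri : `|x| <= `|x - y| + `|y| by rewrite -{1}(subrK y x) ler_normD.
have h1 : K * `|x| <= K * (`|x - y| + `|y|) by exact: ler_wpM2l.
have e : Num.sg y * y = `|y| by rewrite -normrEsg.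
have s1 : `|Num.sg y| <= 1 by rewrite normr_sg; case: (_ == _).
have h2 : `|K * Num.sg y * (x - y)| <= K * `|x - y|.
  rewrite !normrM (ger0_norm K0) ler_wpM2r// -[leRHS]mulr1 ler_wpM2l//.
have := h2; rewrite ler_norml => /andP[h3 _].
have -> : K * Num.sg y * x = K * Num.sg y * (x - y) + K * (Num.sg y * y) by ring.
by rewrite e; lra.
Qed.

Lemma same_state_low (g e z1 h1 : R) C h i : drift_low i z1 C - e <= g ->
  - e - 2 * K * (`|z1 - h1| + \sum_j A j i * `|(C j - h j) - (C i - h i)|) <=
  g - (- K * Num.sg h1) * z1 - gam A (tilt h i) C i.
Proof.
move=> hg.
have key : \sum_j A j i * ((1 - m^-1) * pos (C j - C i) + K * neg (C j - C i)) -
   2 * K * \sum_j A j i * `|(C j - h j) - (C i - h i)| <= - gam A (tilt h i) C i.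
  rewrite /gam mulr_sumr -sumrB -sumrN; apply: ler_sum => j _.
  have [->|ji] := eqVneq j i; first by rewrite !subrr normr0 /pos /neg oppr0 maxxx; lra.
  have := ler_wpM2l (rate_ge0 hA ji) (tilt_mul h i j C).
  rewrite {3}/tilt eqxx subr0; lra.
have := mul_sign z1 h1; move: hg key; rewrite /drift_low; lra.
Qed.

Lemma young_mul (x y q : R) : 0 < q -> `|x| * `|y| <= q * x ^+ 2 + q^-1 * y ^+ 2.
Proof.
move=> q0; rewrite -normrM.
have h (u v : R) : u * v <= q * u ^+ 2 + q^-1 * v ^+ 2.
  have q1 : 0 < q^-1 by rewrite invr_gt0.
  have := mulr_ge0 (ltW q1) (sqr_ge0 (q * u - v)).
  have -> : q^-1 * (q * u - v) ^+ 2 = q * u ^+ 2 + q^-1 * v ^+ 2 - 2 * (u * v).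
    by field; rewrite gt_eqF.
  have a1 : 0 <= q * u ^+ 2 by rewrite mulr_ge0 ?sqr_ge0// ltW.
  have a2 : 0 <= q^-1 * v ^+ 2 by rewrite mulr_ge0 ?sqr_ge0// ltW.
  by case: (leP 0 (u * v)) => ?; lra.
rewrite ler_norml; apply/andP; split; last exact: h.
by rewrite lerNl -mulNr -[x ^+ 2]sqrrN; exact: h.
Qed.

Definition C4 : R := 1 + K + 2 * K * Ca A.
Definition C5 : R := 2 * K * (1 + Ca A).

Lemma sum_young (G q : R) f i : 0 < q -> 0 <= G ->
  \sum_j A j i * `|f j - f i| * G <= q * G ^+ 2 * Ca A + q^-1 * gam A f f i.
Proof.
move=> q0 G0.
apply: (@le_trans _ _ (\sum_j (q * G ^+ 2 * `|A j i| + q^-1 * (A j i * (f j - f i) * (f j - f i))))).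
  apply: ler_sum => j _; have [->|ji] := eqVneq j i.
    by rewrite subrr normr0 !mulr0 mul0r addr0 mulr_ge0// mulr_ge0 ?sqr_ge0// ltW.
  have a0 := rate_ge0 hA ji; rewrite (ger0_norm a0).
  have := ler_wpM2l a0 (young_mul G (f j - f i) q0).
  rewrite (ger0_norm G0); lra.
rewrite big_split /= -!mulr_sumr lerD2r; apply: ler_wpM2l; first by rewrite mulr_ge0 ?sqr_ge0// ltW.
exact: col_le.
Qed.

(* Young's inequality on the cells where the density is positive and the chain
   has not moved, the crude bound elsewhere. *)
Lemma cell_low (G g e z1 h1 q a : R) C h f i (same : bool) : 0 < q -> 0 <= e ->
  `|a| <= K -> (forall j, `|f j| <= K) ->
  (same -> a = - K * Num.sg h1 /\ f = tilt h i) -> drift_low i z1 C - e <= g ->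
  - (`|G| * e) - C5 * q * G ^+ 2
  - 2 * K * q^-1 * ((z1 - h1) ^+ 2 + gam A (fun j => C j - h j) (fun j => C j - h j) i)
  - C4 * q^-1 * (G ^+ 2 * (~~ same)%:R + neg G ^+ 2)
  - 2 * K * q * (g ^+ 2 + (z1 ^+ 2 + gam A C C i)) <=
  G * (g - a * z1 - gam A f C i).
Proof.
move=> q0 e0 aK fK hs hg.
have q1 : 0 < q^-1 by rewrite invr_gt0.
have gC := gam_ge0 hA C i; have gD := gam_ge0 hA (fun j => C j - h j) i.
have sG := sqr_ge0 G; have sn := sqr_ge0 (neg G).
have K0 : 0 <= K := le_trans ler01 K1.
have cA0 := Ca_ge0 A.
have q0' := ltW q0; have q1' := ltW q1; have gG := sqr_ge0 g; have zG := sqr_ge0 z1.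
have hG := sqr_ge0 (z1 - h1); have K20 : 0 <= 2 * K by rewrite mulr_ge0.
have C50 : 0 <= C5 by rewrite /C5 mulr_ge0// addr_ge0.
have t1 : 0 <= C5 * q * G ^+ 2 by rewrite mulr_ge0// mulr_ge0.
have t2 : 0 <= 2 * K * q^-1 * ((z1 - h1) ^+ 2 + gam A (fun j => C j - h j) (fun j => C j - h j) i).
  by apply: mulr_ge0; [exact: mulr_ge0|exact: addr_ge0].
have C40 : 0 <= C4 by rewrite /C4 addr_ge0 ?(mulr_ge0 K20)// addr_ge0.
have t3 : 0 <= C4 * q^-1 * (G ^+ 2 * (~~ same)%:R + neg G ^+ 2).
  by apply: mulr_ge0; [exact: mulr_ge0|apply: addr_ge0 => //; exact: mulr_ge0].
have t4 : 0 <= 2 * K * q * (g ^+ 2 + (z1 ^+ 2 + gam A C C i)).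
  by apply: mulr_ge0; [exact: mulr_ge0|apply: addr_ge0 => //; exact: addr_ge0].
have t5 : 0 <= `|G| * e by rewrite mulr_ge0.
have [/andP[G0 sm]|bad] := boolP ((0 <= G) && same).
  have [-> ->] := hs sm; have := same_state_low h1 h hg.
  set S := \sum_j _; set Psi := g - _ - _ => /(ler_wpM2l G0).
  have y1 := young_mul G (z1 - h1) q0.
  have y2 := sum_young (fun j => C j - h j) i q0 G0; rewrite -mulr_suml -/S in y2.
  have y3 : 2 * K * (G * `|z1 - h1| + S * G) <= 2 * K * (q * G ^+ 2 + q^-1 * (z1 - h1) ^+ 2 +
     (q * G ^+ 2 * Ca A + q^-1 * gam A (fun j => C j - h j) (fun j => C j - h j) i)).
    apply: ler_wpM2l; first by rewrite mulr_ge0.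
    by apply: lerD => //; rewrite -{1}(ger0_norm G0).
  rewrite (ger0_norm G0) in t5 *; move: y3 t1 t2 t3 t4; rewrite /C5.
  set g1 := gam _ _ _ _; set g2 := gam _ _ _ _; set bb := C4 * _ * _.
  lra.
have crude : - C4 * q^-1 * G ^+ 2 - 2 * K * q * (g ^+ 2 + (z1 ^+ 2 + gam A C C i)) <=
    G * (g - a * z1 - gam A f C i).
  have y1 := young_mul g G q0.
  have y2 := young_mul z1 G q0.
  have y3 := sum_young C i q1 (normr_ge0 G).
  rewrite invrK real_normK ?num_real// in y3.
  have n1 : `|G * g| <= q * g ^+ 2 + q^-1 * G ^+ 2 by rewrite normrM mulrC.
  have n2 : `|G * (a * z1)| <= K * (q * z1 ^+ 2 + q^-1 * G ^+ 2).
    rewrite mulrCA normrM; by apply: ler_pM => //; rewrite normrM mulrC.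
  have n3 : `|G * gam A f C i| <= 2 * K * (q^-1 * G ^+ 2 * Ca A + q * gam A C C i).
    apply: le_trans (ler_wpM2l _ y3); last by rewrite mulr_ge0.
    rewrite /gam [in leRHS]mulr_sumr mulr_sumr; apply: le_trans (ler_norm_sum _ _ _) _.
    apply: ler_sum => j _; have [->|ji] := eqVneq j i.
      by rewrite !subrr normr0 !(mulr0, mul0r) normr0.
    have a0 := rate_ge0 hA ji; rewrite !normrM (ger0_norm a0).
    have fd : `|f j - f i| <= 2 * K.
      by apply: le_trans (ler_normB _ _) _; have := fK j; have := fK i; lra.
    have := ler_wpM2l (mulr_ge0 (mulr_ge0 a0 (normr_ge0 (C j - C i))) (normr_ge0 G)) fd.
    lra.
  move: n1 n2 n3; rewrite !ler_norml => /andP[n1 _] /andP[_ n2] /andP[_ n3].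
  have p0 : 0 <= q * g ^+ 2 := mulr_ge0 q0' gG.
  have p1 : q * g ^+ 2 <= K * (q * g ^+ 2) by rewrite ler_peMl.
  have p2 : 0 <= K * (q * g ^+ 2) := mulr_ge0 K0 p0.
  have p3 : 0 <= K * (q * z1 ^+ 2) := mulr_ge0 K0 (mulr_ge0 q0' zG).
  move: n1 n2 n3 p1 p2 p3; rewrite /C4; set g1 := gam A C C i; set g2 := gam A f C i; lra.
(* Outside the good case either the state has changed or [G] is negative, so the two penalty terms
   cover the whole square. *)
have : G ^+ 2 <= G ^+ 2 * (~~ same)%:R + neg G ^+ 2.
  move: bad; rewrite negb_and => /orP[nG|->]; last by rewrite mulr1 lerDl.
  have -> : neg G = - G by apply/max_idPr; rewrite oppr_ge0 ltW// ltNge.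
  by rewrite sqrrN lerDr mulr_ge0.
move=> /(ler_wpM2l (mulr_ge0 C40 (ltW q1))) hX; apply: le_trans crude.
move: hX t1 t2 t5; rewrite !mulNr; set x1 := C4 * _ * (_ + _); set x2 := 2 * K * q^-1 * _.
set x3 := 2 * K * q * _; set x4 := C4 * _ * _; set x5 := C5 * _ * _; set x6 := `|G| * e.
by clearbody x1 x2 x3 x4 x5 x6; lra.
Qed.

End pointwise.

(** * The dual inequality *)

Section linear_integrals.
Context d (T : measurableType d) (R : realType) (mu : {measure set T -> \bar R}).
Implicit Types f g : T -> R.

Lemma int1_lin2 (a b : R) f g : int1 mu f -> int1 mu g -> int1 mu (fun x => a * f x + b * g x).
Proof. by move=> h1 h2; apply: int1D; exact: int1Z. Qed.

Lemma Iv_lin2 (a b : R) f g : int1 mu f -> int1 mu g ->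
  Iv mu (fun x => a * f x + b * g x) = a * Iv mu f + b * Iv mu g.
Proof. by move=> h1 h2; rewrite IvD ?IvZ//; exact: int1Z. Qed.

End linear_integrals.

Section model.
Context {d : measure_display} {Omega : measurableType d} {R : realType}
  {N : nat}.
Variables (P : probability Omega R) (T c : R) (A : 'M[R]_N).
Variables (X : R -> Omega -> 'I_N) (W : R -> Omega -> R).
Hypotheses (Pcomp : measure_is_complete P) (T0 : 0 < T)
  (hA : rate_matrix c A) (hW : brownian_motion P T W)
  (hX : markov_chain P T A X) (hXW : independent_processes P T X W).

Local Notation mu := (P \x lebesgue_measure)%E.
Local Notation piG0 := (piG0 P X W).
Implicit Types (zeta phi lam I J : Omega -> R) (s t a b r : R) (z : @proc R N Omega)
  (e : @item R N Omega) (L : seq (@item R N Omega)).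
Local Notation Xe := (Xext T X).
Local Notation nrm := (pnorm T A X).
Local Notation ipz := (pinner T A X).
Local Notation H s := <<s piG0 s >>.
Local Notation valid := (valid P T X W).
Local Notation el := (el A X W).
Local Notation H2 := (H2 P T A X).

Section dual.
Variables (s D K m : R) (n : nat) (hh : nat -> option 'I_N -> Omega -> R) (B : set Omega).
Local Notation tk := (tk s D).

(** With exact data, [- al * z1] equals [K |z1|] and so offsets the Brownian term of [drift_low];
    [cc] does the same for the jumps. *)
Definition al k w : R := - K * Num.sg (hh k None w).
Definition cc k j w : R := tilt K m (fun l => hh k (Some l) w) (X (tk k) w) j.

Local Notation de := (de s D al cc).
Local Notation Gam := (Gam A X W s D al cc B).

Hypotheses (s0 : 0 <= s) (D0 : 0 < D) (nT : tk n <= T) (K1 : 1 <= K) (m1 : 1 <= m)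
  (B_H : H s B) (D_small : C2 A K * D <= (4 * m)^-1)
  (hh_rv : forall k o, (k < n)%N -> rv_in (H (tk k)) (hh k o))
  (hh_i2 : forall k o, (k < n)%N -> int2 P (hh k o)).

Lemma al_le k w : `|al k w| <= K.
Proof.
have K0 : 0 <= K := le_trans ler01 K1.
rewrite /al mulNr normrN normrM (ger0_norm K0) -[leRHS]mulr1 ler_wpM2l//.
by rewrite normr_sg; case: (_ == _).
Qed.

Lemma cc_le k j w : `|cc k j w| <= K.
Proof. exact: tilt_le. Qed.

Lemma cc_X k w : cc k (X (tk k) w) w = 0.
Proof. by rewrite /cc /tilt eqxx. Qed.

Lemma cc_lo k j w : -1 + m^-1 <= cc k j w.
Proof. exact: tilt_lo. Qed.

Lemma measurable_sg : measurable_fun setT (@Num.sg R).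
Proof.
rewrite (_ : @Num.sg R = fun x => \1_(`]0, +oo[%classic) x - \1_(`]-oo, 0[%classic) x).
  by apply: measurable_funB; apply: measurable_indic; exact: measurable_itv.
apply/funext => x; rewrite !indicE; have [h|h|->] := ltgtP x 0.
- rewrite ltr0_sg// memNset ?mem_set ?sub0r//= in_itv/= ?andbT//.
  by apply/negP; rewrite -leNgt ltW.
- rewrite gtr0_sg// mem_set ?memNset ?subr0//= in_itv/= ?andbT//.
  by apply/negP; rewrite -leNgt ltW.
- by rewrite sgr0 !memNset ?subrr//= in_itv/= ?andbT ltxx.
Qed.

Lemma al_rv k : (k < n)%N -> rv_in (H (tk k)) (al k).
Proof.
move=> kn; apply: (@rv_in_comp _ _ _ _ (fun x => - K * Num.sg x)); last exact: hh_rv.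
by apply: measurable_funM => //; exact: measurable_sg.
Qed.

Lemma cc_rv k j : (k < n)%N -> rv_in (H (tk k)) (cc k j).
Proof.
move=> kn; have kT := tkT D0 nT (ltnW kn).
rewrite (_ : cc k j = fun w => \sum_i dl i (X (tk k) w) * tilt K m (fun l => hh k (Some l) w) i j).
  apply: rv_in_sum => i _; apply: rv_inM.
    by apply: (rv_pi_X (dl i)) => //; rewrite (tk_ge0 s0 D0) lexx.
  rewrite /tilt; case: (j == i); first exact: rv_in_cst.
  apply: (rv_in_if (b := fun w => hh k (Some i) w <= hh k (Some j) w)); try exact: rv_in_cst.
  by apply: rv_in_le; exact: hh_rv.
apply/funext => w; rewrite (bigD1 (X (tk k) w))//= big1 ?addr0 => [|i ip].
  by rewrite /dl eqxx mul1r.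
by rewrite /dl eq_sym (negbTE ip) mul0r.
Qed.

Variables (V : R -> Omega -> R) (g e : Omega * R -> R) (z : @proc R N Omega).
Hypotheses (hB : BE P T A X W s (tk n) V g z) (e_ge0 : forall p, 0 <= e p)
  (e_i2 : int2 mu (fun p => ind s (tk n) p.2 * e p))
  (hlow : {ae mu, forall p, s < p.2 <= tk n ->
     drift_low A K m (Xe p) (z None p) (fun j => z (Some j) p) - e p <= g p}).

Definition zd k : @proc R N Omega :=
  zlin 1 (-1) (cutp (tk k) (tk k.+1) z) (zit (Item (tk k) (tk k.+1) (hh k))).

Local Notation GS := (Gam_spec Pcomp T0 hA hW hX hXW s0 D0 nT K1 al_rv al_le cc_rv cc_le B_H).

(** Loss on one cell. The weights [q] and [q'] come from Young's inequality: once they are small,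
    the inverse powers are beaten by the mesh, by the step approximation, or by the smallness of
    [e]. *)
Definition cost (q q' : R) k : R :=
  q * (C1 A K * D * Iv P (fun w => Gam k w ^+ 2)) +
  q^-1 * (D * Iv mu (fun p => ind (tk k) (tk k.+1) p.2 * g p ^+ 2)) +
  ((q' + C5 A K * q) * (D * Iv P (fun w => Gam k w ^+ 2)) +
   q'^-1 * Iv mu (fun p => ind (tk k) (tk k.+1) p.2 * e p ^+ 2) +
   2 * K * q^-1 * Iv mu (nrm (zd k)) +
   C4 A K * q^-1 * (Ca A * D ^+ 2 * Iv P (fun w => Gam k w ^+ 2) + D * Iv P (fun w => neg (Gam k w) ^+ 2)) +
   2 * K * q * (Iv mu (fun p => ind (tk k) (tk k.+1) p.2 * g p ^+ 2) +
                Iv mu (nrm (cutp (tk k) (tk k.+1) z)))).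

(** [cell_low] holds at almost every point of the cell; [change_strip] bounds the weighted time
    spent away from the initial state. *)
Lemma cell_psi (q q' : R) k : (k < n)%N -> 0 < q -> 0 < q' ->
  - ((q' + C5 A K * q) * (D * Iv P (fun w => Gam k w ^+ 2)) +
   q'^-1 * Iv mu (fun p => ind (tk k) (tk k.+1) p.2 * e p ^+ 2) +
   2 * K * q^-1 * Iv mu (nrm (zd k)) +
   C4 A K * q^-1 * (Ca A * D ^+ 2 * Iv P (fun w => Gam k w ^+ 2) + D * Iv P (fun w => neg (Gam k w) ^+ 2)) +
   2 * K * q * (Iv mu (fun p => ind (tk k) (tk k.+1) p.2 * g p ^+ 2) +
                Iv mu (nrm (cutp (tk k) (tk k.+1) z)))) <=
  Iv mu (fun p => (ind (tk k) (tk k.+1) p.2 * Gam k p.1) * (ind (tk k) (tk k.+1) p.2 * g p)) -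
  Iv mu (ipz (zit (sc (Gam k) (de k))) (cutp (tk k) (tk k.+1) z)).
Proof.
move=> kn q0 q0'; have [hV hg hz hbe] := hB.
have hk := tk_le s D0 k; have h0 := tk_ge0 s0 D0 k; have hT := tkT D0 nT kn.
have hs := tk_s s D0 k; have hn : tk k.+1 <= tk n by exact: (tk_mono s D0).
have eD : tk k.+1 - tk k = D by rewrite tkS addrAC subrr add0r.
have [rG iG _] := GS (ltnW kn).
have [iN _] := Gam_neg Pcomp T0 hA hW hX hXW s0 D0 nT K1 al_rv al_le cc_rv cc_le cc_X B_H m1 cc_lo D_small (ltnW kn).
have v := valid_de Pcomp hW hX s0 D0 nT al_rv al_le cc_rv cc_le kn rG iG.
have vh : valid (tk k) (Item (tk k) (tk k.+1) (hh k)).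
  by split => //= o; split; [exact: hh_rv|exact: hh_i2].
have hz' : H2 (cutp (tk k) (tk k.+1) z) by rewrite -(cutp_cut z hs hn); exact: H2_cutp.
have i1 := int1_strip (tk k) (tk k.+1) iG.2.
have i2 : int1 mu (fun p => ind (tk k) (tk k.+1) p.2 * e p ^+ 2).
  by apply: int1_eq (int2_cut hs hn e_i2).2 => p; rewrite exprMn ind_idem.
have i3 := (H2_lin T0 hA hX 1 (-1) hz' (H2_zit Pcomp T0 hW hX vh)).2.
have i4 := int1_change_strip T0 hX h0 hk hT iG.2.
have i5 := int1_strip (tk k) (tk k.+1) iN.2.
have ig := int2_cut hs hn hg.
have i6 : int1 mu (fun p => ind (tk k) (tk k.+1) p.2 * g p ^+ 2).
  by apply: int1_eq ig.2 => p; rewrite exprMn ind_idem.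
have i7 := hz'.2.
have j67 := int1_lin2 (2 * K * q) (2 * K * q) i6 i7.
have j45 := int1_lin2 (C4 A K * q^-1) (C4 A K * q^-1) i4 i5.
have j47 := int1_lin2 1 1 j45 j67.
have j12 := int1_lin2 (q' + C5 A K * q) q'^-1 i1 i2.
have j37 := int1_lin2 (2 * K * q^-1) 1 i3 j47.
have j17 := int1_lin2 (-1) (-1) j12 j37.
have r2 : rv_in (H (tk k)) (fun w => Gam k w ^+ 2) by exact: (rv_inM rG rG).
have l4 := change_strip Pcomp T0 hW hX hXW h0 hk hT r2 iG.2 (fun w => sqr_ge0 _).
rewrite eD in l4.
have iGg := int2M (int2_strip (tk k) (tk k.+1) iG) ig.
have iip := int1_ipz T0 hA hX (H2_zit Pcomp T0 hW hX v) hz'.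
have q1 : 0 < q^-1 by rewrite invr_gt0.
have K0 : 0 <= K := le_trans ler01 K1.
have C40 : 0 <= C4 A K * q^-1.
  rewrite mulr_ge0 ?(ltW q1)// /C4 addr_ge0 ?addr_ge0// mulr_ge0 ?Ca_ge0// mulr_ge0//.
rewrite -(IvB iGg iip).
apply: (@le_trans _ _ (Iv mu (fun p => -1 * ((q' + C5 A K * q) * (ind (tk k) (tk k.+1) p.2 * Gam k p.1 ^+ 2) +
    q'^-1 * (ind (tk k) (tk k.+1) p.2 * e p ^+ 2)) + -1 * (2 * K * q^-1 * nrm (zd k) p +
    1 * (1 * (C4 A K * q^-1 * (ind (tk k) (tk k.+1) p.2 * (Gam k p.1 ^+ 2 * (X p.2 p.1 != X (tk k) p.1)%:R)) +
       C4 A K * q^-1 * (ind (tk k) (tk k.+1) p.2 * neg (Gam k p.1) ^+ 2)) +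
       1 * (2 * K * q * (ind (tk k) (tk k.+1) p.2 * g p ^+ 2) + 2 * K * q * nrm (cutp (tk k) (tk k.+1) z) p)))))).
  rewrite (Iv_lin2 _ _ j12 j37) (Iv_lin2 _ _ i1 i2) (Iv_lin2 _ _ i3 j47) (Iv_lin2 _ _ j45 j67).
  rewrite (Iv_lin2 _ _ i4 i5) (Iv_lin2 _ _ i6 i7).
  rewrite (Iv_strip hk iG.2) (Iv_strip hk iN.2) eD.
  have := ler_wpM2l C40 l4; set x4 := Iv mu (fun p => _ * (Gam k p.1 ^+ 2 * _)).
  by clearbody x4; lra.
apply: Iv_le_ae j17 (int1B iGg iip) _.
apply: ae_imp hlow => p hp.
rewrite /zd !nrm_lin.
have [i0|i0] := eqVneq (ind (tk k) (tk k.+1) p.2) 0.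
  have z0 (y y' : @proc R N Omega) : (forall o, y o p = 0) -> ipz y y' p = 0.
    by move=> h; rewrite /pinner /gam !h mul0r add0r big1// => j _; rewrite !h subrr mulr0 mul0r.
  have c0 o : cutp (tk k) (tk k.+1) z o p = 0 by rewrite /cutp i0 mul0r.
  have d0 o : zit (Item (tk k) (tk k.+1) (hh k)) o p = 0 by rewrite /zit /= i0 mul0r.
  have f0 o : zit (sc (Gam k) (de k)) o p = 0 by rewrite /zit /= i0 mul0r.
  by rewrite /pnorm !(z0 _ _ c0) !(z0 _ _ d0) !(z0 _ _ f0) i0; lra.
have pin : tk k < p.2 <= tk k.+1 by move: i0; rewrite /ind; case: (_ < _ <= _); rewrite ?eqxx.
have eX := ind_strip X h0 hT i0.
have /andP[p1 p2] := pin.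
have hp' := hp (introT andP (conj (le_lt_trans hs p1) (le_trans p2 hn))).
have i1' : ind (tk k) (tk k.+1) p.2 = 1 by rewrite /ind pin.
have := @cell_low _ _ _ _ hA K m K1 m1 (Gam k p.1) (g p) (e p) (z None p) (hh k None p.1) q (al k p.1)
  (fun j => z (Some j) p) (fun j => hh k (Some j) p.1) (cc k ^~ p.1) (Xe p) (X p.2 p.1 == X (tk k) p.1)
  q0 (e_ge0 p) (al_le k p.1) (fun j => cc_le k j p.1).
have same : X p.2 p.1 == X (tk k) p.1 -> al k p.1 = - K * Num.sg (hh k None p.1) /\
    cc k ^~ p.1 = tilt K m (fun j => hh k (Some j) p.1) (Xe p).
  by move=> /eqP h; split => //; apply/funext => j; rewrite /cc eX h.
move=> /(_ same hp'); rewrite -nrm_lin.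
have -> : nrm (zlin 1 (-1) (cutp (tk k) (tk k.+1) z) (zit (Item (tk k) (tk k.+1) (hh k)))) p =
   (z None p - hh k None p.1) ^+ 2 + gam A (fun j => z (Some j) p - hh k (Some j) p.1)
     (fun j => z (Some j) p - hh k (Some j) p.1) (Xe p).
  rewrite /pnorm /pinner /zlin /cutp /zit /= i1' expr2; congr (_ + _); first by ring.
  by congr (gam _ _ _ _); apply/funext => j; ring.
rewrite nrm_cutp i1' !mul1r.
have -> : nrm z p = z None p ^+ 2 + gam A (fun j => z (Some j) p) (fun j => z (Some j) p) (Xe p).
  by rewrite expr2.
have -> : ipz (zit (sc (Gam k) (de k))) (cutp (tk k) (tk k.+1) z) p =
   Gam k p.1 * (al k p.1 * z None p + gam A (cc k ^~ p.1) (fun j => z (Some j) p) (Xe p)).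
  rewrite /pinner /cutp /zit /= i1' !mul1r mulrDr; congr (_ + _); first by ring.
  by rewrite -[RHS]mulr1 -mulrA (mulrC (gam _ _ _ _)) mulrA -gamZ; congr (gam _ _ _ _); apply/funext => j; ring.
have := young_mul (Gam k p.1) (e p) q0'; rewrite (ger0_norm (e_ge0 p)).
set g1 := gam _ _ _ _; set g2 := gam _ _ _ _; set g3 := gam _ _ _ _; set b := (_ != _)%:R; set x := `|_| * e p.
by clearbody g1 g2 g3 b x; move: (Gam k p.1) (neg _) => G' ng; lra.
Qed.

(** A discrete product rule. [J] is orthogonal to [V] at [tk k] and [I] to [Gam k], so two cross
    terms vanish; the covariation of [J] and [I] joins the drift in [cell_psi], and [J * gi] is left
    to Young's inequality. *)
Lemma cell_step (q q' : R) k : (k < n)%N -> 0 < q -> 0 < q' ->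
  Iv P (fun w => Gam k.+1 w * V (tk k.+1) w) - cost q q' k <= Iv P (fun w => Gam k w * V (tk k) w).
Proof.
move=> kn q0 q0'; have := cell_psi kn q0 q0'; have [hV hg hz hbe] := hB.
have hk := tk_le s D0 k; have h0 := tk_ge0 s0 D0 k; have hT := tkT D0 nT kn.
have kT := le_trans hk hT.
have hs := tk_s s D0 k; have hn : tk k.+1 <= tk n by exact: (tk_mono s D0).
have eD : tk k.+1 - tk k = D by rewrite tkS addrAC subrr add0r.
have [rG iG _] := GS (ltnW kn).
have v := valid_de Pcomp hW hX s0 D0 nT al_rv al_le cc_rv cc_le kn rG iG.
have [I [SI1 e1]] := hbe (tk k) (tk k.+1) hs hk hn.
have [iI hzI _] := SI1.
have SIJ := SI_item Pcomp T0 hW hX hXW v.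
have [rV iV] := hV (tk k) (introT andP (conj hs (le_trans hk hn))).
have [_ iV'] := hV (tk k.+1) (introT andP (conj (le_trans hs hk) hn)).
have [jg hjg] := slice_int2' hs hk hn hg.
have ig := int2_cut hs hn hg.
set gi := slice _ in e1 jg hjg.
set J := el (sc (Gam k) (de k)) in SIJ.
have iJ : int2 P J by exact: (int2_el Pcomp T0 hW hX hXW v).
have eG w : Gam k.+1 w = Gam k w + J w by rewrite /J el_sc /= [LHS]mulrDr mulr1.
have EJ2 := el_norm_le Pcomp T0 hA hW hX hXW s0 D0 nT K1 al_rv al_le cc_rv cc_le kn rG iG.
have EJV : Iv P (fun w => V (tk k) w * J w) = 0 by exact: (E_el Pcomp T0 hW hX hXW v).
have EGI : Iv P (fun w => Gam k w * I w) = 0 by exact: (SI_orth Pcomp T0 hW hX hXW SI1).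
have EJI := SI_polar Pcomp T0 hA hW hX hXW kT SIJ SI1.
have EGg : Iv P (fun w => Gam k w * gi w) =
   Iv mu (fun p => (ind (tk k) (tk k.+1) p.2 * Gam k p.1) * (ind (tk k) (tk k.+1) p.2 * g p)).
  have iGg := int2M (int2_strip (tk k) (tk k.+1) iG) ig.
  rewrite -slice_Iv//; apply: Iv_ae.
  - exact: int1_measurable (int2M iG jg).
  - exact: int1_measurable (slice_int1 iGg).
  apply: ae_imp (int1_slice_ae (int2_int1_strip ig)) => w iw.
  rewrite /gi /slice -IvZ//; apply: Iv_eq => u /=.
  have := ind_idem (tk k) (tk k.+1) u; move: (ind _ _ _) => x hx.
  have -> : x * Gam k w * (x * g (w, u)) = x ^+ 2 * (Gam k w * g (w, u)) by ring.
  by rewrite hx; ring.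
have key : Iv P (fun w => Gam k w * V (tk k) w) =
   Iv P (fun w => Gam k.+1 w * V (tk k.+1) w) + (Iv P (fun w => Gam k w * gi w) + Iv P (fun w => J w * gi w))
   - Iv P (fun w => J w * I w).
  have iGV := int2M iG iV; have iVJ := int2M iV iJ.
  have iG' : int2 P (Gam k.+1) by apply: int2_eq (int2D iG iJ) => w; rewrite eG.
  transitivity (Iv P (fun w => Gam k.+1 w * V (tk k) w)).
    rewrite (_ : Iv P (fun w => Gam k.+1 w * V (tk k) w) = Iv P (fun w => Gam k w * V (tk k) w + V (tk k) w * J w)).
      by rewrite IvD// EJV addr0.
    by apply: Iv_eq => w; rewrite eG; ring.
  transitivity (Iv P (fun w => Gam k.+1 w * V (tk k.+1) w + (Gam k w * gi w + J w * gi w) -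
     (Gam k w * I w + J w * I w))).
    apply: Iv_ae; first exact: int1_measurable (int2M iG' iV).
      exact: (int1_measurable (int1B (int1D (int2M iG' iV') (int1D (int2M iG jg) (int2M iJ jg)))
        (int1D (int2M iG iI) (int2M iJ iI)))).
    by apply: ae_imp e1 => w ->; rewrite eG; ring.
  have i1 := int2M iG jg; have i2 := int2M iJ jg; have i3 := int2M iG iI; have i4 := int2M iJ iI.
  have i5 := int2M iG' iV'.
  rewrite IvB; [|by apply: int1D => //; exact: int1D|exact: int1D].
  rewrite (IvD i5 (int1D i1 i2)) (IvD i1 i2) (IvD i3 i4) EGI add0r//.
have yg : - (q * Iv P (fun w => J w ^+ 2) + q^-1 * Iv P (fun w => gi w ^+ 2)) <= Iv P (fun w => J w * gi w).
  rewrite -(Iv_lin2 _ _ iJ.2 jg.2) -IvN; last exact: int1_lin2 iJ.2 jg.2.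
  apply: Iv_le; [exact: int1N (int1_lin2 _ _ iJ.2 jg.2)|exact: int2M|].
  move=> w; have := young_mul (J w) (gi w) q0; rewrite -normrM ler_norml => /andP[h _].
  by rewrite lerNl; move: h; rewrite lerNl.
have q1 : 0 < q^-1 by rewrite invr_gt0.
have a1 := ler_wpM2l (ltW q0) EJ2.
have a2 := ler_wpM2l (ltW q1) hjg.
rewrite eD in a2.
rewrite key EJI EGg /cost -/J in a1 *; move: a1 a2 yg.
set x1 := Iv P _; set x2 := Iv P _; set x3 := Iv mu _; set x4 := Iv mu _; set x5 := Iv mu _.
lra.
Qed.

Lemma cells_sum (F : Omega * R -> R) k : (k <= n)%N -> int1 mu (fun p => ind s (tk n) p.2 * F p) ->
  \sum_(j < k) Iv mu (fun p => ind (tk j) (tk j.+1) p.2 * F p) = Iv mu (fun p => ind s (tk k) p.2 * F p).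
Proof.
move=> + h; elim: k => [_|k ih kn].
  rewrite big_ord0 /tk mul0r addr0; apply/esym; apply: etrans (Iv0 mu); apply: Iv_eq => p.
  by rewrite /ind (_ : _ < _ <= _ = false) ?mul0r//; apply/negP => /andP[a b]; have := lt_le_trans a b; rewrite ltxx.
have cut a b : s <= a -> b <= tk n -> int1 mu (fun p => ind a b p.2 * F p).
  move=> sa bn; apply: int1_eq (mu_indM a b h) => p.
  by rewrite mulrA -ind_sub.
rewrite big_ord_recr /= ih 1?ltnW// -IvD.
- by apply: Iv_eq => p; rewrite (ind_cat p.2 (tk_s s D0 k) (tk_le s D0 k)) mulrDl.
- by apply: cut => //; apply: (tk_mono s D0); exact: ltnW.
- by apply: cut; [exact: (tk_s s D0)|exact: (tk_mono s D0)].
Qed.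

(** Telescoping of [cell_step]. The moments of [Gam] are bounded uniformly on the grid, so
    contributions of order [D] per cell add up to a multiple of [n D <= T]. *)
Lemma dual_bound (q q' : R) : 0 < q -> 0 < q' ->
  Iv P (fun w => Gam n w * V (tk n) w) -
   ((q * C1 A K + q' + C5 A K * q) * (T * expR (C1 A K * T)) +
    C4 A K * q^-1 * (Ca A * D * (T * expR (C1 A K * T)) + T * (T * Cm K m * expR (C1 A K * T) * D)) +
    (q^-1 * D + 2 * K * q) * Iv mu (fun p => ind s (tk n) p.2 * g p ^+ 2) +
    q'^-1 * Iv mu (fun p => ind s (tk n) p.2 * e p ^+ 2) +
    2 * K * q^-1 * \sum_(k < n) Iv mu (nrm (zd k)) +
    2 * K * q * Iv mu (nrm (cutp s (tk n) z))) <=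
  Iv P (fun w => \1_B w * V s w).
Proof.
move=> q0 q0'; have [hV hg hz hbe] := hB.
have tel k : (k <= n)%N -> Iv P (fun w => Gam k w * V (tk k) w) - \sum_(j < k) cost q q' j <=
   Iv P (fun w => \1_B w * V s w).
  elim: k => [_|k ih kn]; first by rewrite big_ord0 subr0 /tk mul0r addr0.
  by rewrite big_ord_recr /=; have := ih (ltnW kn); have := cell_step kn q0 q0'; lra.
apply: le_trans (tel n (leqnn n)); rewrite lerD2l lerN2.
have ig2 : int1 mu (fun p => ind s (tk n) p.2 * g p ^+ 2).
  by apply: int1_eq hg.2 => p; rewrite exprMn ind_idem.
have ie2 : int1 mu (fun p => ind s (tk n) p.2 * e p ^+ 2).
  by apply: int1_eq e_i2.2 => p; rewrite exprMn ind_idem.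
have iz2 : int1 mu (fun p => ind s (tk n) p.2 * nrm z p).
  by apply: int1_eq hz.2 => p; rewrite nrm_cutp.
rewrite -(cells_sum (leqnn n) ig2) -(cells_sum (leqnn n) ie2).
have -> : Iv mu (nrm (cutp s (tk n) z)) = \sum_(k < n) Iv mu (nrm (cutp (tk k) (tk k.+1) z)).
  rewrite (Iv_eq mu (nrm_cutp T A X s (tk n) z)) -(cells_sum (leqnn n) iz2).
  by apply: eq_bigr => k _; apply: Iv_eq => p; rewrite nrm_cutp.
set M := expR _; set Nn := T * Cm K m * M * D.
have K0 : 0 <= K := le_trans ler01 K1.
have q1 : 0 < q^-1 by rewrite invr_gt0.
have cA0 := Ca_ge0 A.
have C10 := C1_ge0 A K1; have C50 : 0 <= C5 A K by rewrite /C5 mulr_ge0 ?addr_ge0// mulr_ge0.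
have C40 : 0 <= C4 A K * q^-1.
  by rewrite mulr_ge0 ?(ltW q1)// /C4 addr_ge0 ?addr_ge0// mulr_ge0// mulr_ge0.
have M0 : 0 <= M by exact: expR_ge0.
have N0 : 0 <= Nn.
  by rewrite /Nn; apply: mulr_ge0; [apply: mulr_ge0 => //; apply: mulr_ge0; [exact: ltW|exact: Cm_ge0]|exact: ltW].
have D0' := ltW D0; have q0w := ltW q0; have q0w' := ltW q0'.
have nD : n%:R * D <= T by apply: le_trans nT; rewrite /tk lerDr.
pose a1 := (q * C1 A K + q' + C5 A K * q) * (D * M) + C4 A K * q^-1 * (Ca A * D * (D * M) + D * Nn).
have cb (k : 'I_n) : cost q q' k <= a1 +
   ((q^-1 * D + 2 * K * q) * Iv mu (fun p => ind (tk k) (tk k.+1) p.2 * g p ^+ 2) +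
   (q'^-1 * Iv mu (fun p => ind (tk k) (tk k.+1) p.2 * e p ^+ 2) +
   (2 * K * q^-1 * Iv mu (nrm (zd k)) + 2 * K * q * Iv mu (nrm (cutp (tk k) (tk k.+1) z))))).
  have kn := ltnW (ltn_ord k).
  have b1 := Gam_bound Pcomp T0 hA hW hX hXW s0 D0 nT K1 al_rv al_le cc_rv cc_le B_H kn.
  have b2 := Gam_neg_bound Pcomp T0 hA hW hX hXW s0 D0 nT K1 al_rv al_le cc_rv cc_le cc_X B_H m1 cc_lo D_small kn.
  rewrite -/M in b1; rewrite -/M -/Nn in b2.
  have d1 := ler_wpM2l (addr_ge0 (addr_ge0 (mulr_ge0 q0w C10) q0w') (mulr_ge0 C50 q0w)) (ler_wpM2l D0' b1).
  have d2 := ler_wpM2l (mulr_ge0 C40 (mulr_ge0 cA0 (mulr_ge0 D0' D0'))) b1.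
  have d3 := ler_wpM2l (mulr_ge0 C40 D0') b2.
  rewrite /cost /a1; move: d1 d2 d3; rewrite expr2.
  set x1 := Iv P _; set x2 := Iv P _; set x3 := Iv mu _; set x4 := Iv mu _; set x5 := Iv mu _; set x6 := Iv mu _.
  clearbody x1 x2 x3 x4 x5 x6; clearbody M Nn; move: (C4 A K * q^-1) => c4; lra.
apply: le_trans (ler_sum _ (fun k _ => cb k)) _.
rewrite big_split /= sumr_const card_ord !big_split /= -!mulr_sumr.
have a1b : a1 *+ n <= (q * C1 A K + q' + C5 A K * q) * (T * M) + C4 A K * q^-1 * (Ca A * D * (T * M) + T * Nn).
  rewrite -mulr_natl.
  have d1 := ler_wpM2r (mulr_ge0 (addr_ge0 (addr_ge0 (mulr_ge0 q0w C10) q0w') (mulr_ge0 C50 q0w)) M0) nD.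
  have d2 := ler_wpM2r (mulr_ge0 C40 (mulr_ge0 (mulr_ge0 cA0 D0') M0)) nD.
  have d3 := ler_wpM2r (mulr_ge0 C40 N0) nD.
  rewrite /a1; move: d1 d2 d3; move: (C4 A K * q^-1) => c4; clearbody M Nn; lra.
move: a1b; set x1 := \sum_(_ < _) _; set x2 := \sum_(_ < _) _; set x3 := \sum_(_ < _) _; set x4 := \sum_(_ < _) _.
rewrite -/Nn; move: (a1 *+ n) => y.
clearbody Nn M x1 x2 x3 x4; move: (C4 A K * q^-1) => c4; lra.
Qed.

End dual.

End model.

(** * Step approximation on uniform grids *)

Lemma gam_sq_le {R : realType} {N : nat} (A : 'M[R]_N) (f : 'I_N -> R) i :
  gam A f f i <= 4 * Ca A * \sum_j f j ^+ 2.
Proof.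
have S0 : 0 <= \sum_j f j ^+ 2 by apply: sumr_ge0 => j _; exact: sqr_ge0.
have fS j : f j ^+ 2 <= \sum_j f j ^+ 2.
  by rewrite (bigD1 j)//= lerDl; apply: sumr_ge0 => k _; exact: sqr_ge0.
apply: (@le_trans _ _ (\sum_j `|A j i| * (4 * \sum_j f j ^+ 2))); last first.
  rewrite -mulr_suml; have := ler_wpM2r (mulr_ge0 (ler0n R 4) S0) (col_le A i); lra.
apply: ler_sum => j _; apply: le_trans (ler_norm _) _.
rewrite -mulrA normrM; apply: ler_wpM2l => //.
rewrite -expr2 ger0_norm ?sqr_ge0//.
have := sqr_ge0 (f j + f i); have := fS j; have := fS i; rewrite sqrrB sqrrD; lra.
Qed.

Lemma archi_small {R : realType} (C e : R) : 0 <= C -> 0 < e ->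
  exists n0 : nat, forall n, (n0 <= n)%N -> (0 < n)%N -> C / n%:R <= e.
Proof.
move=> C0 e0; exists (Num.truncn (C / e)).+1 => n hn n0.
have nr : (0 : R) < n%:R by rewrite ltr0n.
rewrite ler_pdivrMr// mulrC -ler_pdivrMr//; apply: le_trans (ltW (truncnS_gt _)) _.
by rewrite ler_nat.
Qed.

Section model.
Context {d : measure_display} {Omega : measurableType d} {R : realType}
  {N : nat}.
Variables (P : probability Omega R) (T c : R) (A : 'M[R]_N).
Variables (X : R -> Omega -> 'I_N) (W : R -> Omega -> R).
Hypotheses (Pcomp : measure_is_complete P) (T0 : 0 < T)
  (hA : rate_matrix c A) (hW : brownian_motion P T W)
  (hX : markov_chain P T A X) (hXW : independent_processes P T X W).

Local Notation mu := (P \x lebesgue_measure)%E.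
Local Notation piG0 := (piG0 P X W).
Implicit Types (zeta phi lam I J : Omega -> R) (s t a b r : R) (z : @proc R N Omega)
  (e : @item R N Omega) (L : seq (@item R N Omega)).
Local Notation Xe := (Xext T X).
Local Notation nrm := (pnorm T A X).
Local Notation H s := <<s piG0 s >>.
Local Notation valid := (valid P T X W).
Local Notation H2 := (H2 P T A X).
Local Notation SI := (SI P T A X W).
Local Notation allv := (allv P T X W).

Section grid_approximation.
Variables (s r : R).
Hypotheses (s0 : 0 <= s) (sr : s < r) (rT : r <= T).

Definition step (n : nat) : R := (r - s) / n%:R.

Lemma step_gt0 n : (0 < n)%N -> 0 < step n.
Proof. by move=> n0; rewrite divr_gt0 ?subr_gt0// ltr0n. Qed.

Lemma tk_end n : (0 < n)%N -> tk s (step n) n = r.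
Proof.
by move=> n0; rewrite /tk /step mulrC divfK ?pnatr_eq0 -?lt0n//; ring.
Qed.

Definition grid_ok n (hh : nat -> option 'I_N -> Omega -> R) : Prop :=
  forall k o, (k < n)%N -> rv_in (H (tk s (step n) k)) (hh k o) /\ int2 P (hh k o).

(** Demanded on every sufficiently fine grid, not just along some sequence, because the mesh has to
    meet other smallness conditions at the same time. *)
Definition GA z : Prop := H2 (cutp s r z) /\
  forall eps, 0 < eps -> exists n0 : nat, forall n, (n0 <= n)%N -> (0 < n)%N ->
  exists hh, grid_ok n hh /\ \sum_(k < n) Iv mu (nrm (zd s (step n) hh z k)) <= eps.

Lemma H2_cell n z k : (0 < n)%N -> (k < n)%N -> H2 (cutp s r z) ->
  H2 (cutp (tk s (step n) k) (tk s (step n) k.+1) z).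
Proof.
move=> n0 kn hz; have D0 := step_gt0 n0.
have hs := tk_s s D0 k; have hn : tk s (step n) k.+1 <= r.
  by rewrite -(tk_end n0); exact: (tk_mono s D0).
by rewrite -(cutp_cut z hs hn); exact: H2_cutp.
Qed.

Lemma H2_zd n z hh k : (0 < n)%N -> (k < n)%N -> H2 (cutp s r z) -> grid_ok n hh ->
  H2 (zd s (step n) hh z k).
Proof.
move=> n0 kn hz hg; apply: (H2_lin T0 hA hX); first exact: H2_cell.
have D0 := step_gt0 n0.
apply: (H2_zit Pcomp T0 hW hX (s := tk s (step n) k)); split => //=.
- exact: tk_ge0.
- exact: tk_le.
- by apply: le_trans rT; rewrite -(tk_end n0); exact: (tk_mono s D0).
- by move=> o; exact: hg.
Qed.

Lemma GA_add z z' : GA z -> GA z' -> GA (zlin 1 1 z z').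
Proof.
move=> [hz h] [hz' h']; split; first by rewrite cutp_lin; exact: (H2_lin T0 hA hX).
move=> eps e0; have e4 : 0 < eps / 4 by rewrite divr_gt0.
have [n1 h1] := h _ e4; have [n2 h2] := h' _ e4; exists (maxn n1 n2) => n.
rewrite geq_max => /andP[a b] n0; have [hh [g1 c1]] := h1 n a n0; have [hh' [g2 c2]] := h2 n b n0.
exists (fun k o w => hh k o w + hh' k o w); split.
  move=> k o kn; have [? ?] := g1 k o kn; have [? ?] := g2 k o kn.
  by split; [exact: rv_inD|exact: int2D].
apply: (@le_trans _ _ (\sum_(k < n) (2 * Iv mu (nrm (zd s (step n) hh z k)) + 2 * Iv mu (nrm (zd s (step n) hh' z' k))))).
  apply: ler_sum => k _; have kn := ltn_ord k.
  have := Iv_nrm_young T0 hA hX ltr01 (H2_zd n0 kn hz g1) (H2_zd n0 kn hz' g2).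
  rewrite invr1 (_ : zlin 1 1 _ _ = zd s (step n) (fun k o w => hh k o w + hh' k o w) (zlin 1 1 z z') k)//.
  by apply/funext => o; apply/funext => p; rewrite /zd /zlin /cutp /zit /=; ring.
by rewrite big_split /= -!mulr_sumr; lra.
Qed.

Lemma GA_lim z : H2 (cutp s r z) ->
  (forall eps, 0 < eps -> exists z', GA z' /\ Iv mu (nrm (cutp s r (zlin 1 (-1) z z'))) <= eps) ->
  GA z.
Proof.
move=> hz h; split => // eps e0; have e4 : 0 < eps / 4 by rewrite divr_gt0.
have [z' [[hz' h'] c1]] := h _ e4; have [n1 h1] := h' _ e4; exists n1 => n a n0.
have [hh [g1 c2]] := h1 n a n0; exists hh; split => //.
have D0 := step_gt0 n0.
have hd : H2 (cutp s r (zlin 1 (-1) z z')) by rewrite cutp_lin; exact: (H2_lin T0 hA hX).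
apply: (@le_trans _ _ (\sum_(k < n) (2 * Iv mu (nrm (zd s (step n) hh z' k)) +
   2 * Iv mu (nrm (cutp (tk s (step n) k) (tk s (step n) k.+1) (zlin 1 (-1) z z')))))).
  apply: ler_sum => k _; have kn := ltn_ord k.
  have := Iv_nrm_young T0 hA hX ltr01 (H2_zd n0 kn hz' g1) (H2_cell n0 kn hd).
  rewrite invr1 (_ : zlin 1 1 _ _ = zd s (step n) hh z k)//.
  by apply/funext => o; apply/funext => p; rewrite /zd /zlin /cutp /zit /=; ring.
rewrite big_split /= -!mulr_sumr.
have id : int1 mu (fun p => ind s (tk s (step n) n) p.2 * nrm (zlin 1 (-1) z z') p).
  by rewrite tk_end//; apply: int1_eq hd.2 => p; rewrite nrm_cutp.
have e2 : \sum_(k < n) Iv mu (nrm (cutp (tk s (step n) k) (tk s (step n) k.+1) (zlin 1 (-1) z z'))) =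
   Iv mu (nrm (cutp s r (zlin 1 (-1) z z'))).
  rewrite (Iv_eq mu (nrm_cutp T A X s r _)) -{1}(tk_end n0) -(cells_sum D0 (leqnn n) id).
  by apply: eq_bigr => k _; apply: Iv_eq => p; rewrite nrm_cutp.
rewrite e2; lra.
Qed.

Lemma GA0 : GA (fun _ _ => 0).
Proof.
have e0 a b (w : @proc R N Omega) : (forall o p, w o p = 0) -> nrm w = fun=> 0.
  move=> h; apply/funext => p; rewrite /pnorm /pinner /gam !h mul0r add0r big1// => j _.
  by rewrite !h subrr mulr0.
split.
  rewrite (_ : cutp s r _ = fun _ _ => 0); first exact: proc0.
  by apply/funext => o; apply/funext => p; rewrite /cutp mulr0.
move=> eps e1; exists 0%N => n _ n0; exists (fun _ _ _ => 0); split.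
  by move=> k o kn; split; [exact: rv_in_cst|exact: int2_0].
rewrite big1 ?ltW// => k _.
rewrite (e0 0 0) ?Iv0// => o p; rewrite /zd /zlin /cutp /zit /=; ring.
Qed.

(** The grid misplaces an endpoint [a] only at times within one mesh after it. *)
Lemma grid_ind a u k n : (0 < n)%N -> tk s (step n) k < u <= tk s (step n) k.+1 ->
  ((a < u) != (a <= tk s (step n) k)) -> a < u <= a + step n.
Proof.
move=> n0; have D0 := step_gt0 n0; rewrite tkS => /andP[h1 h2].
case: (leP a (tk s (step n) k)) => h3; first by rewrite (le_lt_trans h3 h1).
by case: (ltP a u) => //= h4 _; rewrite (le_trans h2)// lerD2r ltW.
Qed.

(** A cell is kept when its left end lies in the interval of the item, so that the coefficient is
    known there. The error lives on two strips one mesh long and is dominated by the integrable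
    [Cq]. *)
Lemma GA_item e : valid s e -> GA (zit e).
Proof.
move=> he; have hz := H2_zit Pcomp T0 hW hX he; have [_ sa ab bT hio] := he.
split; first exact: H2_cutp.
move=> eps e0.
pose Cq w : R := io e None w ^+ 2 + 4 * Ca A * \sum_j io e (Some j) w ^+ 2.
have iC : int1 P Cq.
  apply: int1D; first exact: (hio None).2.2.
  by apply: int1Z; apply: int1_sum => j _; exact: (hio (Some j)).2.2.
have C0 w : 0 <= Cq w.
  rewrite addr_ge0 ?sqr_ge0// mulr_ge0 ?mulr_ge0 ?Ca_ge0//.
  by apply: sumr_ge0 => j _; exact: sqr_ge0.
have IC0 : 0 <= 2 * (r - s) * Iv P Cq.
  by rewrite mulr_ge0 ?Iv_ge0// mulr_ge0 ?subr_ge0// ltW.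
have [n1 hn1] := archi_small IC0 e0.
exists n1 => n n1n n0; have D0 := step_gt0 n0; pose D := step n.
exists (fun k o w => ((ia e <= tk s D k) && (tk s D k < ib e))%:R * io e o w).
have gok : grid_ok n (fun k o w => ((ia e <= tk s D k) && (tk s D k < ib e))%:R * io e o w).
  move=> k o kn; have [h1 h2] := hio o; split; last exact: int2Z.
  have [h|h] := leP (ia e) (tk s D k).
    by apply: rv_inZ; apply: rv_in_sub h1; exact: H_mono.
  rewrite (_ : (fun w => _) = fun=> 0); first exact: rv_in_cst.
  by apply/funext => w; rewrite mul0r.
split => //.
pose F (p : Omega * R) := ind (ia e) (ia e + D) p.2 * Cq p.1 + ind (ib e) (ib e + D) p.2 * Cq p.1.
have iF : int1 mu F by apply: int1D; exact: int1_strip.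
have F0 p : 0 <= F p by rewrite addr_ge0// mulr_ge0 ?ind_ge0.
have IF : Iv mu F = 2 * D * Iv P Cq.
  have hD a : a <= a + D by rewrite lerDl ltW.
  rewrite IvD; [|exact: int1_strip|exact: int1_strip].
  by rewrite !(Iv_strip (hD _) iC); ring.
apply: (@le_trans _ _ (\sum_(k < n) Iv mu (fun p => ind (tk s D k) (tk s D k.+1) p.2 * F p))).
  apply: ler_sum => k _; apply: Iv_le; first exact: (H2_zd n0 (ltn_ord k) (H2_cutp s r hz) gok).2.
    exact: mu_indM.
  move=> p; rewrite /zd; set b := (_ && _)%:R.
  set q := ind (tk s D k) (tk s D k.+1) p.2.
  have -> : nrm (zlin 1 (-1) (cutp (tk s (step n) k) (tk s (step n) k.+1) (zit e))
     (zit (Item (tk s (step n) k) (tk s (step n) k.+1) (fun o w => b * io e o w)))) p =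
     (q * (ind (ia e) (ib e) p.2 - b)) ^+ 2 *
       (io e None p.1 * io e None p.1 + gam A (fun j => io e (Some j) p.1) (fun j => io e (Some j) p.1) (Xe p)).
    rewrite [RHS]mulrDr expr2 -gamZ /pnorm /pinner /zlin /cutp /zit /= -/q; congr (_ + _); first by ring.
    by congr (gam _ _ _ _); apply/funext => j; ring.
  have qq : io e None p.1 * io e None p.1 + gam A (fun j => io e (Some j) p.1) (fun j => io e (Some j) p.1) (Xe p) <= Cq p.1.
    by rewrite -expr2 lerD2l; exact: gam_sq_le.
  have [q0|q0] := eqVneq q 0.
    by rewrite q0 mul0r expr0n mul0r mul0r.
  have pin : tk s D k < p.2 <= tk s D k.+1 by move: q0; rewrite /q /ind; case: (_ < _ <= _); rewrite ?eqxx.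
  have -> : q = 1 by rewrite /q /ind pin.
  rewrite !mul1r; apply: (@le_trans _ _ ((ind (ia e) (ib e) p.2 - b) ^+ 2 * Cq p.1)).
    by apply: ler_wpM2l qq; exact: sqr_ge0.
  rewrite /F -mulrDl; apply: ler_wpM2r => //.
  have ga := @grid_ind (ia e) p.2 k n n0 pin; have gb := @grid_ind (ib e) p.2 k n n0 pin.
  have i1 := ind_ge0 (ia e) (ia e + D) p.2; have i2 := ind_ge0 (ib e) (ib e + D) p.2.
  rewrite /b -/D in ga gb *.
  have [/andP[/eqP e1 /eqP e2]|h] := boolP (((ia e < p.2) == (ia e <= tk s D k)) && ((ib e < p.2) == (ib e <= tk s D k))).
    by rewrite {1}/ind (leNgt p.2 (ib e)) (ltNge (tk s D k) (ib e)) e1 e2 subrr expr0n addr_ge0.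
  apply: (@le_trans _ _ 1).
    rewrite {1}/ind; case: (_ < _ <= _); case: (_ && _);
      by rewrite ?subrr ?subr0 ?sub0r ?sqrrN ?expr1n ?expr0n ?ler01.
  move: h; rewrite negb_and => /orP[h|h].
    by rewrite {1}/ind (ga h) lerDl.
  by rewrite {2}/ind (gb h) lerDr.
have iF' : int1 mu (fun p => ind s (tk s D n) p.2 * F p) by exact: mu_indM.
rewrite (cells_sum D0 (leqnn n) iF').
apply: (@le_trans _ _ (Iv mu F)).
  apply: Iv_le => // p; rewrite -[leRHS]mul1r; apply: ler_wpM2r => //; exact: ind_le1.
rewrite IF; apply: le_trans (hn1 n n1n n0); rewrite /D /step.
by rewrite le_eqVlt; apply/orP; left; apply/eqP; ring.
Qed.

Lemma GA_ztot L : allv s L -> GA (ztot L).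
Proof.
elim: L => [_|e L ih [he hL]]; first by rewrite ztot_nil; exact: GA0.
by rewrite ztot_cons; apply: GA_add; [exact: GA_item|exact: ih].
Qed.

Lemma SI_GA I z : SI s I (cutp s r z) -> GA z.
Proof.
move=> [_ hz h]; apply: GA_lim => // eps e0; have [L [vL _ h2]] := h eps e0.
exists (ztot L); split; first exact: GA_ztot.
have hL := H2_ztot Pcomp T0 hA hW hX vL.
apply: le_trans h2.
have -> : cutp s r (zlin 1 (-1) z (ztot L)) = cutp s r (zlin 1 (-1) (cutp s r z) (ztot L)).
  by rewrite !cutp_lin cutp_cut.
have hLz := H2_lin T0 hA hX 1 (-1) hL hz.
apply: Iv_le; [|exact: hLz.2|].
  by apply: (H2_cutp s r _).2; exact: (H2_lin T0 hA hX).
move=> p; rewrite nrm_cutp nrmN -[leRHS]mul1r.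
by apply: ler_wpM2r; [exact: (nrm_ge0 T X hA)|exact: ind_le1].
Qed.

End grid_approximation.

End model.

(** * Comparison *)

Lemma small_factor {R : realType} (C e : R) : 0 <= C -> 0 < e -> exists2 q : R, 0 < q & q * C <= e.
Proof.
move=> C0 e0; have C1 : 0 < C + 1 by lra.
exists (e / (C + 1)); first exact: divr_gt0.
rewrite mulrAC ler_pdivrMr// ler_pM2l//; lra.
Qed.

Section model.
Context {d : measure_display} {Omega : measurableType d} {R : realType}
  {N : nat}.
Variables (P : probability Omega R) (T c : R) (A : 'M[R]_N).
Variables (X : R -> Omega -> 'I_N) (W : R -> Omega -> R).
Hypotheses (Pcomp : measure_is_complete P) (T0 : 0 < T)
  (hA : rate_matrix c A) (hW : brownian_motion P T W)
  (hX : markov_chain P T A X) (hXW : independent_processes P T X W).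

Local Notation mu := (P \x lebesgue_measure)%E.
Local Notation piG0 := (piG0 P X W).
Local Notation dW := (dW W).
Implicit Types (zeta phi lam I J : Omega -> R) (s t a b r : R) (z : @proc R N Omega)
  (e : @item R N Omega) (L : seq (@item R N Omega)).
Local Notation Xe := (Xext T X).
Local Notation nrm := (pnorm T A X).
Local Notation H s := <<s piG0 s >>.

Lemma measurable_atX (f : 'I_N -> Omega * measurableTypeR R -> R) :
  (forall i, measurable_fun setT (f i)) -> measurable_fun setT (fun p => f (Xe p) p).
Proof.
move=> mf; rewrite (_ : (fun p => _) = fun p => \sum_i dl i (Xe p) * f i p).
  by apply: measurable_sum => i; apply: measurable_funM; [exact: (measurable_Xe T0 hX (dl i))|exact: mf].
apply/funext => p; rewrite (bigD1 (Xe p))//= big1 ?addr0 => [|i ip].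
  by rewrite /dl eqxx mul1r.
by rewrite /dl eq_sym (negbTE ip) mul0r.
Qed.

Lemma measurable_pos : measurable_fun setT (@pos R).
Proof. by apply: measurable_maxr => //; exact: measurable_id. Qed.

Definition upj z p : R := \sum_j A j (Xe p) * pos (z (Some j) p - z (Some (Xe p)) p).
Definition dnj z p : R := \sum_j A j (Xe p) * neg (z (Some j) p - z (Some (Xe p)) p).

Lemma measurable_jumps (h : R -> R) z : measurable_fun setT h -> mproc z ->
  measurable_fun setT (fun p : Omega * measurableTypeR R =>
    \sum_j A j (Xe p) * h (z (Some j) p - z (Some (Xe p)) p)).
Proof.
move=> mh mz; apply: (measurable_atX (f := fun i p => \sum_j A j i * h (z (Some j) p - z (Some i) p))) => i.
apply: measurable_sum => j; apply: measurable_funM => //.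
by apply: (measurableT_comp mh); exact: measurable_funB.
Qed.

Lemma jumps_ge0 (h : R -> R) z p : (forall x, 0 <= h x) -> h 0 = 0 ->
  0 <= \sum_j A j (Xe p) * h (z (Some j) p - z (Some (Xe p)) p).
Proof.
move=> h0 h00; apply: sumr_ge0 => j _; have [->|ji] := eqVneq j (Xe p).
  by rewrite subrr h00 mulr0.
by rewrite mulr_ge0// (rate_ge0 hA).
Qed.

Lemma upj_ge0 z p : 0 <= upj z p.
Proof. by apply: jumps_ge0; [exact: pos_ge0|rewrite /pos maxxx]. Qed.

Lemma upj_sq z p : upj z p ^+ 2 <= 4 * (Ca A + 1) * nrm z p.
Proof.
have U0 := upj_ge0 z p; have cA := Ca_ge0 A.
have c1 : 0 < 2 * (Ca A + 1) by lra.
have h : upj z p <= \sum_j A j (Xe p) * `|z (Some j) p - z (Some (Xe p)) p|.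
  apply: ler_sum => j _; have [->|ji] := eqVneq j (Xe p).
    by rewrite subrr normr0 /pos maxxx.
  apply: ler_wpM2l; first exact: (rate_ge0 hA).
  by rewrite /pos ge_max normr_ge0 ler_norm.
(* This weight makes the first term of [sum_young] at most half of [upj z p ^+ 2], which is then
   absorbed on the left. *)
have q0 : 0 < (2 * (Ca A + 1))^-1 by rewrite invr_gt0.
have := sum_young hA (fun j => z (Some j) p) (Xe p) q0 U0.
rewrite -mulr_suml invrK; have := ler_wpM2r U0 h; rewrite -expr2 => h1 h2.
have h3 : (2 * (Ca A + 1))^-1 * upj z p ^+ 2 * Ca A <= upj z p ^+ 2 / 2.
  rewrite mulrC mulrA [leRHS]mulrC; apply: ler_wpM2r; first exact: sqr_ge0.
  rewrite ler_pdivrMr//; lra.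
have h4 : gam A (fun j => z (Some j) p) (fun j => z (Some j) p) (Xe p) <= nrm z p.
  by rewrite /pnorm /pinner lerDr -expr2 sqr_ge0.
have h5 := ler_wpM2l (ltW c1) h4; lra.
Qed.

(** * Comparison and strict comparison for one linear-type equation *)

Section comparison.
Variables (t0 t1 K : R) (V : R -> Omega -> R) (g : Omega * R -> R) (z : @proc R N Omega).
Hypotheses (t00 : 0 <= t0) (t01 : t0 <= t1) (t1T : t1 <= T) (K1 : 1 <= K)
  (hB : BE P T A X W t0 t1 V g z).
(** The excess of the drift over its lower bound. [hbal] is the form in which balancedness is used:
    nonnegative, and zero only in the absence of upward jumps. *)
Definition slack p : R := g p + K * `|z None p| + upj z p + K * dnj z p.
Hypothesis hbal : {ae mu, forall p, t0 < p.2 <= t1 -> 0 <= slack p /\ (slack p = 0 -> upj z p = 0)}.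

Let g0 p := ind t0 t1 p.2 * g p.
Let z0 := cutp t0 t1 z.

(* The part of the defect in the drift bound left over when jumps upwards are
   given the factor 1/m instead of 0. *)
Definition em (m : R) (p : Omega * R) : R := ind t0 t1 p.2 *
  pos (m^-1 * upj z0 p - pos (g0 p + K * `|z0 None p| + upj z0 p + K * dnj z0 p)).

Lemma em_ge0 m p : 0 <= em m p.
Proof. by rewrite mulr_ge0 ?ind_ge0 ?pos_ge0. Qed.

Lemma ind01 (p : Omega * R) : t0 < p.2 <= t1 -> ind t0 t1 p.2 = 1.
Proof. by rewrite /ind => ->. Qed.

Lemma slack_cut p : t0 < p.2 <= t1 ->
  g0 p + K * `|z0 None p| + upj z0 p + K * dnj z0 p = slack p /\ upj z0 p = upj z p.
Proof.
move=> /ind01 i1; rewrite /slack /g0 /z0 /upj /dnj /cutp i1 !mul1r.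
have e (h : R -> R) : \sum_j A j (Xe p) * h (1 * z (Some j) p - z (Some (Xe p)) p) =
  \sum_j A j (Xe p) * h (z (Some j) p - z (Some (Xe p)) p).
  by apply: eq_bigr => j _; rewrite !mul1r.
by rewrite (e (@pos R)) (e (@neg R)).
Qed.

Lemma em_le m p : 0 < m -> m * em m p <= upj z0 p.
Proof.
move=> m0; rewrite /em mulrCA.
have h : m * pos (m^-1 * upj z0 p - pos (g0 p + K * `|z0 None p| + upj z0 p + K * dnj z0 p)) <= upj z0 p.
  rewrite mulrC -ler_pdivlMr// mulrC {1}/pos ge_max; apply/andP; split.
    by rewrite mulr_ge0 ?upj_ge0// invr_ge0 ltW.
  by rewrite lerBlDr lerDl pos_ge0.
apply: le_trans h; rewrite -[leRHS]mul1r; apply: ler_wpM2r; last exact: ind_le1.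
by rewrite mulr_ge0 ?pos_ge0// ltW.
Qed.

Lemma measurable_em m : measurable_fun setT (em m : Omega * measurableTypeR R -> R).
Proof.
have [_ hg hz _] := hB; have mg := int2_measurable hg; have mz := hz.1.
have mU := measurable_jumps measurable_pos mz.
have mL := measurable_jumps (@measurable_neg R) mz.
apply: measurable_funM; first exact: mu_ind.
apply: (measurableT_comp measurable_pos); apply: measurable_funB; first exact: measurable_funM.
apply: (measurableT_comp measurable_pos); apply: measurable_funD; last exact: measurable_funM.
apply: measurable_funD => //; apply: measurable_funD => //.
by apply: measurable_funM => //; exact: measurableT_comp (mz None).
Qed.

Lemma em_sq m p : 0 < m -> (m * em m p) ^+ 2 <= 4 * (Ca A + 1) * nrm z0 p.
Proof.
move=> m0; apply: le_trans (upj_sq z0 p); rewrite ler_pXn2r ?nnegrE ?upj_ge0//.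
  exact: em_le.
by rewrite mulr_ge0 ?em_ge0// ltW.
Qed.

Lemma int1_em m : 0 < m -> int1 mu (fun p => (m * em m p) ^+ 2).
Proof.
move=> m0; have [_ _ hz _] := hB.
apply: (int1_le _ (int1Z (4 * (Ca A + 1)) hz.2)).
  by apply: measurable_funX; apply: measurable_funM => //; exact: measurable_em.
by move=> p; rewrite ger0_norm ?sqr_ge0//; exact: em_sq.
Qed.

Lemma int2_em m : 0 < m -> int2 mu (em m).
Proof.
move=> m0; split; first exact: measurable_em.
apply: int1_eq (int1Z (m^-1 ^+ 2) (int1_em m0)) => p.
by rewrite exprMn mulrA -exprMn mulVf ?gt_eqF// expr1n mul1r.
Qed.

(** [m * em m] is dominated by the upward jumps and tends to 0 pointwise: a positive slack beats
    [upj / m] for large [m], and a zero slack forces [upj] to vanish. *)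
Lemma em_small eps : 0 < eps -> exists2 m : R, 1 <= m & Iv mu (fun p => (m * em m p) ^+ 2) <= eps.
Proof.
move=> e0; have [_ _ hz _] := hB.
have cv : Iv mu (fun p => (n.+1%:R * em n.+1%:R p) ^+ 2) @[n --> \oo] --> Iv mu (fun=> 0).
  apply: (@dct _ _ _ mu (fun n p => (n.+1%:R * em n.+1%:R p) ^+ 2) (fun=> 0) (fun p => 4 * (Ca A + 1) * nrm z0 p)).
  - by move=> n; apply: measurable_funX; apply: measurable_funM => //; exact: measurable_em.
  - exact: measurable_cst.
  - exact: int1Z hz.2.
  - by move=> n p; rewrite ger0_norm ?sqr_ge0//; exact: em_sq.
  apply: ae_imp hbal => p hp; apply: cvg_near_cst.
  have [pin|pout] := boolP (t0 < p.2 <= t1); last first.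
    by exists 0%N => // n _; rewrite /em /ind (negbTE pout) mul0r mulr0 expr0n.
  have [s0 sU] := hp pin; have [e1 e2] := slack_cut pin.
  rewrite /em.
  have ps : pos (slack p) = slack p by exact/max_idPr.
  have [s1|s1] := eqVneq (slack p) 0.
    exists 0%N => // n _; rewrite /= e1 e2 ps (sU s1) s1 mulr0 subrr /pos maxxx !mulr0 expr0n//.
  have s2 : 0 < slack p by rewrite lt_neqAle eq_sym s1.
  have [n0 hn0] := archi_small (upj_ge0 z p) s2; exists n0 => // n hn.
  rewrite /= e1 e2 ps (_ : pos _ = 0) ?mulr0 ?expr0n//.
  by apply/max_idPl; rewrite subr_le0 mulrC; apply: hn0 => //; exact: leq_trans hn (leqnSn n).
rewrite Iv0 in cv; have /cvgrPdist_le/(_ eps e0) [n _ /(_ n (leqnn n))] := cv.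
rewrite sub0r normrN => h; exists n.+1%:R; first by rewrite ler1n.
by apply: le_trans h; exact: ler_norm.
Qed.

Lemma em_low m : 1 <= m -> {ae mu, forall p, t0 < p.2 <= t1 ->
   drift_low A K m (Xe p) (z None p) (fun j => z (Some j) p) - em m p <= g p}.
Proof.
move=> m1; apply: ae_imp hbal => p hp pin; have [s0 _] := hp pin; have [e1 e2] := slack_cut pin.
rewrite /em (ind01 pin) mul1r e1 e2 (_ : pos (slack p) = slack p); last exact/max_idPr.
have h : m^-1 * upj z p - slack p <= pos (m^-1 * upj z p - slack p) by rewrite /pos le_max lexx orbT.
have -> : drift_low A K m (Xe p) (z None p) (fun j => z (Some j) p) =
   - K * `|z None p| - (1 - m^-1) * upj z p - K * dnj z p.
  rewrite /drift_low /upj /dnj !mulr_sumr -addrA -opprD -big_split /=; congr (_ - _).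
  by apply: eq_bigr => j _; ring.
move: h; rewrite /slack; lra.
Qed.

(** The error has to be a small multiple of [1 / m], since the density itself is only of order
    [1 / m] after a change of state. The choices depend on each other in the order [th], [m], [q],
    mesh. *)
Lemma dual_final s r B dlt : t0 <= s -> s < r -> r <= t1 -> H s B -> 0 < dlt ->
  exists2 m : R, 1 <= m & exists n0 : nat, forall n, (n0 <= n)%N -> (0 < n)%N ->
  exists hh, [/\ grid_ok P X W s r n hh, C2 A K * step s r n <= (4 * m)^-1 &
   Iv P (fun w => Gam A X W s (step s r n) (al K hh) (cc X s (step s r n) K m hh) B n w * V r w) - dlt / m
   <= Iv P (fun w => \1_B w * V s w)].
Proof.
move=> ts sr rt HB d0.
have s0 : 0 <= s by exact: le_trans ts.
have rT : r <= T by exact: le_trans t1T.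
have hB' := BE_restrict ts rt hB.
pose M := expR (C1 A K * T); pose M1 := T * M.
have M10 : 0 <= M1 by rewrite mulr_ge0 ?expR_ge0// ltW.
have d4 : 0 < dlt / 4 by rewrite divr_gt0.
have [th th0 hth] := small_factor M10 d4.
have [m m1 hm] := em_small (mulr_gt0 th0 d4).
have m0 : 0 < m by exact: lt_le_trans m1.
(* One eighth of the budget [dlt / m]: the two terms carrying [th / m] use two eighths each; the
   weight [q], the step approximation and the mesh use one each. *)
exists m => //; pose d' := dlt / (8 * m).
have d'0 : 0 < d' by rewrite divr_gt0// mulr_gt0.
have [hV hg hz hbe] := hB'.
pose G2 := Iv mu (fun p => ind s r p.2 * g p ^+ 2).
pose Z2 := Iv mu (nrm (cutp s r z)).
have G20 : 0 <= G2 by apply: Iv_ge0 => p; rewrite mulr_ge0 ?ind_ge0 ?sqr_ge0.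
have Z20 : 0 <= Z2 by apply: Iv_ge0 => p; exact: (nrm_ge0 T X hA).
have K0 : 0 <= K := le_trans ler01 K1; have cA0 := Ca_ge0 A.
have C10 := C1_ge0 A K1; have C50 : 0 <= C5 A K by rewrite /C5 mulr_ge0 ?addr_ge0// mulr_ge0.
have C40 : 0 <= C4 A K by rewrite /C4 addr_ge0 ?addr_ge0// mulr_ge0// mulr_ge0.
have C20 := C2_ge0 A K1.
have Q0 : 0 <= (C1 A K + C5 A K) * M1 + 2 * K * (G2 + Z2).
  exact: addr_ge0 (mulr_ge0 (addr_ge0 C10 C50) M10) (mulr_ge0 (mulr_ge0 (ler0n R 2) K0) (addr_ge0 G20 Z20)).
have CmK : 0 <= Cm K m by exact: Cm_ge0.
have [q q0 hq] := small_factor Q0 d'0; have q1 : 0 < q^-1 by rewrite invr_gt0.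
pose Y := C4 A K * q^-1 * (Ca A * M1 + T * (T * Cm K m * M)) + q^-1 * G2.
have Y0 : 0 <= Y.
  have q1' := ltW q1; have T0' := ltW T0.
  apply: addr_ge0 (mulr_ge0 q1' G20); apply: mulr_ge0 (mulr_ge0 C40 q1') _.
  exact: addr_ge0 (mulr_ge0 cA0 M10) (mulr_ge0 T0' (mulr_ge0 (mulr_ge0 T0' CmK) (expR_ge0 _))).
have sr0 : 0 <= r - s by rewrite subr_ge0 ltW.
have [n1 hn1] := archi_small (mulr_ge0 sr0 Y0) d'0.
have i4 : 0 < (4 * m)^-1 by rewrite invr_gt0 mulr_gt0.
have [n2 hn2] := archi_small (mulr_ge0 sr0 C20) i4.
have [I [SI1 _]] := hbe s r (lexx s) (ltW sr) (lexx r).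
have [_ hGA] := SI_GA Pcomp T0 hA hW hX s0 sr rT SI1.
have k20 : 0 <= 2 * K * q^-1 by rewrite mulr_ge0 ?mulr_ge0// ltW.
have [e' e'0 he'] := small_factor k20 d'0.
have [n3 hn3] := hGA e' e'0.
exists (maxn n1 (maxn n2 n3)) => n; rewrite !geq_max => /and3P[a1 a2 a3] n0.
have [hh [gok herr]] := hn3 n a3 n0; exists hh.
have D0 := step_gt0 sr n0; set D := step s r n in D0 herr *.
have eD : D = (r - s) / n%:R by [].
have Ds : C2 A K * D <= (4 * m)^-1.
  by apply: le_trans (hn2 n a2 n0); rewrite eD le_eqVlt; apply/orP; left; apply/eqP; ring.
split => //.
have en : tk s D n = r by exact: tk_end.
have nT : tk s D n <= T by rewrite en.
have hrv k o : (k < n)%N -> rv_in (H (tk s D k)) (hh k o) by move=> kn; have [] := gok k o kn.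
have hi2 k o : (k < n)%N -> int2 P (hh k o) by move=> kn; have [] := gok k o kn.
have hB'' : BE P T A X W s (tk s D n) V g z by rewrite en.
have ei : int2 mu (fun p => ind s (tk s D n) p.2 * em m p) by apply: mu_indM2; exact: int2_em.
have hl : {ae mu, forall p, s < p.2 <= tk s D n ->
    drift_low A K m (Xe p) (z None p) (fun j => z (Some j) p) - em m p <= g p}.
  rewrite en; apply: ae_imp (em_low m1) => p hp /andP[b1 b2]; apply: hp.
  by rewrite (le_lt_trans ts b1) (le_trans b2 rt).
have q'0 : 0 < th / m by rewrite divr_gt0.
have := dual_bound Pcomp T0 hA hW hX hXW s0 D0 nT K1 m1 HB Ds hrv hi2 hB'' (em_ge0 m) ei hl q0 q'0.
rewrite en -/M; apply: le_trans; rewrite lerD2l lerN2.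
have mm : m * m^-1 = 1 by rewrite mulfV ?gt_eqF.
have mV : 0 < m^-1 by rewrite invr_gt0.
have b1 : (th / m) * M1 <= dlt / 4 / m by have := ler_wpM2r (ltW mV) hth; lra.
have b2 : (th / m)^-1 * Iv mu (fun p => ind s r p.2 * em m p ^+ 2) <= dlt / 4 / m.
  have c1 : Iv mu (fun p => ind s r p.2 * em m p ^+ 2) <= m^-1 ^+ 2 * (th * (dlt / 4)).
    apply: (@le_trans _ _ (m^-1 ^+ 2 * Iv mu (fun p => (m * em m p) ^+ 2))); last first.
      by apply: ler_wpM2l hm; exact: sqr_ge0.
    rewrite -IvZ; last exact: int1_em.
    apply: Iv_le; [exact: mu_indM (int2_em m0).2|exact: int1Z (int1_em m0)|].
    move=> p; have -> : m^-1 ^+ 2 * (m * em m p) ^+ 2 = em m p ^+ 2.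
      by rewrite -exprMn mulrA mulVf ?gt_eqF// mul1r.
    by rewrite -[leRHS]mul1r; apply: ler_wpM2r; [exact: sqr_ge0|exact: ind_le1].
  apply: le_trans (ler_wpM2l _ c1) _; first by rewrite invr_ge0 ltW.
  by rewrite le_eqVlt; apply/orP; left; apply/eqP; field; rewrite !gt_eqF.
have b3' : 2 * K * q^-1 * \sum_(k < n) Iv mu (nrm (zd s D hh z k)) <= d'.
  by apply: le_trans (ler_wpM2l k20 herr) _; rewrite mulrC.
have b4 : Y * D <= d'.
  by apply: le_trans (hn1 n a1 n0); rewrite eD le_eqVlt; apply/orP; left; apply/eqP; ring.
have d8 : dlt / m = 8 * d' by rewrite /d'; field; rewrite gt_eqF.
have d4' : dlt / 4 / m = 2 * d' by rewrite /d'; field; rewrite gt_eqF.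
rewrite -/G2 -/Z2 d8; rewrite d4' in b1 b2; move: hq b1 b2 b3' b4; rewrite /Y /M1.
set x1 := Iv mu (fun p => _ * em m p ^+ 2); set x2 := \sum_(k < n) _.
move: (th / m) ((th / m)^-1) (q^-1) => y1 y2 y3.
clearbody x1 x2 G2 Z2 M D d'; move: (C4 A K) (C1 A K) (C5 A K) (Cm K m) (Ca A) => c4 c1 c5 cm ca; lra.
Qed.

Lemma neg_part (x y q : R) : 0 < q -> 0 <= y -> - (q * y ^+ 2 + q^-1 * neg x ^+ 2) <= x * y.
Proof.
move=> q0 y0; have h := young_mul y (neg x) q0.
rewrite (ger0_norm y0) (ger0_norm (neg_ge0 x)) in h.
have hx : - neg x <= x by rewrite lerNl /neg le_max lexx orbT.
have := ler_wpM2r y0 hx; lra.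
Qed.

(** Tested on the event [B] that [V s] is negative. In the dual lower bound [V r] is nonnegative, so
    only the negative part of the density hurts, and it vanishes with the mesh. *)
Lemma comparison s r : t0 <= s -> s < r -> r <= t1 -> {ae P, forall w, 0 <= V r w} ->
  {ae P, forall w, 0 <= V s w}.
Proof.
move=> ts sr rt Vr; have [hV _ _ _] := hB.
have s0 : 0 <= s by exact: le_trans ts.
have sT : s <= T by apply: le_trans (ltW sr) (le_trans rt t1T).
have [rs is_] := hV s (introT andP (conj ts (le_trans (ltW sr) rt))).
have [rr ir] := hV r (introT andP (conj (le_trans ts (ltW sr)) rt)).
pose B := [set w | V s w < 0].
have HB : H s B by apply: rv_in_lt => //; exact: rv_in_cst.
have rB : rv_in (H s) (\1_B : Omega -> R) by exact: rv_in_indic.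
have mB : measurable B by exact: (pi_sub Pcomp hW hX sT).
have iBV : int2 P (fun w => \1_B w * V s w) by exact: int2_set.
have BV0 w : \1_B w * V s w <= 0.
  rewrite indicE; case: (boolP (w \in B)) => [/set_mem h|_]; last by rewrite mul0r.
  by rewrite mul1r; exact: ltW.
have i1 : int1 P (fun w => \1_B w * V s w) by exact: int1_set (int1_eq (fun w => mulr1 _) (int2M is_ (int2_cst P 1))).
suff E0 : 0 <= Iv P (fun w => \1_B w * V s w).
  have h0 : Iv P (fun w => - (\1_B w * V s w)) = 0.
    apply/eqP; rewrite eq_le Iv_ge0 ?andbT => [|w]; last by rewrite oppr_ge0.
    by rewrite IvN// oppr_le0.
  have hp w : 0 <= - (\1_B w * V s w) by rewrite oppr_ge0.
  apply: ae_imp (Iv_eq0_ae (int1N i1) hp h0) => w /eqP; rewrite oppr_eq0 => /eqP e.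
  rewrite leNgt; apply/negP => Vs; move: e; rewrite indicE mem_set// mul1r => e.
  by rewrite e ltxx in Vs.
apply/ler_addgt0Pr => eps e0; rewrite -lerBlDr sub0r.
have e3 : 0 < eps / 3 by rewrite divr_gt0.
have [m m1 [n0 hn]] := dual_final ts sr rt HB e3.
have V20 : 0 <= Iv P (fun w => V r w ^+ 2) by apply: Iv_ge0 => w; exact: sqr_ge0.
have [q q0 hq] := small_factor V20 e3; have q1 : 0 < q^-1 by rewrite invr_gt0.
pose Y := T * Cm K m * expR (C1 A K * T).
have CmK : 0 <= Cm K m by exact: Cm_ge0.
have Y0' : 0 <= Y := mulr_ge0 (mulr_ge0 (ltW T0) CmK) (expR_ge0 _).
have Y0 : 0 <= q^-1 * Y := mulr_ge0 (ltW q1) Y0'.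
have sr0 : 0 <= r - s by rewrite subr_ge0 ltW.
have [n1 hn1] := archi_small (mulr_ge0 sr0 Y0) e3.
pose n := (maxn n0 n1).+1.
have nn0 : (n0 <= n)%N by rewrite /n leqW// leq_maxl.
have [hh [gok Ds hd]] := hn n nn0 isT.
have nn : (0 < n)%N by [].
have rT : r <= T by exact: le_trans t1T.
have D0 := step_gt0 sr nn; set D := step s r n in D0 Ds hd.
have nT : tk s D n <= T by rewrite tk_end.
have hrv k o : (k < n)%N -> rv_in (H (tk s D k)) (hh k o) by move=> kn; have [] := gok k o kn.
have [rG iG _] := Gam_spec Pcomp T0 hA hW hX hXW s0 D0 nT K1 (al_rv K hrv) (al_le hh K1)
  (cc_rv K m s0 D0 nT hrv) (cc_le X s D hh K1 m1) HB (leqnn n).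
have [iN _] := Gam_neg Pcomp T0 hA hW hX hXW s0 D0 nT K1 (al_rv K hrv) (al_le hh K1)
  (cc_rv K m s0 D0 nT hrv) (cc_le X s D hh K1 m1) (cc_X X s D K m hh) HB m1 (cc_lo X s D hh K1 m1) Ds (leqnn n).
have bN := Gam_neg_bound Pcomp T0 hA hW hX hXW s0 D0 nT K1 (al_rv K hrv) (al_le hh K1)
  (cc_rv K m s0 D0 nT hrv) (cc_le X s D hh K1 m1) (cc_X X s D K m hh) HB m1 (cc_lo X s D hh K1 m1) Ds (leqnn n).
set Ga := Gam _ _ _ _ _ _ _ _ n in hd iG iN bN.
have h1 : - (q * Iv P (fun w => V r w ^+ 2) + q^-1 * Iv P (fun w => neg (Ga w) ^+ 2)) <= Iv P (fun w => Ga w * V r w).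
  have il := int1_lin2 q q^-1 ir.2 iN.2.
  rewrite -(Iv_lin2 _ _ ir.2 iN.2) -IvN//.
  apply: Iv_le_ae (int1N il) (int2M iG ir) _.
  by apply: ae_imp Vr => w hw; exact: neg_part.
have h2 := ler_wpM2l (ltW q1) bN.
have h3 : q^-1 * (T * Cm K m * expR (C1 A K * T) * D) <= eps / 3.
  apply: le_trans (hn1 n _ nn); last by rewrite leqW// leq_maxr.
  by rewrite /D /step /Y le_eqVlt; apply/orP; left; apply/eqP; ring.
have h4 : eps / 3 / m <= eps / 3.
  by rewrite ler_pdivrMr ?(lt_le_trans ltr01 m1)// ler_peMr// ltW.
lra.
Qed.

Lemma int1_bool (b : Omega -> bool) : measurable [set w | b w] -> int1 P (fun w => (b w)%:R : R).
Proof.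
move=> mb; apply: (int1_le _ (int1_cst P 1)).
  rewrite (_ : (fun w => _) = \1_[set w | b w]); first exact: measurable_indic.
  by apply/funext => w; rewrite indicE; case: (boolP (b w)) => h; [rewrite mem_set|rewrite memNset//=; exact/negP].
by move=> w; rewrite ger0_norm ?ler0n// -[1]/(1%:R) ler_nat; case: (b w).
Qed.

Lemma mset_lt (f h : Omega -> R) : measurable_fun setT f -> measurable_fun setT h ->
  measurable [set w | f w < h w].
Proof. by move=> mf mh; rewrite -[X in measurable X]setTI; exact: measurable_fun_ltr. Qed.

Lemma mset_le (f h : Omega -> R) : measurable_fun setT f -> measurable_fun setT h ->
  measurable [set w | f w <= h w].
Proof. by move=> mf mh; rewrite -[X in measurable X]setTI; exact: measurable_fun_ler. Qed.

(** Dominated convergence along the levels [1 / n]. It provides a uniform lower bound for the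
    positive values of [V r], outside a set of small probability. *)
Lemma level_small (f : Omega -> R) eps : measurable_fun setT f -> 0 < eps ->
  exists2 eta : R, 0 < eta & Iv P (fun w => ((0 < f w) && (f w <= eta))%:R) <= eps.
Proof.
move=> mf e0.
have mb eta : measurable [set w | (0 < f w) && (f w <= eta)].
  rewrite (_ : [set w | _] = [set w | 0 < f w] `&` [set w | f w <= eta]).
    by apply: measurableI; [exact: mset_lt|exact: mset_le].
  by apply/seteqP; split => w /= => [/andP//|[-> ->]].
have cv : Iv P (fun w => ((0 < f w) && (f w <= n.+1%:R^-1))%:R) @[n --> \oo] --> Iv P (fun=> 0).
  apply: (@dct _ _ _ P (fun n w => ((0 < f w) && (f w <= n.+1%:R^-1))%:R) (fun=> 0) (fun=> 1)).
  - by move=> n; exact: int1_measurable (int1_bool (mb _)).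
  - exact: measurable_cst.
  - exact: int1_cst.
  - by move=> n w; rewrite ger0_norm ?ler0n// -[1]/(1%:R) ler_nat; case: (_ && _).
  apply: ae_all => w; apply: cvg_near_cst; have [h|h] := ltP 0 (f w); last by exists 0%N.
  have [n0 hn0] := small_inv h; exists n0 => // n hn /=.
  by rewrite leNgt hn0.
rewrite Iv0 in cv; have /cvgrPdist_le/(_ eps e0) [n _ /(_ n (leqnn n))] := cv.
rewrite sub0r normrN => h; exists n.+1%:R^-1; first by rewrite invr_gt0.
by apply: le_trans h; exact: ler_norm.
Qed.

(** The tangent at [k] lies below the convex function [1 / y]; it allows the inverse of [Yp] to be
    bounded below through the mean of [Yp] alone. *)
Lemma inv_tangent (y k : R) : 0 < y -> 0 < k -> 2 / k - y / k ^+ 2 <= y^-1.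
Proof.
move=> y0 k0; rewrite -subr_ge0.
have -> : y^-1 - (2 / k - y / k ^+ 2) = y * (y^-1 - k^-1) ^+ 2 by field; rewrite !gt_eqF.
by rewrite mulr_ge0 ?sqr_ge0// ltW.
Qed.

(** On [B], where [V s] vanishes, [dual_final] bounds the mean of [Gam V_r] by [dlt / m], while
    [Gam] is at least [1 / (4 m Y)] outside rare events; so [V r > eta] is improbable on [B]. Two or
    more changes of state form the one exceptional event that a finer mesh does not remove, whence
    the quadratic term. *)
Lemma strict_step s r eps : t0 <= s -> s < r -> r <= t1 ->
  {ae P, forall w, 0 <= V r w} -> 0 < eps ->
  Iv P (fun w => ((V s w == 0) && (0 < V r w))%:R) <= (Ca A * (r - s)) ^+ 2 + eps.
Proof.
move=> ts sr rt Vr e0; have [hV _ _ _] := hB.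
have s0 : 0 <= s by exact: le_trans ts.
have rT : r <= T by exact: le_trans t1T.
have sT : s <= T by apply: le_trans (ltW sr) rT.
have [rs is_] := hV s (introT andP (conj ts (le_trans (ltW sr) rt))).
have [rr ir] := hV r (introT andP (conj (le_trans ts (ltW sr)) rt)).
have mVs := is_.1; have mVr := ir.1.
have rc (x : R) : rv_in (H s) (fun=> x) by exact: rv_in_cst.
pose B := [set w | V s w = 0].
have HB : H s B by exact: (rv_in_eq rs (rc 0)).
have mB : measurable B by exact: (pi_sub Pcomp hW hX sT).
have e4 : 0 < eps / 4 by rewrite divr_gt0.
have [eta eta0 heta] := level_small mVr e4.
pose M3 := expR (C3 T A K * T); have M30 : 0 < M3 by exact: expR_gt0.
(* The tangent point for [inv_tangent]. Together with [dlt] it makes each of the two errors in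
   [main] equal to [eps / 4] times the common factor [w0 * (2 / kap)]. *)
pose kap := 2 * M3 / eps.
have kap0 : 0 < kap by rewrite divr_gt0// mulr_gt0.
pose dlt := eta * eps / (16 * kap).
have d0 : 0 < dlt by apply: divr_gt0; apply: mulr_gt0.
have [m m1 [n0 hn]] := dual_final ts sr rt HB d0.
have m0 : 0 < m by exact: lt_le_trans m1.
have dm0 : 0 < dlt / m / 2 by rewrite divr_gt0// divr_gt0.
have V20 : 0 <= Iv P (fun w => V r w ^+ 2) by apply: Iv_ge0 => w; exact: sqr_ge0.
have [q q0 hq] := small_factor V20 dm0; have q1 : 0 < q^-1 by rewrite invr_gt0.
pose Y := T * Cm K m * expR (C1 A K * T).
have CmK : 0 <= Cm K m by exact: Cm_ge0.
have Y0' : 0 <= Y := mulr_ge0 (mulr_ge0 (ltW T0) CmK) (expR_ge0 _).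
have Y0 : 0 <= q^-1 * Y := mulr_ge0 (ltW q1) Y0'.
have sr0 : 0 <= r - s by rewrite subr_ge0 ltW.
have [n1 hn1] := archi_small (mulr_ge0 sr0 Y0) dm0.
pose c64 := 64 * (4 * m * K) ^+ 4.
have K0 : 0 <= K := le_trans ler01 K1.
have c640 : 0 <= c64 by rewrite mulr_ge0// exprn_ge0// mulr_ge0// mulr_ge0// ltW.
have [n2 hn2] := archi_small (mulr_ge0 (sqr_ge0 (r - s)) c640) e4.
pose n := (maxn n0 (maxn n1 n2)).+1.
have nn0 : (n0 <= n)%N by rewrite /n leqW// leq_maxl.
have nn1 : (n1 <= n)%N by rewrite /n leqW// leq_max leq_maxl orbT.
have nn2 : (n2 <= n)%N by rewrite /n leqW// leq_max leq_maxr orbT.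
have [hh [gok Ds hd]] := hn n nn0 isT.
have nn : (0 < n)%N by [].
have nr : (0 : R) < n%:R by rewrite ltr0n.
have D0 := step_gt0 sr nn; set D := step s r n in D0 Ds hd.
have eD : n%:R * D = r - s by rewrite /D /step mulrC divfK ?gt_eqF.
have nT : tk s D n <= T by rewrite tk_end.
have hrv k o : (k < n)%N -> rv_in (H (tk s D k)) (hh k o) by move=> kn; have [] := gok k o kn.
have arv k : (k < n)%N -> rv_in (H (tk s D k)) (al K hh k) by exact: al_rv.
have crv k j : (k < n)%N -> rv_in (H (tk s D k)) (cc X s D K m hh k j) by exact: cc_rv.
have ale := al_le hh K1; have cle := cc_le X s D hh K1 m1; have clo := cc_lo X s D hh K1 m1.
have cX := cc_X X s D K m hh.
have [_ iG _] := Gam_spec Pcomp T0 hA hW hX hXW s0 D0 nT K1 arv ale crv cle HB (leqnn n).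
have [iN _] := Gam_neg Pcomp T0 hA hW hX hXW s0 D0 nT K1 arv ale crv cle cX HB m1 clo Ds (leqnn n).
have bN := Gam_neg_bound Pcomp T0 hA hW hX hXW s0 D0 nT K1 arv ale crv cle cX HB m1 clo Ds (leqnn n).
have glow w := @Gam_low _ _ _ _ _ _ _ _ W T0 hX s D K n (al K hh) (cc X s D K m hh) B s0 D0 nT K1 ale cle cX m m1 clo Ds n w (leqnn n).
have [_ iY _] := Yp_spec Pcomp T0 hW hX hXW s0 D0 nT K1 arv ale (leqnn n).
have bY := Yp_bound Pcomp T0 hW hX hXW s0 D0 nT K1 arv ale (leqnn n).
have Ygt w := Yp_gt0 A W s D K (al K hh) n w.
have [_ _ _ [iS bS]] := Sc_spec Pcomp T0 hW hX hXW s0 D0 nT (leqnn n).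
have lW k (kn : (k < n)%N) := dW_large Pcomp hW hX hXW s0 D0 nT K1 m1 kn.
set Ga := Gam _ _ _ _ _ _ _ _ n in hd iG iN bN glow.
set Yn := Yp _ _ _ _ _ _ n in glow iY bY Ygt.
pose bad k w : R := ((4 * m)^-1 < K * `|dW (tk s D k) (tk s D k.+1) w|)%R%:R.
pose bB w : R := \1_B w * (eta < V r w)%R%:R.
have ieta : int1 P (fun w => (eta < V r w)%R%:R) by apply: int1_bool; exact: mset_lt.
have ibB : int1 P bB by exact: int1_set.
have ibad k : (k < n)%N -> int1 P (bad k) by move=> kn; have [] := lW k kn.
have isum : int1 P (fun w => \sum_(k < n) bad k w) by apply: int1_sum => k _; exact: ibad.
(* A lower bound, possibly negative, for the indicator of the good event: [bet w > 0] forces [B w],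
   [eta < V r w], no large Brownian increment and at most one change of state. *)
pose bet w := bB w - (\sum_(k < n) bad k w + (1 < Sc X s D n w)%N%:R).
have ibet : int1 P bet by exact: int1B ibB (int1D isum iS).
have bad0 k w : 0 <= bad k w by exact: ler0n.
have m4 : 0 < (4 * m)^-1 by rewrite invr_gt0 mulr_gt0.
have m41 : (4 * m)^-1 <= 1 by rewrite invf_le1 ?mulr_gt0//; lra.
pose w0 := eta * (4 * m)^-1.
have w00 : 0 < w0 by rewrite mulr_gt0.
(* If [bet w <= 0], the left side is negative and the right side is nonnegative by [neg_part];
   otherwise [Gam_low] and the tangent inequality apply. *)
have pw : {ae P, forall w, w0 * (2 / kap) * bet w + - (w0 / kap ^+ 2) * Yn w <=
     Ga w * V r w + (q * V r w ^+ 2 + q^-1 * neg (Ga w) ^+ 2)}.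
  apply: ae_imp Vr => w Vw.
  have R0 : 0 <= q * V r w ^+ 2 + q^-1 * neg (Ga w) ^+ 2.
    by apply: addr_ge0; apply: mulr_ge0; rewrite ?sqr_ge0// ltW.
  have np := neg_part (Ga w) q0 Vw.
  have y1 : 0 < w0 / kap ^+ 2 * Yn w by rewrite mulr_gt0// divr_gt0// exprn_gt0.
  have k2 : 0 < w0 * (2 / kap) by rewrite mulr_gt0// divr_gt0.
  have [Sb [Cb [eS eC betE]]] : exists Sb Cb : R, [/\ Sb = \sum_(k < n) bad k w,
      Cb = (1 < Sc X s D n w)%N%:R & bet w = bB w - (Sb + Cb)] by do 2 eexists.
  have S0 : 0 <= Sb by rewrite eS; apply: sumr_ge0 => k _; exact: bad0.
  have C0 : 0 <= Cb by rewrite eC ler0n.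
  have [bet0|bet0] := leP (bet w) 0.
    have := ler_wpM2l (ltW k2) bet0; rewrite mulr0; lra.
  have bB1 : bB w <= 1.
    by rewrite /bB indicE; case: (w \in B); case: (eta < V r w); rewrite ?(mulr1, mul1r, mul0r, mulr0) ?lexx ?ler01.
  have hB1 : 0 < bB w by move: bet0; rewrite betE; lra.
  move: hB1; rewrite /bB indicE; case: (boolP (w \in B)) => [/set_mem Bw|_]; last by rewrite mul0r ltxx.
  rewrite mul1r; case: (ltP eta (V r w)) => [Veta|_]; last by rewrite ltxx.
  move=> _; have Sc1 : (Sc X s D n w <= 1)%N.
    rewrite leqNgt; apply/negP => h; move: eC; rewrite h /= => eC; move: bet0 bB1; rewrite betE; lra.
  have nb j : (j < n)%N -> K * `|dW (tk s D j) (tk s D j.+1) w| <= (4 * m)^-1.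
    move=> jn; rewrite leNgt; apply/negP => h.
    have : 1 <= Sb.
      rewrite eS (bigD1 (Ordinal jn))//= /bad h lerDl; apply: sumr_ge0 => k _; exact: bad0.
    move: bet0 bB1; rewrite betE; lra.
  have lo := glow w Bw nb.
  have lo' : (4 * m)^-1 <= Ga w * Yn w.
    apply: le_trans lo; case: (Sc X s D n w) Sc1 => [|[|//]] _; rewrite ?expr1// expr0//.
  have GY : (4 * m)^-1 * (Yn w)^-1 <= Ga w by rewrite ler_pdivrMr.
  have t := inv_tangent (Ygt w) kap0.
  have iy : 0 < (Yn w)^-1 by rewrite invr_gt0.
  have GV : (4 * m)^-1 * (Yn w)^-1 * eta <= Ga w * V r w.
    by apply: ler_pM => //; [rewrite mulr_ge0// ltW|exact: ltW|exact: ltW].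
  have t2 := ler_wpM2l (ltW w00) t.
  have bet1 : bet w <= 1 by rewrite betE; lra.
  have t3 := ler_wpM2l (ltW k2) bet1.
  have e1 : (4 * m)^-1 * (Yn w)^-1 * eta = w0 * (Yn w)^-1 by rewrite /w0; ring.
  have e2 : w0 * (2 / kap - Yn w / kap ^+ 2) = w0 * (2 / kap) * 1 - w0 / kap ^+ 2 * Yn w by ring.
  rewrite e1 in GV; rewrite e2 in t2; rewrite mulNr; lra.
have iGV := int2M iG ir.
have iq := int1_lin2 q q^-1 ir.2 iN.2.
have := Iv_le_ae (int1_lin2 (w0 * (2 / kap)) (- (w0 / kap ^+ 2)) ibet iY) (int1D iGV iq) pw.
rewrite (Iv_lin2 _ _ ibet iY) (IvD iGV iq) (Iv_lin2 _ _ ir.2 iN.2).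
have E0 : Iv P (fun w => \1_B w * V s w) = 0.
  apply: etrans (Iv0 P); apply: Iv_eq => w; rewrite indicE; case: (boolP (w \in B)) => [/set_mem ->|_];
   by rewrite ?mulr0 ?mul0r.
rewrite E0 in hd.
have h3 : q^-1 * (T * Cm K m * expR (C1 A K * T) * D) <= dlt / m / 2.
  apply: le_trans (hn1 n nn1 nn).
  by rewrite /D /step /Y le_eqVlt; apply/orP; left; apply/eqP; ring.
have h2 := ler_wpM2l (ltW q1) bN.
have ebet : Iv P bet = Iv P bB - (\sum_(k < n) Iv P (bad k) + Iv P (fun w => (1 < Sc X s D n w)%N%:R)).
  rewrite (IvB ibB (int1D isum iS)) (IvD isum iS).
  by rewrite (@Iv_sum _ _ _ P _ _ _ (fun k : 'I_n => bad k))// => k _; exact: ibad.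
have hbad : \sum_(k < n) Iv P (bad k) <= eps / 4.
  apply: (@le_trans _ _ (\sum_(k < n) c64 * D ^+ 2)).
    by apply: ler_sum => k _; have [_] := lW k (ltn_ord k).
  rewrite sumr_const card_ord -[(c64 * D ^+ 2) *+ n]mulr_natl; apply: le_trans (hn2 n nn2 nn).
  rewrite /D /step le_eqVlt; apply/orP; left; apply/eqP; field; by rewrite gt_eqF.
rewrite mulrA eD mulrC [X in X ^+ 2]mulrC in bS || rewrite (_ : n%:R * (Ca A * D) = Ca A * (r - s)) in bS; last by rewrite -eD; ring.
have YM : - (w0 / kap ^+ 2 * M3) <= - (w0 / kap ^+ 2) * Iv P Yn.
  rewrite mulNr lerN2; apply: ler_wpM2l bY; apply: divr_ge0; [exact: ltW|exact: sqr_ge0].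
move=> hmain.
have main : w0 * (2 / kap) * Iv P bet <= w0 / kap ^+ 2 * M3 + 2 * (dlt / m).
  move: hmain YM hd h2 h3 hq; set x1 := Iv P Yn; set x2 := Iv P bet; set x3 := Iv P (fun w => Ga w * _).
  set x4 := Iv P _; set x5 := Iv P _; lra.
have bound : Iv P bet <= eps / 2.
  have e1 : w0 / kap ^+ 2 * M3 = w0 * (2 / kap) * (eps / 4).
    have ke : kap * eps = 2 * M3 by rewrite /kap divfK ?gt_eqF.
    rewrite (_ : M3 = kap * eps / 2); last by rewrite ke; field.
    by field; rewrite gt_eqF.
  have e2 : 2 * (dlt / m) = w0 * (2 / kap) * (eps / 4).
    by rewrite /dlt /w0; field; rewrite !gt_eqF.
  have k2 : 0 < w0 * (2 / kap) by rewrite mulr_gt0// divr_gt0.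
  rewrite e1 e2 -mulrDr ler_pM2l// in main; lra.
have msB : measurable [set w | (V s w == 0) && (0 < V r w)].
  rewrite (_ : [set w | _] = B `&` [set w | 0 < V r w]).
    by apply: measurableI => //; exact: mset_lt.
  apply/seteqP; split => [w /andP[/eqP e1 e2]|w [e1 /= ->]]; first by split.
  by rewrite /= andbT; apply/eqP.
have mlev : measurable [set w | (0 < V r w) && (V r w <= eta)].
  rewrite (_ : [set w | _] = [set w | 0 < V r w] `&` [set w | V r w <= eta]).
    by apply: measurableI; [exact: mset_lt|exact: mset_le].
  by apply/seteqP; split => w /= => [/andP//|[-> ->]].
apply: (@le_trans _ _ (Iv P (fun w => bB w + ((0 < V r w) && (V r w <= eta))%:R))).
  apply: Iv_le; [exact: int1_bool|by apply: int1D => //; exact: int1_bool|].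
  move=> w; rewrite /bB indicE; case: eqP => [e|_] /=; last by rewrite addr_ge0// mulr_ge0.
  rewrite mem_set// mul1r; case: (ltP 0 (V r w)) => // h; last by rewrite addr_ge0.
  by case: (leP (V r w) eta) => // h'; rewrite /= ?addr0 ?add0r.
rewrite IvD//; last exact: int1_bool.
move: ebet bound hbad bS heta; rewrite -/bad; set x1 := Iv P bet; set x2 := Iv P bB; set x3 := \sum_(_ < _) _; lra.
Qed.

(** On a uniform partition, positivity can only arise in a step that starts from 0. Each of the [n]
    steps contributes order [1 / n^2], so the total vanishes. *)
Lemma strict_comparison : {ae P, forall w, 0 <= V t1 w} -> {ae P, forall w, V t0 w = 0} ->
  {ae P, forall w, V t1 w = 0}.
Proof.
move=> V1 V0; have [hV _ _ _] := hB.
have [lt01|] := ltP t0 t1; last first.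
  by move=> h; rewrite (_ : t1 = t0)//; apply/eqP; rewrite eq_le h t01.
have mV t : t0 <= t <= t1 -> measurable_fun setT (V t) by move=> tt; have [_ []] := hV t tt.
have mpos t : t0 <= t <= t1 -> int1 P (fun w => (0 < V t w)%R%:R).
  by move=> tt; apply: int1_bool; apply: mset_lt => //; exact: mV.
have t1in : t0 <= t1 <= t1 by rewrite t01 lexx.
have I0 : 0 <= Iv P (fun w => (0 < V t1 w)%R%:R) by apply: Iv_ge0 => w; exact: ler0n.
suff E0 : Iv P (fun w => (0 < V t1 w)%R%:R) <= 0.
  have e0 : Iv P (fun w => (0 < V t1 w)%R%:R) = 0 by apply/eqP; rewrite eq_le E0.
  apply: ae_imp2 V1 (Iv_eq0_ae (mpos t1 t1in) (fun w => ler0n _ _) e0) => w h.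
  case: ltP => [_ /eqP|h' _]; first by rewrite oner_eq0.
  by apply/eqP; rewrite eq_le h' h.
apply/ler_addgt0Pr => eps e0; rewrite add0r.
have [n0 hn0] := archi_small (sqr_ge0 (Ca A * (t1 - t0))) e0.
pose n := n0.+1; have nn : (0 < n)%N by [].
have D0 := step_gt0 lt01 nn; set D := step t0 t1 n in D0.
have en : tk t0 D n = t1 by exact: tk_end.
have inn k : (k <= n)%N -> t0 <= tk t0 D k <= t1.
  by move=> kn; rewrite (tk_s t0 D0)/= -en; exact: (tk_mono t0 D0).
have Vk k : (k <= n)%N -> {ae P, forall w, 0 <= V (tk t0 D k) w}.
  rewrite leq_eqVlt => /orP[/eqP ->|kn]; first by rewrite en.
  apply: (comparison _ _ (lexx t1) V1); first exact: (tk_s t0 D0).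
  by rewrite -en /tk ltrD2l ltr_pM2r// ltr_nat.
have nr : (0 : R) < n%:R by rewrite ltr0n.
suff tel k : (k <= n)%N -> Iv P (fun w => (0 < V (tk t0 D k) w)%R%:R) <= k%:R * (Ca A * D) ^+ 2.
  have := tel n (leqnn n); rewrite en => h; apply: le_trans h _.
  apply: le_trans (hn0 n (leqnSn n0) nn).
  rewrite /D /step le_eqVlt; apply/orP; left; apply/eqP; field; by rewrite gt_eqF.
elim: k => [_|k ih kn].
  rewrite mul0r /tk mul0r addr0.
  suff -> : Iv P (fun w => (0 < V t0 w)%R%:R) = 0 by [].
  rewrite -[RHS](Iv0 P); apply: Iv_ae.
  - by apply: int1_measurable (mpos t0 _); rewrite lexx.
  - exact: measurable_cst.
  - by apply: ae_imp V0 => w ->; rewrite ltxx.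
apply/ler_addgt0Pr => e' e'0.
have st : tk t0 D k.+1 - tk t0 D k = D by rewrite tkS addrAC subrr add0r.
have lt : tk t0 D k < tk t0 D k.+1 by rewrite tkS ltrDl.
have /andP[k0 k1] := inn k (ltnW kn); have /andP[k0' k1'] := inn k.+1 kn.
have := strict_step k0 lt k1' (Vk k.+1 kn) e'0; rewrite st => h.
have msB : measurable [set w | (V (tk t0 D k) w == 0) && (0 < V (tk t0 D k.+1) w)].
  rewrite (_ : [set w | _] = ([set w | V (tk t0 D k) w <= 0] `&` [set w | 0 <= V (tk t0 D k) w]) `&` [set w | 0 < V (tk t0 D k.+1) w]).
    apply: measurableI; first apply: measurableI.
    - by apply: mset_le => //; apply: mV; exact: inn (ltnW kn).
    - by apply: mset_le => //; apply: mV; exact: inn (ltnW kn).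
    - by apply: mset_lt => //; apply: mV; exact: inn kn.
  apply/seteqP; split => w /=.
    by move=> /andP[/eqP -> ->]; rewrite lexx.
  by move=> [[a b] ->]; rewrite andbT eq_le a b.
have ih' := ih (ltnW kn).
apply: (@le_trans _ _ (Iv P (fun w => (0 < V (tk t0 D k) w)%R%:R +
   ((V (tk t0 D k) w == 0) && (0 < V (tk t0 D k.+1) w))%:R))).
  apply: Iv_le_ae; [exact: mpos (inn _ kn)|by apply: int1D; [exact: mpos (inn _ (ltnW kn))|exact: int1_bool]|].
  apply: ae_imp (Vk k (ltnW kn)) => w; rewrite le_eqVlt => /orP[/eqP <-|->].
    by rewrite eqxx /= lerDr.
  by apply: (@le_trans _ _ 1); [rewrite -[1]/(1%:R) ler_nat; case: (_ < _)|rewrite lerDl].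
rewrite IvD; [|exact: mpos (inn _ (ltnW kn))|exact: int1_bool].
rewrite -[k.+1%:R]natr1; lra.
Qed.

End comparison.

End model.

(** * The driver along a solution *)

Section countable_codes.
Context {d : measure_display} {S : measurableType d} {R : realType} (K : countType).

(** A countable code cuts the space into measurable pieces with a fixed measurable function on each;
    pickling indexes the pieces by natural numbers. *)
Lemma measurable_code (q : S -> K) (h : K -> S -> R) :
  (forall k, measurable [set x | q x = k]) -> (forall k, measurable_fun setT (h k)) ->
  measurable_fun setT (fun x => h (q x) x).
Proof.
move=> mq mh _ B mB; rewrite setTI.
rewrite (_ : _ @^-1` B = \bigcup_n (if @choice.unpickle K n is Some k then [set x | q x = k] `&` h k @^-1` B else set0)).
  apply: bigcup_measurable => n _; case: (@choice.unpickle K n) => [k|]; last exact: measurable0.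
  by apply: measurableI => //; rewrite -[X in measurable X]setTI; exact: mh.
apply/seteqP; split => [x hx|x [n _]].
  by exists (choice.pickle (q x)) => //; rewrite choice.pickleK.
by case: (@choice.unpickle K n) => // k [<-].
Qed.

Lemma measurable_floor_set (Y : S -> R) (n : nat) (k : int) : measurable_fun setT Y ->
  measurable [set x | Num.floor (n%:R * Y x) = k].
Proof.
move=> mY; have mn : measurable_fun setT (fun x => n%:R * Y x) by exact: measurable_funM.
rewrite (_ : [set x | _] = (fun x => n%:R * Y x) @^-1` `[k%:~R, (k + 1)%:~R[%classic).
  by rewrite -[X in measurable X]setTI; apply: mn => //; exact: measurable_itv.
by apply/seteqP; split => x /=; rewrite in_itv /= -real_floor_eq ?num_real// => /eqP.
Qed.

End countable_codes.

Lemma floor_cvg {R : realType} (y : R) n : (0 < n)%N ->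
  0 <= y - (Num.floor (n%:R * y))%:~R / n%:R <= n%:R^-1.
Proof.
move=> n0; have nr : (0 : R) < n%:R by rewrite ltr0n.
have h1 := floor_le_tmp (n%:R * y); have h2 := floorD1_gt (n%:R * y).
rewrite subr_ge0 lerBlDr ler_pdivrMr// (mulrC y) h1 /=.
rewrite -(ler_pM2l nr) mulrDr mulfV ?gt_eqF// mulrCA mulfV ?gt_eqF// mulr1 addrC.
by apply/ltW; rewrite intrD in h2.
Qed.

Lemma Rabs_sq_le {R : realType} (x a : R) : 0 <= x <= a -> `|x| ^+ 2 <= a ^+ 2.
Proof. by move=> /andP[x0 xa]; rewrite ger0_norm// ler_pXn2r ?nnegrE// (le_trans x0). Qed.

Section model.
Context {d : measure_display} {Omega : measurableType d} {R : realType}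
  {N : nat}.
Variables (P : probability Omega R) (T c : R) (A : 'M[R]_N).
Variables (X : R -> Omega -> 'I_N) (W : R -> Omega -> R).
Hypotheses (Pcomp : measure_is_complete P) (T0 : 0 < T)
  (hA : rate_matrix c A) (hW : brownian_motion P T W)
  (hX : markov_chain P T A X) (hXW : independent_processes P T X W).

Implicit Types (zeta phi lam I J : Omega -> R) (s t a b r : R) (z : @proc R N Omega)
  (e : @item R N Omega) (L : seq (@item R N Omega)).
Local Notation Xe := (Xext T X).

Variable F : driver Omega R N.
Hypothesis hF : is_driver P T A X W F.

(* Rounding all the arguments down to multiples of 1/n leaves countably many
   cases, so that the rounded process is measurable; Lipschitz continuity gives
   the limit. *)
Lemma measurable_driver (Y Z1 : R -> Omega -> R) (Z2 : R -> Omega -> 'cV[R]_N) :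
  jointly_measurable T Y -> jointly_measurable T Z1 ->
  (forall j, jointly_measurable T (fun u w => Z2 u w j 0)) ->
  measurable_fun setT (fun p : Omega * measurableTypeR R =>
    ind 0 T p.2 * F p.1 p.2 (Y p.2 p.1) (Z1 p.2 p.1) (Z2 p.2 p.1) (Xe p)).
Proof.
move=> mY mZ1 mZ2; have [aF [L [L0 lipF]]] := hF.
pose y (p : Omega * measurableTypeR R) := ind 0 T p.2 * Y p.2 p.1.
pose z1 (p : Omega * measurableTypeR R) := ind 0 T p.2 * Z1 p.2 p.1.
pose z2 j (p : Omega * measurableTypeR R) := ind 0 T p.2 * Z2 p.2 p.1 j 0.
have my : measurable_fun setT y by exact: (measurable_strip_on (lexx 0) (lexx T) mY).
have mz1 : measurable_fun setT z1 by exact: (measurable_strip_on (lexx 0) (lexx T) mZ1).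
have mz2 j : measurable_fun setT (z2 j) by exact: (measurable_strip_on (lexx 0) (lexx T) (mZ2 j)).
pose K := (int * int * {ffun 'I_N -> int} * 'I_N)%type.
pose q n (p : Omega * measurableTypeR R) : K := (Num.floor (n%:R * y p), Num.floor (n%:R * z1 p),
  [ffun j => Num.floor (n%:R * z2 j p)], Xe p).
pose h n (k : K) (p : Omega * measurableTypeR R) : R :=
  ind 0 T p.2 * F p.1 p.2 (k.1.1.1%:~R / n%:R) (k.1.1.2%:~R / n%:R) (\col_j ((k.1.2 j)%:~R / n%:R)) k.2.
have mh n k : measurable_fun setT (h n k).
  have [_ m _] := aF (k.1.1.1%:~R / n%:R) (k.1.1.2%:~R / n%:R) (\col_j ((k.1.2 j)%:~R / n%:R)) k.2.
  exact: (measurable_strip_on (lexx 0) (lexx T) m).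
have mq n k : measurable [set p | q n p = k].
  case: k => [[[k1 k2] k3] k4].
  have a1 : measurable [set p | Num.floor (n%:R * y p) = k1] by exact: measurable_floor_set.
  have a2 : measurable [set p | Num.floor (n%:R * z1 p) = k2] by exact: measurable_floor_set.
  have a3 : measurable (\bigcap_(j in [set: 'I_N]) [set p | Num.floor (n%:R * z2 j p) = k3 j]).
    by apply: fin_bigcap_measurable; [exact: finite_finset|move=> j _; exact: measurable_floor_set].
  have a4 : measurable ((fun p : Omega * measurableTypeR R => dl k4 (Xe p) : R) @^-1` [set 1]).
    rewrite -[X in measurable X]setTI.
    exact: (measurable_Xe T0 hX (dl k4) measurableT (measurable_set1 1)).
  have := measurableI _ _ (measurableI _ _ (measurableI _ _ a1 a2) a3) a4.
  congr (measurable _).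
  apply/seteqP; split => p /=; last first.
    move=> [<- <- <- <-]; split; last by rewrite /dl eqxx.
    by split => // j _ /=; rewrite ffunE.
  move=> [[[h1 h2] h3] h4]; rewrite /q h1 h2; congr (_, _, _, _).
    by apply/ffunP => j; rewrite ffunE h3.
  move: h4; rewrite /dl; case: eqP => // _ /esym/eqP; by rewrite oner_eq0.
have mhq n := measurable_code (mq n) (mh n).
apply: (measurable_fun_cvg (h := fun n p => h n.+1 (q n.+1 p) p)).
  by move=> n; exact: mhq.
move=> p _; rewrite /h /=.
have [i0|i0] := eqVneq (ind 0 T p.2) 0.
  rewrite i0 mul0r (_ : (fun n => _) = fun=> 0); first exact: cvg_cst.
  by apply/funext => n; rewrite mul0r.
have pT : 0 < p.2 <= T by move: i0; rewrite /ind; case: (_ < _ <= _); rewrite ?eqxx.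
have i1 : ind 0 T p.2 = 1 by rewrite /ind pT.
have pT' : 0 <= p.2 <= T by have /andP[a ->] := pT; rewrite ltW.
rewrite i1; under eq_fun do rewrite mul1r; rewrite mul1r.
(* Squared rounding error in units of the squared mesh: 1 for each of [y] and [z1], and [4 Ca] for
   each coordinate of [z2] by [gam_sq_le]. *)
pose CC : R := L * (2 + 4 * Ca A * N%:R).
have CC0 : 0 <= CC.
  by rewrite /CC mulr_ge0 ?(ltW L0)// addr_ge0// mulr_ge0 ?mulr_ge0 ?Ca_ge0.
set x0 := F _ _ _ _ _ _.
have bnd n : `|F p.1 p.2 ((Num.floor (n.+1%:R * y p))%:~R / n.+1%:R) ((Num.floor (n.+1%:R * z1 p))%:~R / n.+1%:R)
    (\col_j (([ffun j0 => Num.floor (n.+1%:R * z2 j0 p)] j)%:~R / n.+1%:R)) (Xe p) - x0| <=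
    Num.sqrt CC * n.+1%:R^-1.
  rewrite -(ger0_norm (mulr_ge0 (sqrtr_ge0 CC) _)); last by rewrite invr_ge0.
  rewrite -ler_sqr ?nnegrE// -[X in _ <= X]normrX (ger0_norm (sqr_ge0 _)) exprMn sqr_sqrtr//.
  rewrite distrC; apply: le_trans (lipF _ _ _ _ _ _ _ _ _ pT') _.
  rewrite /CC -[leRHS]mulrA; apply: ler_wpM2l; first exact: ltW.
  have f1 : Y p.2 p.1 = y p by rewrite /y i1 mul1r.
  have f2 : Z1 p.2 p.1 = z1 p by rewrite /z1 i1 mul1r.
  rewrite f1 f2; have b1 := Rabs_sq_le (floor_cvg (y p) (ltn0Sn n)).
  have b2 := Rabs_sq_le (floor_cvg (z1 p) (ltn0Sn n)).
  have b3 : sqnorm A (left_state X p.2 p.1) (Z2 p.2 p.1 - \col_j (([ffun j0 => Num.floor (n.+1%:R * z2 j0 p)] j)%:~R / n.+1%:R))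
     <= 4 * Ca A * N%:R * n.+1%:R^-1 ^+ 2.
    rewrite (sqnormE hA); apply: le_trans (gam_sq_le _ _ _) _.
    rewrite -[leRHS]mulrA; apply: ler_wpM2l; first by rewrite mulr_ge0 ?Ca_ge0.
    apply: (@le_trans _ _ (\sum_(j < N) n.+1%:R^-1 ^+ 2)).
      apply: ler_sum => j _; rewrite /colf !mxE ffunE.
      have -> : Z2 p.2 p.1 j 0 = z2 j p by rewrite /z2 i1 mul1r.
      by have := Rabs_sq_le (floor_cvg (z2 j p) (ltn0Sn n)); rewrite real_normK ?num_real.
    by rewrite sumr_const card_ord -[_ *+ N]mulr_natl lexx.
  move: b1 b2 b3; set v := n.+1%:R^-1 ^+ 2; set s1 := sqnorm _ _ _; set a1 := `|y p - _| ^+ 2; set a2 := `|z1 p - _| ^+ 2.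
  clearbody v s1 a1 a2; rewrite mulrDl; move: (4 * Ca A * N%:R * v) => k; lra.
apply/cvgrPdist_le => e e0.
have [n0 hn0] := archi_small (sqrtr_ge0 CC) e0.
exists n0 => // n /= hn; rewrite distrC; apply: le_trans (bnd n) _.
by apply: hn0 => //; exact: leq_trans hn (leqnSn n).
Qed.

End model.

(** * From solutions of the backward equation to their two-time form *)

Section model.
Context {d : measure_display} {Omega : measurableType d} {R : realType}
  {N : nat}.
Variables (P : probability Omega R) (T c : R) (A : 'M[R]_N).
Variables (X : R -> Omega -> 'I_N) (W : R -> Omega -> R).
Hypotheses (Pcomp : measure_is_complete P) (T0 : 0 < T)
  (hA : rate_matrix c A) (hW : brownian_motion P T W)
  (hX : markov_chain P T A X) (hXW : independent_processes P T X W).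

Local Notation leb := (@lebesgue_measure R).
Local Notation mu := (P \x lebesgue_measure)%E.
Local Notation G := (filtrationG P X W).
Implicit Types (zeta phi lam I J : Omega -> R) (s t a b r : R) (z : @proc R N Omega)
  (e : @item R N Omega) (L : seq (@item R N Omega)).
Local Notation Xe := (Xext T X).
Local Notation nrm := (pnorm T A X).
Local Notation H2 := (H2 P T A X).
Local Notation SI := (SI P T A X W).

Lemma zof_cut t (Z1 : R -> Omega -> R) (Z2 : R -> Omega -> 'cV[R]_N) : 0 <= t ->
  zof T t Z1 Z2 = cutp t T (zof T 0 Z1 Z2).
Proof.
move=> t0; apply/funext => o; apply/funext => p; rewrite /zof /cutp mulrA; congr (_ * _).
by rewrite {1}(ind0 T p.2 t0) mulrC.
Qed.

Lemma zof_id (Z1 : R -> Omega -> R) (Z2 : R -> Omega -> 'cV[R]_N) (o : option 'I_N) p :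
  0 < p.2 <= T -> zof T 0 Z1 Z2 o p = if o is Some j then Z2 p.2 p.1 j 0 else Z1 p.2 p.1.
Proof. by move=> h; rewrite /zof /ind h mul1r. Qed.

Variable F : driver Omega R N.
Hypotheses (hF : is_driver P T A X W F) (hN : normalized P T F) (hS : subadditive_driver T F).
Variable Lc : R.
Hypotheses (Lc0 : 0 < Lc) (lipF : forall (w : Omega) t (x : 'I_N) (y z1 : R) (z2 : 'cV[R]_N) (y' z1' : R)
      (z2' : 'cV[R]_N), 0 <= t <= T ->
      `|F w t y z1 z2 x - F w t y' z1' z2' x| ^+ 2 <=
      Lc * (`|y - y'| ^+ 2 + `|z1 - z1'| ^+ 2 + sqnorm A (left_state X t w) (z2 - z2'))).

(** The driver with [y] set to 0 and the state set to its current value; at a [good] point it gives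
    the driver for every [y]. *)
Definition fp (p : Omega * R) (z1 : R) (C : 'cV[R]_N) : R := F p.1 p.2 0 z1 C (Xe p).
Definition zcol z p : 'cV[R]_N := \col_j z (Some j) p.
Definition fz z p : R := fp p (z None p) (zcol z p).

Definition good (p : Omega * R) : Prop :=
  [/\ 0 <= p.2 <= T, left_state X p.2 p.1 = Xe p, X p.2 p.1 = Xe p, fp p 0 0 = 0 &
      forall (y z1 : R) (C : 'cV[R]_N), F p.1 p.2 y z1 C (Xe p) = fp p z1 C].

(** Subadditivity against the argument [(y', 0, 0)], where the driver vanishes, shows that adding
    [y'] does not increase the driver; going from 0 to [y] and back gives independence of [y]. *)
Lemma good_ae : {ae mu, forall p, 0 < p.2 <= T -> good p}.
Proof.
apply: ae_imp2 hN (left_ae Pcomp T0 hW hX hXW) => p hp hl h.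
have /andP[h1 h2] := h; have h' : 0 <= p.2 <= T by rewrite h2 ltW.
have eX : Xe p = X p.2 p.1 by exact: XextE.
split; [exact: h'|by rewrite eX; exact: hl|by rewrite eX|exact: hp|].
have sub (y y' z1 : R) (C : 'cV[R]_N) : F p.1 p.2 (y + y') z1 C (Xe p) <= F p.1 p.2 y z1 C (Xe p).
  have := hS p.1 (Xe p) h' y z1 C y' 0 0; rewrite !addr0 => /le_trans; apply.
  by rewrite (hp h') addr0.
move=> y z1 C; rewrite /fp; apply/eqP; rewrite eq_le; apply/andP; split.
  by have h0 := sub 0 y z1 C; rewrite add0r in h0; exact: h0.
by have h0 := sub y (- y) z1 C; rewrite subrr in h0; exact: h0.
Qed.

Lemma colf_zcol z p : colf (zcol z p) = fun j => z (Some j) p.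
Proof. by apply/funext => j; rewrite /colf mxE. Qed.

Lemma fp_lip p (z1 z1' : R) (C C' : 'cV[R]_N) : good p ->
  (fp p z1 C - fp p z1' C') ^+ 2 <= Lc * ((z1 - z1') ^+ 2 + gam A (colf (C - C')) (colf (C - C')) (Xe p)).
Proof.
move=> [pT hl _ _ _]; have := lipF p.1 (Xe p) 0 z1 C 0 z1' C' pT.
by rewrite !real_normK ?num_real// subrr expr0n /= add0r hl (sqnormE hA).
Qed.

Lemma fz_lip z z' p : good p -> (fz z p - fz z' p) ^+ 2 <= Lc * nrm (zlin 1 (-1) z z') p.
Proof.
move=> gp; apply: le_trans (fp_lip _ _ _ _ gp) _; apply: ler_wpM2l; first exact: ltW.
rewrite /pnorm /pinner /zlin expr2 le_eqVlt; apply/orP; left; apply/eqP.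
congr (_ + _); first by ring.
by congr (gam _ _ _ _); apply/funext => j; rewrite /colf !mxE; ring.
Qed.

Lemma fz_sq z p : good p -> fz z p ^+ 2 <= Lc * nrm z p.
Proof.
move=> gp; have [_ _ _ f0 _] := gp; have := fp_lip (z None p) 0 (zcol z p) 0 gp.
by rewrite f0 !subr0 colf_zcol expr2.
Qed.

(** The equations at [s] and [r] are subtracted. The drift is replaced by [fz], which agrees with it
    almost everywhere and no longer contains [Y]; its square-integrability comes from the Lipschitz
    bound against the integrand. *)
Lemma bsde_BE Q Y Z1 Z2 : int2 P Q -> bsde_solution P T A X W F Q Y Z1 Z2 ->
  BE P T A X W 0 T Y (fun p => ind 0 T p.2 * fz (zof T 0 Z1 Z2) p) (zof T 0 Z1 Z2) /\
  {ae P, forall w, Y T w = Q w}.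
Proof.
move=> iQ [aY aZ1 pZ2 fZ2 hsol]; set z := zof T 0 Z1 Z2.
have [rY mY _] := aY; have [_ mZ1 _] := aZ1.
have mZ2 j : jointly_measurable T (fun u w => Z2 u w j 0).
  have sG s : s <= T -> G s `<=` measurable by move=> sT; exact: (G_sub Pcomp hW hX sT).
  exact: (predictable_measurable j sG (ltW T0) pZ2).
have T00 : 0 <= (0 : R) <= T by apply/andP; split => //; exact: ltW.
have hSI t : 0 <= t <= T -> exists I, SI t I (cutp t T z) /\ {ae P, forall w, Y t w
     - (\int[leb]_(u in `[t, T]) F w u (Y u w) (Z1 u w) (Z2 u w) (X u w))%R + I w = Q w}.
  move=> tT; have [I1 [I2 [b1 b2 e]]] := hsol t tT.
  have h := bsde_SI Pcomp T0 hA hW hX hXW tT aZ1 pZ2 fZ2 b1 b2.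
  exists (fun w => I1 w + I2 w); split.
    by have /andP[t0 _] := tT; rewrite -(zof_cut Z1 Z2 t0).
  by apply: ae_imp e => w; rewrite addrA.
have hz : H2 z.
  have [I [[_ h _] _]] := hSI 0 T00.
  by rewrite (_ : z = cutp 0 T z)// -zof_cut.
pose gY (p : Omega * R) := ind 0 T p.2 * F p.1 p.2 (Y p.2 p.1) (Z1 p.2 p.1) (Z2 p.2 p.1) (Xe p).
have mgY : measurable_fun setT (gY : Omega * measurableTypeR R -> R).
  exact: (measurable_driver T0 hA hX hF mY mZ1 mZ2).
pose g (p : Omega * R) := ind 0 T p.2 * fz z p.
have mg : measurable_fun setT (g : Omega * measurableTypeR R -> R).
  have m0 : jointly_measurable T (fun (_ : R) (_ : Omega) => 0 : R) by exact: measurable_cst.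
  have := measurable_driver T0 hA hX hF m0 mZ1 mZ2.
  rewrite (_ : (fun p : Omega * measurableTypeR R => _) = g)//.
  apply/funext => p; rewrite /g /fz /fp; have [i0|i0] := eqVneq (ind 0 T p.2) 0.
    by rewrite i0 !mul0r.
  have pin : 0 < p.2 <= T by move: i0; rewrite /ind; case: (_ < _ <= _); rewrite ?eqxx.
  rewrite /z zof_id//; congr (_ * F _ _ _ _ _ _); apply/colP => j.
  by rewrite mxE zof_id.
have ggY : {ae mu, forall p, g p = gY p}.
  apply: ae_imp good_ae => p hp; rewrite /g /gY /ind.
  case: (boolP (0 < p.2 <= T)) => pin; last by rewrite !mul0r.
  have [_ _ _ _ yi] := hp pin; rewrite !mul1r yi /fz /z zof_id//; congr (fp _ _ _).
  by apply/colP => j; rewrite mxE zof_id.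
have gsq : {ae mu, forall p, `|g p ^+ 2| <= Lc * nrm z p}.
  apply: ae_imp good_ae => p hp; rewrite ger0_norm ?sqr_ge0// /g /ind.
  case: (boolP (0 < p.2 <= T)) => pin; last first.
    by rewrite mul0r expr0n mulr_ge0 ?(nrm_ge0 T X hA)// ltW.
  by rewrite mul1r; exact: fz_sq (hp pin).
have ig : int2 mu g.
  split => //; apply: int1_le_ae gsq; last exact: int1Z hz.2.
  exact: measurable_funX.
have ig' : int2 mu (fun p => ind 0 T p.2 * g p) by exact: mu_indM2.
have path t : 0 <= t <= T -> {ae P, forall w,
    (\int[leb]_(u in `[t, T]) F w u (Y u w) (Z1 u w) (Z2 u w) (X u w))%R =
    slice (fun p => ind t T p.2 * g p) w}.
  move=> /andP[t0 tT].
  have i1 := int2_int1_strip (mu_indM2 t T ig).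
  have m2 : measurable_fun setT (fun p : Omega * measurableTypeR R => ind t T p.2 * gY p).
    by apply: measurable_funM => //; exact: mu_ind.
  have e2 : {ae mu, forall p, ind t T p.2 * g p = ind t T p.2 * gY p}.
    by apply: ae_imp ggY => p ->.
  have := slice_ae i1 m2 e2; apply: ae_imp => w ->.
  have E u : ind t T u * F w u (Y u w) (Z1 u w) (Z2 u w) (X u w) = ind t T u * gY (w, u).
    have [i0|i0] := eqVneq (ind t T u) 0; first by rewrite i0 !mul0r.
    have pin : t < u <= T by move: i0; rewrite /ind; case: (_ < _ <= _); rewrite ?eqxx.
    have /andP[h1 h2] := pin; have h3 := le_lt_trans t0 h1.
    have iu : ind 0 T u = 1 by rewrite /ind h3 h2.
    by rewrite /gY /= iu mul1r XextE//= (ltW h3) h2.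
  rewrite Rintegral_ind//; first by apply: Iv_eq => u; rewrite E.
  by rewrite (funext E); exact: (measurable_section w m2).
have eqY t : 0 <= t <= T -> exists I, SI t I (cutp t T z) /\
   {ae P, forall w, Y t w = Q w + slice (fun p => ind t T p.2 * g p) w - I w}.
  move=> tT; have [I [h e]] := hSI t tT; exists I; split => //.
  by apply: ae_imp2 (path t tT) e => w -> <-; ring.
have sl t : 0 <= t -> t <= T -> int2 P (slice (fun p => ind t T p.2 * g p)).
  by move=> t0 tT; have [] := slice_int2' t0 tT (lexx T) ig'.
split; last first.
  (* At [T] the interval of integration is empty, so the stochastic integral has norm zero and the
     terminal value remains. *)
  have TT : 0 <= T <= T by rewrite lexx ltW.
  have [I [h e]] := eqY T TT; have [iI _ _] := h.
  have iz s : ind T T s = 0.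
    by rewrite /ind (_ : _ < _ <= _ = false)//; apply/negP => /andP[a b]; have := lt_le_trans a b; rewrite ltxx.
  have nI : Iv P (fun w => I w ^+ 2) <= 0.
    rewrite (SI_norm Pcomp T0 hA hW hX hXW h) (_ : Iv mu _ = 0)//.
    by apply: etrans (Iv0 mu); apply: Iv_eq => p; rewrite nrm_cutp iz mul0r.
  apply: ae_imp2 (Iv_sqr0_ae iI nI) e => w -> ->; rewrite subr0 /slice.
  rewrite (_ : Iv leb _ = 0) ?addr0//; apply: etrans (Iv0 leb); apply: Iv_eq => u.
  by rewrite iz mul0r.
split => //.
- move=> t tT; have /andP[t0 tT'] := tT; split.
    by apply: rv_in_sub (rY t tT); exact: G_pi.
  have [I [[iI _ _] e]] := eqY t tT.
  have mYt : measurable_fun setT (Y t) := rv_in_measurable (G_sub Pcomp hW hX tT') (rY t tT).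
  apply: (int2_ae mYt _ (int2B (int2D iQ (sl t t0 tT')) iI)).
  by apply: ae_imp e => w ->.
- exact: H2_cutp.
move=> s r s0 sr rT; have sT := le_trans sr rT; have r0 := le_trans s0 sr.
have [I [h e]] := eqY s (introT andP (conj s0 sT)).
have [J [h' e']] := eqY r (introT andP (conj r0 rT)).
exists (fun w => 1 * I w + -1 * J w); split.
  exact: (SI_cut Pcomp T0 hA hW hX hXW s0 sr rT (lexx T) h h').
have j1 := int2_int1_strip (mu_indM2 s r ig); have j2 := int2_int1_strip (mu_indM2 r T ig).
apply: ae_imp2 (filterI e e') (slice_lin 1 1 j1 j2) => w [-> ->].
have -> : (fun p : Omega * R => 1 * (ind s r p.2 * g p) + 1 * (ind r T p.2 * g p)) = (fun p => ind s T p.2 * g p).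
  by apply/funext => p; rewrite (ind_cat p.2 sr rT); ring.
by move=> ->; ring.
Qed.

End model.

(** * Balanced drivers *)

Section model.
Context {d : measure_display} {Omega : measurableType d} {R : realType}
  {N : nat}.
Variables (P : probability Omega R) (T c : R) (A : 'M[R]_N).
Variables (X : R -> Omega -> 'I_N) (W : R -> Omega -> R).
Hypotheses (Pcomp : measure_is_complete P) (T0 : 0 < T)
  (hA : rate_matrix c A) (hW : brownian_motion P T W)
  (hX : markov_chain P T A X) (hXW : independent_processes P T X W).

Local Notation leb := (@lebesgue_measure R).
Local Notation mu := (P \x lebesgue_measure)%E.
Local Notation G := (filtrationG P X W).
Local Notation piG0 := (piG0 P X W).
Implicit Types (zeta phi lam I J : Omega -> R) (s t a b r : R) (z : @proc R N Omega)
  (e : @item R N Omega) (L : seq (@item R N Omega)).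
Local Notation Xe := (Xext T X).
Local Notation nrm := (pnorm T A X).
Local Notation H s := <<s piG0 s >>.
Local Notation el := (el A X W).
Local Notation eltot := (eltot A X W).

Variable F : driver Omega R N.
Hypotheses (hF : is_driver P T A X W F) (hN : normalized P T F) (hS : subadditive_driver T F)
  (hP : positively_homogeneous_driver T F).
Variable Lc : R.
Hypotheses (Lc0 : 0 < Lc) (lipF : forall (w : Omega) t (x : 'I_N) (y z1 : R) (z2 : 'cV[R]_N) (y' z1' : R)
      (z2' : 'cV[R]_N), 0 <= t <= T ->
      `|F w t y z1 z2 x - F w t y' z1' z2' x| ^+ 2 <=
      Lc * (`|y - y'| ^+ 2 + `|z1 - z1'| ^+ 2 + sqnorm A (left_state X t w) (z2 - z2'))).

Local Notation fp := (fp T X F).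
Local Notation fz := (fz T X F).
Local Notation good := (good T X F).
Local Notation goodae := (good_ae Pcomp T0 hW hX hXW hN hS).

Let fpl p (z1 z1' : R) (C C' : 'cV[R]_N) : good p ->
  (fp p z1 C - fp p z1' C') ^+ 2 <= Lc * ((z1 - z1') ^+ 2 + gam A (colf (C - C')) (colf (C - C')) (Xe p)).
Proof. by move=> gp; apply: fp_lip; do ?[exact: gp | exact: hA | exact: lipF | exact: Lc0]. Qed.

Let fzl z z' p : good p -> (fz z p - fz z' p) ^+ 2 <= Lc * nrm (zlin 1 (-1) z z') p.
Proof. by move=> gp; apply: fz_lip; do ?[exact: gp | exact: hA | exact: lipF | exact: Lc0]. Qed.

(** Its square dominates both [Lc], for the Brownian argument, and [Lc / c], for downward jumps at
    rates at least [c]; the comparison also asks for a value at least 1. *)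
Definition Kc : R := 1 + Lc / c.

Lemma c_gt0 : 0 < c. Proof. by have [/andP[]] := hA. Qed.

Lemma Kc_ge1 : 1 <= Kc.
Proof. by rewrite /Kc lerDl divr_ge0// ltW// c_gt0. Qed.

Lemma Kc_sq : Lc / c <= Kc ^+ 2 /\ Lc <= Kc ^+ 2.
Proof.
have [/andP[c0 c1] _ _] := hA.
have x0 : 0 <= Lc / c by rewrite divr_ge0// ltW.
have e : Kc ^+ 2 = 1 + 2 * (Lc / c) + (Lc / c) ^+ 2 by rewrite /Kc; ring.
have h : Lc <= Lc / c by rewrite ler_pdivlMr// ler_piMr// ltW.
by have := sqr_ge0 (Lc / c); rewrite e; split; lra.
Qed.

Lemma sqr_le_norm (x y : R) : 0 <= y -> x ^+ 2 <= y ^+ 2 -> `|x| <= y.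
Proof. by move=> y0 h; rewrite -ler_sqr ?nnegrE// real_normK ?num_real. Qed.

(** Balancedness at one point, with [y] removed and the current state in place of the left limit. *)
Definition balp p (b : R) : Prop := forall C C' : 'cV[R]_N, exists eps : R, 0 < eps /\
  ((forall j, j != Xe p -> ((C - C')^T *m psi A (Xe p) *m unit_col j) 0 0 >= - eps * snorm A (Xe p) (C - C')) ->
   let dF := fp p b C - fp p b C' in
   let rhs := ((C - C')^T *m psi A (Xe p) *m unit_col (Xe p)) 0 0 in
   dF >= rhs /\ (dF = rhs -> snorm A (Xe p) (C - C') = 0)).

Lemma psi_unit (C : 'cV[R]_N) i j : j != i -> (C^T *m psi A i *m unit_col j) 0 0 = A j i * (C j 0 - C i 0).
Proof.
move=> ji; rewrite (psiE hA) /gam (bigD1 j)//= big1 ?addr0 => [|k kj].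
  by rewrite /colf /unit_col !mxE !eqxx (eq_sym i) (negbTE ji) subr0 mulr1.
by rewrite /colf /unit_col !mxE !eqxx (negbTE kj) (eq_sym i) (negbTE ji) subr0 mulr0.
Qed.

Lemma psi_self (C : 'cV[R]_N) i : C i 0 = 0 ->
  (C^T *m psi A i *m unit_col i) 0 0 = - \sum_j A j i * C j 0.
Proof.
move=> Ci; rewrite (psiE hA) /gam -sumrN; apply: eq_bigr => j _.
rewrite /colf /unit_col !mxE !eqxx Ci subr0; have [->|ji] := eqVneq j i; first by rewrite Ci; ring.
by rewrite /=; ring.
Qed.

Lemma sum_sq_le (x : 'I_N -> R) : (forall j, 0 <= x j) -> \sum_j x j ^+ 2 <= (\sum_j x j) ^+ 2.
Proof.
move=> x0; rewrite [leRHS]expr2 mulr_sumr; apply: ler_sum => j _; rewrite expr2.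
by apply: ler_wpM2r => //; rewrite (bigD1 j)//= lerDl; apply: sumr_ge0.
Qed.

(* Lowering only the coordinates that jump upwards gives a pair to which
   balancedness applies; the remaining difference is controlled by the Lipschitz
   bound, the rates being bounded below. *)
Lemma bal_core p b (C C' : 'cV[R]_N) : good p -> balp p b ->
  let D j := (C - C') j 0 - (C - C') (Xe p) 0 in
  let U := \sum_j A j (Xe p) * pos (D j) in
  - U - Kc * \sum_j A j (Xe p) * neg (D j) <= fp p b C - fp p b C' /\
  (fp p b C - fp p b C' = - U - Kc * \sum_j A j (Xe p) * neg (D j) -> U = 0).
Proof.
move=> gp hb D U; set i := Xe p in D U *; set S := \sum_j _.
have [[/andP[c0 c1]] hr _] := hA.
pose C'' : 'cV[R]_N := \col_j (C j 0 - pos (D j)).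
have Di : D i = 0 by rewrite /D subrr.
have dE j : (C - C'') j 0 = pos (D j) by rewrite !mxE opprB addrCA subrr addr0.
have di : (C - C'') i 0 = 0 by rewrite dE Di /pos maxxx.
have [eps [e0 heps]] := hb C C''.
(* [C - C''] vanishes at the current state and is nonnegative elsewhere, so the left sides are
   nonnegative and the premise holds whatever [eps] is. *)
have prem j : j != i -> ((C - C'')^T *m psi A i *m unit_col j) 0 0 >= - eps * snorm A i (C - C'').
  move=> ji; rewrite psi_unit// di subr0 dE; apply: (@le_trans _ _ 0).
    by rewrite mulNr oppr_le0 mulr_ge0 ?sqrtr_ge0// ltW.
  by rewrite mulr_ge0 ?pos_ge0// (rate_ge0 hA).
have [h1 h2] := heps prem; rewrite -/i psi_self// in h1 h2.
have eU : \sum_j A j i * (C - C'') j 0 = U by apply: eq_bigr => j _; rewrite dE.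
rewrite eU in h1 h2.
have S0 : 0 <= S.
  apply: sumr_ge0 => j _; have [->|ji] := eqVneq j i; first by rewrite Di /neg oppr0 maxxx mulr0.
  by rewrite mulr_ge0 ?neg_ge0// (rate_ge0 hA).
have K0 : 0 <= Kc := le_trans ler01 Kc_ge1.
have lip : `|fp p b C'' - fp p b C'| <= Kc * S.
  apply: sqr_le_norm; first exact: mulr_ge0.
  apply: le_trans (fpl b b C'' C' gp) _.
  rewrite subrr expr0n add0r exprMn.
  (* A rate at least [c] gives [A x^2 <= (A x)^2 / c]; a sum of squares of nonnegative terms is at
     most the square of their sum. *)
  have hg : gam A (colf (C'' - C')) (colf (C'' - C')) i <= c^-1 * S ^+ 2.
    apply: (@le_trans _ _ (c^-1 * \sum_j (A j i * neg (D j)) ^+ 2)); last first.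
      apply: ler_wpM2l; first by rewrite invr_ge0 ltW.
      apply: sum_sq_le => j; have [->|ji] := eqVneq j i; first by rewrite Di /neg oppr0 maxxx mulr0.
      by rewrite mulr_ge0 ?neg_ge0// (rate_ge0 hA).
    rewrite mulr_sumr; apply: ler_sum => j _; have [->|ji] := eqVneq j i.
      by rewrite subrr !mulr0 mulr_ge0 ?invr_ge0 ?sqr_ge0// ltW.
    have -> : colf (C'' - C') j - colf (C'' - C') i = - neg (D j).
      have e1 : C'' j 0 = C j 0 - pos (D j) by rewrite mxE.
      have e2 : C'' i 0 = C i 0 by rewrite mxE Di /pos maxxx subr0.
      have e3 : D j = C j 0 - C' j 0 - (C i 0 - C' i 0) by rewrite /D !mxE.
      rewrite /colf ![(C'' - C') _ _]mxE ![(- C') _ _]mxE e1 e2.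
      by have [[_ [-> ->]]|[_ [-> ->]]] := posneg (D j); rewrite e3; ring.
    have /andP[ca _] := hr j i ji; have a0 := rate_ge0 hA ji.
    have -> : A j i * - neg (D j) * - neg (D j) = A j i * neg (D j) ^+ 2 by ring.
    have -> : c^-1 * (A j i * neg (D j)) ^+ 2 = (c^-1 * A j i * A j i) * neg (D j) ^+ 2 by ring.
    apply: ler_wpM2r; first exact: sqr_ge0.
    rewrite -{1}[A j i]mul1r; apply: ler_wpM2r => //.
    by rewrite mulrC ler_pdivlMr// mul1r.
  have [k1 _] := Kc_sq; apply: le_trans (ler_wpM2l (ltW Lc0) hg) _.
  by rewrite mulrA; apply: ler_wpM2r k1; exact: sqr_ge0.
move: lip; rewrite ler_norml => /andP[lip _].
split; first by lra.
move=> eq; have e1 : fp p b C - fp p b C'' = - U by lra.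
have /eqP := h2 e1; rewrite /snorm sqrtr_eq0 (sqnormE hA) => g0.
have z j : A j i * pos (D j) ^+ 2 = 0.
  have nn k : true -> 0 <= A k i * pos (D k) ^+ 2.
    have [->|ki] := eqVneq k i; first by rewrite Di /pos maxxx expr0n mulr0.
    by rewrite mulr_ge0 ?sqr_ge0// (rate_ge0 hA).
  apply: (psumr_eq0P nn) => //; apply/eqP; rewrite eq_le sumr_ge0// andbT.
  apply: le_trans g0; rewrite le_eqVlt; apply/orP; left; apply/eqP; apply: eq_bigr => k _.
  by rewrite /colf !dE Di /pos maxxx -/(pos _) subr0 -mulrA -expr2.
apply: big1 => j _; have /eqP := z j; rewrite mulf_eq0 sqrf_eq0 => /orP[/eqP ->|/eqP ->];
  by rewrite ?mul0r ?mulr0.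
Qed.

Lemma fp_lip1 p (a b : R) (C : 'cV[R]_N) : good p -> `|fp p a C - fp p b C| <= Kc * `|a - b|.
Proof.
move=> gp; have K0 : 0 <= Kc := le_trans ler01 Kc_ge1.
apply: sqr_le_norm; first exact: mulr_ge0.
apply: le_trans (fpl a b C C gp) _.
rewrite subrr exprMn real_normK ?num_real// (_ : gam _ _ _ _ = 0) ?addr0; last first.
  by rewrite /gam big1// => j _; rewrite /colf !mxE subrr mulr0.
by apply: ler_wpM2r (Kc_sq.2); exact: sqr_ge0.
Qed.

Lemma jumps_zcol (h : R -> R) (y z z' : @proc R N Omega) p :
  (forall j, y (Some j) p = z (Some j) p - z' (Some j) p) ->
  \sum_j A j (Xe p) * h ((zcol z p - zcol z' p) j 0 - (zcol z p - zcol z' p) (Xe p) 0) =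
  \sum_j A j (Xe p) * h (y (Some j) p - y (Some (Xe p)) p).
Proof. by move=> e; apply: eq_bigr => j _; rewrite !mxE !e. Qed.

(** The Brownian argument is frozen at that of the subtracted process; [slack_lower] freezes it at
    that of the other one. Which is needed depends on where the solution whose [Z1] enters the
    balanced condition stands. *)
Lemma slack_upper (g : Omega * R -> R) y z z' p : good p -> balp p (z' None p) ->
  (forall o, y o p = z o p - z' o p) -> fz z p - fz z' p <= g p ->
  0 <= slack T A X Kc g y p /\ (slack T A X Kc g y p = 0 -> upj T A X y p = 0).
Proof.
move=> gp hb ey hg; have := bal_core (zcol z p) (zcol z' p) gp hb.
rewrite /= (jumps_zcol (@pos R) (fun j => ey (Some j))) (jumps_zcol (@neg R) (fun j => ey (Some j))).
rewrite -/(upj T A X y p) -/(dnj T A X y p) /slack ey => -[h1 h2].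
have := fp_lip1 (z None p) (z' None p) (zcol z p) gp; rewrite ler_norml => /andP[h3 _].
move: hg; rewrite /fz => hg; split; first by lra.
by move=> e; apply: h2; lra.
Qed.

Lemma slack_lower (g : Omega * R -> R) y z z' p : good p -> balp p (z None p) ->
  (forall o, y o p = z o p - z' o p) -> fz z p - fz z' p <= g p ->
  0 <= slack T A X Kc g y p /\ (slack T A X Kc g y p = 0 -> upj T A X y p = 0).
Proof.
move=> gp hb ey hg; have := bal_core (zcol z p) (zcol z' p) gp hb.
rewrite /= (jumps_zcol (@pos R) (fun j => ey (Some j))) (jumps_zcol (@neg R) (fun j => ey (Some j))).
rewrite -/(upj T A X y p) -/(dnj T A X y p) /slack ey => -[h1 h2].
have := fp_lip1 (z None p) (z' None p) (zcol z' p) gp; rewrite ler_norml => /andP[h3 _].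
move: hg; rewrite /fz => hg; split; first by lra.
by move=> e; apply: h2; lra.
Qed.

Lemma BE_fz_unique t0 t1 V g z V' g' z' : 0 <= t0 -> t0 <= t1 -> t1 <= T ->
  BE P T A X W t0 t1 V g z -> BE P T A X W t0 t1 V' g' z' ->
  {ae mu, forall p, t0 < p.2 <= t1 -> g p = fz z p} ->
  {ae mu, forall p, t0 < p.2 <= t1 -> g' p = fz z' p} ->
  {ae P, forall w, V t1 w = V' t1 w} -> {ae P, forall w, V t0 w = V' t0 w}.
Proof.
move=> t00 t01 t1T b b' e e' V1.
have bb := BE_lin Pcomp T0 hA hW hX hXW 1 (-1) t00 t1T b b'.
have gg : {ae mu, forall p, t0 < p.2 <= t1 -> (1 * g p + -1 * g' p) ^+ 2 <= Lc * nrm (zlin 1 (-1) z z') p}.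
  have ee : {ae mu, forall p, (t0 < p.2 <= t1 -> g p = fz z p) /\ (t0 < p.2 <= t1 -> g' p = fz z' p)}.
    by apply: ae_imp2 e e' => p; split.
  apply: ae_imp2 ee goodae => p [h h'] gp pin.
  have /andP[p0 p1] := pin.
  rewrite h// h'// mul1r mulN1r; apply: fzl; apply: gp.
  by rewrite (le_lt_trans t00 p0) (le_trans p1 t1T).
have V10 : {ae P, forall w, 1 * V t1 w + -1 * V' t1 w = 0}.
  by apply: ae_imp V1 => w ->; ring.
have := BE_unique Pcomp T0 hA hW hX hXW t00 t01 t1T bb gg V10.
by apply: ae_imp => w /eqP; rewrite mul1r mulN1r subr_eq0 => /eqP.
Qed.

Lemma BE_cst t Q : 0 <= t <= T -> rv_in (H t) Q -> int2 P Q ->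
  BE P T A X W t T (fun _ => Q) (fun=> 0) (fun _ _ => 0).
Proof.
move=> /andP[t0 tT] rQ iQ.
have cz s r : cutp s r (fun _ _ => 0) = (fun _ _ => 0) :> @proc R N Omega.
  by apply/funext => o; apply/funext => p; rewrite /cutp mulr0.
split.
- by move=> s /andP[ts sT]; split => //; apply: rv_in_sub rQ; exact: H_mono.
- by apply: int2_eq (int2_0 mu) => p; rewrite mulr0.
- by rewrite cz; exact: proc0.
move=> s r ts sr rT; exists (fun=> 0); split.
  rewrite cz; split; [exact: int2_0|exact: proc0|move=> eps e0; exists [::]; split => //].
  - rewrite (_ : Iv P _ = 0) ?ltW//; apply: etrans (Iv0 P); apply: Iv_eq => w.
    by rewrite /eltot big_nil subrr expr0n.
  - rewrite (_ : Iv mu _ = 0) ?ltW//; apply: etrans (Iv0 mu); apply: Iv_eq => p.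
    by rewrite /pnorm /pinner /gam /zlin /ztot !big_nil !mulr0 addr0 mul0r add0r big1// => j _;
      rewrite !big_nil !mulr0 addr0 subrr mulr0.
apply: ae_all => w; rewrite subr0 (_ : slice _ _ = 0) ?addr0//.
by apply: etrans (Iv0 leb); apply: Iv_eq => u; rewrite mulr0.
Qed.

Lemma L2_int2 t Q : t <= T -> L2 P (G t) Q -> int2 P Q.
Proof.
move=> tT [rQ fQ]; have mQ := rv_in_measurable (G_sub Pcomp hW hX tT) rQ.
by split => //; apply: int1_fin; [exact: measurable_funX|move=> w; exact: sqr_ge0|].
Qed.

Lemma int2_L2 t Q : rv_in (G t) Q -> int2 P Q -> L2 P (G t) Q.
Proof. by move=> rQ [_ iQ]; split => //; rewrite -EFin_Iv// ltry. Qed.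

(** * The properties of the nonlinear expectation *)

Variables (Qs : R -> set (Omega -> R)) (E : R -> (Omega -> R) -> (Omega -> R)).
Hypotheses (hQ : forall t, 0 <= t <= T -> Qs t `<=` L2 P (G T))
  (hBal : balanced P T A X W F Qs) (hE : solution_functional P T A X W F E).

Definition gz z p : R := ind 0 T p.2 * fz z p.

Lemma gz_ae' z t0 t1 : 0 <= t0 -> t1 <= T -> {ae mu, forall p : Omega * R, t0 < p.2 <= t1 -> gz z p = fz z p}.
Proof.
move=> t00 t1T; apply: ae_all => p /andP[a b].
by rewrite /gz /ind (le_lt_trans t00 a) (le_trans b t1T) mul1r.
Qed.

Lemma solE Q : L2 P (G T) Q -> exists Y Z1 Z2, [/\ bsde_solution P T A X W F Q Y Z1 Z2,
  BE P T A X W 0 T Y (gz (zof T 0 Z1 Z2)) (zof T 0 Z1 Z2), {ae P, forall w, Y T w = Q w} &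
  forall t, 0 <= t <= T -> {ae P, forall w, E t Q w = Y t w}].
Proof.
move=> hQ'; have [Y [Z1 [Z2 [sol e]]]] := hE hQ'; exists Y, Z1, Z2.
by have [b e'] := bsde_BE Pcomp T0 hA hW hX hXW hF hN hS Lc0 lipF (L2_int2 (lexx T) hQ') sol.
Qed.

Lemma balp_ae t Q1 Q2 Y1 Z11 Z21 Y2 Z12 Z22 : 0 <= t <= T -> Qs t Q1 -> Qs t Q2 ->
  bsde_solution P T A X W F Q1 Y1 Z11 Z21 -> bsde_solution P T A X W F Q2 Y2 Z12 Z22 ->
  {ae mu, forall p : Omega * R, t < p.2 <= T -> good p /\ balp p (zof T 0 Z12 Z22 None p)}.
Proof.
move=> tT q1 q2 s1 s2; have := hBal tT q1 q2 s1 s2; have /andP[t0 _] := tT.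
move=> hb; apply: ae_imp2 hb goodae => p hp hg pin.
have /andP[a b] := pin; have pin' : 0 < p.2 <= T by rewrite (le_lt_trans t0 a) b.
have gp := hg pin'; split => //; have [_ el eX _ yi] := gp.
move=> C C'; have [eps [e0 h]] := hp pin C C'; exists eps; split => // prem.
rewrite el eX !yi in h; rewrite zof_id//; exact: h.
Qed.

Lemma E_mem t Q : 0 <= t <= T -> L2 P (G T) Q -> L2 P (G t) (E t Q).
Proof.
move=> tT hQ'; have [Y [Z1 [Z2 [[aY _ _ _ _] b _ e]]]] := solE hQ'.
have [rY _ _] := aY; have [hV _ _ _] := b; have [_ iY] := hV t tT.
have /andP[_ tT'] := tT; have e' : {ae P, forall w, Y t w = E t Q w}.
  by apply: ae_imp (e t tT) => w ->.
have rE := rv_in_ae tT' (rY t tT) e'.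
apply: int2_L2 => //.
exact: (int2_ae (rv_in_measurable (G_sub Pcomp hW hX tT') rE) e' iY).
Qed.

(** In the equivalence, [strict_comparison] gives one direction and uniqueness the other. *)
Lemma E_mono t Q1 Q2 : 0 <= t <= T -> Qs t Q1 -> Qs t Q2 -> {ae P, forall w, Q2 w <= Q1 w} ->
  {ae P, forall w, E t Q2 w <= E t Q1 w} /\
  ({ae P, forall w, E t Q1 w = E t Q2 w} <-> {ae P, forall w, Q1 w = Q2 w}).
Proof.
move=> tT q1 q2 le12; have /andP[t0 tT'] := tT.
have [Y1 [Z11 [Z21 [s1 b1 f1 e1]]]] := solE (hQ tT q1).
have [Y2 [Z12 [Z22 [s2 b2 f2 e2]]]] := solE (hQ tT q2).
have b1' := BE_restrict t0 (lexx T) b1; have b2' := BE_restrict t0 (lexx T) b2.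
have bb := BE_lin Pcomp T0 hA hW hX hXW 1 (-1) t0 (lexx T) b1' b2'.
have hb : {ae mu, forall p : Omega * R, t < p.2 <= T ->
   0 <= slack T A X Kc (fun p => 1 * gz (zof T 0 Z11 Z21) p + -1 * gz (zof T 0 Z12 Z22) p)
     (zlin 1 (-1) (zof T 0 Z11 Z21) (zof T 0 Z12 Z22)) p /\
   (slack T A X Kc (fun p => 1 * gz (zof T 0 Z11 Z21) p + -1 * gz (zof T 0 Z12 Z22) p)
     (zlin 1 (-1) (zof T 0 Z11 Z21) (zof T 0 Z12 Z22)) p = 0 ->
     upj T A X (zlin 1 (-1) (zof T 0 Z11 Z21) (zof T 0 Z12 Z22)) p = 0)}.
  apply: ae_imp (balp_ae tT q1 q2 s1 s2) => p hp pin; have [gp hb] := hp pin.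
  apply: (slack_upper gp hb) => [i0| ]; first by rewrite /zlin mul1r mulN1r.
  have /andP[a b] := pin.
  by rewrite /gz /ind (le_lt_trans t0 a) b !mul1r mulN1r.
have VT : {ae P, forall w, 0 <= 1 * Y1 T w + -1 * Y2 T w}.
  by apply: ae_imp2 le12 (filterI f1 f2) => w h [-> ->]; rewrite mul1r mulN1r subr_ge0.
have Vt : {ae P, forall w, 0 <= 1 * Y1 t w + -1 * Y2 t w}.
  have [tlt|] := ltP t T; last by move=> h; rewrite (_ : t = T)//; apply/eqP; rewrite eq_le tT' h.
  exact: (comparison Pcomp T0 hA hW hX hXW t0 (lexx T) Kc_ge1 bb hb (lexx t) tlt (lexx T) VT).
split.
  by apply: ae_imp2 Vt (filterI (e1 t tT) (e2 t tT)) => w h [-> ->]; rewrite -subr_ge0; lra.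
split => [eE|eQ].
- have V0 : {ae P, forall w, 1 * Y1 t w + -1 * Y2 t w = 0}.
    by apply: ae_imp2 eE (filterI (e1 t tT) (e2 t tT)) => w h [h1 h2]; rewrite -h1 -h2 h; ring.
  have := strict_comparison Pcomp T0 hA hW hX hXW t0 tT' (lexx T) Kc_ge1 bb hb VT V0.
  apply: ae_imp2 (filterI f1 f2) => w [-> ->] /eqP.
  by rewrite mul1r mulN1r subr_eq0 => /eqP.
- have eT : {ae P, forall w, Y1 T w = Y2 T w}.
    by apply: ae_imp2 eQ (filterI f1 f2) => w h [-> ->].
  have := BE_fz_unique t0 tT' (lexx T) b1' b2' (gz_ae' _ t0 (lexx T)) (gz_ae' _ t0 (lexx T)) eT.
  by apply: ae_imp2 (filterI (e1 t tT) (e2 t tT)) => w [-> ->].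
Qed.

(** A terminal value known at [t] is solved on [t, T] by the constant process with zero integrand,
    since the driver vanishes there; uniqueness identifies it. *)
Lemma sol_measurable t Q Q' Y z : 0 <= t <= T -> rv_in (G t) Q' -> int2 P Q' ->
  BE P T A X W 0 T Y (gz z) z -> {ae P, forall w, Y T w = Q w} -> {ae P, forall w, Q w = Q' w} ->
  {ae P, forall w, Y t w = Q' w}.
Proof.
move=> tT rQ iQ b f e; have /andP[t0 tT'] := tT.
have b' := BE_restrict t0 (lexx T) b.
have rQH : rv_in (H t) Q' by apply: rv_in_sub rQ; exact: G_pi.
have bc := BE_cst tT rQH iQ.
apply: (BE_fz_unique t0 tT' (lexx T) b' bc (gz_ae' _ t0 (lexx T))).
  apply: ae_imp goodae => p hp /andP[a q].
  have [_ _ _ f0 _] := hp (introT andP (conj (le_lt_trans t0 a) q)).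
  rewrite /fz (_ : zcol _ p = 0) ?f0//; by apply/colP => j; rewrite !mxE.
by apply: ae_imp2 f e => w ->.
Qed.

Lemma E_meas t Q : 0 <= t <= T -> L2 P (G t) Q -> {ae P, forall w, E t Q w = Q w}.
Proof.
move=> tT hQt; have /andP[t0 tT'] := tT; have iQ := L2_int2 tT' hQt; have [rQ _] := hQt.
have hQT : L2 P (G T) Q by apply: int2_L2 => //; apply: rv_in_sub rQ; exact: G_mono.
have [Y [Z1 [Z2 [_ b f e]]]] := solE hQT.
have h := sol_measurable tT rQ iQ b f (ae_all _ (fun w => erefl (Q w))).
by apply: ae_imp2 h (e t tT) => w <-.
Qed.

(** The solution with terminal value [E t Q] passes through that value at [t], like the solution for
    [Q]; both solve the same equation on [s, t], and uniqueness applies. *)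
Lemma E_tower s t Q : 0 <= s -> s <= t -> t <= T -> L2 P (G T) Q ->
  {ae P, forall w, E s (E t Q) w = E s Q w}.
Proof.
move=> s0 st tT hQT; have t0 := le_trans s0 st; have tin : 0 <= t <= T by rewrite t0.
have sin : 0 <= s <= T by rewrite s0 (le_trans st tT).
have hQt := E_mem tin hQT; have iQ := L2_int2 tT hQt; have [rQ _] := hQt.
have hQt' : L2 P (G T) (E t Q) by apply: int2_L2 => //; apply: rv_in_sub rQ; exact: G_mono.
have [Y [Z1 [Z2 [_ b f e]]]] := solE hQT; have [Y' [Z1' [Z2' [_ b' f' e']]]] := solE hQt'.
have h := sol_measurable tin rQ iQ b' f' (ae_all _ (fun w => erefl _)).
have hh : {ae P, forall w, Y' t w = Y t w} by apply: ae_imp2 h (e t tin) => w -> ->.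
have := BE_fz_unique s0 st tT (BE_restrict s0 tT b') (BE_restrict s0 tT b)
  (gz_ae' _ s0 tT) (gz_ae' _ s0 tT) hh.
by apply: ae_imp2 (filterI (e s sin) (e' s sin)) => w [-> ->].
Qed.

(** Bounded factors on both sides let one statement serve indicators, compared with the factor 1,
    and unbounded multipliers, truncated on both sides. *)
Lemma scale_unique t lam lam' (k k' : R) Q Q' Y Y' z z' : 0 <= t <= T ->
  rv_in (G t) lam -> (forall w, 0 <= lam w) -> (forall w, lam w <= k) ->
  rv_in (G t) lam' -> (forall w, 0 <= lam' w) -> (forall w, lam' w <= k') ->
  BE P T A X W 0 T Y (gz z) z -> BE P T A X W 0 T Y' (gz z') z' ->
  {ae P, forall w, Y T w = Q w} -> {ae P, forall w, Y' T w = Q' w} ->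
  {ae P, forall w, lam w * Q w = lam' w * Q' w} ->
  {ae P, forall w, lam w * Y t w = lam' w * Y' t w}.
Proof.
move=> tT r l0 lk r' l0' lk' b b' f f' e; have /andP[t0 tT'] := tT.
have sc1 (l : Omega -> R) q V y : rv_in (G t) l -> (forall w, 0 <= l w) -> (forall w, l w <= q) ->
   BE P T A X W 0 T V (gz y) y ->
   BE P T A X W t T (fun u w => l w * V u w) (fun p => l p.1 * gz y p) (zsc l y) /\
   {ae mu, forall p : Omega * R, t < p.2 <= T -> l p.1 * gz y p = fz (zsc l y) p}.
  move=> rl ll lq bV; split.
    apply: (BE_scale Pcomp T0 hA hW hX hXW t0 (lexx T) (k := q)); last exact: BE_restrict bV.
      by apply: rv_in_sub rl; exact: G_pi.
    by move=> w; rewrite ger0_norm.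
  apply: ae_all => p /andP[a bb]; have p0 := le_lt_trans t0 a.
  have pT : 0 <= p.2 <= T by rewrite ltW.
  rewrite /gz /ind p0 bb mul1r /fz /fp.
  have := hP p.1 (Xe p) pT 0 (y None p) (zcol y p) (ll p.1); rewrite mulr0 => <-.
  by congr (F _ _ _ _ _ _); apply/colP => j; rewrite !mxE.
have [c1 g1] := sc1 _ _ _ _ r l0 lk b; have [c2 g2] := sc1 _ _ _ _ r' l0' lk' b'.
apply: (BE_fz_unique t0 tT' (lexx T) c1 c2 g1 g2).
by apply: ae_imp2 e (filterI f f') => w h [-> ->].
Qed.

Lemma E_indic t B Q : 0 <= t <= T -> G t B -> L2 P (G T) Q ->
  {ae P, forall w, \1_B w * E t Q w = E t (fun w' => \1_B w' * Q w') w}.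
Proof.
move=> tT GB hQT; have /andP[t0 tT'] := tT.
have mB : measurable B by exact: (G_sub Pcomp hW hX tT').
have rB : rv_in (G t) (\1_B : Omega -> R) by exact: rv_in_indic.
have iQ := L2_int2 (lexx T) hQT.
have hBQ : L2 P (G T) (fun w => \1_B w * Q w).
  apply: int2_L2; last exact: int2_set.
  by apply: rv_inM; [apply: rv_in_sub rB; exact: G_mono|case: hQT].
have [Y [Z1 [Z2 [_ b f e]]]] := solE hQT; have [Y' [Z1' [Z2' [_ b' f' e']]]] := solE hBQ.
have B0 (w : Omega) : 0 <= (\1_B w : R) by rewrite indicE ler0n.
have B1 (w : Omega) : (\1_B w : R) <= 1 by rewrite indicE -[1]/(1%:R) ler_nat; case: (_ \in _).
have rc : rv_in (G t) (fun=> 1 : R) by exact: rv_in_cst.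
have eq1 : {ae P, forall w, \1_B w * Q w = 1 * (\1_B w * Q w)} by apply: ae_all => w; rewrite mul1r.
have h := scale_unique tT rB B0 B1 rc (fun w => ler01) (fun w => lexx 1) b b' f f' eq1.
by apply: ae_imp2 h (filterI (e t tT) (e' t tT)) => w + [-> ->]; rewrite mul1r.
Qed.

(** The sum [Q1 + Q2] may lie outside [Qs t], so balancedness is applied to the solutions for [Q1]
    and [Q2] only. Subadditivity for [z3 = z1 + (z3 - z1)] bounds the drift of the difference below
    by the change of the driver from [z3 - z1] to [z2]. *)
Lemma E_subadd t Q1 Q2 : 0 <= t <= T -> Qs t Q1 -> Qs t Q2 ->
  {ae P, forall w, E t (fun w' => Q1 w' + Q2 w') w <= E t Q1 w + E t Q2 w}.
Proof.
move=> tT q1 q2; have /andP[t0 tT'] := tT.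
have h1 := hQ tT q1; have h2 := hQ tT q2.
have h3 : L2 P (G T) (fun w => Q1 w + Q2 w).
  apply: int2_L2; first by apply: rv_inD; [case: h1|case: h2].
  by apply: int2D; [exact: L2_int2 h1|exact: L2_int2 h2].
have [Y1 [Z11 [Z21 [s1 b1 f1 e1]]]] := solE h1; have [Y2 [Z12 [Z22 [s2 b2 f2 e2]]]] := solE h2.
have [Y3 [Z13 [Z23 [s3 b3 f3 e3]]]] := solE h3.
set z1 := zof T 0 Z11 Z21 in b1; set z2 := zof T 0 Z12 Z22 in b2; set z3 := zof T 0 Z13 Z23 in b3.
have b12 := BE_lin Pcomp T0 hA hW hX hXW 1 1 t0 (lexx T) (BE_restrict t0 (lexx T) b1) (BE_restrict t0 (lexx T) b2).
have bb := BE_lin Pcomp T0 hA hW hX hXW 1 (-1) t0 (lexx T) b12 (BE_restrict t0 (lexx T) b3).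
set gg := fun p => 1 * (1 * gz z1 p + 1 * gz z2 p) + -1 * gz z3 p in bb.
set zz := zlin 1 (-1) (zlin 1 1 z1 z2) z3 in bb.
have hb : {ae mu, forall p : Omega * R, t < p.2 <= T ->
   0 <= slack T A X Kc gg zz p /\ (slack T A X Kc gg zz p = 0 -> upj T A X zz p = 0)}.
  apply: ae_imp (balp_ae tT q1 q2 s1 s2) => p hp pin; have [gp hb] := hp pin.
  apply: (@slack_lower gg zz z2 (zlin 1 (-1) z3 z1) p gp hb) => [i0| ]; first by rewrite /zz /zlin; ring.
  have /andP[a b] := pin; have pT : 0 <= p.2 <= T by rewrite b (le_trans t0 (ltW a)).
  have iE : ind 0 T p.2 = 1 by rewrite /ind (le_lt_trans t0 a) b.
  rewrite /gg /gz iE !mul1r mulN1r.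
  have := hS p.1 (Xe p) pT 0 (z1 None p) (zcol z1 p) 0 (zlin 1 (-1) z3 z1 None p) (zcol (zlin 1 (-1) z3 z1) p).
  have -> : z1 None p + zlin 1 (-1) z3 z1 None p = z3 None p by rewrite /zlin; ring.
  have -> : zcol z1 p + zcol (zlin 1 (-1) z3 z1) p = zcol z3 p.
    by apply/colP => j; rewrite !mxE /zlin; ring.
  rewrite addr0 -!/(fp p _ _) -!/(fz _ p); lra.
have VT : {ae P, forall w, 0 <= 1 * (1 * Y1 T w + 1 * Y2 T w) + -1 * Y3 T w}.
  by apply: ae_imp2 f3 (filterI f1 f2) => w -> [-> ->]; rewrite !mul1r mulN1r subrr.
have Vt : {ae P, forall w, 0 <= 1 * (1 * Y1 t w + 1 * Y2 t w) + -1 * Y3 t w}.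
  have [tlt|] := ltP t T; last by move=> h; rewrite (_ : t = T)//; apply/eqP; rewrite eq_le tT' h.
  exact: (comparison Pcomp T0 hA hW hX hXW t0 (lexx T) Kc_ge1 bb hb (lexx t) tlt (lexx T) VT).
by apply: ae_imp2 (filterI Vt (e3 t tT)) (filterI (e1 t tT) (e2 t tT)) => w [h ->] [-> ->]; lra.
Qed.

(** [lam] may be unbounded. Cutting both sides by the event [bd n], known at [t], gives the bounded
    case, and almost every point lies in some [bd n]. *)
Lemma E_scale t lam Q : 0 <= t <= T -> L2 P (G t) lam -> {ae P, forall w, 0 <= lam w} ->
  L2 P (G T) Q -> Qs t (fun w => lam w * Q w) ->
  {ae P, forall w, E t (fun w' => lam w' * Q w') w = lam w * E t Q w}.
Proof.
move=> tT hl l0 hQT hlQ; have [rl _] := hl.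
have [Y [Z1 [Z2 [_ b f e]]]] := solE hQT; have [Y' [Z1' [Z2' [_ b' f' e']]]] := solE (hQ tT hlQ).
have rc (x : R) : rv_in (G t) (fun=> x) by exact: rv_in_cst.
pose bd (n : nat) w := (0 <= lam w) && (lam w <= n%:R).
have Gb n : G t [set w | bd n w].
  rewrite (_ : [set w | bd n w] = [set w | lam w * (lam w - n%:R) <= 0]).
    exact: (rv_in_le (rv_inM rl (rv_inB rl (rc n%:R))) (rc 0)).
  apply/seteqP; split => w /=.
    by move=> /andP[a1 a2]; apply: mulr_ge0_le0 => //; rewrite subr_le0.
  move=> h; rewrite /bd; apply/andP; split; rewrite leNgt; apply/negP => h'.
    have : 0 < lam w * (lam w - n%:R).
      by rewrite nmulr_rgt0// subr_lt0; apply: lt_le_trans h' (ler0n _ _).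
    by rewrite ltNge h.
  have lp : 0 < lam w by exact: le_lt_trans (ler0n R n) h'.
  have : 0 < lam w * (lam w - n%:R) by rewrite mulr_gt0// subr_gt0.
  by rewrite ltNge h.
have main n : {ae P, forall w, (if bd n w then lam w else 0) * Y t w = (if bd n w then 1 else 0) * Y' t w}.
  apply: (@scale_unique t _ _ n%:R 1 Q (fun w => lam w * Q w) Y Y' _ _ tT _ _ _ _ _ _ b b' f f').
  - exact: (rv_in_if (Gb n) rl (rc 0)).
  - by move=> w; case: ifP => // /andP[].
  - by move=> w; case: ifP => // /andP[].
  - exact: (rv_in_if (Gb n) (rc 1) (rc 0)).
  - by move=> w; case: ifP.
  - by move=> w; case: ifP.
  - by apply: ae_all => w; case: ifP; rewrite ?mul1r ?mul0r.
apply: ae_imp2 (filterI l0 (ae_foralln main)) (filterI (e t tT) (e' t tT)) => w [h0 h] [-> ->].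
have := h (Num.truncn (lam w)).+1; rewrite /bd h0 (ltW (truncnS_gt _)) /= mul1r => ->.
by [].
Qed.

End model.

Theorem theorem5p6 (d : measure_display) (Omega : measurableType d)
  (R : realType) (P : probability Omega R) (T c : R) (N : nat) (A : 'M[R]_N)
  (X : R -> Omega -> 'I_N) (W : R -> Omega -> R) (F : driver Omega R N)
  (Qs : R -> set (Omega -> R)) (E : R -> (Omega -> R) -> (Omega -> R)) :
  measure_is_complete P ->
  0 < T ->
  rate_matrix c A ->
  brownian_motion P T W ->
  markov_chain P T A X ->
  independent_processes P T X W ->
  (forall t, 0 <= t <= T -> Qs t `<=` L2 P (filtrationG P X W T)) ->
  (forall s t, 0 <= s -> s <= t -> t <= T -> Qs s `<=` Qs t) ->
  is_driver P T A X W F ->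
  balanced P T A X W F Qs ->
  normalized P T F ->
  solution_functional P T A X W F E ->
  subadditive_driver T F ->
  positively_homogeneous_driver T F ->
  sublinear_expectation P T (filtrationG P X W) Qs E.
Proof.
move=> Pcomp T0 hA hW hX hXW hQ _ hF hBal hN hE hS hP.
have [_ [L [L0 lipF]]] := hF.
have lip (w : Omega) t (x : 'I_N) (y z1 : R) (z2 : 'cV[R]_N) (y' z1' : R) (z2' : 'cV[R]_N) :
    0 <= t <= T -> `|F w t y z1 z2 x - F w t y' z1' z2' x| ^+ 2 <=
    L * (`|y - y'| ^+ 2 + `|z1 - z1'| ^+ 2 + sqnorm A (left_state X t w) (z2 - z2')).
  exact: lipF.
split; first by move=> t Q; exact: (E_mem Pcomp T0 hA hW hX hXW hF hN hS L0 lip hE).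
split.
- move=> t Q1 Q2 tT q1 q2 le; exact: (E_mono Pcomp T0 hA hW hX hXW hF hN hS L0 lip hQ hBal hE tT q1 q2 le).
- by move=> t Q; exact: (E_meas Pcomp T0 hA hW hX hXW hF hN hS L0 lip hE).
- by move=> s t Q; exact: (E_tower Pcomp T0 hA hW hX hXW hF hN hS L0 lip hE).
- by move=> t B Q; exact: (E_indic Pcomp T0 hA hW hX hXW hF hN hS hP L0 lip hE).
split.
- by move=> t Q1 Q2; exact: (E_subadd Pcomp T0 hA hW hX hXW hF hN hS L0 lip hQ hBal hE).
- by move=> t lambda Q; exact: (E_scale Pcomp T0 hA hW hX hXW hF hN hS hP L0 lip hQ hE).
Qed.
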